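(* Let $M$ be a compact connected Kähler manifold of complex dimension $n\geq 2$, let $r\geq 1$ be an integer, and let $\beta_0,\beta_1,\ldots,\beta_r,\gamma_3,\ldots,\gamma_n$ be $n+r-1$ arbitrary nef classes in $H^{1,1}(M;\mathbb{R})$. Denote $$d_{ij}=\beta_i\cdot\beta_j\cdot\gamma_3\cdots\gamma_n,\qquad 0\leq i,j\leq r.$$ Then $$\det\Big(\big(d_{0i}d_{0j}-d_{00}d_{ij}\big)_{i,j=1}^r\Big)\geq0\qquad\text{and}\qquad(-1)^r\det\Big(\big(d_{ij}\big)_{i,j=0}^r\Big)\geq0.$$
   Context: For $\alpha_1,\ldots,\alpha_n\in H^{1,1}(M;\mathbb{R})$, the intersection number is $\alpha_1\cdot\alpha_2\cdots\alpha_n:=\int_M\alpha_1\wedge\cdots\wedge\alpha_n\in\mathbb{R}$. The Kähler cone $\mathcal{K}\subset H^{1,1}(M;\mathbb{R})$ is the open cone of all Kähler classes; a class is nef if it lies in the closure $\overline{\mathcal{K}}$. For $n=2$ the list $\gamma_3,\ldots,\gamma_n$ is empty. *)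

(* Defs.v *)
From HB Require Import structures.
From mathcomp Require Import all_boot all_order all_fingroup all_algebra.
From mathcomp Require Import all_classical all_reals all_analysis.
Set Implicit Arguments.
Unset Strict Implicit.
Unset Printing Implicit Defensive.
Import Order.TTheory GRing.Theory Num.Theory.
Import numFieldNormedType.Exports.
Local Open Scope classical_set_scope.
Local Open Scope ring_scope.

(* C^n is 'rV[R]_(n * 2): the index mxvec_index k b is the coordinate x_k for
   b = 0 and y_k for b = 1, where z_k = x_k + i y_k.  Hence the order of the
   coordinates is (x_0, y_0, x_1, y_1, ...), which is the complex orientation.
   Tangent vectors are rows, and linear maps act on the right. *)
Notation Cspace R n := 'rV[R]_(n * 2).

(* Multiplication by i, (x_k, y_k) |-> (- y_k, x_k). *)
Definition imul (R : realType) (n : nat) : 'M[R]_(n * 2) :=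
  lin_mulmxr (\matrix_(a < 2, b < 2)
    (if (a == 0) && (b == 1) then 1 else if (a == 1) && (b == 0) then -1 else 0)).

(* Complex differentiability: the real differential exists and is C-linear. *)
Definition holomorphic_at (R : realType) (n : nat)
    (f : Cspace R n -> Cspace R n) (z : Cspace R n) : Prop :=
  differentiable f z /\ imul R n *m 'J f z = 'J f z *m imul R n.

Fixpoint class_C (R : realType) (m k : nat) (U : set 'rV[R]_m)
    (f : 'rV[R]_m -> R) : Prop :=
  if k is k'.+1 then
    forall j : 'I_m,
      (forall z, U z -> derivable f z (delta_mx 0 j)) /\
      class_C k' U ('D_(delta_mx 0 j) f)
  else forall z, U z -> {for z, continuous f}.

Definition smooth_on (R : realType) (m : nat) (U : set 'rV[R]_m)
    (f : 'rV[R]_m -> R) : Prop := forall k, class_C k U f.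

Definition pderiv (R : realType) (m : nat) (j : 'I_m) (f : 'rV[R]_m -> R)
    (z : 'rV[R]_m) : R := 'D_(delta_mx 0 j) f z.

(* The values of chart i outside dom i, and those of chart_inv i outside
   chart i @` dom i, are irrelevant. *)
Record complex_manifold (R : realType) (n : nat) (M : topologicalType) := {
  chart_index : Type;
  dom : chart_index -> set M;
  chart : chart_index -> M -> Cspace R n;
  chart_inv : chart_index -> Cspace R n -> M;
  manifold_hausdorff : hausdorff_space M;
  manifold_second_countable : @second_countable M;
  dom_open : forall i, open (dom i);
  dom_cover : forall x, exists i, dom i x;
  chart_open : forall i, open (chart i @` dom i);
  chart_continuous : forall i x, dom i x -> {for x, continuous (chart i)};
  chart_inv_continuous : forall i z, (chart i @` dom i) z ->
    {for z, continuous (chart_inv i)};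
  chartK : forall i x, dom i x -> chart_inv i (chart i x) = x;
  transition_holomorphic : forall i j z, (chart i @` dom i) z ->
    dom j (chart_inv i z) -> holomorphic_at (chart j \o chart_inv i) z
}.

Section Forms.
Context {R : realType} {n : nat} {M : topologicalType}.
Variable X : complex_manifold R n M.

Local Notation index := (chart_index X).

Definition chart_image (i : index) : set (Cspace R n) := chart i @` dom i.

Definition transition (i j : index) : Cspace R n -> Cspace R n :=
  chart j \o chart_inv i.

(* A differential form is given by its coefficients in each chart; only their
   values on chart_image i matter. *)
Definition coef1 := index -> Cspace R n -> 'rV[R]_(n * 2).
Definition coef2 := index -> Cspace R n -> 'M[R]_(n * 2).

Definition smooth_function (f : M -> R) : Prop :=
  forall i, smooth_on (chart_image i) (f \o chart_inv i).

Definition one_form (e : coef1) : Prop :=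
  (forall i k, smooth_on (chart_image i) (fun z => e i z 0 k)) /\
  (forall i j z, chart_image i z -> dom j (chart_inv i z) ->
     e i z = e j (transition i j z) *m ('J (transition i j) z)^T).

(* The 2-form with coefficients a takes the value v *m a i z *m w^T on the
   tangent vectors v, w at chart_inv i z. *)
Definition two_form (a : coef2) : Prop :=
  [/\ forall i k l, smooth_on (chart_image i) (fun z => a i z k l),
      forall i z, chart_image i z -> (a i z)^T = - a i z
    & forall i j z, chart_image i z -> dom j (chart_inv i z) ->
        a i z = 'J (transition i j) z *m a j (transition i j z)
                  *m ('J (transition i j) z)^T].

(* A real 2-form is of type (1,1) when a(iv, iw) = a(v, w). *)
Definition type11 (a : coef2) : Prop :=
  forall i z, chart_image i z -> imul R n *m a i z *m (imul R n)^T = a i z.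

Definition closed_form (a : coef2) : Prop :=
  forall i z, chart_image i z -> forall j k l,
    pderiv j (fun z => a i z k l) z + pderiv k (fun z => a i z l j) z
      + pderiv l (fun z => a i z j k) z = 0.

Definition closed11 (a : coef2) : Prop :=
  [/\ two_form a, type11 a & closed_form a].

(* a - b is the exterior derivative of a real 1-form. *)
Definition cohomologous (a b : coef2) : Prop :=
  exists2 e : coef1, one_form e & forall i z, chart_image i z -> forall k l,
    a i z k l - b i z k l =
      pderiv k (fun z => e i z 0 l) z - pderiv l (fun z => e i z 0 k) z.

Definition coh_class (a : coef2) : set coef2 :=
  [set b | closed11 b /\ cohomologous a b].

(* H^{1,1}(M; R) *)
Definition H11 := {c : set coef2 | exists2 a, closed11 a & c = coh_class a}.

Definition rep (c : H11) : coef2 := s2val (cid2 (svalP c)).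

(* The Kaehler condition a(v, iv) > 0. *)
Definition positive11 (a : coef2) : Prop :=
  forall i z, chart_image i z -> forall v : Cspace R n, v != 0 ->
    0 < (v *m a i z *m (v *m imul R n)^T) 0 0.

Definition kahler_form (w : coef2) : Prop := closed11 w /\ positive11 w.

Definition kahler_cone : set H11 :=
  [set c | exists2 w, sval c w & kahler_form w].

(* c = \sum_j t_j e_j in the real vector space H^{1,1}(M; R). *)
Definition coordinates m (e : 'I_m -> H11) (t : 'rV[R]_m) (c : H11) : Prop :=
  sval c (fun i z => \sum_(j < m) t 0 j *: rep (e j) i z).

Definition H11_basis m (e : 'I_m -> H11) : Prop :=
  forall c, exists! t : 'rV[R]_m, coordinates e t c.

(* Closure for the topology of a finite-dimensional real vector space, which
   is read off from the coordinates in a basis. *)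
Definition H11_closure (A : set H11) : set H11 :=
  [set c | exists m (e : 'I_m -> H11), H11_basis e /\
     exists2 t, coordinates e t c &
       closure [set s | exists2 c', A c' & coordinates e s c'] t].

Definition nef : set H11 := H11_closure kahler_cone.

End Forms.

(* Lebesgue integral over R^m as an iterated integral. *)
Fixpoint integral_rV (R : realType) (m : nat) : ('rV[R]_m -> R) -> R :=
  if m is m'.+1 then fun f =>
    \int[@lebesgue_measure R]_(x in setT)
      integral_rV (fun v : 'rV[R]_m' => f (row_mx (x%:M : 'rV[R]_1) v))
  else fun f => f 0.

(* (a_0 /\ ... /\ a_(n-1)) evaluated on the frame
   (d/dx_0, d/dy_0, ..., d/dx_(n-1), d/dy_(n-1)). *)
Definition wedge_top (R : realType) (n : nat) (a : 'I_n -> 'M[R]_(n * 2)) : R :=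
  2 ^- n * \sum_(s : 'S_(n * 2)) (-1) ^+ s *
    \prod_(k < n) a k (s (mxvec_index k 0)) (s (mxvec_index k 1)).

Section Integration.
Context {R : realType} {n : nat} {M : topologicalType}.
Variable X : complex_manifold R n M.

Definition partition_of_unity N (c : 'I_N -> chart_index X)
    (rho : 'I_N -> M -> R) : Prop :=
  [/\ forall k, smooth_function X (rho k),
      forall k x, 0 <= rho k x,
      forall k, closure [set x | rho k x != 0] `<=` dom (c k)
    & forall x, \sum_(k < N) rho k x = 1].

Definition integral_wrt N (c : 'I_N -> chart_index X) (rho : 'I_N -> M -> R)
    (tau : chart_index X -> Cspace R n -> R) : R :=
  \sum_(k < N) integral_rV
    ((fun z => rho k (chart_inv (c k) z) * tau (c k) z)
       \_ (chart_image (c k))).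

(* The integral over a compact M of the top form with coefficient tau i in
   chart i; it does not depend on the chosen partition of unity. *)
Definition integral_top (tau : chart_index X -> Cspace R n -> R) : R :=
  xget 0 [set s | exists N (c : 'I_N -> chart_index X) (rho : 'I_N -> M -> R),
    partition_of_unity c rho /\ s = integral_wrt c rho tau].

Definition intersection_number (a : 'I_n -> H11 X) : R :=
  integral_top (fun i z => wedge_top (fun k => rep (a k) i z)).

End Integration.

(* Main.v *)
(** Nef classes are limits of Kahler classes, and both determinants depend
    continuously on the class in each slot, so all classes may be taken Kahler.
    Let b and g be Kahler. If a.b.g = 0 then a.a.g <= 0; hence
    (a.b.g)^2 >= (a.a.g)(b.b.g), the first matrix is positive semidefinite, and
    the second determinant follows by a Schur complement.

    For the index statement, put G = b g and solve (a + dd^c u) /\ G = 0: then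
    (a + dd^c u)^2 /\ g <= 0 holds pointwise, because the wedge product of
    (1,1)-forms is a real stable polynomial in its factors. It is enough to solve
    the equation up to a small error in L^2. Such u are obtained by mollifying in
    charts almost minimizers of the Dirichlet energy of G: the Poincare inequality
    bounds the energy from below, and Friedrichs' commutator lemma controls the
    error, so that no regularity theory is needed. Transition maps are only
    assumed complex differentiable; Weyl's lemma makes them smooth. *)

Require Import Defs.
From HB Require Import structures.
From mathcomp Require Import all_boot all_order all_fingroup all_algebra.
From mathcomp Require Import all_classical all_reals all_analysis.
From mathcomp Require Import complex ring lra zify.
Set Implicit Arguments.
Unset Strict Implicit.
Unset Printing Implicit Defensive.
Import Order.TTheory GRing.Theory Num.Theory.
Import numFieldNormedType.Exports.
Local Open Scope classical_set_scope.
Local Open Scope ring_scope.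

Local Notation "''e_' j" := (delta_mx 0 j) (at level 8, j at level 2, format "''e_' j").
Local Notation U := (@chart_image _ _ _ _).
Local Notation inv := (@chart_inv _ _ _ _).
Local Notation dom := (@Defs.dom _ _ _ _).
Local Notation chart := (@Defs.chart _ _ _ _).
Local Notation T := (@transition _ _ _ _).

(** The approximate solution rests on an order of choices. The commutator of the operator with
    mollification at radius e is bounded from H^1 to L^2 uniformly in e, and two almost minimizers
    of mean zero are close in H^1. So one almost minimizer [u0] is fixed first; then e, so small
    that the commutator on [u0] is near its limit; and only then a better almost minimizer [u],
    whose residual is so small against test functions that it is small in L^2 after mollification at
    the fixed e. The solution is the mollified [u]; no limit of minimizers is taken, and no
    completion of the space of smooth functions is needed. For the coordinate changes the obstacle
    is that their differentials need not be continuous. A Kaehler form, compared in two charts,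
    bounds them locally, and boundedness is enough to pass to the limit in integrals of difference
    quotients. Integrals are iterated one-dimensional ones. Fubini and the change of variables are
    therefore derived for positive functionals on compactly supported continuous functions, from
    primitives and from uniqueness of the translation invariant functional. *)

Lemma cvg_sumr (K : numFieldType) (V : normedModType K) T (F : set_system T) (FF : Filter F)
    I (r : seq I) (P : pred I) (f : I -> T -> V) (l : I -> V) :
  (forall i, P i -> f i x @[x --> F] --> l i) ->
  \sum_(i <- r | P i) f i x @[x --> F] --> \sum_(i <- r | P i) l i.
Proof.
move=> fl; elim: r => [|i r IH].
  by rewrite big_nil; under eq_fun do rewrite big_nil; exact: cvg_cst.
rewrite big_cons; case Pi: (P i); last by under eq_fun do rewrite big_cons Pi.
by under eq_fun do rewrite big_cons Pi; apply: cvgD => //; exact: fl.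
Qed.

(** * Continuity at a point *)

Lemma cont_comp (X Y Z : topologicalType) (f : X -> Y) (g : Y -> Z) x :
  {for x, continuous f} -> {for f x, continuous g} -> {for x, continuous (fun u => g (f u))}.
Proof. exact: continuous_comp. Qed.

Lemma cont_at (X Y : topologicalType) (f : X -> Y) : (forall x, {for x, continuous f}) -> continuous f.
Proof. by []. Qed.

Lemma cont_for (X Y : topologicalType) (f : X -> Y) x : {for x, continuous f} -> {for x, continuous f}.
Proof. by []. Qed.

Section ContinuityAt.
Context {R : realType} {T : topologicalType}.
Implicit Types (f g : T -> R) (x : T).

Lemma cont_cst (S : topologicalType) (c : S) x : {for x, continuous (fun _ : T => c)}.
Proof. exact: cvg_cst. Qed.

Lemma cont_id x : {for x, continuous (fun y : T => y)}.
Proof. exact: cvg_id. Qed.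

Lemma cont_pair (S Y : topologicalType) (f : T -> S) (g : T -> Y) x :
  {for x, continuous f} -> {for x, continuous g} -> {for x, continuous (fun y => (f y, g y))}.
Proof. exact: cvg_pair. Qed.

Lemma cont_fst (S Y : topologicalType) (f : T -> S * Y) x : {for x, continuous f} -> {for x, continuous (fun y => (f y).1)}.
Proof. by move=> cf; apply: cont_comp cf _; exact: cvg_fst. Qed.

Lemma cont_snd (S Y : topologicalType) (f : T -> S * Y) x : {for x, continuous f} -> {for x, continuous (fun y => (f y).2)}.
Proof. by move=> cf; apply: cont_comp cf _; exact: cvg_snd. Qed.

Lemma cont_shift (V : normedModType R) (f g : T -> V) x : {for x, continuous f} -> {for x, continuous g} ->
  {for x, continuous (fun y => f y + g y)}.
Proof. by move=> cf cg; apply: (@cvgD _ _ _ (nbhs x)). Qed.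

Lemma cont_oppV (V : normedModType R) (f : T -> V) x : {for x, continuous f} -> {for x, continuous (fun y => - f y)}.
Proof. by move=> cf; apply: (@cvgN _ _ _ (nbhs x)). Qed.

Lemma cont_scale (V : normedModType R) (s : T -> R) (f : T -> V) x : {for x, continuous s} ->
  {for x, continuous f} -> {for x, continuous (fun y => s y *: f y)}.
Proof. by move=> cf cg; apply: (@cvgZ _ _ _ (nbhs x)). Qed.

Lemma cont_norm (V : normedModType R) (f : T -> V) x : {for x, continuous f} -> {for x, continuous (fun y => `|f y|)}.
Proof. by move=> cf; apply: cont_comp cf _; exact: norm_continuous. Qed.

Lemma cont_add f g x : {for x, continuous f} -> {for x, continuous g} -> {for x, continuous (fun y => f y + g y)}.
Proof. exact: (@cont_shift R). Qed.

Lemma cont_mul f g x : {for x, continuous f} -> {for x, continuous g} -> {for x, continuous (fun y => f y * g y)}.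
Proof. by move=> cf cg; apply: (@cvgM _ _ (nbhs x)). Qed.

Lemma cont_opp f x : {for x, continuous f} -> {for x, continuous (fun y => - f y)}.
Proof. exact: (@cont_oppV R). Qed.

Lemma cont_sub f g x : {for x, continuous f} -> {for x, continuous g} -> {for x, continuous (fun y => f y - g y)}.
Proof. by move=> cf cg; apply: cont_add => //; exact: cont_opp. Qed.

Lemma cont_inv f x : f x != 0 -> {for x, continuous f} -> {for x, continuous (fun y => (f y)^-1)}.
Proof. by move=> f0 cf; apply: (@cvgV _ _ (nbhs x)). Qed.

Lemma cont_exp f x p : {for x, continuous f} -> {for x, continuous (fun y => f y ^+ p)}.
Proof.
move=> cf; elim: p => [|p IH]; first exact: cont_cst.
have -> : (fun y => f y ^+ p.+1) = fun y => f y * f y ^+ p by apply/funext => y; rewrite exprS.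
exact: cont_mul.
Qed.

Lemma cont_sum (I : Type) (r : seq I) (P : pred I) (F : I -> T -> R) x :
  (forall i, P i -> {for x, continuous (F i)}) -> {for x, continuous (fun y => \sum_(i <- r | P i) F i y)}.
Proof. by move=> cF; apply: (@cvg_sumr _ _ _ (nbhs x) (nbhs_filter x)). Qed.

Lemma cont_prod (I : Type) (r : seq I) (P : pred I) (F : I -> T -> R) x :
  (forall i, P i -> {for x, continuous (F i)}) -> {for x, continuous (fun y => \prod_(i <- r | P i) F i y)}.
Proof.
move=> cF; elim: r => [|i r IH].
  have -> : (fun y => \prod_(i <- [::] | P i) F i y) = (fun _ => 1) by apply/funext => y; rewrite big_nil.
  exact: cont_cst.
have -> : (fun y => \prod_(j <- i :: r | P j) F j y) =
  (fun y => (if P i then F i y else 1) * \prod_(j <- r | P j) F j y).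
  by apply/funext => y; rewrite big_cons; case: ifP => // _; rewrite mul1r.
apply: cont_mul => //; case Pi: (P i); [exact: cF | exact: cont_cst].
Qed.

Lemma cont_coord p (f : T -> 'rV[R]_p) j x : {for x, continuous f} -> {for x, continuous (fun y => f y 0 j)}.
Proof.
by move=> cf; apply: (@continuous_comp _ _ _ f (fun v : 'rV[R]_p => v 0 j)) => //; exact: coord_continuous.
Qed.

End ContinuityAt.

(* Extended below by the continuity lemmas of the development. *)
Ltac cont_fact := exact: norm_continuous.

Ltac cont_hyp := match goal with H : context [@continuous_at] |- _ => solve [exact: H] | _ => solve [cont_fact] end.

Ltac cont_rec := intros; cbv beta;
  match goal with |- prop_for _ (inPhantom (forall y, continuous_at y ?f)) =>
    lazymatch f with
    | fun y => y => exact: cont_id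
    | @fst _ _ => exact: cvg_fst
    | @snd _ _ => exact: cvg_snd
    | fun _ => ?c => exact: cont_cst
    | fun y => (@?f y, @?g y) => apply: cont_pair; cont_rec
    | fun y => fst (@?f y) => apply: cont_fst; cont_rec
    | fun y => snd (@?f y) => apply: cont_snd; cont_rec
    | fun y => @GRing.mul _ (@?f y) (@?g y) => apply: cont_mul; cont_rec
    | fun y => @GRing.scale _ _ (@?f y) (@?g y) => apply: cont_scale; cont_rec
    | fun y => @Algebra.add _ (@?a y) (@?b y) =>
        lazymatch type of f with _ -> Real.sort _ => apply: cont_add | _ => apply: cont_shift end; cont_rec
    | fun y => @Algebra.opp _ (@?a y) =>
        lazymatch type of f with _ -> Real.sort _ => apply: cont_opp | _ => apply: cont_oppV end; cont_rec
    | fun y => @GRing.exp _ (@?f y) _ => apply: cont_exp; cont_rec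
    | fun y => @Num.norm _ _ (@?f y) => apply: cont_norm; cont_rec
    | fun y => @bigop.body _ _ _ _ (@?F y) => apply: cont_sum; cont_rec
    | fun y => @fun_of_matrix _ _ _ (@?f y) _ _ => apply: cont_coord; cont_rec
    | fun y => @derive _ _ _ _ y _ => try cont_hyp
    | fun y => @derive _ _ _ ?f (@?g y) ?v => apply: (@cont_comp _ _ _ g ('D_v f)); cont_rec
    | fun y => ?F (@?g y) (@?h y) => first [lazymatch type of F with ?A -> ?B -> _ =>
        let t := constr:(fun y => (g y, h y)) in let s := constr:(fun p : A * B => F p.1 p.2) in
        apply: (@cont_comp _ _ _ t s); [cont_rec | cont_hyp] end
      | lazymatch f with fun y => ?k (@?h y) => apply: (@cont_comp _ _ _ h k); cont_rec end]
    | fun y => ?k (@?g y) => apply: (@cont_comp _ _ _ g k); cont_rec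
    | ?F ?c => first [cont_hyp | lazymatch type of f with ?B -> _ =>
        let s := constr:(fun y : B => F c y) in apply: (@cont_for _ _ s); cont_rec end]
    | _ => try cont_hyp
    end
  | _ => idtac
  end.

Ltac cont := intros; try match goal with
  | |- prop_for _ (inPhantom (forall y, continuous_at y ?f)) => match type of f with ?S -> _ => apply: (@cont_for S) end
  | |- continuous_at _ ?f => match type of f with ?S -> _ => apply: (@cont_for S) end end; cont_rec.

Lemma cont_slice (X Y Z : topologicalType) (F : X -> Y -> Z) x : continuous (fun p => F p.1 p.2) -> continuous (F x).
Proof. by move=> cF y; apply: (cont_comp (f := fun y => (x, y))) (cF _); cont. Qed.

(** * Calculus on row vectors *)

Section RowNorm.
Context {R : realType}.

Lemma row_norm_ge m (x : 'rV[R]_m) j : `|x 0 j| <= `|x|.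
Proof.
rewrite [leRHS]/Num.norm /= mx_normrE.
exact: (le_bigmax _ (fun i => `|x i.1 i.2|) (0, j)).
Qed.

Lemma row_norm_le m (x : 'rV[R]_m) M : 0 <= M ->
  (forall j, `|x 0 j| <= M) -> `|x| <= M.
Proof.
move=> M0 xM; rewrite /Num.norm /= mx_normrE bigmax_le // => -[i j] _ /=.
by rewrite ord1.
Qed.

Lemma row_norm_lt m (x : 'rV[R]_m) M : 0 < M ->
  (forall j, `|x 0 j| < M) -> `|x| < M.
Proof.
move=> M0 xM; rewrite /Num.norm /= mx_normrE bigmax_lt // => -[i j] _ /=.
by rewrite ord1.
Qed.

End RowNorm.

Section MeanValue.
Context {R : realType}.

Lemma is_derive_line (V : normedModType R) (f : V -> R) x v t (d : R) :
  is_derive (x + t *: v) v f d -> is_derive t (1 : R) (fun s : R => f (x + s *: v)) d.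
Proof.
have E : (fun h : R => h^-1 *: (((fun s : R => f (x + s *: v)) \o shift t) (h *: (1 : R)) - f (x + t *: v)))
    = (fun h => h^-1 *: ((f \o shift (x + t *: v)) (h *: v) - f (x + t *: v))).
  apply/funext => h /=; congr (_ *: (f _ - _)).
  by rewrite [h *: 1]mulr1 scalerDl addrCA.
by move=> [fx <-]; split; [rewrite /derivable | rewrite /derive]; rewrite E.
Qed.

(** The two conditions on [s] say that it lies between 0 and [a], so that one statement serves both
    signs of [a] and the case [a = 0]. *)
Lemma mvt_signed (g dg : R -> R) (a : R) :
  (forall s : R, `|s| <= `|a| -> 0 <= s * a -> is_derive s (1 : R) g (dg s)) ->
  exists s : R, [/\ `|s| <= `|a|, 0 <= s * a & g a - g 0 = dg s * a].
Proof.
move=> gd; case: (ltrgtP a 0) => [a0|a0|->]; last first.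
- by exists 0; rewrite normr0 !subrr !mulr0.
- have gd' s : s \in `[0, a]%R -> is_derive s (1 : R) g (dg s).
    rewrite in_itv /= => /andP[s0 sa]; apply: gd; last by rewrite mulr_ge0 // ltW.
    by rewrite !ger0_norm // ltW.
  have [|c ca gc] := MVT a0 (fun s (sa : s \in `]0, a[%R) => gd' s (subset_itv_oo_cc sa)).
    apply: derivable_within_continuous => c ca.
    by have [] := gd' _ ca.
  move: ca; rewrite in_itv /= => /andP[c0 ca].
  exists c; split; [by rewrite !gtr0_norm ?ltW | by rewrite mulr_ge0 ?ltW |].
  by rewrite gc subr0.
- have gd' s : s \in `[a, 0]%R -> is_derive s (1 : R) g (dg s).
    rewrite in_itv /= => /andP[sa s0]; apply: gd; last by rewrite mulr_le0 // ltW.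
    by rewrite !ler0_norm ?lerN2 // ltW.
  have [|c ca gc] := MVT a0 (fun s (sa : s \in `]a, 0[%R) => gd' s (subset_itv_oo_cc sa)).
    apply: derivable_within_continuous => c ca.
    by have [] := gd' _ ca.
  move: ca; rewrite in_itv /= => /andP[ca c0].
  exists c; split; [by rewrite !ltr0_norm ?lerN2 ?ltW | by rewrite mulr_le0 ?ltW |].
  by rewrite -opprB gc; ring.
Qed.

(** The path from [x] to [y] changes one coordinate at a time. The norm of a row is the maximum of
    its entries, so the ball around [x0] is a cube and contains this path; thus partial derivatives
    suffice. *)
Lemma mean_value_coord m (f : 'rV[R]_m -> R) x0 r c (d : R) :
  (forall z, `|z - x0| < r -> forall j, derivable f z 'e_j /\
     `|'D_'e_j f z - c j| <= d) ->
  forall x y, `|x - x0| < r -> `|y - x0| < r ->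
  `|f y - f x - \sum_j (y - x) 0 j * c j| <= d * (m%:R * `|y - x|).
Proof.
move=> fd x y xr yr.
pose w k : 'rV[R]_m := \row_j (if (j < k)%N then y 0 j else x 0 j).
have w0 : w 0 = x by apply/rowP => j; rewrite mxE.
have wm : w m = y by apply/rowP => j; rewrite mxE ltn_ord.
have -> : f y - f x = \sum_(k < m) (f (w k.+1) - f (w k)).
  by rewrite -(big_mkord xpredT (fun k => f (w k.+1) - f (w k))) telescope_sumr ?wm ?w0.
rewrite -sumrB; apply: (le_trans (ler_norm_sum _ _ _)).
suff H (k : 'I_m) : `|f (w k.+1) - f (w k) - (y - x) 0 k * c k| <= d * `|y - x|.
  apply: (le_trans (ler_sum _ (fun k _ => H k))).
  by rewrite sumr_const card_ord -[leLHS]mulr_natl mulrCA lexx.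
have r0 : 0 < r by apply: le_lt_trans xr.
set a := (y - x) 0 k.
have wS : w k.+1 = w k + a *: 'e_k.
  apply/rowP => j; rewrite !mxE ltnS leq_eqVlt /= eq_sym.
  case: (eqVneq k j) => [<-|kj]; first by rewrite ltnn eqxx mulr1 /a !mxE /= addrC subrK.
  by rewrite (negbTE (kj : val k != val j)) mulr0 addr0.
have xj j : - r < x 0 j - x0 0 j < r.
  by rewrite -ltr_norml (le_lt_trans _ xr) // (le_trans _ (row_norm_ge _ j)) // !mxE.
have yj j : - r < y 0 j - x0 0 j < r.
  by rewrite -ltr_norml (le_lt_trans _ yr) // (le_trans _ (row_norm_ge _ j)) // !mxE.
have wr s : `|s| <= `|a| -> 0 <= s * a -> `|w k + s *: 'e_k - x0| < r.
  move=> sa sa0; apply: row_norm_lt => // j; rewrite !mxE.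
  have := xj j; have := yj j; case: (eqVneq j k) => [->|jk] /=; last first.
    by rewrite mulr0 addr0 => ? ?; case: ifP; rewrite ltr_norml.
  rewrite ltnn mulr1 ltr_norml => /andP[y1 y2] /andP[x1 x2].
  move: sa sa0; rewrite /a !mxE => + +.
  case: (lerP 0 (y 0 k - x 0 k)) => a0; case: (lerP 0 s) => s0;
    rewrite ?(ger0_norm a0) ?(ger0_norm s0) ?(ltr0_norm a0) ?(ltr0_norm s0) => h1 h2.
  - by apply/andP; split; lra.
  - by move: h2; rewrite (nmulr_rge0 _ s0) => h2; apply/andP; split; lra.
  - by move: h2; rewrite (nmulr_lge0 _ a0) => h2; apply/andP; split; lra.
  - by apply/andP; split; lra.
have [s sa sa0|s [sa sa0]] := @mvt_signed (fun s => f (w k + s *: 'e_k))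
    (fun s => 'D_'e_k f (w k + s *: 'e_k)) a.
  by apply: is_derive_line; apply: derivableP; have [] := fd _ (wr _ sa sa0) k.
rewrite -wS scale0r addr0 => ->.
rewrite mulrC -mulrBr normrM mulrC ler_pM //.
  by have [] := fd _ (wr _ sa sa0) k.
exact: row_norm_ge.
Qed.

End MeanValue.

Lemma differentiable_of_bound (K : numFieldType) (V W : normedModType K) (f : V -> W)
    (dl : {linear V -> W}) z : continuous dl ->
  (forall e, 0 < e -> \forall v \near 0, `|f (v + z) - f z - dl v| <= e * `|v|) ->
  differentiable f z /\ 'd f z = dl :> (V -> W).
Proof.
move=> cl H.
have E : f \o shift z = cst (f z) + dl +o_ 0 id.
  apply/eqaddoP => _/posnumP[e]; near=> v => /=.
  rewrite -![(_ + _ : _ -> _) _]/(_ + _) -![(- _ : _ -> _) _]/(- _) /= opprD addrA.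
  by near: v; exact: H.
have dz : 'd f z = dl :> (_ -> _) by apply: diff_unique.
by split => //; apply/diff_locallyP; rewrite dz.
Unshelve. all: by end_near. Qed.

Section C1.
Context {R : realType}.

(** Strict differentiability: the estimate is uniform in two points near [z]. This is what the
    double difference in Schwarz's theorem requires. *)
Lemma C1_strict m (f : 'rV[R]_m -> R) (U : set 'rV[R]_m) z : open U -> U z ->
  (forall x j, U x -> derivable f x 'e_j) ->
  (forall j, {for z, continuous ('D_'e_j f)}) ->
  forall e : R, 0 < e -> exists2 r : R, 0 < r & forall x y,
    `|x - z| < r -> `|y - z| < r ->
    `|f y - f x - \sum_j (y - x) 0 j * 'D_'e_j f z| <= e * `|y - x|.
Proof.
move=> oU Uz df cf e e0.
(* The divisor absorbs the factor [m] of [mean_value_coord]; adding 1 covers [m = 0]. *)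
have e1 : 0 < e / (m%:R + 1) by rewrite divr_gt0 // ltr_wpDl.
have : \forall x \near z, U x /\ forall j, `|'D_'e_j f x - 'D_'e_j f z| <= e / (m%:R + 1).
  near=> x; split; first by near: x; exact: open_nbhs_nbhs.
  near: x; apply: filter_forall => j; have /cvgrPdist_le/(_ _ e1) := cf j.
  by apply: filterS => x; rewrite distrC.
move=> /nbhs_ballP[r /= r0 rP]; exists r => // x y xr yr.
apply: (le_trans (@mean_value_coord _ m f z r _ (e / (m%:R + 1)) _ _ _ xr yr)).
  move=> t tr j; have [|Ut dt] := rP t; first by rewrite -ball_normE /= distrC.
  by split; [exact: df | exact: dt].
rewrite mulrA ler_wpM2r // -mulrA ger_pMr // mulrC ler_pdivrMr ?ltr_wpDl //.
by rewrite mul1r lerDl.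
Unshelve. all: by end_near. Qed.

Definition lincomb m (c : 'I_m -> R) (v : 'rV[R]_m) : R := \sum_j v 0 j * c j.

Lemma lincomb_is_linear m (c : 'I_m -> R) : linear (lincomb c).
Proof.
move=> a u v; rewrite /lincomb scaler_sumr -big_split; apply: eq_bigr => j _ /=.
by rewrite !mxE mulrDl scalerAl.
Qed.

HB.instance Definition _ m (c : 'I_m -> R) :=
  GRing.isLinear.Build R 'rV[R]_m R^o *:%R (lincomb c : 'rV[R]_m -> R^o) (lincomb_is_linear c).

Lemma lincomb_continuous m (c : 'I_m -> R) : continuous (lincomb c).
Proof.
move=> v; rewrite /lincomb; apply: (@cvg_sumr _ _ _ (nbhs v) (nbhs_filter v)) => j _.
apply: (@cvgMl _ _ (nbhs v)).
exact: coord_continuous.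
Qed.

Lemma C1_differentiable m (f : 'rV[R]_m -> R) (U : set 'rV[R]_m) z : open U -> U z ->
  (forall x j, U x -> derivable f x 'e_j) ->
  (forall j, {for z, continuous ('D_'e_j f)}) ->
  differentiable f z /\
  forall v, 'D_v f z = \sum_j v 0 j * 'D_'e_j f z.
Proof.
move=> oU Uz df cf; set c := fun j => 'D_'e_j f z.
have [v|dfz dz] := @differentiable_of_bound _ 'rV[R]_m R f (lincomb c) z (@lincomb_continuous _ c).
  move=> v0; have [r r0 rP] := C1_strict oU Uz df cf v0.
  have : \forall w \near (0 : 'rV[R]_m), `|w| < r by exact: nbhs0_lt.
  apply: (@filterS _ (nbhs (0 : 'rV[R]_m)) (nbhs_filter _)) => w wr.
  have := rP z (w + z); rewrite subrr normr0 addrK => /(_ r0 wr).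
  by rewrite /lincomb.
by split => // v; rewrite deriveE // dz.
Unshelve. all: by end_near. Qed.

End C1.

Section ChainRule.
Context {R : realType}.

Lemma derive_line (V W : normedModType R) (f : V -> W) x v :
  'D_v f x = 'D_(1 : R) (fun s : R => f (s *: v + x)) 0.
Proof.
rewrite /derive; set g1 := fun h => h^-1 *: _; set g2 := fun h => h^-1 *: _.
suff -> : g1 = g2 by [].
by rewrite funeqE /g1 /g2 => h /=; rewrite addr0 scale0r add0r [_%:A]mulr1.
Qed.

Lemma is_derive_comp1 (V : normedModType R) (h : R -> R) (f : V -> R) x v (d : R) :
  is_derive x v f d -> derivable h (f x) 1 ->
  is_derive x v (h \o f) ('D_1 h (f x) * d).
Proof.
move=> fd hd; have f0 : f (0 *: v + x) = f x by rewrite scale0r add0r.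
have fl : derivable (fun s : R => f (s *: v + x)) 0 1.
  by apply: (proj1 (derivable1P _ _ _)); have [] := fd.
have hd' : derivable h (f (0 *: v + x)) 1 by rewrite f0.
split; last first.
  rewrite derive_line -derive1E (derive1_comp fl hd') !derive1E f0 -derive_line.
  by have [_ ->] := fd.
apply/derivable1P/derivable1_diffP.
by apply: (@differentiable_comp _ _ _ _ (fun s : R => f (s *: v + x)) h); apply/derivable1_diffP.
Qed.

Lemma is_derive_compn (V : normedModType R) p (g : 'rV[R]_p -> R) (f : V -> 'rV[R]_p) x v :
  (forall j, derivable (fun y => f y 0 j) x v) -> differentiable g (f x) ->
  is_derive x v (g \o f) ('D_(\row_j 'D_v (fun y => f y 0 j) x) g (f x)).
Proof.
move=> fd gd; have fd' : derivable f x v by apply/derivable_mxP => i j; rewrite ord1.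
set c := fun s : R => f (s *: v + x).
have c0 : c 0 = f x by rewrite /c scale0r add0r.
have cd : differentiable c 0 by apply/derivable1_diffP; move/derivable1P: fd'.
have gd' : differentiable g (c 0) by rewrite c0.
have dc := differentiable_comp cd gd'.
have k2 : 'D_1 (g \o c) 0 = 'D_(\row_j 'D_v (fun y => f y 0 j) x) g (f x).
  rewrite deriveE // diff_comp //= -deriveE // -deriveE // c0; congr ('D__ g _).
  by rewrite -derive_line derive_mx //; apply/rowP => j; rewrite !mxE.
split; first by apply/derivable1P/derivable1_diffP.
by rewrite -k2 derive_line.
Qed.

Lemma is_deriveZl (V : normedModType R) (c : R) (F : V -> R) (dF : R) x v :
  is_derive x v F dF -> is_derive x v (fun y => c * F y) (c * dF).
Proof. by move=> H; exact: is_deriveZ. Qed.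

End ChainRule.

(** * Smooth functions and their closure properties *)

Section Smooth.
Context {R : realType}.
Implicit Types m : nat.

Lemma class_C_eq m k (U : set 'rV[R]_m) f g : open U ->
  (forall z, U z -> f z = g z) -> class_C k U f -> class_C k U g.
Proof.
move=> oU; elim: k f g => [|k IH] f g fg /=.
  move=> cf z Uz; suff : g x @[x --> z] --> g z by [].
  rewrite -(fg z Uz); apply: cvg_trans (cf z Uz).
  apply: (@near_eq_cvg _ _ (nbhs z) (nbhs_filter z)).
  apply: (@filterS _ (nbhs z) (nbhs_filter z) U) (open_nbhs_nbhs (conj oU Uz)) => x Ux.
  exact: fg.
move=> cf j; have [df dcf] := cf j; split.
  move=> z Uz; apply: near_eq_derivable (df z Uz).
  by near=> x; apply: fg; near: x; exact: open_nbhs_nbhs.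
apply: IH dcf => z Uz; apply: near_eq_derive.
by near=> x; apply: fg; near: x; exact: open_nbhs_nbhs.
Unshelve. all: by end_near. Qed.

Lemma smooth_eq m (U : set 'rV[R]_m) f g : open U ->
  (forall z, U z -> f z = g z) -> smooth_on U f -> smooth_on U g.
Proof. by move=> oU fg sf k; apply: class_C_eq (sf k). Qed.

Lemma smooth_cont m (U : set 'rV[R]_m) f z : smooth_on U f -> U z -> {for z, continuous f}.
Proof. by move=> sf; exact: (sf 0). Qed.

Lemma smooth_derivable m (U : set 'rV[R]_m) f z j : smooth_on U f -> U z ->
  derivable f z 'e_j.
Proof. by move=> sf Uz; have [+ _] := sf 1%N j; exact. Qed.

Lemma smooth_on_is_derive m (U : set 'rV[R]_m) f z j : smooth_on U f -> U z -> is_derive z 'e_j f ('D_'e_j f z).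
Proof. by move=> sf Uz; apply: derivableP; exact: smooth_derivable sf Uz. Qed.

Lemma smooth_pderiv m (U : set 'rV[R]_m) f j : smooth_on U f ->
  smooth_on U ('D_'e_j f).
Proof. by move=> sf k; have [_] := sf k.+1 j. Qed.

Lemma smooth_sub m (U W : set 'rV[R]_m) f : U `<=` W -> smooth_on W f -> smooth_on U f.
Proof.
move=> UW sf k; move: (sf k); elim: k f {sf} => [|k IH] f /=; first by move=> h z /UW; exact: h.
by move=> h j; have [h1 h2] := h j; split=> [z /UW|]; [exact: h1 | exact: IH].
Qed.

Lemma smooth_local m (U : set 'rV[R]_m) f :
  (forall z, U z -> exists2 W, W z & smooth_on W f) -> smooth_on U f.
Proof.
move=> h k.
have {h} : forall z, U z -> exists2 W, W z & class_C k W f.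
  by move=> z /h[W Wz sW]; exists W.
elim: k f => [|k IH] f /= h; first by move=> z /h[W Wz]; exact.
move=> j; split; first by move=> z /h[W Wz /(_ j)[+ _]]; exact.
by apply: IH => z /h[W Wz /(_ j)[_ ?]]; exists W.
Qed.

(** Smooth functions form the largest family of continuous functions that is stable under partial
    derivatives on [U]. To prove smoothness it is enough to exhibit one such family. *)
Lemma smooth_coind m (U : set 'rV[R]_m) (P : set ('rV[R]_m -> R)) : open U ->
  (forall f, P f -> (forall z, U z -> {for z, continuous f}) /\
    forall j, (forall z, U z -> derivable f z 'e_j) /\
      exists2 g, P g & forall z, U z -> 'D_'e_j f z = g z) ->
  forall f, P f -> smooth_on U f.
Proof.
move=> oU H f Pf k; elim: k f Pf => [|k IH] f /H[cf df] //= j.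
have [dfj [g Pg fg]] := df j; split => //.
by apply: class_C_eq (IH _ Pg) => // z Uz; rewrite fg.
Qed.

Lemma smooth_differentiable m (U : set 'rV[R]_m) f z : open U -> smooth_on U f -> U z ->
  differentiable f z /\ forall v, 'D_v f z = \sum_j v 0 j * 'D_'e_j f z.
Proof.
move=> oU sf Uz; apply: (C1_differentiable oU Uz).
  by move=> x j; exact: smooth_derivable.
by move=> j; apply: smooth_cont Uz; exact: smooth_pderiv.
Qed.

(* The algebra generated by smooth functions under the operations for which
   smoothness is claimed below; it is closed under partial derivatives. *)
Inductive sgen m (U : set 'rV[R]_m) : ('rV[R]_m -> R) -> Prop :=
| sg_base f : smooth_on U f -> sgen U f
| sg_cst c : sgen U (fun=> c)
| sg_coord j : sgen U (fun x => x 0 j)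
| sg_add f g : sgen U f -> sgen U g -> sgen U (fun x => f x + g x)
| sg_mul f g : sgen U f -> sgen U g -> sgen U (fun x => f x * g x)
| sg_inv f : sgen U f -> (forall z, U z -> f z != 0) -> sgen U (fun x => (f x)^-1)
| sg_comp1 (G : set (R -> R)) h f :
    (forall h, G h -> (forall t : R, derivable h t 1) /\ exists2 h', G h' & 'D_1 h = h') ->
    G h -> sgen U f -> sgen U (fun x => h (f x))
| sg_compn p (W : set 'rV[R]_p) (g : 'rV[R]_p -> R) (f : 'rV[R]_m -> 'rV[R]_p) :
    open W -> (forall z, U z -> W (f z)) -> smooth_on W g ->
    (forall j, sgen U (fun x => f x 0 j)) -> sgen U (fun x => g (f x)).

Lemma sgen_sum m (U : set 'rV[R]_m) I (r : seq I) (P : pred I) (F : I -> 'rV[R]_m -> R) :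
  (forall i, P i -> sgen U (F i)) -> sgen U (fun x => \sum_(i <- r | P i) F i x).
Proof.
move=> h; elim: r => [|i r IH].
  by under eq_fun do rewrite big_nil; exact: sg_cst.
under eq_fun do rewrite big_cons; case Pi: (P i) => //.
by apply: sg_add => //; exact: h.
Qed.

Lemma row_continuous (T : topologicalType) p (f : T -> 'rV[R]_p) x :
  (forall j, {for x, continuous (fun y => f y 0 j)}) -> {for x, continuous f}.
Proof.
move=> h; apply/cvgrPdist_lt => e e0.
have : \forall y \near x, forall j, `|f x 0 j - f y 0 j| < e.
  by apply: filter_forall => j; have /cvgrPdist_lt/(_ e e0) := h j.
by apply: filterS => y fy; apply: row_norm_lt => // j; rewrite !mxE.
Qed.

(** Each generating operation has a differentiation rule whose result is again generated, which is
    the premise of [smooth_coind]. In [sg_comp1] the outer function comes with a family [G] stable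
    under derivatives, as the flat exponentials will. *)
Lemma sgen_step m (U : set 'rV[R]_m) f : open U -> sgen U f ->
  (forall z, U z -> {for z, continuous f}) /\
  forall j, (forall z, U z -> derivable f z 'e_j) /\
      exists2 g, sgen U g & forall z, U z -> 'D_'e_j f z = g z.
Proof.
move=> oU; elim=> {f}.
- move=> f sf; split=> [z|j]; first exact: smooth_cont.
  split=> [z|]; first exact: smooth_derivable.
  by exists ('D_'e_j f) => //; apply: sg_base; exact: smooth_pderiv.
- move=> c; split=> [z _|j]; first exact: cst_continuous.
  split=> [z _|]; first exact: derivable_cst.
  by exists (fun=> 0); [exact: sg_cst | move=> z _; rewrite derive_cst].
- move=> j; split=> [z _|k]; first exact: coord_continuous.
  have dc z : is_derive z 'e_k (fun x : 'rV[R]_m => x 0 j) ((k == j)%:R).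
    have E : (fun x : 'rV[R]_m => x 0 j) = lincomb (fun i => (i == j)%:R).
      apply/funext => x; rewrite /lincomb (bigD1 j) //= eqxx mulr1 big1 ?addr0 //.
      by move=> i /negbTE ->; rewrite mulr0.
    have dE : differentiable (lincomb (fun i => (i == j)%:R : R)) z.
      by apply: linear_differentiable; exact: lincomb_continuous.
    rewrite E; split; first exact: diff_derivable.
    rewrite deriveE // diff_lin; last exact: lincomb_continuous.
    rewrite -[LHS]/(lincomb _ _) /lincomb (bigD1 k) //= mxE !eqxx mul1r big1 ?addr0 // => i /negbTE ki.
    by rewrite mxE eqxx ki mul0r.
  split=> [z _|]; first by have [] := dc z.
  by exists (fun=> (k == j)%:R); [exact: sg_cst | move=> z _; have [] := dc z].
- move=> f g sf [cf df] sg [cg dg]; split=> [z Uz|j].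
    by cont.
  have [df1 [f' sf' ff']] := df j; have [dg1 [g' sg' gg']] := dg j.
  split=> [z Uz|]; first by apply: (@derivableD _ _ _ f g); [exact: df1 | exact: dg1].
  exists (fun x => f' x + g' x); first exact: sg_add.
  by move=> z Uz; rewrite -[LHS]/('D__ (f + g) z) deriveD ?ff' ?gg' //; [exact: df1 | exact: dg1].
- move=> f g sf [cf df] sg [cg dg]; split=> [z Uz|j].
    by cont.
  have [df1 [f' sf' ff']] := df j; have [dg1 [g' sg' gg']] := dg j.
  split=> [z Uz|]; first by apply: (@derivableM _ _ f g); [exact: df1 | exact: dg1].
  exists (fun x => f x * g' x + g x * f' x); first by apply: sg_add; apply: sg_mul.
  by move=> z Uz; rewrite -[LHS]/('D__ (f * g) z) deriveM ?ff' ?gg' //; [exact: df1 | exact: dg1].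
- move=> f sf [cf df] f0; split=> [z Uz|j].
    have fz0 := f0 z Uz; have cfz := cf z Uz.
    exact: (@cvgV _ _ (nbhs z)).
  have [df1 [f' sf' ff']] := df j.
  split=> [z Uz|]; first by apply: derivableV; [exact: f0 | exact: df1].
  exists (fun x => (- 1 * ((f x)^-1 * (f x)^-1)) * f' x).
    apply: sg_mul => //; apply: sg_mul; first exact: sg_cst.
    by apply: sg_mul; apply: sg_inv.
  move=> z Uz; have fz0 := f0 z Uz; have dfz := df1 z Uz.
  rewrite deriveV // ff' //.
  by rewrite mulN1r -invfM expr2.
- move=> G h f HG Gh sf [cf df]; have [dh [h' Gh' hh']] := HG _ Gh; split=> [z Uz|j].
    cont.
    by apply/differentiable_continuous/derivable1_diffP.
  have [df1 [f' sf' ff']] := df j.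
  have D z : U z -> is_derive z 'e_j (h \o f) ('D_1 h (f z) * f' z).
    by move=> Uz; apply: is_derive_comp1 => //; rewrite -ff' //; apply: derivableP; exact: df1.
  split=> [z Uz|]; first by have [] := D z Uz.
  exists (fun x => h' (f x) * f' x); last by move=> z Uz; have [_] := D z Uz; rewrite -hh'.
  by apply: sg_mul => //; apply: sg_comp1 HG _ _.
- move=> p W g f oW UW sg sf IH; split=> [z Uz|j].
    apply: (@continuous_comp _ _ _ f g); last by apply: smooth_cont sg _; exact: UW.
    by apply: row_continuous => j; have [+ _] := IH j; exact.
  have D z : U z -> is_derive z 'e_j (g \o f)
      ('D_(\row_i 'D_'e_j (fun y => f y 0 i) z) g (f z)).
    move=> Uz; apply: is_derive_compn; last by have [] := smooth_differentiable oW sg (UW _ Uz).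
    by move=> i; have [_ /(_ j)[+ _]] := IH i; exact.
  split=> [z Uz|]; first by have [] := D z Uz.
  have /choice[f' f'P] : forall i, exists g : 'rV[R]_m -> R, sgen U g /\
     forall z, U z -> 'D_'e_j (fun y => f y 0 i) z = g z.
    by move=> i; have [_ /(_ j)[_ [f' ? ?]]] := IH i; exists f'.
  exists (fun x => \sum_i f' i x * 'D_'e_i g (f x)).
    apply: sgen_sum => i _; apply: sg_mul; first by have [] := f'P i.
    exact: (sg_compn oW UW (smooth_pderiv i sg) sf).
  move=> z Uz; have [_ ->] := D z Uz.
  have [_ ->] := smooth_differentiable oW sg (UW _ Uz).
  by apply: eq_bigr => i _; rewrite mxE; have [_ ->] := f'P i.
Qed.

Lemma sgen_smooth m (U : set 'rV[R]_m) f : open U -> sgen U f -> smooth_on U f.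
Proof. move=> oU; apply: (@smooth_coind m U (sgen U)) => // g; exact: sgen_step. Qed.

End Smooth.

(** * Symmetry of second derivatives *)

Section Schwarz.
Context {R : realType}.

Lemma delta_norm m (i : 'I_m) : `|'e_i : 'rV[R]_m| <= 1.
Proof.
by apply: row_norm_le => // j; rewrite mxE eqxx /=; case: (j == i); rewrite ?normr1 ?normr0.
Qed.

Lemma sum_scale_delta m (s : R) (i : 'I_m) (c : 'I_m -> R) :
  \sum_k (s *: ('e_i : 'rV[R]_m)) 0 k * c k = s * c i.
Proof.
rewrite (bigD1 i) //= !mxE !eqxx mulr1 big1 ?addr0 // => j /negbTE ji.
by rewrite !mxE eqxx ji mulr0 mul0r.
Qed.

(** The mean value theorem along ['e_j] turns the double difference into [s] times an increment of
    ['D_'e_j f] between points that differ by [s *: 'e_i]; strict differentiability of ['D_'e_j f]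
    at [z] evaluates this increment. *)
Lemma second_difference m (U : set 'rV[R]_m) f z i j : open U -> smooth_on U f -> U z ->
  forall e : R, 0 < e -> exists2 r : R, 0 < r & forall s : R, `|s| < r ->
  `|(f (z + s *: 'e_i + s *: 'e_j) - f (z + s *: 'e_j))
     - (f (z + s *: 'e_i) - f z)
     - s * s * 'D_'e_i ('D_'e_j f) z| <= e * (`|s| * `|s|).
Proof.
move=> oU sf Uz e e0; have sj := smooth_pderiv j sf.
have [r1 r10 H] := @C1_strict R m ('D_'e_j f) U z oU Uz
  (fun x k Ux => smooth_derivable sj Ux)
  (fun k => smooth_cont (smooth_pderiv k sj) Uz) e e0.
have /nbhs_ballP[r2 /= r20 UB] := open_nbhs_nbhs (conj oU Uz).
pose r := Num.min r1 r2; have r0 : 0 < r by rewrite lt_min r10.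
(* A corner of the parallelogram is reached from [z] by two moves of length at most |s|. *)
exists (r / 2); first by rewrite divr_gt0.
move=> s sr; pose ei := 'e_i : 'rV[R]_m; pose ej := 'e_j : 'rV[R]_m.
have nr a b : `|a| <= `|s| -> `|b| <= `|s| -> `|z + a *: ei + b *: ej - z| < r.
  move=> ha hb; rewrite -[z + _ + _]addrA [z + _]addrC addrK.
  apply: (le_lt_trans (ler_normD _ _)); rewrite !normrZ.
  have h1 : `|a| * `|ei| <= `|s| by apply: le_trans ha; rewrite ler_piMr // delta_norm.
  have h2 : `|b| * `|ej| <= `|s| by apply: le_trans hb; rewrite ler_piMr // delta_norm.
  by lra.
have inU x : `|x - z| < r -> U x.
  by move=> xr; apply: UB; rewrite -ball_normE /= distrC (lt_le_trans xr) // ge_min lexx orbT.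
have dl a t : `|a| <= `|s| -> `|t| <= `|s| ->
   is_derive t (1 : R) (fun t => f (z + a *: ei + t *: ej)) ('D_ej f (z + a *: ei + t *: ej)).
  by move=> ha ht; apply: is_derive_line; apply: derivableP; apply: smooth_derivable sf _; apply: inU; exact: nr.
have [t ts _|t [ts _]] := @mvt_signed R (fun t => f (z + s *: ei + t *: ej) - f (z + 0 *: ei + t *: ej))
   (fun t => 'D_ej f (z + s *: ei + t *: ej) - 'D_ej f (z + 0 *: ei + t *: ej)) s.
  by apply: is_deriveB; apply: dl => //; rewrite normr0.
rewrite !scale0r !addr0 => E.
have -> : (f (z + s *: ei + s *: ej) - f (z + s *: ej)) - (f (z + s *: ei) - f z) =
   ('D_ej f (z + s *: ei + t *: ej) - 'D_ej f (z + t *: ej)) * s by rewrite -E; ring.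
set X := 'D_ej f _ - 'D_ej f _; set Y := 'D_'e_i _ z.
rewrite (_ : X * s - s * s * Y = s * (X - s * Y)); last by ring.
rewrite normrM mulrCA ler_wpM2l // /X /Y.
have {}nr : `|z + t *: ej - z| < r by have := nr 0 t; rewrite scale0r addr0 normr0; apply.
have nr' : `|z + s *: ei + t *: ej - z| < r.
  rewrite -[z + _ + _]addrA [z + _]addrC addrK; apply: (le_lt_trans (ler_normD _ _)); rewrite !normrZ.
  have h1 : `|s| * `|ei| <= `|s| by rewrite ler_piMr // delta_norm.
  have h2 : `|t| * `|ej| <= `|s| by apply: le_trans ts; rewrite ler_piMr // delta_norm.
  by lra.
have rr1 : r <= r1 by rewrite ge_min lexx.
have := H _ _ (lt_le_trans nr rr1) (lt_le_trans nr' rr1).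
have -> : z + s *: ei + t *: ej - (z + t *: ej) = s *: ei.
  by rewrite [z + _ + _]addrAC [_ + s *: ei]addrC addrK.
rewrite sum_scale_delta => /le_trans; apply.
by apply: ler_wpM2l; [exact: ltW | rewrite normrZ ler_piMr // delta_norm].
Qed.

(** The double difference is symmetric in [i] and [j], and divided by [s * s] it approximates either
    mixed derivative. *)
Lemma schwarz m (U : set 'rV[R]_m) f z i j : open U -> smooth_on U f -> U z ->
  'D_'e_i ('D_'e_j f) z = 'D_'e_j ('D_'e_i f) z.
Proof.
move=> oU sf Uz; apply/eqP; rewrite -subr_eq0 -normr_le0; apply/ler_addgt0Pl => e e0.
rewrite addr0.
have e2 : 0 < e / 2 by rewrite divr_gt0.
have [r1 r10 H1] := second_difference i j oU sf Uz e2.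
have [r2 r20 H2] := second_difference j i oU sf Uz e2.
pose s := Num.min r1 r2 / 2; have s0 : 0 < s by rewrite divr_gt0 // lt_min r10.
have m0 : 0 < Num.min r1 r2 by rewrite lt_min r10.
have sm : `|s| < Num.min r1 r2 by rewrite gtr0_norm // /s; lra.
have s1 : `|s| < r1 by rewrite (lt_le_trans sm) // ge_min lexx.
have s2 : `|s| < r2 by rewrite (lt_le_trans sm) // ge_min lexx orbT.
move: (H1 s s1) (H2 s s2); rewrite !(gtr0_norm s0).
rewrite [z + _ *: 'e_j + _]addrAC.
set A := f (_ + _ + _); set B := f _; set C := f _; set D := f _; set a := derive _ _ _; set b := derive _ _ _.
move=> h1 h2; rewrite -(ler_pM2l (mulr_gt0 s0 s0)) -{1}(gtr0_norm (mulr_gt0 s0 s0)) -normrM.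
have -> : s * s * (a - b) = (A - C - (B - D) - s * s * b) - (A - B - (C - D) - s * s * a) by ring.
apply: (le_trans (ler_normB _ _)); apply: (le_trans (lerD h2 h1)); by rewrite le_eqVlt; apply/orP; left; apply/eqP; field.
Qed.

End Schwarz.

(** * Positive functionals on compactly supported continuous functions *)

Section PosFun.
Context {R : realType} {V : normedModType R}.
Implicit Types f g : V -> R.

Definition cc f := continuous f /\ exists B : R, forall x, B < `|x| -> f x = 0.

Lemma cc0 : cc (fun=> 0).
Proof. by split; [move=> x; exact: cst_continuous | exists 0]. Qed.

Lemma cc_lin (a : R) f g : cc f -> cc g -> cc (fun x => a * f x + g x).
Proof.
move=> [cf [B fB]] [cg [C gC]]; split.
  by cont.
exists (Num.max B C) => x; rewrite gt_max => /andP[xB xC].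
by rewrite fB // gC // mulr0 addr0.
Qed.

Lemma ccMl f g : continuous f -> cc g -> cc (fun x => f x * g x).
Proof.
move=> cf [cg [B gB]]; split; last by exists B => x /gB ->; rewrite mulr0.
by cont.
Qed.

Lemma ccMr f g : cc f -> continuous g -> cc (fun x => f x * g x).
Proof. by move=> ? ?; under eq_fun do rewrite mulrC; exact: ccMl. Qed.

Lemma ccD f g : cc f -> cc g -> cc (fun x => f x + g x).
Proof. by move=> cf cg; have := cc_lin 1 cf cg; under eq_fun do rewrite mul1r. Qed.

Lemma ccZ (a : R) f : cc f -> cc (fun x => a * f x).
Proof. by move=> cf; have := cc_lin a cf cc0; under eq_fun do rewrite addr0. Qed.

Lemma ccN f : cc f -> cc (fun x => - f x).
Proof. by move=> cf; have := ccZ (-1) cf; under eq_fun do rewrite mulN1r. Qed.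

Lemma ccB f g : cc f -> cc g -> cc (fun x => f x - g x).
Proof. by move=> cf cg; exact: ccD cf (ccN cg). Qed.

Lemma cc_norm f : cc f -> cc (fun x => `|f x|).
Proof.
move=> [cf [B fB]]; split; last by exists B => x /fB ->; rewrite normr0.
by cont.
Qed.

Lemma cc_sum I (r : seq I) (P : pred I) (F : I -> V -> R) :
  (forall i, P i -> cc (F i)) -> cc (fun x => \sum_(i <- r | P i) F i x).
Proof.
move=> h; elim: r => [|i r IH]; first by under eq_fun do rewrite big_nil; exact: cc0.
case Pi: (P i); last by under eq_fun do rewrite big_cons Pi.
by under eq_fun do rewrite big_cons Pi; apply: ccD => //; exact: h.
Qed.

(** Positive linear functionals on compactly supported continuous functions; the values of [J]
    elsewhere are unconstrained. Integrals over a segment, over the line and over R^m, and their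
    pullbacks by linear maps, are treated alike through these two properties. *)
Definition posfun (J : (V -> R) -> R) :=
  (forall (a : R) f g, cc f -> cc g -> J (fun x => a * f x + g x) = a * J f + J g) /\
  (forall f, cc f -> (forall x, 0 <= f x) -> 0 <= J f).

Section Linear.
Variables (J : (V -> R) -> R) (posJ : posfun J).

Lemma posfunD f g : cc f -> cc g -> J (fun x => f x + g x) = J f + J g.
Proof. by move=> cf cg; have [/(_ 1 f g cf cg)] := posJ; under eq_fun do rewrite mul1r; rewrite mul1r. Qed.

Lemma posfun0 : J (fun=> 0) = 0.
Proof.
have := posfunD cc0 cc0; under eq_fun do rewrite addr0.
by move/eqP; rewrite -subr_eq subrr => /eqP.
Qed.

Lemma posfunZ (a : R) f : cc f -> J (fun x => a * f x) = a * J f.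
Proof.
move=> cf; have [/(_ a f _ cf cc0)] := posJ; under eq_fun do rewrite addr0.
by rewrite posfun0 addr0.
Qed.

Lemma posfunN f : cc f -> J (fun x => - f x) = - J f.
Proof. by move=> cf; under eq_fun do rewrite -mulN1r; rewrite posfunZ // mulN1r. Qed.

Lemma posfunB f g : cc f -> cc g -> J (fun x => f x - g x) = J f - J g.
Proof. by move=> cf cg; rewrite -posfunN // -posfunD //; exact: ccN. Qed.

Lemma posfun_sum I (r : seq I) (P : pred I) (F : I -> V -> R) :
  (forall i, P i -> cc (F i)) ->
  J (fun x => \sum_(i <- r | P i) F i x) = \sum_(i <- r | P i) J (F i).
Proof.
move=> h; elim: r => [|i r IH].
  by under eq_fun do rewrite big_nil; rewrite big_nil posfun0.
rewrite big_cons; case Pi: (P i); last by under eq_fun do rewrite big_cons Pi.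
under eq_fun do rewrite big_cons Pi; rewrite posfunD ?IH //; first exact: h.
by apply: cc_sum.
Qed.

Lemma posfun_le f g : cc f -> cc g -> (forall x, f x <= g x) -> J f <= J g.
Proof.
move=> cf cg fg; rewrite -subr_ge0 -posfunB //.
by apply: (proj2 posJ); [exact: ccB | move=> x; rewrite subr_ge0].
Qed.

Lemma posfun_norm f g : cc f -> cc g -> (forall x, `|f x| <= g x) -> `|J f| <= J g.
Proof.
move=> cf cg fg; rewrite ler_norml -posfunN //; apply/andP; split.
  by apply: posfun_le => //; [exact: ccN | move=> x; rewrite lerNl; move: (fg x); rewrite ler_norml lerNl => /andP[]].
by apply: posfun_le => // x; apply: le_trans (fg x); exact: ler_norm.
Qed.

Definition plateau (B : R) (x : V) : R := Num.max 0 (Num.min 1 (B + 1 - `|x|)).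

Lemma cc_plateau B : cc (plateau B).
Proof.
split; last by exists (B + 1) => x xB; rewrite /plateau max_l // ge_min subr_le0 (ltW xB) orbT.
move=> x; apply: (@continuous_max _ _ (fun=> 0 : R^o) (fun x => Num.min 1 (B + 1 - `|x|) : R^o)); first exact: cst_continuous.
apply: (@continuous_min _ _ (fun=> 1 : R^o) (fun x => (B + 1 - `|x|) : R^o)); first exact: cst_continuous.
by cont.
Qed.

Lemma plateau_ge0 B x : 0 <= plateau B x.
Proof. by rewrite /plateau le_max lexx. Qed.

Lemma plateau1 B x : `|x| <= B -> plateau B x = 1.
Proof.
move=> xB; have h : 1 <= B + 1 - `|x| by lra.
by rewrite /plateau (min_idPl h) max_r.
Qed.

(** [J (plateau B)] stands in for the mass of the ball of radius [B]. *)
Lemma posfun_bound B f (M : R) : cc f -> (forall x, B < `|x| -> f x = 0) ->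
  (forall x, `|f x| <= M) -> `|J f| <= M * J (plateau B).
Proof.
move=> cf fB fM; rewrite -posfunZ; last exact: cc_plateau.
apply: posfun_norm => //; first by apply: ccZ; exact: cc_plateau.
move=> x; have M0 : 0 <= M by apply: le_trans (fM x).
case: (lerP `|x| B) => xB; first by rewrite plateau1 // mulr1.
by rewrite fB // normr0 mulr_ge0 // plateau_ge0.
Qed.

Hypothesis Vc : forall B : R, compact [set x : V | `|x| <= B].

(** Compactness of the ball turns joint continuity at the points [(x0, y)] into uniform closeness of
    [F x] to [F x0], and positivity bounds the difference of the values of [J]. *)
Lemma posfun_cont (X : topologicalType) (F : X -> V -> R) x0 (B : R) :
  (forall x, continuous (F x)) ->
  (forall y, {for (x0, y), continuous (fun p : X * V => F p.1 p.2)}) ->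
  (forall x y, B < `|y| -> F x y = 0) ->
  {for x0, continuous (fun x => J (F x))}.
Proof.
move=> cF jF FB; have ccF x : cc (F x) by split => //; exists B; exact: FB.
apply/cvgrPdist_le => e e0.
have P0 : 0 <= J (plateau B) by apply: (proj2 posJ); [exact: cc_plateau | exact: plateau_ge0].
(* The mass may be 0, hence the added 1. *)
pose d := e / (J (plateau B) + 1); have d0 : 0 < d by rewrite divr_gt0 // ltr_wpDl.
have /compact_near_coveringP K := Vc (B := B).
have : \forall x \near x0, [set y | `|y| <= B] `<=` (fun y => `|F x0 y - F x y| <= d).
  apply: (K X (nbhs x0) (fun x y => `|F x0 y - F x y| <= d)) => y _.
  have d2 : 0 < d / 2 by rewrite divr_gt0.
  have /cvgrPdist_le/(_ _ d2) [[A C] /= [Ax Cy] AC] := jF y.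
  exists (C, A) => //= -[y' x'] /= [Cy' Ax'].
  have h1 := AC (x', y') (conj Ax' Cy'); have h2 := AC (x0, y') (conj (nbhs_singleton Ax) Cy').
  move: h1 h2 => /=; set a := F x0 y; set b := F x' y'; set c := F x0 y' => h1 h2.
  rewrite (_ : c - b = (a - b) - (a - c)); last by ring.
  by apply: (le_trans (ler_normB _ _)); lra.
apply: filterS => x xK; rewrite -posfunB //.
apply: (@le_trans _ _ (d * J (plateau B))).
  apply: posfun_bound; first exact: ccB.
    by move=> y yB; rewrite !FB // subrr.
  move=> y; case: (lerP `|y| B) => yB; first exact: xK.
  by rewrite !FB // subrr normr0 ltW.
by rewrite /d mulrAC ler_pdivrMr ?ltr_wpDl // ler_wpM2l ?ltW //; lra.
Qed.

(** By the mean value theorem the difference quotient, completed by the derivative at [h = 0], is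
    continuous at [h = 0] jointly with [y]. Differentiation under [J] is then an instance of
    [posfun_cont]. *)
Lemma posfun_derive (F G : R -> V -> R) (B : R) (t : R) :
  (forall s, continuous (F s)) ->
  (forall s y, is_derive s (1 : R) (F ^~ y) (G s y)) ->
  continuous (fun p : R * V => G p.1 p.2) ->
  (forall s y, B < `|y| -> F s y = 0) ->
  is_derive t (1 : R) (fun s => J (F s)) (J (G t)).
Proof.
move=> cF dF cG FB.
have cGt s : continuous (G s).
  by cont.
have GB s y : B < `|y| -> G s y = 0.
  move=> yB; have [_ <-] := dF s y.
  by rewrite (_ : F ^~ y = cst 0) ?derive_cst //; apply/funext => u; exact: FB.
have ccF s : cc (F s) by split => //; exists B; exact: FB.
have ccG s : cc (G s) by split => //; exists B; exact: GB.
pose H (h : R) y := if h == 0 then G t y else h^-1 * (F (h + t) y - F t y).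
have Hcont h : continuous (H h).
  rewrite /H; case: (h == 0) => //.
  by cont.
have HB h y : B < `|y| -> H h y = 0.
  by move=> yB; rewrite /H GB // !FB // subrr mulr0 if_same.
have Hmv h y : exists2 s : R, `|s| <= `|h| & H h y = G (t + s) y.
  rewrite /H; case: eqP => [->|/eqP h0]; first by exists 0; rewrite ?addr0 // normr0.
  have [s ss _|s [sh _ E]] := @mvt_signed R (fun s => F (t + s) y) (fun s => G (t + s) y) h.
    have := dF (t + s) y => dFs; rewrite -[s]/(id s).
    have E : (fun s => F (t + s) y) = (fun s : R => (F ^~ y) (t + s *: (1 : R))).
      by apply/funext => u; rewrite [u *: 1]mulr1.
    by rewrite E; apply: (@is_derive_line R R (F ^~ y) t 1 s); rewrite [s *: 1]mulr1.
  by exists s => //; move: E; rewrite addr0 [h + t]addrC => ->; rewrite mulrC mulfK.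
have : {for 0, continuous (fun h => J (H h))}.
  apply: (posfun_cont (B := B)) => // y; apply/cvgrPdist_le => e e0.
  have /cvgrPdist_le/(_ e e0) [[A C] /= [At Cy] AC] := cG (t, y).
  have /nbhs_ballP[r /= r0 rA] := At.
  exists (ball 0 r, C); first by split => //; exact: nbhsx_ballx.
  move=> [h y'] /= [hr Cy']; have [s sh ->] := Hmv h y'.
  rewrite {1}/H eqxx; apply: (AC (t + s, y')); split => //=; apply: rA.
  rewrite /ball /= opprD addrA subrr sub0r normrN (le_lt_trans sh) //.
  by move: hr; rewrite /ball /= sub0r normrN.
move=> JH.
have E0 : J (H 0) = J (G t) by congr J; apply/funext => y; rewrite /H eqxx.
have lim : (fun h : R => h^-1 *: (((fun s => J (F s)) \o shift t) (h *: (1:R)) - J (F t))) @ 0^' --> J (G t).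
  rewrite -E0.
  have JH' : (fun h => J (H h)) @ 0^' --> J (H 0) by apply/continuous_withinNx.
  apply: cvg_trans JH'; apply: near_eq_cvg; apply: filterS (nbhs_dnbhs_neq (0 : R)) => h h0 /=.
  rewrite [h *: 1]mulr1 -[RHS]/(h^-1 * (J (F (h + t)) - J (F t))) -posfunB // -posfunZ; last exact: ccB.
  by congr J; apply/funext => y; rewrite /H (negbTE h0).
by split; [apply/cvg_ex; exists (J (G t)) | exact: cvg_lim].
Qed.

End Linear.
End PosFun.

(** * The iterated Lebesgue integral *)

Section Integral1.
Context {R : realType}.
Local Notation mu := (@lebesgue_measure R).
Implicit Types f g : R -> R.

Lemma compact_normR (B : R) : compact [set x : R | `|x| <= B].
Proof.
rewrite (_ : [set x : R | `|x| <= B] = `[- B, B]%classic); first exact: segment_compact.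
by apply/seteqP; split => x /=; rewrite in_itv /= ler_norml.
Qed.

Lemma compact_norm_row m (B : R) : compact [set x : 'rV[R]_m | `|x| <= B].
Proof.
apply: bounded_closed_compact.
  by exists B; split; [exact: num_real | move=> M BM x /= xB; exact: le_trans xB (ltW BM)].
rewrite (_ : [set x : 'rV[R]_m | _] = (fun x : 'rV[R]_m => `|x|) @^-1` [set y | y <= B]) //.
by apply: closed_comp; [move=> x _; exact: norm_continuous | exact: closed_le].
Qed.

Lemma integrable_seg a b f : continuous f -> mu.-integrable `[a, b] (EFin \o f).
Proof.
by move=> cf; apply: continuous_compact_integrable; [exact: segment_compact | exact: continuous_subspaceT].
Qed.

Lemma posfun_seg a b : posfun (fun f : R -> R => \int[mu]_(x in `[a, b]) f x).
Proof.
split=> [c f g [cf _] [cg _]|f _ f0]; last by apply: Rintegral_ge0 => x _.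
rewrite RintegralD //; [rewrite RintegralZl //; exact: integrable_seg| |exact: integrable_seg].
by apply: integrable_seg => x; cont.
Qed.

(** The lower limit lies one unit to the left of the interval [-B, B] that carries [f]. Thus the
    primitive vanishes to the left of -B, and the fundamental theorem applies at every point from -B
    on. *)
Definition prim (B : R) f (x : R) : R := \int[mu]_(t in `[- (B + 1), x]) f t.

Lemma prim_left B f x : (forall y, B < `|y| -> f y = 0) -> x < - B -> prim B f x = 0.
Proof.
move=> fB xB; rewrite -(posfun0 (posfun_seg (- (B + 1)) x)); apply: eq_Rintegral => y.
rewrite inE /= in_itv /= => /andP[_ yx]; apply: fB.
have : B < - y by lra.
by move=> h; apply: (lt_le_trans h); rewrite -normrN ler_norm.
Qed.

Lemma prim_derive B f x : continuous f -> (forall y, B < `|y| -> f y = 0) ->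
  is_derive x (1 : R) (prim B f) (f x).
Proof.
move=> cf fB; case: (ltP (- (B + 1)) x) => xB.
  have x1 : x < x + 1 by rewrite ltrDl.
  have [d1 d2] := continuous_FTC1_closed x1 (integrable_seg (- (B + 1)) (x + 1) cf) xB (cf x).
  by split; [exact: d1 | rewrite -derive1E; exact: d2].
have xB' : x < - B by lra.
have -> : f x = 0.
  by apply: fB; rewrite -normrN; apply: (lt_le_trans _ (ler_norm _)); lra.
have h : is_derive x (1 : R) (cst 0 : R -> R) 0 by exact: is_derive_cst.
apply: near_eq_is_derive h; near=> y; rewrite /= prim_left //; near: y; exact: lt_nbhsl.
Unshelve. all: by end_near. Qed.

Lemma int1E B f b : (forall y, B < `|y| -> f y = 0) -> B <= b ->
  \int[mu]_(x in setT) f x = prim B f b.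
Proof.
move=> fB Bb; rewrite /prim [RHS]Rintegral_mkcond; congr (Rintegral _ _ _).
apply/funext => x; rewrite patchE; case: ifPn => //; rewrite notin_setE /= in_itv /= => /negP.
rewrite negb_and -!ltNge => h; apply: fB; case/orP: h => h.
  by rewrite -normrN; apply: (lt_le_trans _ (ler_norm _)); lra.
by apply: (lt_le_trans _ (ler_norm _)); lra.
Qed.

Lemma derive0_const (G : R -> R) : (forall x, is_derive x (1 : R) G 0) -> forall a b, G a = G b.
Proof.
move=> dG; suff H a b : a < b -> G a = G b.
  by move=> a b; case: (ltrgtP a b) => [/H|/H|->].
move=> ab; have [|c _] := @MVT _ G (fun=> 0) a b ab (fun x _ => dG x).
  by apply: derivable_within_continuous => x _; have [] := dG x.
by rewrite mul0r => /eqP; rewrite subr_eq0 => /eqP.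
Qed.

Lemma int1_prim B f F a b : continuous f -> (forall y, B < `|y| -> f y = 0) ->
  (forall x, is_derive x (1 : R) F (f x)) -> a < - B -> B <= b ->
  \int[mu]_(x in setT) f x = F b - F a.
Proof.
move=> cf fB dF aB Bb; rewrite (int1E fB Bb).
have dG x : is_derive x (1 : R) (F - prim B f) 0.
  by have -> : 0 = f x - f x by [rewrite subrr]; apply: is_deriveB; exact: prim_derive.
have := derive0_const dG a b; rewrite -![(_ - _ : _ -> _) _]/(_ - _) (prim_left fB aB) => H.
by move: H => /=; lra.
Qed.

Lemma posfun_int1 : posfun (fun f : R -> R => \int[mu]_(x in setT) f x).
Proof.
split=> [c f g ccf ccg|f _ f0]; last exact: Rintegral_ge0.
have [_ [B fB]] := ccf; have [_ [C gC]] := ccg.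
pose D := Num.max B C.
have fD y : D < `|y| -> f y = 0 by rewrite gt_max => /andP[? _]; exact: fB.
have gD y : D < `|y| -> g y = 0 by rewrite gt_max => /andP[_ ?]; exact: gC.
rewrite (int1E fD (lexx D)) (int1E gD (lexx D)) (@int1E D _ D) //.
  by have [h _] := posfun_seg (- (D + 1)) D; exact: h.
by move=> y yD; rewrite fD // gD // mulr0 addr0.
Qed.

Lemma int1_shift f a : cc f -> \int[mu]_(x in setT) f (x + a) = \int[mu]_(x in setT) f x.
Proof.
move=> [cf [B0 fB0]]; pose B := `|B0|.
have fB y : B < `|y| -> f y = 0.
  by move=> h; apply: fB0; apply: le_lt_trans h; exact: ler_norm.
have B0' : 0 <= B by exact: normr_ge0.
pose C := B + `|a|.
have fC y : C < `|y| -> f (y + a) = 0.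
  move=> h; apply: fB; have := ler_normB (y + a) a; rewrite addrK /C in h *; lra.
have cfa : continuous (fun x => f (x + a)).
  by cont.
have dp x : is_derive x (1 : R) (fun x => prim B f (x + a)) (f (x + a)).
  have := @is_derive_line R R (prim B f) a 1 x (f (x + a)).
  under eq_fun do rewrite [_ *: 1]mulr1 addrC; rewrite [_ *: 1]mulr1 addrC; apply.
  exact: prim_derive.
have C1 : - (C + 1) < - C by rewrite ltrN2 ltrDl.
rewrite (int1_prim cfa fC dp C1 (lexx C)).
rewrite (int1E fB (_ : B <= C + a)) ?(@prim_left B f (- (C + 1) + a) fB) ?subr0 //.
  by have := ler_norm a; rewrite /C; lra.
by have := ler_norm (- a); rewrite normrN /C; lra.
Qed.

Lemma int1_gt0 f x0 : cc f -> (forall x, 0 <= f x) -> 0 < f x0 -> 0 < \int[mu]_(x in setT) f x.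
Proof.
move=> [cf [B fB]] f0 fx0.
have /cvgrPdist_lt/(_ _ fx0)/nbhs_ballP[r /= r0 rP] := cf x0.
pose a := x0 - r / 2; pose b := x0 + r / 2; pose F := prim B f.
have dF x : is_derive x (1 : R) F (f x) by exact: prim_derive.
have mvt x y : x < y -> exists2 c, x <= c <= y & F y - F x = f c * (y - x).
  move=> xy; have [|c cc E] := @MVT _ F f x y xy (fun z _ => dF z).
    by apply: derivable_within_continuous => z _; have [] := dF z.
  by exists c => //; move: cc; rewrite in_itv /= => /andP[? ?]; rewrite !ltW.
have mono x y : x < y -> F x <= F y.
  by move=> xy; have [c _ E] := mvt x y xy; rewrite -subr_ge0 E mulr_ge0 // subr_ge0 ltW.
have [] := mvt a b; first by rewrite /a /b; lra.
move=> c /andP[ac cb] E.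
have fc : 0 < f c.
  have := rP c; rewrite /ball /= => /(_ _); have -> : `|x0 - c| < r.
    by rewrite ltr_norml; rewrite /a /b in ac cb; apply/andP; split; lra.
  by move=> /(_ isT); rewrite ltr_norml => /andP[h1 h2]; lra.
have ab0 : 0 < F b - F a by rewrite E mulr_gt0 // /a /b; lra.
pose a' := - (`|B| + `|a| + 1); pose b' := `|B| + `|b| + 1.
have aB : a' < - B by have := ler_norm B; have := normr_ge0 a; rewrite /a'; lra.
have bB : B <= b' by have := ler_norm B; have := normr_ge0 b; rewrite /b'; lra.
rewrite (int1_prim cf fB dF aB bB).
have h1 : F a' <= F a.
  by apply: mono; have := normr_ge0 B; have := ler_norm (- a); rewrite normrN /a'; lra.
have h2 : F b <= F b'.
  by apply: mono; have := normr_ge0 B; have := ler_norm b; rewrite /b'; lra.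
lra.
Qed.

Lemma int1_bounded_cvg (g : nat -> R -> R) (B M : R) : (forall k, continuous (g k)) ->
  (forall k y, B < `|y| -> g k y = 0) -> (forall k y, `|g k y| <= M) ->
  (forall y, g k y @[k --> \oo] --> 0) ->
  \int[mu]_(x in setT) g k x @[k --> \oo] --> 0.
Proof.
move=> cg gB gM g0; pose D := `[- (B + 1), B]%classic.
have mD : measurable D by exact: measurable_itv.
have ig k : mu.-integrable D (EFin \o g k) by exact: integrable_seg.
have [|||||_ _ H] := @dominated_convergence _ _ R mu D mD (fun k x => (g k x)%:E) (fun=> 0%E) (fun=> M%:E).
- by move=> k; have /integrableP[] := ig k.
- exact: measurable_cst.
- by apply: aeW => x _; apply: (cvg_EFin (f := fun k => (g k x)%:E)); [exact: nearW | exact: g0].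
- have := @integrable_seg (- (B + 1)) B (fun=> M); apply; move=> x; exact: cst_continuous.
- by apply: aeW => x k _; rewrite lee_fin.
rewrite integral0 in H.
have E k : \int[mu]_(x in setT) g k x = fine (\int[mu]_(x in D) (g k x)%:E).
  by rewrite (@int1E B (g k) B (gB k)).
under eq_fun do rewrite E.
exact: (fine_cvg H).
Qed.

Section Fubini1.
Context {V : normedModType R} (J : (V -> R) -> R).
Hypothesis posJ : posfun J.
Hypothesis Vc : forall B : R, compact [set x : V | `|x| <= B].

(** [J] applied to the primitive of [F] in [x] has derivative [J (F x)] by [posfun_derive] and
    vanishes far to the left, so its value on the right is the integral of [J (F x)]. *)
Lemma int1_swap (F : R -> V -> R) (B : R) : continuous (fun p : R * V => F p.1 p.2) ->
  (forall x y, B < `|x| -> F x y = 0) -> (forall x y, B < `|y| -> F x y = 0) ->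
  J (fun y => \int[mu]_(x in setT) F x y) = \int[mu]_(x in setT) J (F x).
Proof.
move=> cF FBx FBy.
have cFx x : continuous (F x).
  by cont.
have cFy y : continuous (F ^~ y).
  by cont.
pose P x y := prim B (F ^~ y) x.
have dP x : is_derive x (1 : R) (fun s => J (P s)) (J (F x)).
  apply: (@posfun_derive _ _ _ posJ Vc P F B) => //.
  - move=> s y; apply: (@posfun_cont _ _ _ (posfun_seg (- (B + 1)) s) compact_normR _ (fun y x => F x y) y B) => //.
      by cont.
    by move=> y' x'; exact: FBx.
  - by move=> s y; apply: prim_derive => // x'; exact: FBx.
  - move=> s y yB; rewrite /P -(posfun0 (posfun_seg (- (B + 1)) s)); apply: eq_Rintegral => u _.
    exact: FBy.
have cJ : continuous (fun x => J (F x)).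
  by move=> x; apply: (@posfun_cont _ _ _ posJ Vc _ F x B) => // y; exact: cF.
have JB x : B < `|x| -> J (F x) = 0.
  by move=> xB; rewrite -(posfun0 posJ); congr J; apply/funext => y; exact: FBx.
have aB : - (`|B| + 1) < - B by have := ler_norm B; lra.
rewrite (int1_prim cJ JB dP aB (lexx B)).
have -> : J (P (- (`|B| + 1))) = 0.
  rewrite -(posfun0 posJ); congr J; apply/funext => y; apply: prim_left => [x|//].
  exact: FBx.
rewrite subr0; congr J; apply/funext => y; apply: int1E => // x; exact: FBx.
Qed.

End Fubini1.

End Integral1.

Section Integral.
Context {R : realType}.
Local Notation mu := (@lebesgue_measure R).
Local Notation I := (@integral_rV R _).

Definition rcons0 m (x : R) (v : 'rV[R]_m) : 'rV[R]_m.+1 := row_mx (x%:M : 'rV[R]_1) v.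

Lemma rcons0_0 m x (v : 'rV[R]_m) : rcons0 x v 0 0 = x.
Proof.
rewrite /rcons0 (_ : 0 = lshift m 0 :> 'I_(1 + m)); last exact: val_inj.
by apply: etrans (@row_mxEl R 1 1 m x%:M v 0 0) _; rewrite mxE eqxx mulr1n.
Qed.

Lemma rcons0_S m x (v : 'rV[R]_m) j : rcons0 x v 0 (lift ord0 j) = v 0 j.
Proof.
rewrite /rcons0 (_ : lift ord0 j = rshift 1 j :> 'I_(1 + m)); last exact: val_inj.
exact: (@row_mxEr R 1 1 m x%:M v 0 j).
Qed.

Lemma rcons0_surj m (u : 'rV[R]_m.+1) : u = rcons0 (u 0 0) (\row_j u 0 (lift ord0 j)).
Proof.
apply/rowP => j; case: (unliftP ord0 j) => [k ->|->].
  by rewrite rcons0_S mxE.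
by rewrite rcons0_0.
Qed.

Lemma rcons0D m x y (v w : 'rV[R]_m) : rcons0 x v + rcons0 y w = rcons0 (x + y) (v + w).
Proof. by rewrite [RHS]/rcons0 raddfD -add_row_mx. Qed.

Lemma rcons0_continuous m : continuous (fun p : R * 'rV[R]_m => rcons0 p.1 p.2).
Proof.
move=> p; apply: row_continuous => j; case: (unliftP ord0 j) => [k ->|->].
  rewrite (_ : (fun y => _) = (fun y : R * 'rV[R]_m => y.2 0 k)); last by apply/funext => y; rewrite rcons0_S.
  by cont.
rewrite (_ : (fun y => _) = (fun y : R * 'rV[R]_m => y.1)); first exact: cvg_fst.
by apply/funext => y; rewrite rcons0_0.
Qed.

Ltac cont_fact ::= first [exact: norm_continuous | exact: rcons0_continuous].

Lemma rcons0_ge1 m x (v : 'rV[R]_m) : `|x| <= `|rcons0 x v|.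
Proof. by have := row_norm_ge (rcons0 x v) 0; rewrite rcons0_0. Qed.

Lemma rcons0_ge2 m x (v : 'rV[R]_m) : `|v| <= `|rcons0 x v|.
Proof. by apply: row_norm_le => // j; rewrite -(rcons0_S x); exact: row_norm_ge. Qed.

Lemma rcons0_cc m (f : 'rV[R]_m.+1 -> R) x : cc f -> cc (fun v => f (rcons0 x v)).
Proof.
move=> [cf [B fB]]; split; last by exists B => v vB; apply: fB; exact: lt_le_trans (rcons0_ge2 _ _).
by cont.
Qed.

Lemma integral_rVS m (f : 'rV[R]_m.+1 -> R) :
  I f = \int[mu]_(x in setT) I (fun v : 'rV[R]_m => f (rcons0 x v)).
Proof. by []. Qed.

Lemma inner_cc m (f : 'rV[R]_m.+1 -> R) : posfun (@integral_rV R m) -> cc f ->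
  cc (fun x => I (fun v : 'rV[R]_m => f (rcons0 x v))).
Proof.
move=> pI ccf; have [cf [B fB]] := ccf; split.
  move=> x; apply: (@posfun_cont _ _ _ pI (@compact_norm_row R m) _ (fun x v => f (rcons0 x v)) x B).
  - by move=> x'; have [] := rcons0_cc x' ccf.
  - by cont.
  - by move=> x' v vB; apply: fB; exact: lt_le_trans (rcons0_ge2 _ _).
exists B => x xB; rewrite -(posfun0 pI); congr I; apply/funext => v.
by apply: fB; exact: lt_le_trans (rcons0_ge1 _ _).
Qed.

Lemma posfun_int m : posfun (@integral_rV R m).
Proof.
elim: m => [|m IH]; first by split=> [a f g _ _|f _ f0] //=; exact: f0.
split=> [a f g cf cg|f cf f0]; rewrite !integral_rVS.
  have [+ _] := @posfun_int1 R => <-; [|exact: inner_cc..].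
  congr (Rintegral _ _ _); apply/funext => x.
  by have [+ _] := IH => <- //; exact: rcons0_cc.
have [_] := @posfun_int1 R; apply; first exact: inner_cc.
by move=> x; have [_] := IH; apply => //; exact: rcons0_cc.
Qed.

(** Induction moves one coordinate at a time past [J]. The inner integral [G] stays jointly
    continuous by [posfun_cont], which makes the one-dimensional exchange applicable. *)
Lemma int_swap m (V : normedModType R) (J : (V -> R) -> R) (F : 'rV[R]_m -> V -> R) (B : R) :
  posfun J -> (forall C : R, compact [set x : V | `|x| <= C]) ->
  continuous (fun p : 'rV[R]_m * V => F p.1 p.2) ->
  (forall x y, B < `|x| -> F x y = 0) -> (forall x y, B < `|y| -> F x y = 0) ->
  J (fun y => I (F ^~ y)) = I (fun x => J (F x)).
Proof.
move=> pJ Vc; elim: m F => [|m IH] F cF FBx FBy //.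
have cG : continuous (fun p : (R * V) * 'rV[R]_m => F (rcons0 p.1.1 p.2) p.1.2).
  by cont.
have cGp q : continuous (fun v => F (rcons0 q.1 v) q.2) by cont.
pose G (x : R) y := I (fun v : 'rV[R]_m => F (rcons0 x v) y).
have cGG : continuous (fun p : R * V => G p.1 p.2).
  move=> p; apply: (@posfun_cont _ _ _ (posfun_int m) (@compact_norm_row R m) _
    (fun p v => F (rcons0 p.1 v) p.2) p B) => // [y|q v vB]; first exact: cG.
  by apply: FBx; exact: lt_le_trans (rcons0_ge2 _ _).
have GBx x y : B < `|x| -> G x y = 0.
  move=> xB; rewrite -(posfun0 (posfun_int m)); congr I; apply/funext => v; apply: FBx.
  exact: lt_le_trans (rcons0_ge1 _ _).
have GBy x y : B < `|y| -> G x y = 0.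
  by move=> yB; rewrite -(posfun0 (posfun_int m)); congr I; apply/funext => v; exact: FBy.
have -> : (fun y => I (F ^~ y)) = (fun y => \int[mu]_(x in setT) G x y) by [].
rewrite (int1_swap pJ Vc cGG GBx GBy).
rewrite integral_rVS; congr (Rintegral _ _ _); apply/funext => x.
apply: (IH (fun v y => F (rcons0 x v) y)).
- by move=> p; apply: (cont_comp (f := fun p => ((x, p.2), p.1))) (cG _); cont.
- by move=> v y vB; apply: FBx; exact: lt_le_trans (rcons0_ge2 _ _).
- by move=> v y; exact: FBy.
Qed.

Lemma cc_shift (V : normedModType R) (f : V -> R) a : cc f -> cc (fun x => f (x + a)).
Proof.
move=> [cf [B fB]]; split.
  by cont.
exists (B + `|a|) => x xB; apply: fB.
by have := ler_normB (x + a) a; rewrite addrK => h; lra.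
Qed.

Lemma int_shift m (f : 'rV[R]_m -> R) a : cc f -> I (fun x => f (x + a)) = I f.
Proof.
elim: m f a => [|m IH] f a cf; first by rewrite /= add0r; congr f; apply/rowP; case.
rewrite !integral_rVS [a]rcons0_surj.
transitivity (\int[mu]_(x in setT) I (fun v : 'rV[R]_m => f (rcons0 (x + a 0 0) v))).
  congr (Rintegral _ _ _); apply/funext => x; rewrite -[RHS](IH _ (\row_j a 0 (lift ord0 j))).
    by congr I; apply/funext => v; rewrite rcons0D.
  exact: rcons0_cc.
apply: (@int1_shift R (fun x => I (fun v : 'rV[R]_m => f (rcons0 x v)))).
exact: inner_cc (posfun_int m) cf.
Qed.

Lemma int_gt0 m (f : 'rV[R]_m -> R) x0 : cc f -> (forall x, 0 <= f x) -> 0 < f x0 -> 0 < I f.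
Proof.
elim: m f x0 => [|m IH] f x0 cf f0 fx0.
  by rewrite /= (_ : 0 = x0) //; apply/rowP; case.
rewrite integral_rVS; apply: (@int1_gt0 R _ (x0 0 0)); first exact: inner_cc (posfun_int m) cf.
  by move=> x; apply: (proj2 (posfun_int m)) => //; exact: rcons0_cc.
apply: (IH _ (\row_j x0 0 (lift ord0 j))); [exact: rcons0_cc | by [] |].
by rewrite -rcons0_surj.
Qed.

Lemma int_bounded_cvg m (g : nat -> 'rV[R]_m -> R) (B M : R) : (forall k, continuous (g k)) ->
  (forall k y, B < `|y| -> g k y = 0) -> (forall k y, `|g k y| <= M) ->
  (forall y, g k y @[k --> \oo] --> 0) ->
  I (g k) @[k --> \oo] --> 0.
Proof.
elim: m g M => [|m IH] g M cg gB gM g0; first exact: g0.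
have ccg k : cc (g k) by split => //; exists B; exact: gB.
under eq_fun do rewrite integral_rVS.
have M0 : 0 <= M by apply: le_trans (gM 0 0).
apply: (@int1_bounded_cvg R (fun k x => I (fun v => g k (rcons0 x v))) B (M * I (@plateau R 'rV[R]_m B))).
- by move=> k; have [] := inner_cc (posfun_int m) (ccg k).
- move=> k x xB; rewrite -(posfun0 (posfun_int m)); congr I; apply/funext => v; apply: gB.
  exact: lt_le_trans (rcons0_ge1 _ _).
- move=> k x; apply: (posfun_bound (posfun_int m)) => //; first exact: rcons0_cc.
  by move=> v vB; apply: gB; exact: lt_le_trans (rcons0_ge2 _ _).
- move=> x; apply: (IH _ M).
  + by move=> k; have [] := rcons0_cc x (ccg k).
  + by move=> k v vB; apply: gB; exact: lt_le_trans (rcons0_ge2 _ _).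
  + by move=> k v.
  + by move=> v; exact: g0.
Qed.

(* Translation invariance, differentiated at 0. *)
Lemma int_pderiv m (f : 'rV[R]_m -> R) j : cc f -> (forall x, derivable f x 'e_j) ->
  continuous ('D_'e_j f) -> I ('D_'e_j f) = 0.
Proof.
move=> ccf df cdf; have [cf [B fB]] := ccf.
pose e := 'e_j : 'rV[R]_m.
pose c (s : R) := Num.max (-1) (Num.min 1 s).
(* Truncating s to [-1, 1] keeps the supports uniformly bounded. *)
pose F (s : R) (y : 'rV[R]_m) := f (y + s *: e).
have ccF s : cc (F s) by exact: cc_shift.
have IF s : I (F s) = I f by exact: int_shift.
suff H : is_derive (0 : R) (1 : R) (fun s => I (F s)) (I ('D_e f)).
  have [_ <-] := H; rewrite (_ : (fun s => I (F s)) = cst (I f)) ?derive_cst //.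
  by apply/funext => s; exact: IF.
have -> : I ('D_e f) = I (fun y => 'D_e f (y + (0 : R) *: e)).
  by congr I; apply/funext => y; rewrite scale0r addr0.
(* The factor [P] bounds the supports uniformly in [s], as [posfun_derive] requires. As long as |s|
   < 1 it equals 1 on the support of [F s]. *)
pose P := @plateau R 'rV[R]_m (B + 1).
have near1 : \forall s \near (0 : R), I (fun y => P y * F s y) = I (F s).
  have s1 : \forall s \near (0 : R), `|s| < 1 by exact: nbhs0_lt.
  apply: filterS s1 => s s1; congr I; apply/funext => y.
  case: (lerP `|y| (B + 1)) => yB; first by rewrite /P plateau1 // mul1r.
  rewrite /F fB ?mulr0 //; have := ler_normB (y + s *: e) (s *: e); rewrite addrK normrZ => h.
  have h2 : `|s| * `|e| <= 1 by rewrite mulr_ile1 ?delta_norm // ltW.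
  by lra.
apply: (near_eq_is_derive near1).
have cP : continuous P by have [] := @cc_plateau R 'rV[R]_m (B + 1).
have -> : I (fun y => 'D_e f (y + (0 : R) *: e)) = I (fun y => P y * 'D_e f (y + (0 : R) *: e)).
  congr I; apply/funext => y; rewrite scale0r addr0.
  case: (lerP `|y| (B + 1)) => yB; first by rewrite /P plateau1 // mul1r.
  have -> : 'D_e f y = 0; last by rewrite mulr0.
  rewrite (@near_eq_derive _ _ _ _ (cst 0)) ?derive_cst //.
  have : \forall z \near y, B < `|z|.
    have /cvgrPdist_lt/(_ 1 ltr01) := @norm_continuous _ _ y.
    apply: filterS => z; rewrite ltr_norml => /andP[_]; lra.
  by apply: filterS => z; exact: fB.
apply: (@posfun_derive _ _ _ (posfun_int m) (@compact_norm_row R m) (fun s y => P y * F s y)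
   (fun s y => P y * 'D_e f (y + s *: e)) (B + 1 + 1)).
- by move=> s; have [] := ccMl cP (ccF s).
- move=> s y; have h : is_derive s (1 : R) (fun s => F s y) ('D_e f (y + s *: e)).
    by apply: is_derive_line; apply: derivableP; exact: df.
  have := @is_deriveZ R R R (fun s => F s y) (P y) s 1 _ h; exact.
- by cont.
- by move=> s y yB; rewrite /P /plateau max_l ?mul0r // ge_min subr_le0 (ltW yB) orbT.
Qed.

End Integral.

Section IntegralLaws.
Context {R : realType} {m : nat}.

Definition int_ge0 := proj2 (@posfun_int R m).
Definition int0 := posfun0 (@posfun_int R m).
Definition intD := posfunD (@posfun_int R m).
Definition intN := posfunN (@posfun_int R m).
Definition intB := posfunB (@posfun_int R m).
Definition intZ := posfunZ (@posfun_int R m).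
Definition int_sum := posfun_sum (@posfun_int R m).
Definition int_le := posfun_le (@posfun_int R m).
Definition int_norm := posfun_norm (@posfun_int R m).
Definition int_bound := posfun_bound (@posfun_int R m).
Definition int_cont := posfun_cont (@posfun_int R m) (@compact_norm_row R m).
Definition int_derive := posfun_derive (@posfun_int R m) (@compact_norm_row R m).

End IntegralLaws.

(** * Bump functions *)

Section FlatExp.
Context {R : realType}.
Implicit Types p : {poly R}.

(** The functions p(1/t) exp(-1/t), extended by 0. They form a family stable under differentiation:
    d/dt acts on them through the map [fexp_der] on polynomials. *)
Definition fexp p (t : R) : R := if t <= 0 then 0 else p.[t^-1] * expR (- t^-1).

Definition fexp_der p : {poly R} := 'X^2 * (p - p^`()).

Lemma poly_bound p : exists2 C : R, 0 <= C & forall y : R, 1 <= y -> `|p.[y]| <= C * y ^+ size p.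
Proof.
exists (\sum_(i < size p) `|p`_i|); first by apply: sumr_ge0 => i _.
move=> y y1; have y0 : 0 <= y by lra.
rewrite horner_coef mulr_suml; apply: (le_trans (ler_norm_sum _ _ _)).
apply: ler_sum => i _; rewrite normrM ler_wpM2l // normrX ger0_norm //.
by rewrite ler_weXn2l // ltnW.
Qed.

(** The exponential of [y] is the power of order k + 1 of the exponential of y / (k + 1), which
    exceeds y / (k + 1). *)
Lemma expR_pow_le (k : nat) (y : R) : 0 < y -> y ^+ k.+1 <= (k.+1%:R) ^+ k.+1 * expR y.
Proof.
move=> y0; have E : expR y = expR (y / k.+1%:R) ^+ k.+1.
  by rewrite -expRM_natl mulrC divfK // pnatr_eq0.
rewrite E -exprMn; apply: lerXn2r; rewrite ?nnegrE ?mulr_ge0 ?expR_ge0 //; first exact: ltW.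
have := expR_ge1Dx (y / k.+1%:R); set e := expR _ => h.
have k0 : 0 < k.+1%:R :> R by rewrite ltr0n.
apply: (@le_trans _ _ (k.+1%:R * (1 + y / k.+1%:R))); last by rewrite ler_pM2l.
by rewrite mulrDr mulrCA divff ?pnatr_eq0 // mulr1 mulr1 lerDr ltW.
Qed.

(** Applied to ['X * p], this bounds the difference quotient of [fexp p] at 0, since dividing by [t]
    multiplies the polynomial by ['X]. *)
Lemma fexp_small p : exists2 C : R, 0 <= C & forall t : R, 0 < t -> t <= 1 -> `|fexp p t| <= C * t.
Proof.
have [C C0 Cp] := poly_bound p; set k := size p in Cp.
exists (C * k.+1%:R ^+ k.+1); first by rewrite mulr_ge0 // exprn_ge0.
move=> t t0 t1; rewrite /fexp (leNgt t 0) t0 /= normrM (ger0_norm (expR_ge0 _)).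
have y0 : 0 < t^-1 by rewrite invr_gt0.
have y1 : 1 <= t^-1 by rewrite invf_ge1.
apply: (le_trans (ler_wpM2r (expR_ge0 _) (Cp _ y1))).
have H := expR_pow_le k y0.
rewrite expRN -!mulrA ler_wpM2l // ler_pdivrMr ?expR_gt0 //.
rewrite mulrAC; have -> : t^-1 ^+ k = t * t^-1 ^+ k.+1.
  by rewrite exprS mulrA divff ?mul1r // gt_eqF.
by rewrite mulrC ler_pM2r.
Qed.

Lemma fexp_is_derive p (t : R) : is_derive t (1 : R) (fexp p) (fexp (fexp_der p) t).
Proof.
case: (ltrgtP t 0) => [t0|t0|->].
- rewrite {2}/fexp ltW //.
  have h : is_derive t (1 : R) (cst 0 : R -> R) 0 by exact: is_derive_cst.
  apply: near_eq_is_derive h; near=> s; rewrite /fexp /= ifT //.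
  by apply: ltW; near: s; exact: lt_nbhsl.
- rewrite {2}/fexp leNgt t0 /=.
  have dinv : is_derive t (1 : R) (fun s : R => s^-1) (- t ^- 2).
    have t0' : (id : R -> R) t != 0 by rewrite gt_eqF.
    split; first by apply: (@derivableV R R id) => //; exact: derivable_id.
    have dd : derivable (id : R -> R) t 1 by exact: derivable_id.
    rewrite -[LHS]/('D_1 (fun s : R => (id s)^-1) t) (deriveV t0' dd).
    by rewrite derive_id [_ *: _]mulr1.
  have d1 : is_derive t (1 : R) (horner p \o (fun s : R => s^-1)) ((p^`()).[t^-1] * - t ^- 2).
    have := @is_derive_comp1 R R (horner p) (fun s : R => s^-1) t 1 _ dinv (@derivable_horner R p _).
    by rewrite -derive1E -derivE.
  have d2 : is_derive t (1 : R) (expR \o (fun s : R => - s^-1)) (expR (- t^-1) * (t ^- 2)).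
    have dn : is_derive t (1 : R) (fun s : R => - s^-1) (t ^- 2).
      by have := is_deriveN dinv; rewrite opprK.
    have := @is_derive_comp1 R R expR (fun s : R => - s^-1) t 1 _ dn (@derivable_expR R _).
    by rewrite -[derive expR _ _]/('D_1 expR (- t^-1)) (congr1 (fun f : R -> R => f (- t^-1)) (@derive_expR R)).
  have := is_deriveM d1 d2; rewrite ![_ *: _]/(_ * _) /= => d3.
  have -> : (fexp_der p).[t^-1] * expR (- t^-1) =
     p.[t^-1] * (expR (- t^-1) / t ^+ 2) + expR (- t^-1) * ((p^`()).[t^-1] * - t ^- 2).
    rewrite /fexp_der hornerM hornerXn hornerD hornerN exprVn; ring.
  apply: near_eq_is_derive d3; near=> s; rewrite /fexp ifF //; apply/negbTE; rewrite -ltNge.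
  by near: s; exact: lt_nbhsr.
- rewrite {2}/fexp lexx.
  have [C C0 CP] := fexp_small ('X * p).
  have lim : (fun h : R => h^-1 *: ((fexp p \o shift 0) (h *: (1 : R)) - fexp p 0)) @ 0^' --> (0 : R).
    apply/cvgrPdist_le => e e0.
    have d0 : 0 < Num.min 1 (e / (C + 1)) by rewrite lt_min ltr01 divr_gt0 // ltr_wpDl.
    have : \forall h \near (0 : R)^', `|h| < Num.min 1 (e / (C + 1)) by exact: dnbhs0_lt.
    apply: filterS => h; rewrite lt_min => /andP[h1 he] /=.
    rewrite addr0 [h *: 1]mulr1 {2}/fexp lexx subr0 sub0r normrN -[h^-1 *: fexp p h]/(h^-1 * fexp p h).
    case: (lerP h 0) => h0; first by rewrite /fexp h0 mulr0 normr0 ltW.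
    have -> : h^-1 * fexp p h = fexp ('X * p) h by rewrite /fexp leNgt h0 /= hornerM hornerX mulrA.
    rewrite gtr0_norm // in h1; rewrite gtr0_norm // in he.
    apply: (le_trans (CP h h0 (ltW h1))).
    have C1 : 0 < C + 1 by lra.
    by move: he; rewrite ltr_pdivlMr // => he; nra.
  by split; [apply/cvg_ex; exists 0 | exact: cvg_lim].
Unshelve. all: by end_near. Qed.

Lemma fexp_ge0 p t : (forall y : R, 0 < y -> 0 <= p.[y]) -> 0 <= fexp p t.
Proof.
move=> p0; rewrite /fexp; case: (lerP t 0) => // t0.
by rewrite mulr_ge0 ?expR_ge0 // p0 // invr_gt0.
Qed.

Lemma fexp_closed h : range fexp h -> (forall t : R, derivable h t 1) /\ exists2 h', range fexp h' & 'D_1 h = h'.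
Proof.
move=> [p _ <-]; split=> [t|]; first by have [] := fexp_is_derive p t.
by exists (fexp (fexp_der p)); [exists (fexp_der p) | apply/funext => t; have [] := fexp_is_derive p t].
Qed.

End FlatExp.

Section Bump.
Context {R : realType}.
Variable m : nat.
Implicit Types x y : 'rV[R]_m.

(** The Euclidean square. Unlike the norm of rows, which is a maximum, it is smooth; by [sqn_ge] it
    dominates the square of that norm, so bumps built from it vanish outside the unit cube. *)
Definition sqn x : R := \sum_j x 0 j * x 0 j.

Lemma sgen_sqn (U : set 'rV[R]_m) : sgen U sqn.
Proof. by apply: sgen_sum => j _; apply: sg_mul; exact: sg_coord. Qed.

Lemma sqn_ge0 x : 0 <= sqn x.
Proof. by apply: sumr_ge0 => j _; rewrite -expr2 sqr_ge0. Qed.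

Lemma sqn_ge x : `|x| * `|x| <= sqn x.
Proof.
have [x0|/mx_norm_neq0[[i j] E]] := eqVneq (mx_norm x) 0.
  by rewrite -[`|x|]/(mx_norm x) x0 mulr0 sqn_ge0.
rewrite -[`|x|]/(mx_norm x) E /= ord1 -normrM ger0_norm -?expr2 ?sqr_ge0 // expr2 /sqn (bigD1 j) //=.
by rewrite lerDl; apply: sumr_ge0 => k _; rewrite -expr2 sqr_ge0.
Qed.

Lemma pderiv_coord j k x : 'D_'e_k (fun y : 'rV[R]_m => y 0 j) x = (k == j)%:R.
Proof.
have E : (fun y : 'rV[R]_m => y 0 j) = lincomb (fun i => (i == j)%:R).
  apply/funext => y; rewrite /lincomb (bigD1 j) //= eqxx mulr1 big1 ?addr0 //.
  by move=> i /negbTE ->; rewrite mulr0.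
rewrite E deriveE; last by apply: linear_differentiable; exact: lincomb_continuous.
rewrite diff_lin; last exact: lincomb_continuous.
rewrite -[LHS]/(lincomb _ _) /lincomb (bigD1 k) //= mxE !eqxx mul1r big1 ?addr0 // => i /negbTE ki.
by rewrite mxE eqxx ki mul0r.
Qed.

Lemma is_derive_sqn k x : is_derive x 'e_k sqn (2 * x 0 k).
Proof.
have dc j : is_derive x 'e_k (fun y : 'rV[R]_m => y 0 j) ((k == j)%:R).
  split; last exact: pderiv_coord.
  by apply: (smooth_derivable (U := setT)) => //; apply: sgen_smooth openT _; exact: sg_coord.
have -> : sqn = \sum_j ((fun y : 'rV[R]_m => y 0 j) * (fun y : 'rV[R]_m => y 0 j)).
  by apply/funext => y; rewrite fct_sumE.
have := is_derive_sum (fun j => is_deriveM (dc j) (dc j)).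
move/is_derive_eq; apply; rewrite (bigD1 k) //= big1 ?addr0.
  by rewrite eqxx -[LHS]/(x 0 k * 1 + x 0 k * 1); ring.
by move=> j /negbTE jk; rewrite eq_sym jk !scaler0 addr0.
Qed.

Definition bmp (p : {poly R}) x : R := fexp p (1 - sqn x).

(** The polynomial ['X^2] is [fexp_der 1]. Hence the derivative of [bmp 1] in the direction k is -2
    x_k times [moll], the relation behind the mean value property of harmonic functions below. *)
Definition moll x := bmp 'X^2 x.

Lemma smooth_bmp p : smooth_on setT (bmp p).
Proof.
apply: sgen_smooth openT _.
apply: (@sg_comp1 R m setT (range fexp) (fexp p) (fun x => 1 - sqn x)).
- exact: fexp_closed.
- by exists p.
- have -> : (fun x => 1 - sqn x) = (fun x => 1 + (- 1) * sqn x) by apply/funext => x; rewrite mulN1r.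
  apply: sg_add; first exact: sg_cst.
  by apply: sg_mul; [exact: sg_cst | exact: sgen_sqn].
Qed.

Lemma bmp_out p x : 1 <= `|x| -> bmp p x = 0.
Proof.
move=> x1; rewrite /bmp /fexp ifT // subr_le0; apply: le_trans (sqn_ge x).
by rewrite -[1]mulr1 ler_pM.
Qed.

Lemma pderiv_bmp p k x : 'D_'e_k (bmp p) x = - 2 * x 0 k * bmp (fexp_der p) x.
Proof.
have d1 : is_derive x 'e_k (fun x => 1 - sqn x) (- (2 * x 0 k)).
  have := is_deriveB (is_derive_cst (1 : R) x 'e_k) (is_derive_sqn k x).
  by rewrite sub0r.
have [dp dv] := fexp_is_derive p (1 - sqn x).
have [_ ->] := is_derive_comp1 d1 dp.
by rewrite dv /bmp; ring.
Qed.

Lemma fexp_der1 : fexp_der 1 = 'X^2 :> {poly R}.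
Proof. by rewrite /fexp_der -[1]/(1%:P) derivC subr0 mulr1. Qed.

Lemma moll_ge0 x : 0 <= moll x.
Proof. by apply: fexp_ge0 => y y0; rewrite hornerXn exprn_ge0 // ltW. Qed.

Lemma moll_gt0 x : sqn x < 1 -> 0 < moll x.
Proof.
move=> x1; rewrite /moll /bmp /fexp leNgt subr_gt0 x1 /= hornerXn mulr_gt0 ?expR_gt0 //.
by rewrite exprn_gt0 // invr_gt0 subr_gt0.
Qed.

Lemma sqn0 : sqn 0 = 0.
Proof. by rewrite /sqn big1 // => j _; rewrite mxE mulr0. Qed.

Lemma sqnN x : sqn (- x) = sqn x.
Proof. by apply: eq_bigr => j _; rewrite mxE mulrNN. Qed.

Lemma mollN x : moll (- x) = moll x.
Proof. by rewrite /moll /bmp sqnN. Qed.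

Definition sc (f : 'rV[R]_m -> R) :=
  smooth_on setT f /\ exists B : R, forall x, B < `|x| -> f x = 0.

Lemma sc_cont f : sc f -> continuous f.
Proof. by move=> [sf _] x; exact: smooth_cont sf _. Qed.

Lemma sc_cc f : sc f -> cc f.
Proof. by move=> scf; split; [exact: sc_cont | case: scf]. Qed.

Lemma pderiv_out (f : 'rV[R]_m -> R) (B : R) : (forall x, B < `|x| -> f x = 0) ->
  forall j x, B < `|x| -> 'D_'e_j f x = 0.
Proof.
move=> fB j x xB; rewrite (@near_eq_derive _ _ _ _ (cst 0)) ?derive_cst //.
have d0 : 0 < `|x| - B by lra.
have /cvgrPdist_lt/(_ _ d0) := @norm_continuous _ _ x.
apply: filterS => z; rewrite ltr_norml => /andP[_ h]; apply: fB; lra.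
Qed.

Lemma sc_pderiv f j : sc f -> sc ('D_'e_j f).
Proof.
move=> [sf [B fB]]; split; first exact: smooth_pderiv.
by exists B; exact: pderiv_out.
Qed.

Lemma int_pderiv_sc f j : sc f -> integral_rV ('D_'e_j f) = 0.
Proof.
move=> scf; apply: int_pderiv; first exact: sc_cc.
  by move=> x; apply: smooth_derivable (proj1 scf) _.
exact: sc_cont (sc_pderiv j scf).
Qed.

Lemma sc_bmp p : sc (bmp p).
Proof. by split; [exact: smooth_bmp | exists 1 => x /ltW; exact: bmp_out]. Qed.

Lemma sc_moll : sc moll. Proof. exact: sc_bmp. Qed.

Lemma int_moll_gt0 : 0 < integral_rV moll.
Proof.
apply: (int_gt0 (x0 := 0)); [exact/sc_cc/sc_moll | exact: moll_ge0 |].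
by apply: moll_gt0; rewrite sqn0.
Qed.

End Bump.

(** * Change of variables *)

Section LinearChange.
Context {R : realType}.
Local Notation I := (@integral_rV R _).

(* Both sides are the value at (f, g) of the double functional of
   f (x) g (y - x), evaluated in two orders. *)
Lemma haar_unique m (J : ('rV[R]_m -> R) -> R) f : posfun J ->
  (forall f a, cc f -> J (fun x => f (x + a)) = J f) -> cc f ->
  J f * I (@moll R m) = J (@moll R m) * I f.
Proof.
move=> pJ shJ ccf; pose g := @moll R m.
have ccg : cc g by exact/sc_cc/sc_moll.
have [cf [B0 fB0]] := ccf; have [cg _] := ccg.
pose B := Num.max 0 B0 + 1.
have B1 : 1 <= B by rewrite /B lerDr le_max lexx.
have fB x : B - 1 < `|x| -> f x = 0.
  move=> h; apply: fB0; apply: le_lt_trans h; rewrite /B addrK le_max lexx orbT //.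
have gB x : 1 < `|x| -> g x = 0 by move=> /ltW; exact: bmp_out.
pose F (x y : 'rV[R]_m) := f x * g (y - x).
pose G (x y : 'rV[R]_m) := f (x + y) * g (- x).
have Ffar (x y : 'rV[R]_m) : B - 1 < `|x| -> F x y = 0 by move=> h; rewrite /F fB ?mul0r.
have FB y x : B < `|y| -> F x y = 0.
  move=> h; case: (ltP (B - 1) `|x|) => [/Ffar-> //|xB].
  by rewrite /F gB ?mulr0 //; have := ler_normB (y - x) (- x); rewrite opprK subrK normrN => h2; lra.
have Gfar (x y : 'rV[R]_m) : 1 < `|x| -> G x y = 0 by move=> h; rewrite /G gB ?mulr0 // normrN.
have GB y x : B < `|y| -> G x y = 0.
  move=> h; case: (ltP 1 `|x|) => [/Gfar-> //|xB].
  by rewrite /G fB ?mul0r //; have := ler_normB (x + y) x; rewrite [x + y]addrC addrK addrC => h2; lra.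
have cF : continuous (fun p => F p.1 p.2) by rewrite /F; cont.
have cG : continuous (fun p => G p.1 p.2) by rewrite /G; cont.
have Bl1 (x y : 'rV[R]_m) : B < `|x| -> F x y = 0 by move=> h; apply: Ffar; lra.
have Bl2 (x y : 'rV[R]_m) : B < `|x| -> G x y = 0 by move=> h; apply: Gfar; lra.
have E1 := @int_swap R m _ J F B pJ (@compact_norm_row R m) cF Bl1 (fun x y => @FB y x).
have E2 := @int_swap R m _ J G B pJ (@compact_norm_row R m) cG Bl2 (fun x y => @GB y x).
have EFG y : I (F ^~ y) = I (G ^~ y).
  have -> : (G ^~ y) = (fun x => (F ^~ y) (x + y)).
    by apply/funext => x; rewrite /G /F opprD addrCA subrr addr0.
  apply/esym; apply: (@int_shift R m (F ^~ y) y); split; last by exists B => x; exact: Bl1.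
  by rewrite /F; cont.
have {E1} E1 : J (fun y => I (F ^~ y)) = J g * I f.
  rewrite E1 -intZ //; congr I; apply/funext => x.
  rewrite mulrC -(shJ g (- x)) // -(posfunZ pJ) //; exact: cc_shift.
rewrite -E1 (_ : (fun y => I (F ^~ y)) = (fun y => I (G ^~ y))); last by apply/funext => y.
rewrite E2 -intZ //; congr I; apply/funext => x.
have -> : G x = (fun y => g x * f (y + x)).
  by apply/funext => y; rewrite /G [g (- x)]mollN mulrC [x + y]addrC.
by rewrite (posfunZ pJ) ?shJ 1?mulrC //; exact: cc_shift.
Qed.

Lemma mulmx_bound m (A : 'M[R]_m) : exists2 C : R, 0 <= C & forall x : 'rV[R]_m, `|x *m A| <= C * `|x|.
Proof.
have S0 : 0 <= \sum_i \sum_j `|A i j| by apply: sumr_ge0 => i _; apply: sumr_ge0.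
exists (\sum_i \sum_j `|A i j|) => // x.
apply: row_norm_le => [|j]; first by rewrite mulr_ge0.
rewrite mxE (le_trans (ler_norm_sum _ _ _)) // mulr_suml; apply: ler_sum => i _.
rewrite normrM mulrC ler_pM ?row_norm_ge //.
by rewrite (bigD1 j) //= lerDl sumr_ge0.
Qed.

Lemma mulmx_rV_continuous m p (A : 'M[R]_(m, p)) : continuous (fun x : 'rV[R]_m => x *m A).
Proof.
move=> x; apply: row_continuous => j.
rewrite (_ : (fun y => _) = lincomb (A ^~ j)); first exact: lincomb_continuous.
by apply/funext => y; rewrite mxE.
Qed.

Lemma cc_mulmx m (A : 'M[R]_m) (f : 'rV[R]_m -> R) : A \in unitmx -> cc f -> cc (fun x => f (x *m A)).
Proof.
move=> uA [cf [B fB]]; split.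
  by move=> x; apply: (cont_comp (f := fun x : 'rV[R]_m => x *m A)) (cf _); exact: mulmx_rV_continuous.
have [C C0 HC] := mulmx_bound (invmx A); exists (C * B) => x xB; apply: fB.
have := HC (x *m A); rewrite mulmxK // => h.
have Cp : 0 < C.
  rewrite lt_neqAle C0 andbT; apply/eqP => C1; move: xB h; rewrite -C1 !mul0r => h1 h2; lra.
by rewrite -(ltr_pM2l Cp) (lt_le_trans xB).
Qed.

(** Composition with [A] preserves translation invariance, so by [haar_unique] it multiplies all
    integrals by one constant, measured here on [moll]. By [lc_det] this constant is the inverse of
    |det A|. *)
Definition lc m (A : 'M[R]_m) : R := I (fun x => moll (x *m A)) / I (@moll R m).

Lemma int_lin m (A : 'M[R]_m) f : A \in unitmx -> cc f -> I (fun x => f (x *m A)) = lc A * I f.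
Proof.
move=> uA cf; have e0 := @int_moll_gt0 R m.
pose J (f : 'rV[R]_m -> R) := I (fun x => f (x *m A)).
have pJ : posfun J.
  split=> [a f1 f2 c1 c2|f1 c1 p1].
    exact: (proj1 (posfun_int m) a _ _ (cc_mulmx uA c1) (cc_mulmx uA c2)).
  exact: (int_ge0 (cc_mulmx uA c1) (fun x => p1 _)).
have shJ f1 a : cc f1 -> J (fun x => f1 (x + a)) = J f1.
  move=> c1; have -> : J f1 = I (fun x => f1 ((x + a *m invmx A) *m A)).
    by rewrite (@int_shift R m (fun x => f1 (x *m A))) //; exact: cc_mulmx.
  by congr I; apply/funext => x; rewrite mulmxDl mulmxKV.
have H := haar_unique pJ shJ cf.
by rewrite /lc mulrAC -[X in X / _]H mulfK // gt_eqF.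
Qed.

Lemma lc_gt0 m (A : 'M[R]_m) : A \in unitmx -> 0 < lc A.
Proof.
move=> uA; rewrite divr_gt0 ?int_moll_gt0 //.
apply: (int_gt0 (x0 := 0)); first by apply: cc_mulmx => //; exact/sc_cc/sc_moll.
  by move=> x; exact: moll_ge0.
by apply: moll_gt0; rewrite mul0mx sqn0.
Qed.

Lemma lcM m (A B : 'M[R]_m) : A \in unitmx -> B \in unitmx -> lc (A *m B) = lc A * lc B.
Proof.
move=> uA uB; rewrite {1}/lc.
under [X in I X / _]eq_fun do rewrite mulmxA.
rewrite (@int_lin m A (fun x => moll (x *m B))) ?mulrA //.
by apply: cc_mulmx => //; exact/sc_cc/sc_moll.
Qed.

Lemma lc1 m : lc (1%:M : 'M[R]_m) = 1.
Proof.
by rewrite /lc; under [X in I X / _]eq_fun do rewrite mulmx1; rewrite divff // gt_eqF // int_moll_gt0.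
Qed.

Lemma int1_scale (f : R -> R) (a : R) : a != 0 -> cc f ->
  \int[@lebesgue_measure R]_(x in setT) f (x * a) = `|a|^-1 * \int[@lebesgue_measure R]_(x in setT) f x.
Proof.
move=> a0 [cf [B0 fB0]]; pose B := `|B0|.
have fB y : B < `|y| -> f y = 0 by move=> h; apply: fB0; apply: le_lt_trans h; exact: ler_norm.
have BB : 0 <= B by exact: normr_ge0.
have na : 0 < `|a| by rewrite normr_gt0.
pose C := B / `|a|; pose b := (B + 1) / `|a|.
have fC y : C < `|y| -> f (y * a) = 0.
  by rewrite /C ltr_pdivrMr // => h; apply: fB; rewrite normrM.
have cfa : continuous (fun x : R => f (x * a)) by cont.
have dp x : is_derive x (1 : R) (fun x => a^-1 * prim B f (x * a)) (f (x * a)).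
  have dm : is_derive x (1 : R) (fun x : R => x * a) a.
    have := @is_deriveM R R id (cst a) x 1 _ _ (is_derive_id _ _) (is_derive_cst _ _ _).
    by move/is_derive_eq; apply; rewrite scaler0 add0r [_ *: _]mulr1.
  have [pd pv] := prim_derive (x * a) cf fB.
  have := @is_deriveZ R R R _ a^-1 x 1 _ (is_derive_comp1 dm pd).
  by move/is_derive_eq; apply; rewrite pv -[_ *: _]/(a^-1 * (f (x * a) * a)) mulrC mulfK.
have bC : - b < - C by rewrite ltrN2 /b /C ltr_pM2r ?invr_gt0 // ltrDl.
have Cb : C <= b by rewrite -lerN2 ltW.
rewrite (int1_prim cfa fC dp bC Cb).
have [ap|an] : 0 < a \/ a < 0 by move: a0; rewrite neq_lt => /orP[]; [right | left].
  have ba : b * a = B + 1 by rewrite /b gtr0_norm // divfK // gt_eqF.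
  rewrite mulNr ba (@prim_left _ B f (- (B + 1))) //; last by rewrite ltrN2 ltrDl.
  by rewrite mulr0 subr0 gtr0_norm // (int1E fB (_ : B <= B + 1)) // lerDl.
have ba : b * a = - (B + 1) by rewrite /b ltr0_norm // invrN mulrN mulNr divfK // lt_eqF.
rewrite mulNr ba opprK (@prim_left _ B f (- (B + 1))) //; last by rewrite ltrN2 ltrDl.
by rewrite mulr0 sub0r ltr0_norm // (int1E fB (_ : B <= B + 1)) ?lerDl // invrN mulNr.
Qed.

Lemma rcons0_mul_block m x (v : 'rV[R]_m) a (b : 'rV[R]_m) (S : 'M[R]_m) :
  rcons0 x v *m (block_mx (a%:M : 'M[R]_1) b 0 S : 'M[R]_(1 + m)) = rcons0 (x * a) (v *m S + x *: b).
Proof.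
rewrite /rcons0; apply: etrans (@mul_row_block R 1 1 m 1 m x%:M v a%:M b 0 S) _.
by rewrite mulmx0 addr0 -scalar_mxM mul_scalar_mx addrC.
Qed.

(** For a fixed first coordinate, the remaining ones undergo [S] and a translation; the first
    coordinate is scaled by [a]. *)
Lemma lc_block m (a : R) (b : 'rV[R]_m) (S : 'M[R]_m) : a != 0 -> S \in unitmx ->
  lc (block_mx (a%:M : 'M[R]_1) b 0 S : 'M[R]_(1 + m)) = `|a|^-1 * lc S.
Proof.
move=> a0 uS; have e0 := @int_moll_gt0 R m.+1.
have cce : cc (@moll R m.+1) by exact/sc_cc/sc_moll.
apply: (mulIf (lt0r_neq0 e0)); rewrite divfK ?gt_eqF // integral_rVS.
transitivity (\int[@lebesgue_measure R]_(x in setT) (lc S * I (fun v : 'rV[R]_m => moll (rcons0 (x * a) v)))).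
  congr (Rintegral _ _ _); apply/funext => x.
  have cs := rcons0_cc (x * a) cce.
  rewrite -int_lin // -(@int_shift R m (fun v => moll (rcons0 (x * a) (v *m S))) (x *: b *m invmx S)); last first.
    by apply: (cc_mulmx uS cs).
  congr I; apply/funext => v; rewrite (@rcons0_mul_block m) mulmxDl mulmxKV //.
have cin := inner_cc (posfun_int m) cce.
have E := posfunZ (@posfun_int1 R) (lc S) (_ : cc (fun x : R => I (fun v : 'rV[R]_m => moll (rcons0 (x * a) v)))).
rewrite E; last first.
  have [ci [B iB]] := cin; split.
    by move=> x; apply: (cont_comp (f := fun x : R => x * a)) (ci _); cont.
  exists (B / `|a|) => x; rewrite ltr_pdivrMr ?normr_gt0 // => h; apply: iB; rewrite normrM //.
rewrite (@int1_scale (fun x => I (fun v : 'rV[R]_m => moll (rcons0 x v))) a a0 cin).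
by rewrite -integral_rVS; ring.
Qed.

(** The shear [T] is conjugate to its square by [D]. As [lc] is multiplicative and positive, its
    value at [T] equals its own square, hence 1. *)
Lemma lc_lower m (w : 'cV[R]_m) :
  lc (block_mx (1%:M : 'M[R]_1) 0 w 1%:M : 'M[R]_(1 + m)) = 1.
Proof.
set T := block_mx _ _ _ _; pose D : 'M[R]_(1 + m) := block_mx (2%:M : 'M[R]_1) 0 0 1%:M.
have uT : T \in unitmx by rewrite unitmxE det_lblock !det1 mulr1 unitr1.
have uD : D \in unitmx by rewrite unitmxE det_ublock det1 mulr1 det_scalar1 unitfE.
have E : T *m D = D *m (T *m T).
  rewrite !mulmx_block !(mul0mx, mulmx0, mul1mx, mulmx1, addr0, add0r).
  by rewrite -mulr2n mul_mx_scalar scaler_nat.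
have := congr1 (@lc _) E; rewrite !lcM ?unitmx_mul ?uT //.
have := lc_gt0 uT; have := lc_gt0 uD; move: (lc T) (lc D) => t d d0 t0 h.
have : d * t * (t - 1) = d * (t * t) - t * d by ring.
by rewrite h subrr => /eqP; rewrite mulf_eq0 gt_eqF ?mulr_gt0 //= subr_eq0 => /eqP.
Qed.

Lemma lc_tperm m (i j : 'I_m) : lc (tperm_mx i j : 'M[R]_m) = 1.
Proof.
have u : (tperm_mx i j : 'M[R]_m) \in unitmx by exact: unitmx_perm.
have := lcM u u; rewrite -perm_mxM tperm2 perm_mx1 lc1 => h.
have := lc_gt0 u; set t := lc _ in h * => t0.
by apply/eqP; rewrite -(@eqrXn2 _ 2) // ?ltW // expr2 expr1n -h.
Qed.

(** Gaussian elimination: a transposition brings a nonzero pivot into the corner, and the result is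
    the product of a shear, of constant 1, and a block triangular matrix. *)
Lemma lc_det m (A : 'M[R]_m) : A \in unitmx -> lc A = `|\det A|^-1.
Proof.
elim: m A => [|m IH] A uA.
  by rewrite (flatmx0 A) det_mx00 normr1 invr1 -(flatmx0 1%:M) lc1.
have [i Ai0] : exists i, A i 0 != 0.
  apply/existsP; apply: contraT; rewrite negb_exists => /forallP A0.
  move: uA; rewrite unitmxE (expand_det_col A 0) big1 ?unitr0 // => i _.
  by move: (A0 i); rewrite negbK => /eqP ->; rewrite mul0r.
pose P := tperm_mx i 0 : 'M[R]_m.+1; pose A' : 'M[R]_(1 + m) := P *m A.
have uP : P \in unitmx by exact: unitmx_perm.
have uA' : A' \in unitmx by rewrite unitmx_mul uP.
pose a := A' 0 0; have a0 : a != 0.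
  have -> : a = A i 0 by rewrite /a /A' /P -xrowE !mxE tpermR.
  exact: Ai0.
have l1 : lc A' = lc A by rewrite lcM // /P lc_tperm mul1r.
have d1 : `|\det A'| = `|\det A|.
  by rewrite det_mulmx normrM /P det_perm normrX normrN1 expr1n mul1r.
clearbody A'.
pose b := ursubmx A'; pose c := dlsubmx A'; pose S := drsubmx A' - a^-1 *: (c *m b).
have ula : ulsubmx A' = a%:M.
  by rewrite [LHS]mx11_scalar !mxE /a; congr (A' _ _)%:M; exact: val_inj.
pose T : 'M[R]_(1 + m) := block_mx (1%:M : 'M[R]_1) 0 (a^-1 *: c) 1%:M.
pose B : 'M[R]_(1 + m) := block_mx (a%:M : 'M[R]_1) b 0 S.
have EA : A' = T *m B.
  rewrite -[A']submxK ula /T /B mulmx_block !(mul0mx, mulmx0, mul1mx, mulmx1, addr0, add0r).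
  rewrite -/b -/c mul_mx_scalar scalerA mulfV // scale1r -scalemxAl.
  by rewrite /S addrCA subrr addr0.
have uT : T \in unitmx by rewrite unitmxE det_lblock !det1 mulr1 unitr1.
have uB : B \in unitmx by move: uA'; rewrite EA unitmx_mul => /andP[].
have dB : \det B = a * \det S by rewrite det_ublock det_scalar1.
have uS : S \in unitmx by move: uB; rewrite !unitmxE dB unitrM => /andP[].
have l2 : lc A' = `|a|^-1 * `|\det S|^-1.
  have lT : lc T = 1 by exact: lc_lower.
  have lB : lc B = `|a|^-1 * lc S by exact: lc_block.
  by rewrite EA (lcM uT uB) lT mul1r lB (IH _ uS).
rewrite -l1 l2 -invfM -normrM -dB -d1.
by rewrite EA det_mulmx det_lblock !det1 !mul1r.
Qed.

End LinearChange.

(** * Extension by zero, bounds and Lipschitz constants on compact sets *)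

Section Extension.
Context {R : realType}.

Lemma near_continuous (T S : topologicalType) (f g : T -> S) x :
  {near x, f =1 g} -> {for x, continuous f} -> {for x, continuous g}.
Proof.
move=> fg cf; suff : g y @[y --> x] --> g x by [].
by rewrite -(nbhs_singleton fg); apply: cvg_trans cf; exact: (@near_eq_cvg _ _ (nbhs x) (nbhs_filter x)).
Qed.

Lemma ext_continuous (T : topologicalType) (U K : set T) (f : T -> R) :
  open U -> closed K -> K `<=` U -> (forall x, U x -> {for x, continuous f}) ->
  (forall x, U x -> ~ K x -> f x = 0) -> continuous (f \_ U).
Proof.
move=> oU cK KU cf f0 x; have [Ux|nUx] := pselect (U x).
  apply: near_continuous (cf x Ux).
  by apply: filterS (open_nbhs_nbhs (conj oU Ux)) => y Uy; rewrite patchE mem_set.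
apply: (@near_continuous _ _ (fun=> 0)); last exact: cst_continuous.
have oK : open (~` K) by rewrite openC.
have nKx : (~` K) x by move=> /KU.
apply: filterS (open_nbhs_nbhs (conj oK nKx)) => y nKy; rewrite patchE.
by case: ifPn => // /set_mem Uy; rewrite f0.
Qed.

Lemma sgen_prod m (U : set 'rV[R]_m) I (r : seq I) (P : pred I) (F : I -> 'rV[R]_m -> R) :
  (forall i, P i -> sgen U (F i)) -> sgen U (fun x => \prod_(i <- r | P i) F i x).
Proof.
move=> h; elim: r => [|i r IH].
  by under eq_fun do rewrite big_nil; exact: sg_cst.
case Pi: (P i); last by under eq_fun do rewrite big_cons Pi.
by under eq_fun do rewrite big_cons Pi; apply: sg_mul => //; exact: h.
Qed.

Lemma sgen_det m p (U : set 'rV[R]_m) (M : 'rV[R]_m -> 'M[R]_p) :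
  (forall i j, sgen U (fun x => M x i j)) -> sgen U (fun x => \det (M x)).
Proof.
move=> h; apply: sgen_sum => s _; apply: sg_mul; first exact: sg_cst.
by apply: sgen_prod => i _.
Qed.

Lemma cc_bounded (V : normedModType R) (f : V -> R) :
  (forall B : R, compact [set x : V | `|x| <= B]) -> cc f -> exists2 M : R, 0 <= M & forall x, `|f x| <= M.
Proof.
move=> Vc [cf [B fB]].
have : compact (f @` [set x : V | `|x| <= B]).
  by apply: continuous_compact; [exact: continuous_subspaceT | exact: Vc].
move=> /compact_bounded [M0 [_ /(_ (Num.max 0 M0 + 1))]] H.
exists (Num.max 0 M0 + 1); first by rewrite addr_ge0 // le_max lexx.
move=> x; case: (lerP `|x| B) => xB; last by rewrite fB // normr0 addr_ge0 // le_max lexx.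
apply: H; last by exists x.
by rewrite ltr_pwDr // le_max lexx orbT.
Qed.

Lemma local_lipschitz m p (U : set 'rV[R]_m) (phi : 'rV[R]_m -> 'rV[R]_p) x :
  open U -> U x -> (forall i, smooth_on U (fun z => phi z 0 i)) ->
  exists L, exists2 r : R, 0 < r & 0 <= L /\ forall y z, `|y - x| < r -> `|z - x| < r ->
    `|phi z - phi y| <= L * `|z - y|.
Proof.
move=> oU Ux sphi.
pose D := \sum_i \sum_j `|'D_'e_j (fun z => phi z 0 i) x|.
have D0 : 0 <= D by apply: sumr_ge0 => i _; apply: sumr_ge0.
have : \forall z \near x, U z /\ forall i j, `|'D_'e_j (fun z => phi z 0 i) z| <= D + 1.
  apply: filterI; first exact: open_nbhs_nbhs.
  suff H (q : 'I_p * 'I_m) : \forall z \near x, `|'D_('e_q.2) (fun z => phi z 0 q.1) z| <= D + 1.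
    by have := filter_forall (nbhs_filter x) H; apply: filterS => z h i j; exact: (h (i, j)).
  case: q => i j /=.
  have /cvgrPdist_le/(_ 1 ltr01) := smooth_cont (smooth_pderiv j (sphi i)) Ux.
  apply: filterS => z h; have Dij : `|'D_'e_j (fun z => phi z 0 i) x| <= D.
    rewrite /D (bigD1 i) //= (bigD1 j) //= -addrA lerDl addr_ge0 ?sumr_ge0 // => k _.
    exact: sumr_ge0.
  have := ler_normB ('D_'e_j (fun z => phi z 0 i) x) ('D_'e_j (fun z => phi z 0 i) x - 'D_'e_j (fun z => phi z 0 i) z).
  by rewrite subKr; lra.
move=> /nbhs_ballP[r /= r0 rP]; exists ((D + 1) * m%:R); exists r => //; split.
  by rewrite mulr_ge0 // addr_ge0.
move=> y z yr zr; apply: row_norm_le => [|i]; first by rewrite !mulr_ge0 ?addr_ge0.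
have := @mean_value_coord R m (fun z => phi z 0 i) x r (fun=> 0) (D + 1) _ y z yr zr.
rewrite big1 ?subr0; last by move=> j _; rewrite mulr0.
rewrite !mxE mulrA; apply => t tr j; have [|Ut dt] := rP t; first by rewrite -ball_normE /= distrC.
by split; [exact: smooth_derivable (sphi i) Ut | rewrite subr0; exact: dt].
Qed.

(** One constant serves as Lipschitz constant and as inverse of the admissible distance; only [x]
    has to lie in [K]. Compactness is applied to the filter of small positive radii. *)
Lemma compact_lipschitz m p (U K : set 'rV[R]_m) (phi : 'rV[R]_m -> 'rV[R]_p) :
  open U -> compact K -> K `<=` U -> (forall i, smooth_on U (fun z => phi z 0 i)) ->
  exists2 L : R, 0 < L & forall x y, K x -> `|y - x| < L^-1 -> `|phi y - phi x| <= L * `|y - x|.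
Proof.
move=> oU /compact_near_coveringP cK KU sphi.
have := cK R (at_right (0 : R)) (fun e x => forall y, `|y - x| < e -> `|phi y - phi x| <= e^-1 * `|y - x|).
case=> [x Kx|e /= e0 He].
  have [L [r r0 [L0 H]]] := local_lipschitz oU (KU _ Kx) sphi.
  exists (ball x (r / 2), [set e : R | 0 < e /\ e < Num.min (r / 2) (L + 1)^-1]) => /=.
    split; first by apply: nbhsx_ballx; rewrite divr_gt0.
    have h : 0 < Num.min (r / 2) (L + 1)^-1 by rewrite lt_min divr_gt0 // invr_gt0 ltr_wpDl.
    by near=> e; split; near: e; [exact: nbhs_right_gt | exact: nbhs_right_lt].
  move=> [x' e] /= [x'r [e0]]; rewrite lt_min => /andP[er eL] y ye.
  move: x'r; rewrite -ball_normE /= distrC => x'r.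
  have yr : `|y - x| < r.
    by rewrite -(subrK x' y) -addrA; apply: (le_lt_trans (ler_normD _ _)); lra.
  have x'r' : `|x' - x| < r by lra.
  apply: (le_trans (H _ _ x'r' yr)); rewrite ler_wpM2r //.
  have L1 : 0 < L + 1 by lra.
  have := eL; rewrite -ltf_pV2 ?posrE ?invr_gt0 // invrK => h; lra.
pose L := 2 / e; exists L; first by rewrite divr_gt0.
move=> x y Kx yL; have e2 : 0 < e / 2 by rewrite divr_gt0.
have := He (e / 2); rewrite /ball /= sub0r normrN gtr0_norm // => /(_ _ e2 x Kx).
rewrite /L invf_div in yL; rewrite /L -(invf_div e 2).
apply => //; lra.
Unshelve. all: by end_near. Qed.

End Extension.

Section ChangeOfVariables.
Context {R : realType}.
Local Notation I := (@integral_rV R _).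
Variable m : nat.
Local Notation V := 'rV[R]_m.
Local Notation moll := (@moll R m).

(** The dilation may be centred at any [y]. The proof of [change_of_variables] centres it near the
    point where the integrand concentrates. *)
Lemma scale_shift (k : V -> R) (s : R) (y : V) : s != 0 -> cc k ->
  (lc (s%:M : 'M[R]_m))^-1 * I k = I (fun h => k (y + s^-1 *: h)).
Proof.
move=> s0 ck.
have us : (s%:M : 'M[R]_m) \in unitmx by rewrite unitmxE det_scalar unitrX // unitfE.
have us' : (s^-1%:M : 'M[R]_m) \in unitmx by rewrite unitmxE det_scalar unitrX // unitfE invr_neq0.
have -> : I (fun h => k (y + s^-1 *: h)) = I (fun h => (fun z => k (z + y)) (h *m s^-1%:M)).
  by congr I; apply/funext => h; rewrite mul_mx_scalar addrC.
rewrite (int_lin us' (cc_shift y ck)) int_shift //; congr (_ * _).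
have := lcM us us'; rewrite -scalar_mxM mulfV // lc1 => h.
by apply: (mulfI (lt0r_neq0 (lc_gt0 us))); rewrite -h mulfV // gt_eqF // lc_gt0.
Qed.

Lemma deriv_matrix_inverse (U W : set V) (phi psi : V -> V) : open U -> open W ->
  (forall x, U x -> W (phi x) /\ psi (phi x) = x) ->
  (forall i, smooth_on U (fun z => phi z 0 i)) -> (forall i, smooth_on W (fun z => psi z 0 i)) ->
  forall x, U x -> (\matrix_(i, j) 'D_'e_i (fun z => phi z 0 j) x)
    *m (\matrix_(i, j) 'D_'e_i (fun z => psi z 0 j) (phi x)) = 1%:M.
Proof.
move=> oU oW UW sphi spsi x Ux; apply/matrixP => i j; rewrite !mxE.
have [Wx _] := UW _ Ux.
have [dpsi vpsi] := smooth_differentiable oW (spsi j) Wx.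
have [|_ E] := @is_derive_compn R V m (fun z => psi z 0 j) phi x 'e_i _ dpsi.
  by move=> k; exact: smooth_derivable (sphi k) Ux.
transitivity ('D_'e_i ((fun z => psi z 0 j) \o phi) x).
  by rewrite E vpsi; apply: eq_bigr => k _; rewrite !mxE.
rewrite -(pderiv_coord j i x); apply: near_eq_derive.
by apply: filterS (open_nbhs_nbhs (conj oU Ux)) => z Uz /=; have [_ ->] := UW _ Uz.
Qed.

Lemma cvg_seq_line (X : normedModType R) (x h : X) (t : nat -> R) :
  t k @[k --> \oo] --> (0 : R) -> x + t k *: h @[k --> \oo] --> x.
Proof.
move=> t0; rewrite -[X in _ --> X]addr0 -[X in _ --> _ + X](scale0r h).
by apply: cvgD; [exact: cvg_cst | apply: cvgZ => //; exact: cvg_cst].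
Qed.

Lemma cvg_seq_cont (X Y : topologicalType) (f : X -> Y) (u : nat -> X) x :
  {for x, continuous f} -> u k @[k --> \oo] --> x -> f (u k) @[k --> \oo] --> f x.
Proof. by move=> cf ux A /cf fA; exact: (ux _ fA). Qed.

Lemma cvg_seq_addc (u : nat -> R) (c : R) :
  u k @[k --> \oo] --> (0 : R) -> u k + c @[k --> \oo] --> c.
Proof.
move=> u0; rewrite -[X in _ --> X]add0r.
by apply: cvgD => //; exact: cvg_cst.
Qed.

Lemma inv_seq_dnbhs (s : nat -> R) : (forall k, 0 < s k) -> s k @[k --> \oo] --> +oo ->
  (s k)^-1 @[k --> \oo] --> (0 : R)^'.
Proof.
move=> s0 soo A [e /= e0 eA].
have /cvgryPgt/(_ e^-1) := soo; apply: filterS => k ek; apply: eA.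
  by rewrite /= sub0r normrN normfV (gtr0_norm (s0 k)) -[e]invrK ltf_pV2 ?posrE ?invr_gt0.
by rewrite invr_neq0 // gt_eqF.
Qed.

Lemma int_cvg (u : nat -> V -> R) f (B M : R) : (forall k, cc (u k)) -> cc f ->
  (forall k x, B < `|x| -> u k x = 0) -> (forall k x, `|u k x| <= M) ->
  (forall x, u k x @[k --> \oo] --> f x) -> I (u k) @[k --> \oo] --> I f.
Proof.
move=> cu cf uB uM uf; have [_ [C fC]] := cf; have [N _ fN] := cc_bounded (@compact_norm_row R m) cf.
have -> : (fun k => I (u k)) = fun k => I (fun x => u k x - f x) + I f.
  by apply/funext => k; rewrite intB // subrK.
apply: cvg_seq_addc; apply: (@int_bounded_cvg R m _ (Num.max B C) (M + N)) => [k|k x|k x|x].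
- by have [] := ccB (cu k) cf.
- by rewrite gt_max => /andP[? ?]; rewrite uB // fC // subrr.
- by apply: le_trans (ler_normB _ _) _; rewrite lerD.
- by rewrite -(subrr (f x)); apply: cvgB; [exact: uf | exact: cvg_cst].
Qed.

Lemma cc_affine (k : V -> R) y (s : R) : s != 0 -> cc k -> cc (fun h => k (y + s *: h)).
Proof.
move=> s0 ck; have := cc_mulmx (A := s%:M) _ (cc_shift y ck).
rewrite unitmxE det_scalar unitrX ?unitfE // => /(_ isT).
by congr cc; apply/funext => h; rewrite mul_mx_scalar addrC.
Qed.

Variables (U W : set V) (phi psi : V -> V) (K : set V) (g : V -> R).
Hypotheses (oU : open U) (oW : open W).
Hypothesis UW : forall x, U x -> W (phi x) /\ psi (phi x) = x.
Hypothesis WU : forall y, W y -> U (psi y) /\ phi (psi y) = y.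
Hypothesis sphi : forall i, smooth_on U (fun z => phi z 0 i).
Hypothesis spsi : forall i, smooth_on W (fun z => psi z 0 i).
Hypotheses (cg : continuous g) (cK : compact K) (KW : K `<=` W) (gK : forall y, ~ K y -> g y = 0).

Let absJ x := `|\det (\matrix_(i, j) 'D_'e_i (fun z => phi z 0 j) x)|.

(* With s = 1 / epsilon, both sides of the formula are the limit of the double
   integrals of g y * moll ((psi y - x) / epsilon), rescaled in x or in y. *)
Lemma change_of_variables : I ((fun x => g (phi x) * absJ x) \_ U) = I g.
Proof.
have hV : hausdorff_space V by exact: norm_hausdorff.
have clK : closed K by exact: compact_closed.
have cphi x : U x -> {for x, continuous phi}.
  by move=> Ux; apply: row_continuous => j; exact: smooth_cont (sphi j) Ux.
have cpsi y : W y -> {for y, continuous psi}.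
  by move=> Wy; apply: row_continuous => j; exact: smooth_cont (spsi j) Wy.
pose K' := psi @` K.
have cK' : compact K'.
  apply: continuous_compact cK; apply: continuous_in_subspaceT => y /set_mem Ky.
  by apply: cpsi; exact: KW.
have clK' : closed K' by exact: compact_closed.
have K'U : K' `<=` U by move=> _ [y Ky <-]; have [] := WU (KW Ky).
have [L L0 lipL] := compact_lipschitz oU cK' K'U sphi.
have bndK (A : set V) : compact A -> exists B : R, forall y, A y -> `|y| <= B.
  move=> /compact_bounded [M0 [_ /(_ (M0 + 1))]] H; exists (M0 + 1) => y Ay.
  by apply: H; rewrite ?ltrDl.
have [B KB] := bndK _ cK; have [B' KB'] := bndK _ cK'.
have ccg : cc g.
  by split=> //; exists B => y yB; apply: gK => /KB; rewrite leNgt yB.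
have cce : cc moll by exact/sc_cc/sc_moll.
have [cmoll _] := cce.
have [M M0 gM] := cc_bounded (@compact_norm_row R m) ccg.
have [N N0 eN] := cc_bounded (@compact_norm_row R m) cce.
have e0 := @int_moll_gt0 R m.
(* [s k] is the inverse of the smoothing radius. The offset [n0] makes it exceed [2 * L] from the
   first index on, so that points at distance less than 2 / s k fall under the Lipschitz bound. *)
pose n0 := Num.bound (2 * L).
pose s k : R := (k + n0).+1%:R.
have s0 k : 0 < s k by rewrite ltr0n.
have sL k : 2 * L < s k.
  have h : 0 <= 2 * L by rewrite mulr_ge0 // ltW.
  by apply: (lt_le_trans (archi_boundP h)); rewrite ler_nat /n0; lia.
have s1 k : 1 <= s k by rewrite ler1n.
have soo : s k @[k --> \oo] --> +oo.
  apply/cvgryPge => A; near=> k; rewrite (le_trans (ler_norm _)) //.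
  apply: ltW; apply: (lt_le_trans (archi_boundP (normr_ge0 A))).
  rewrite ler_nat; apply: (@leq_trans k); last by lia.
  by near: k; exact: nbhs_infty_ge.
pose Q k x y := g y * moll (s k *: (psi y - x)).
have QK k x y : Q k x y != 0 -> K y /\ `|psi y - x| < (s k)^-1.
  rewrite /Q mulf_eq0 negb_or => /andP[gy ey]; split.
    by apply: contrapT => /gK; move/eqP: gy.
  rewrite ltNge; apply/negP => h; move: ey; rewrite /moll bmp_out ?eqxx // normrZ gtr0_norm //.
  by rewrite -ler_pdivrMl // mulr1.
have far k x : B' + 1 < `|x| -> ~ exists y, K y /\ `|psi y - x| < (s k)^-1.
  move=> h [y [Ky d]]; have h1 : `|psi y| <= B' by apply: KB'; exists y.
  have h2 : (s k)^-1 <= 1 by rewrite invf_le1.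
  have h3 := ler_normB (psi y) (psi y - x); rewrite subKr in h3.
  have := le_lt_trans h3 (ler_ltD h1 (lt_le_trans d h2)).
  by rewrite ltNge (ltW h).
have Q0 k x : ~ (exists y, K y /\ `|psi y - x| < (s k)^-1) -> forall y, Q k x y = 0.
  by move=> nex y; apply/eqP; apply: contraT => /QK Kd; case: nex; exists y.
have Qx k x y : B' + 1 < `|x| -> Q k x y = 0 by move=> /(far k) /Q0.
have Qy k x y : B < `|y| -> Q k x y = 0.
  by move=> h; apply/eqP; apply: contraT => /QK[/KB]; rewrite leNgt h.
have jQ k p : {for p, continuous (fun p : V * V => Q k p.1 p.2)}.
  case: p => x y; have [Wy|nWy] := pselect (W y).
    by have cp := cpsi _ Wy; rewrite /Q; cont.
  have oK : open (~` K) by rewrite openC.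
  have nKy : (~` K) y by move=> /KW.
  apply: (@near_continuous _ _ (fun=> 0)); last exact: cst_continuous.
  exists (setT, ~` K) => /=; first by split; [exact: filterT | exact: open_nbhs_nbhs].
  by move=> [x' y'] /= [_ h]; rewrite /Q gK // mul0r.
have cQ k x : cc (Q k x).
  split; last by exists B; exact: Qy.
  by cont.
pose ka k := lc ((s k)%:M : 'M[R]_m).
have uk k : ((s k)%:M : 'M[R]_m) \in unitmx by rewrite unitmxE det_scalar unitrX // unitfE gt_eqF.
(* Normalized by the factor of the dilation, [Phi k] has the integral [I moll * I g] for every [k]
   and converges pointwise to [I moll * F]. *)
pose Phi k x := (ka k)^-1 * I (Q k x).
have cIQ k : cc (fun x => I (Q k x)).
  split.
    move=> x; apply: (@int_cont _ _ _ (Q k) x B) => // [x'|x' y].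
      by cont.
    exact: Qy.
  exists (B' + 1) => x xB; rewrite -(int0 (m := m)); congr I; apply/funext => y.
  exact: Qx.
have cPhi k : cc (Phi k) by exact: ccZ.
have IPhi k : I (Phi k) = I moll * I g.
  rewrite intZ //.
  have := @int_swap R m V (@integral_rV R m) (fun y x => Q k x y) (Num.max B (B' + 1)) (posfun_int m)
     (@compact_norm_row R m).
  move=> ->; first last.
  - by move=> y x; rewrite gt_max => /andP[_ h]; exact: Qx.
  - by move=> y x; rewrite gt_max => /andP[h _]; exact: Qy.
  - by cont.
  have Qe y : (fun x => Q k x y) = fun x => g y * (fun z => moll (z *m (s k)%:M)) (x - psi y).
    by apply/funext => x; rewrite /Q -mollN mul_mx_scalar -scalerN opprB.
  have -> : (fun y => I (fun x => Q k x y)) = (fun y => (ka k * I moll) * g y).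
    apply/funext => y; rewrite Qe intZ; last exact: cc_shift (- psi y) (cc_mulmx (uk k) cce).
    by rewrite (int_shift (- psi y) (cc_mulmx (uk k) cce)) int_lin // mulrC.
  by rewrite (intZ _ ccg) -mulrA mulKf // gt_eqF // lc_gt0.
have Phi0 k x : ~ (exists y, K y /\ `|psi y - x| < (s k)^-1) -> Phi k x = 0.
  by move=> /Q0 Qk0; rewrite /Phi (_ : Q k x = fun=> 0) ?int0 ?mulr0 //; apply/funext.
have PhiE k x y : Phi k x = I (fun h => Q k x (y + (s k)^-1 *: h)).
  by rewrite /Phi /ka (scale_shift y) // gt_eqF.
pose F := (fun x => g (phi x) * absJ x) \_ U.
have cF : continuous F.
  apply: (ext_continuous oU clK' K'U).
    move=> x Ux; have cp := cphi _ Ux; apply: cont_mul; [cont | apply: cont_norm].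
    apply: smooth_cont Ux; apply: sgen_smooth => //; apply: sgen_det => i j.
    by under eq_fun do rewrite mxE; apply: sg_base; exact: smooth_pderiv.
  move=> x Ux nK'x; rewrite gK ?mul0r // => Kx; apply: nK'x; exists (phi x) => //.
  by have [] := UW Ux.
have FB x : B' < `|x| -> F x = 0.
  move=> h; rewrite /F patchE; case: ifPn => // /set_mem Ux; rewrite gK ?mul0r // => Kx.
  have : `|x| <= B' by apply: KB'; exists (phi x) => //; have [] := UW Ux.
  by rewrite leNgt h.
have ccF : cc F by split => //; exists B'.
have bQ k x y : `|Q k x y| <= M * N by rewrite /Q normrM ler_pM.
have sLinv k : (s k)^-1 < L^-1 by rewrite ltf_pV2 ?posrE //; have := sL k; lra.
have s2L k : 2 * (s k)^-1 < L^-1.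
  by rewrite -ltr_pdivlMl // -[X in _ < X]invfM ltf_pV2 ?posrE ?mulr_gt0 // mulrC.
(* If some [y1] contributes to [Phi k x], the integral is rescaled about [y1]; the Lipschitz bound
   on [phi] then confines the variable [h] to the ball of radius [2 * L], whatever [k]. *)
have bPhi k x : `|Phi k x| <= M * N * I (@plateau R V (2 * L)).
  have [[y1 [Ky1 d1]]|nex] := pselect (exists y, K y /\ `|psi y - x| < (s k)^-1).
    rewrite (PhiE k x y1); apply: int_bound => //.
      by apply: cc_affine; rewrite ?invr_neq0 ?gt_eqF.
    move=> h hL; apply/eqP; apply: contraT => /QK[Ky d].
    set y := y1 + _ in Ky d.
    have Wy := KW Ky; have Wy1 := KW Ky1.
    have dd : `|psi y - psi y1| < 2 * (s k)^-1.
      rewrite -(subrK x (psi y)) -addrA; apply: (le_lt_trans (ler_normD _ _)).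
      by rewrite [`|x - _|]distrC (_ : 2 / s k = (s k)^-1 + (s k)^-1) ?ltrD //; ring.
    have K'y1 : K' (psi y1) by exists y1.
    have := lipL _ _ K'y1 (lt_trans dd (s2L k)).
    rewrite (proj2 (WU Wy)) (proj2 (WU Wy1)) /y addrC addKr normrZ gtr0_norm ?invr_gt0 // => h2.
    have : (s k)^-1 * `|h| < (s k)^-1 * (2 * L).
      by rewrite (_ : _ * (2 * L) = L * (2 / s k)); [apply: (le_lt_trans h2); rewrite ltr_pM2l | ring].
    by rewrite ltr_pM2l ?invr_gt0 // ltNge (ltW hL).
  by rewrite (Phi0 _ _ nex) normr0 !mulr_ge0 //; apply: int_ge0; [exact: cc_plateau | exact: plateau_ge0].
have lPhi x : Phi k x @[k --> \oo] --> I moll * F x.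
  have [Ux|nUx] := pselect (U x); last first.
    rewrite /F patchE memNset // mulr0.
    have nK'x : (~` K') x by move=> /K'U.
    have oK' : open (~` K') by rewrite openC.
    have /nbhs_ballP[r /= r0 rP] := open_nbhs_nbhs (conj oK' nK'x).
    apply: cvg_near_cst; have /cvgryPgt/(_ r^-1) := soo; apply: filterS => k kr.
    apply: Phi0 => -[y [Ky d]]; apply: (rP (psi y)); last by exists y.
    rewrite -ball_normE /= distrC (lt_trans d) // -[r]invrK ltf_pV2 ?posrE ?invr_gt0 //.
  (* Rescaled about [phi x], the integrand tends to g (phi x) moll (h Bm), because s (psi (phi x + h
     / s) - x) tends to h Bm. The integral of the limit contains 1 / |det Bm|, which is the Jacobian
     of [phi] at [x]. *)
  set Bm := \matrix_(i, j) 'D_'e_i (fun z => psi z 0 j) (phi x).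
  have AB := deriv_matrix_inverse oU oW UW sphi spsi Ux.
  have uB : Bm \in unitmx by have [] := mulmx1_unit AB.
  have -> : I moll * F x = I (fun h => g (phi x) * moll (h *m Bm)).
    rewrite intZ; last exact: cc_mulmx.
    rewrite int_lin // lc_det // /F patchE mem_set // mulrC -mulrA; congr (_ * (_ * _)).
    have := congr1 determinant AB; rewrite det_mulmx det1 -/Bm => h.
    rewrite /absJ; have nB : \det Bm != 0 by rewrite -unitfE -unitmxE.
    by apply: (mulIf (_ : `|\det Bm| != 0)); rewrite ?normr_eq0 // mulVf ?normr_eq0 // -normrM h normr1.
  have [Wx psx] := UW Ux.
  pose T k h := Q k x (phi x + (s k)^-1 *: h).
  have cT k : cc (T k) by apply: cc_affine; rewrite ?invr_neq0 ?gt_eqF.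
  have TB k h : L < `|h| -> T k h = 0.
    move=> hL; apply/eqP; apply: contraT => /QK[Ky d].
    set y := phi x + _ in Ky d.
    have K'y : K' (psi y) by exists y.
    rewrite distrC in d.
    have := lipL _ _ K'y (lt_trans d (sLinv k)).
    rewrite (proj2 (WU (KW Ky))) /y opprD addNKr normrN normrZ gtr0_norm ?invr_gt0 // => h2.
    have : (s k)^-1 * `|h| < L * (s k)^-1 by apply: (le_lt_trans h2); rewrite ltr_pM2l.
    by rewrite [L * _]mulrC ltr_pM2l ?invr_gt0 // ltNge (ltW hL).
  have lT h : T k h @[k --> \oo] --> g (phi x) * moll (h *m Bm).
    have sd := inv_seq_dnbhs s0 soo.
    have s00 : (s k)^-1 @[k --> \oo] --> (0 : R).
      by move=> A A0; apply: sd; apply: filterS A0 => t At _.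
    apply: cvgM.
      apply: (@cvg_seq_cont V R g); first exact: cg.
      exact: cvg_seq_line.
    suff lB : s k *: (psi (phi x + (s k)^-1 *: h) - x) @[k --> \oo] --> h *m Bm.
      apply: (@cvg_seq_cont V R moll _ (h *m Bm)); [exact: cmoll | exact: lB].
    apply/cvgrPdist_lt => e ep.
    have : \forall k \near \oo, forall j, `|(h *m Bm) 0 j - (s k *: (psi (phi x + (s k)^-1 *: h) - x)) 0 j| < e.
      apply: filter_forall => j.
      have [dj vj] := smooth_differentiable oW (spsi j) Wx.
      have dq : (t^-1 *: (psi (t *: h + phi x) 0 j - psi (phi x) 0 j)) @[t --> (0 : R)^'] --> 'D_h (fun z => psi z 0 j) (phi x).
        exact: (@diff_derivable _ _ _ _ _ h dj).
      have dqs := cvg_comp _ _ sd dq.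
      have E : (h *m Bm) 0 j = 'D_h (fun z => psi z 0 j) (phi x).
        by rewrite vj mxE; apply: eq_bigr => i _; rewrite mxE.
      rewrite E; have /cvgrPdist_lt/(_ e ep) := dqs; apply: filterS => k /=.
      have -> : (s k *: (psi (phi x + (s k)^-1 *: h) - x)) 0 j
          = s k *: (psi ((s k)^-1 *: h + phi x) 0 j - x 0 j) by rewrite !mxE [phi x + _]addrC.
      by rewrite invrK psx.
    by apply: filterS => k hk; apply: row_norm_lt => // j; have := hk j; rewrite !mxE.
  have ccl : cc (fun h => g (phi x) * moll (h *m Bm)) by apply: ccZ; exact: cc_mulmx.
  by under eq_fun do rewrite (PhiE _ x (phi x)); exact: (int_cvg cT ccl TB (fun k h => bQ k x _) lT).
have ccMF : cc (fun x => I moll * F x) by exact: ccZ.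
have : I (Phi k) @[k --> \oo] --> I (fun x => I moll * F x).
  by apply: (int_cvg cPhi ccMF _ bPhi lPhi (B := B' + 1)) => k x /(far k) /Phi0.
rewrite intZ //; under eq_fun do rewrite IPhi.
move=> /(cvg_lim (@norm_hausdorff _ _)); rewrite lim_cst // => /eqP.
by rewrite -subr_eq0 -mulrBr mulf_eq0 gt_eqF //= subr_eq0 => /eqP ->.
Unshelve. all: by end_near. Qed.

End ChangeOfVariables.

(** * Mollifiers and Weyl's lemma *)

Section Mollify.
Context {R : realType}.
Local Notation I := (@integral_rV R _).
Variable m : nat.
Local Notation V := 'rV[R]_m.
Local Notation moll := (@moll R m).
Implicit Types (f g k : V -> R) (x y z w : V) (e s : R).

Lemma line_is_derive f x v (d : R) :
  is_derive (0 : R) (1 : R) (fun s => f (x + s *: v)) d -> is_derive x v f d.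
Proof.
have E : (fun s : R => f (x + s *: v)) = (fun s : R => f (s *: v + x)).
  by apply/funext => s; rewrite addrC.
rewrite E => -[h1 h2]; split; first by apply/derivable1P.
by rewrite derive_line h2.
Qed.

(** [x] enters only through the kernel, so each derivative in [x] falls on [k], with a sign, and [f]
    need only be continuous. *)
Definition kconv k f x : R := I (fun y => k (y - x) * f y).

Lemma kconv_is_derive k f x j : sc k -> cc f ->
  is_derive x 'e_j (kconv k f) (kconv (fun y => (- 1) * 'D_'e_j k y) f x).
Proof.
move=> sk cf; have [cf0 [B fB]] := cf.
have ck := sc_cont sk.
have cdk i : continuous ('D_'e_i k) by exact: sc_cont (sc_pderiv i sk).
apply: line_is_derive; pose G s y := (- 1 * 'D_'e_j k (y - (x + s *: 'e_j))) * f y.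
have -> : kconv (fun y => (- 1) * 'D_'e_j k y) f x = I (G 0).
  by congr (I _); apply/funext => y; rewrite /G scale0r addr0.
apply: (@int_derive _ _ (fun s y => k (y - (x + s *: 'e_j)) * f y) G B).
- by cont.
- move=> s y; have dk : is_derive s (1 : R) (fun s => k (y - (x + s *: 'e_j))) (- 1 * 'D_'e_j k (y - (x + s *: 'e_j))).
    have -> : (fun s => k (y - (x + s *: 'e_j))) = (fun s => k ((y - x) + s *: (- 'e_j))).
      by apply/funext => u; rewrite opprD addrA scalerN.
    apply: is_derive_line; rewrite scalerN -addrA -opprD.
    have [dk vk] := @smooth_differentiable R m setT k (y - (x + s *: 'e_j)) openT (proj1 sk) Logic.I.
    split; first exact: diff_derivable.
    have -> : - 'e_j = (-1) *: 'e_j :> V by rewrite scaleN1r.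
    exact: (etrans (vk _) (sum_scale_delta _ _ _)).
  have := @is_deriveM R R (fun s => k (y - (x + s *: 'e_j))) (cst (f y)) s 1 _ _ dk (is_derive_cst _ _ _).
  by move/is_derive_eq; apply; rewrite scaler0 add0r /G [RHS]mulrC.
- by rewrite /G; cont.
- by move=> s y yB; rewrite fB // mulr0.
Qed.

Lemma kconv_smooth k f : sc k -> cc f -> smooth_on setT (kconv k f).
Proof.
move=> sk cf; have [cf0 [B fB]] := cf.
pose P (h : V -> R) := exists2 k, sc k & h = kconv k f.
apply: (@smooth_coind R m setT P) => //; first exact: openT; last by exists k.
move=> _ {k sk} [k sk ->].
have ck := sc_cont sk.
have cdk i : continuous ('D_'e_i k) by exact: sc_cont (sc_pderiv i sk).
split=> [x _|j].
  apply: (@int_cont _ _ _ (fun x y => k (y - x) * f y) x B).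
  - by cont.
  - by cont.
  - by move=> x' y yB; rewrite fB // mulr0.
have D x := @kconv_is_derive k f x j sk cf.
split=> [x _|]; first by have [] := D x.
exists (kconv (fun y => (- 1) * 'D_'e_j k y) f).
  exists (fun y => (- 1) * 'D_'e_j k y) => //.
  have [s1 [C kC]] := sc_pderiv j sk; split; last by exists C => y yC; rewrite kC // mulr0.
  by apply: sgen_smooth openT _; apply: sg_mul; [exact: sg_cst | exact: sg_base].
by move=> x _; have [] := D x.
Qed.

Lemma moll_far w : 1 < `|w| -> moll w = 0 :> R.
Proof. by move=> /ltW; exact: bmp_out. Qed.

Lemma moll_cc : cc moll. Proof. exact: sc_cc (@sc_moll R m). Qed.

Lemma moll_cont : continuous moll. Proof. exact: proj1 moll_cc. Qed.

Ltac cont_fact ::= first [exact: norm_continuous | exact: moll_cont | exact: sc_cont].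

Lemma sc_mul f g : smooth_on setT f -> sc g -> sc (fun x => f x * g x).
Proof.
move=> sf [sg [B gB]]; split; last by exists B => x /gB ->; rewrite mulr0.
by apply: sgen_smooth openT _; apply: sg_mul; exact: sg_base.
Qed.

Lemma smooth_affine f x e : smooth_on setT f -> smooth_on setT (fun w => f (x + e *: w)).
Proof.
move=> sf; apply: sgen_smooth openT _; apply: (@sg_compn R m setT m setT f (fun w => x + e *: w)) => //; first exact: openT.
by move=> j; under eq_fun do rewrite 2!mxE; apply: sg_add; [exact: sg_cst | apply: sg_mul; [exact: sg_cst | exact: sg_coord]].
Qed.

Lemma smooth_is_derive f z j : smooth_on setT f -> is_derive z 'e_j f (pderiv j f z).
Proof. by move=> sf; exact: smooth_on_is_derive sf _. Qed.

Lemma is_derive_affine f x e w j : smooth_on setT f ->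
  is_derive w 'e_j (fun w => f (x + e *: w)) (e * pderiv j f (x + e *: w)).
Proof.
move=> sf; apply: line_is_derive.
rewrite (_ : (fun s : R => _) = (fun s : R => f ((x + e *: w) + (e * s) *: 'e_j))); last first.
  by apply/funext => s; rewrite scalerDr scalerA addrA.
have H := @is_derive_line R V f (x + e *: w) 'e_j (e * 0) (pderiv j f (x + e *: w)).
rewrite mulr0 scale0r addr0 in H; have {}H := H (smooth_is_derive _ _ sf).
have D : is_derive (0 : R) (1 : R) (fun s : R => e * s) e.
  have Hi := is_deriveZl e (is_derive_id (0 : R) (1 : R)); rewrite mulr1 in Hi; exact: Hi.
have H' : derivable (fun s : R => f (x + e *: w + s *: 'e_j)) (e * 0) 1 by rewrite mulr0; case: H.
have := is_derive_comp1 D H'; rewrite mulr0 (derive_val (is_derive := H)) mulrC; exact.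
Qed.

(** The average in the rescaled variable: the weight keeps a fixed support, and the result is
    jointly continuous in [e] and [x] down to [e = 0]. [mol_kconv] passes to the form that shows
    smoothness. *)
Definition kav psi e f x : R := I (fun w => psi w * f (x + e *: w)).

Lemma kav_cc_arg psi e f x : cc psi -> continuous f -> cc (fun w => psi w * f (x + e *: w)).
Proof. by move=> cp cf; apply: ccMr => //; cont. Qed.

Lemma kav_cont psi f : cc psi -> continuous f -> continuous (fun p : R * V => kav psi p.1 f p.2).
Proof.
move=> cp cf p; have [cpsi [B pB]] := cp.
apply: (@int_cont _ _ _ (fun (p : R * V) (w : V) => psi w * f (p.2 + p.1 *: w)) p B) => [q|w|q w /pB ->]; last by rewrite mul0r.
- by have [] := kav_cc_arg q.1 q.2 cp cf.
- by cont.
Qed.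

Lemma kav_contx psi e f : cc psi -> continuous f -> continuous (kav psi e f).
Proof. by move=> cp cf; exact: (cont_slice (F := fun e x => kav psi e f x)) (kav_cont cp cf). Qed.

(* e = 0 is allowed and gives f itself. *)
Definition mol e f x : R := kav moll e f x / I moll.

Lemma mol_cc_arg e f x : continuous f -> cc (fun w => moll w * f (x + e *: w)).
Proof. exact: kav_cc_arg moll_cc. Qed.

Lemma mol_cont f : continuous f -> continuous (fun p : R * V => mol p.1 f p.2).
Proof.
by move=> cf; apply: cont_at => p; apply: cont_mul; [exact: kav_cont moll_cc cf p | exact: cont_cst].
Qed.

Lemma mol_contx e f : continuous f -> continuous (mol e f).
Proof. by move=> cf; exact: (cont_slice (F := fun e x => mol e f x)) (mol_cont cf). Qed.

Lemma mol0 f x : mol 0 f x = f x.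
Proof.
rewrite /mol /kav; under [X in I X / _]eq_fun do rewrite scale0r addr0 mulrC.
by rewrite intZ ?mulfK // ?gt_eqF ?int_moll_gt0 //; exact: sc_cc (@sc_moll R m).
Qed.

Definition mkern e w : R := moll (e^-1 *: w).

Lemma sc_mkern e : e != 0 -> sc (mkern e).
Proof.
move=> e0; split.
  apply: sgen_smooth openT _; apply: (@sg_compn R m setT m setT moll (fun w => e^-1 *: w)) => //.
  - exact: openT.
  - exact: (proj1 (@sc_moll R m)).
  - by move=> j; under eq_fun do rewrite mxE; apply: sg_mul; [exact: sg_cst | exact: sg_coord].
exists `|e| => w ew; rewrite /mkern moll_far // normrZ normfV.
by rewrite ltr_pdivlMl ?normr_gt0 // mulr1.
Qed.

Lemma mol_kconv e f : e != 0 -> cc f ->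
  mol e f = (fun x => ((lc ((e^-1)%:M : 'M[R]_m))^-1 / I moll) * kconv (mkern e) f x).
Proof.
move=> e0 cf; apply/funext => x; rewrite /mol /kav mulrAC; congr (_ / _).
rewrite /kconv (scale_shift x) ?invr_neq0 //; last first.
  apply: ccMl; last exact: cf.
  by have [ck _] := sc_cc (sc_mkern e0); cont.
congr (I _); apply/funext => w; rewrite invrK /mkern addrAC subrr add0r.
by rewrite scalerA mulVf // scale1r.
Qed.

Lemma mol_smooth e f : e != 0 -> cc f -> smooth_on setT (mol e f).
Proof.
move=> e0 cf; rewrite mol_kconv //; apply: sgen_smooth openT _.
by apply: sg_mul; [exact: sg_cst | apply: sg_base; apply: kconv_smooth => //; exact: sc_mkern].
Qed.

Lemma pderiv_mol e f j x : sc f ->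
  is_derive x 'e_j (mol e f) (mol e ('D_'e_j f) x).
Proof.
move=> sf; pose d := 'e_j : V.
have cf := sc_cont sf; have cdf := sc_cont (sc_pderiv j sf).
have H : is_derive x d (fun x => I (fun w => moll w * f (x + e *: w))) (I (fun w => moll w * 'D_d f (x + e *: w))).
  apply: line_is_derive; pose G s w := moll w * 'D_d f (x + s *: d + e *: w).
  have -> : I (fun w => moll w * 'D_d f (x + e *: w)) = I (G 0).
    by congr (I _); apply/funext => y; rewrite /G scale0r addr0.
  apply: (@int_derive _ _ (fun s w => moll w * f (x + s *: d + e *: w)) G 1).
  - by move=> s; have [] := mol_cc_arg e (x + s *: d) cf.
  - move=> s w; have h : is_derive s (1 : R) (fun s => f (x + s *: d + e *: w)) ('D_d f (x + s *: d + e *: w)).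
      have -> : (fun s => f (x + s *: d + e *: w)) = (fun s => f ((x + e *: w) + s *: d)).
        by apply/funext => u; rewrite addrAC.
      rewrite addrAC; apply: is_derive_line; apply: derivableP.
      exact: (smooth_derivable (proj1 sf) Logic.I).
    exact: (@is_deriveZ R R R _ (moll w) s 1 _ h).
  - by rewrite /G; cont.
  - by move=> s w w1; rewrite moll_far // mul0r.
have := @is_deriveZ R V R _ (I moll)^-1 x d _ H.
have -> : (I moll)^-1 \*: (fun x => I (fun w => moll w * f (x + e *: w))) = mol e f.
  by apply/funext => y; rewrite /mol mulrC.
by move/is_derive_eq; apply; rewrite /mol mulrC.
Qed.

Definition laplace f x : R := \sum_j 'D_'e_j ('D_'e_j f) x.

(* The derivative in s is (s/2) times the integral of the second bump against
   the Laplacian. *)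
Lemma mean_value_harmonic G z (rho : R) : smooth_on setT G -> 0 <= rho ->
  (forall y, `|y - z| <= rho -> laplace G y = 0) -> mol rho G z = G z.
Proof.
move=> sG rho0 hG; pose b1 := @bmp R m 1.
have cG : continuous G by move=> x; exact: smooth_cont sG _.
have cD j : continuous ('D_'e_j G) by move=> x; exact: smooth_cont (smooth_pderiv j sG) _.
pose F s := I (fun w => moll w * G (z + s *: w)).
pose dF s := I (fun w => moll w * \sum_j w 0 j * 'D_'e_j G (z + s *: w)).
have dFF s : is_derive s (1 : R) F (dF s).
  apply: (@int_derive _ _ (fun s w => moll w * G (z + s *: w))
    (fun s w => moll w * \sum_j w 0 j * 'D_'e_j G (z + s *: w)) 1).
  - by move=> t; have [] := mol_cc_arg t z cG.
  - move=> t w; have h : is_derive t (1 : R) (fun s => G (z + s *: w)) (\sum_j w 0 j * 'D_'e_j G (z + t *: w)).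
      have [dG vG] := @smooth_differentiable R m setT G (z + t *: w) openT sG Logic.I.
      by apply: is_derive_line; split; [exact: diff_derivable | rewrite vG].
    exact: (@is_deriveZ R R R _ (moll w) t 1 _ h).
  - by cont.
  - by move=> t w w1; rewrite moll_far // mul0r.
have sGs s (j : 'I_m) : smooth_on setT (fun w => 'D_'e_j G (z + s *: w)) by exact: smooth_affine z s (smooth_pderiv j sG).
have dF0 s : 0 <= s -> s <= rho -> dF s = 0.
  move=> s0 srho.
  (* These are the components of [b1] times the gradient of [G]. Their divergence is s * b1 times
     the Laplacian, minus twice the integrand of [dF s]; its integral is 0. *)
  pose h (j : 'I_m) w := b1 w * 'D_'e_j G (z + s *: w).
  have sch j : sc (h j).
    split; last by exists 1 => w w1; rewrite /h /b1 bmp_out ?mul0r // ltW.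
    by apply: sgen_smooth openT _; apply: sg_mul; apply: sg_base; [exact: smooth_bmp | exact: sGs].
  have dh j w : 'D_'e_j (h j) w =
     b1 w * (s * 'D_'e_j ('D_'e_j G) (z + s *: w)) +
     (-2) * (moll w * (w 0 j * 'D_'e_j G (z + s *: w))).
    have D1 := smooth_is_derive w j (@smooth_bmp R m 1); have D2 := is_derive_affine z s w j (smooth_pderiv j sG).
    rewrite [LHS](derive_val (is_derive := is_deriveM D1 D2)) /pderiv.
    rewrite pderiv_bmp fexp_der1 /moll; congr (_ + _).
    rewrite -[LHS]/('D_'e_j G (z + s *: w) * (-2 * w 0 j * bmp 'X^2 w)); ring.
  have hsum : (fun w => moll w * \sum_j w 0 j * 'D_'e_j G (z + s *: w)) =
      (fun w => (- 2^-1) * \sum_j 'D_'e_j (h j) w).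
    apply/funext => w; under [in RHS]eq_bigr do rewrite dh.
    rewrite big_split /= -!mulr_sumr -/(laplace G _).
    have [w1|w1] := lerP `|w| 1; last by rewrite /b1 bmp_out ?ltW // moll_far //; ring.
    rewrite (_ : laplace G (z + s *: w) = 0); first by field.
    apply: hG; rewrite addrC addKr normrZ ger0_norm //.
    by apply: le_trans srho; rewrite ler_piMr.
  rewrite /dF hsum intZ; last by apply: cc_sum => j _; exact: sc_cc (sc_pderiv j (sch j)).
  rewrite int_sum => [|j _]; last exact: sc_cc (sc_pderiv j (sch j)).
  by rewrite big1 ?mulr0 // => j _; exact: int_pderiv_sc.
have FF : F rho = F 0.
  have [s [sr s0 E]] := @mvt_signed R F dF rho (fun s _ _ => dFF s).
  apply/eqP; rewrite -subr_eq0 E; move: rho0; rewrite le_eqVlt => /orP[/eqP <-|rp]; first by rewrite mulr0.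
  rewrite dF0 ?mul0r //; first by rewrite -(pmulr_lge0 _ rp).
  by rewrite (le_trans (ler_norm _)) // (le_trans sr) // gtr0_norm.
by rewrite /mol /kav -/(F rho) FF -(mol0 G).
Qed.

End Mollify.

Section Weyl.
Context {R : realType}.
Local Notation I := (@integral_rV R _).
Variable m : nat.
Local Notation V := 'rV[R]_m.
Implicit Types (f g k : V -> R) (x y z w : V).

Lemma derive_shift (X : normedModType R) (f : X -> R) (a b v : X) :
  'D_v (fun y : X => f (y + a)) b = 'D_v f (b + a).
Proof.
rewrite /derive; set g1 := fun h => h^-1 *: _; set g2 := fun h => h^-1 *: _.
suff -> : g1 = g2 by [].
by apply/funext => h; rewrite /g1 /g2 /= addrA.
Qed.

Lemma sc_shift k a : sc k -> sc (fun y => k (y + a)).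
Proof.
move=> sk; split; last exact: (proj2 (cc_shift a (sc_cc sk))).
apply: sgen_smooth openT _; apply: (@sg_compn R m setT m setT k (fun y => y + a)) => //.
- exact: openT.
- exact: (proj1 sk).
- by move=> j; under eq_fun do rewrite mxE; apply: sg_add; [exact: sg_coord | exact: sg_cst].
Qed.

Lemma laplace_shift k a x : laplace (fun y => k (y + a)) x = laplace k (x + a).
Proof.
apply: eq_bigr => j _.
have -> : 'D_'e_j (fun y => k (y + a)) = (fun y => 'D_'e_j k (y + a)).
  by apply/funext => y; exact: derive_shift.
exact: derive_shift.
Qed.

Lemma scN1 k : sc k -> sc (fun y => (- 1) * k y).
Proof.
move=> [sk [B kB]]; split; last by exists B => y /kB ->; rewrite mulr0.
by apply: sgen_smooth openT _; apply: sg_mul; [exact: sg_cst | exact: sg_base].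
Qed.

Lemma laplace_kconv k f x : sc k -> cc f -> laplace (kconv k f) x = I (fun y => f y * laplace k (y - x)).
Proof.
move=> sk cf; rewrite /laplace.
have E j : 'D_'e_j ('D_'e_j (kconv k f)) x =
    I (fun y => f y * 'D_'e_j ('D_'e_j k) (y - x)).
  pose k1 y := (- 1) * 'D_'e_j k y.
  have sk1 : sc k1 by apply: scN1; exact: sc_pderiv.
  have -> : 'D_'e_j (kconv k f) = kconv k1 f.
    by apply/funext => y; have [_ ->] := kconv_is_derive y j sk cf.
  have [_ ->] := kconv_is_derive x j sk1 cf; rewrite /kconv; congr (I _).
  apply/funext => y; rewrite mulrC; congr (_ * _).
  have d : derivable ('D_'e_j k) (y - x) 'e_j.
    exact: (smooth_derivable (proj1 (sc_pderiv j sk)) Logic.I).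
  have := deriveZ (-1) d; rewrite -[X in X = _]/('D_'e_j k1 (y - x)) => ->.
  by rewrite -[_ *: _]/(_ * _) mulrA mulrNN !mul1r.
transitivity (\sum_j I (fun y => f y * 'D_'e_j ('D_'e_j k) (y - x))); first by apply: eq_bigr => j _; exact: E.
rewrite -(int_sum (m := m)) => [|j _].
  by congr (I _); apply/funext => y; rewrite mulr_sumr.
have c2 := sc_cont (sc_pderiv j (sc_pderiv j sk)); apply: ccMr; first exact: cf.
cont.
Qed.

(** The mollification of [f] at a radius e < r / 4 is harmonic on the ball of radius r / 4 about
    [z], the translated kernel being an admissible test function. It therefore has the mean value
    property there, which passes to the limit as e tends to 0. *)
Lemma weyl_core f z0 (r : R) : cc f -> 0 < r ->
  (forall g, sc g -> (forall x, r <= `|x - z0| -> g x = 0) -> I (fun x => f x * laplace g x) = 0) ->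
  forall z, `|z - z0| < r / 4 -> mol (r / 4) f z = f z.
Proof.
move=> ccf r0 H z zr; have [cf _] := ccf; have r4 : 0 < r / 4 by rewrite divr_gt0.
have step (e : R) : 0 < e -> e < r / 4 -> mol (r / 4) (mol e f) z = mol e f z.
  move=> e0 er; have en : e != 0 by rewrite gt_eqF.
  apply: mean_value_harmonic; [exact: mol_smooth | exact: ltW |].
  move=> y yz; rewrite mol_kconv //; set c := _ / _.
  have sk := @sc_mkern R m _ en.
  have sK := kconv_smooth sk ccf.
  have -> : laplace (fun x => c * kconv (mkern e) f x) y = c * laplace (kconv (mkern e) f) y.
    rewrite /laplace mulr_sumr; apply: eq_bigr => j _.
    have -> : 'D_'e_j (fun x => c * kconv (mkern e) f x) = c \*: 'D_'e_j (kconv (mkern e) f).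
      by apply/funext => x; apply: deriveZ; exact: (smooth_derivable sK Logic.I).
    by apply: deriveZ; exact: (smooth_derivable (smooth_pderiv j sK) Logic.I).
  rewrite laplace_kconv //.
  have -> : (fun x => f x * laplace (mkern e) (x - y)) = (fun x => f x * laplace (fun u => mkern e (u - y)) x).
    by apply/funext => x; rewrite laplace_shift.
  rewrite H ?mulr0 //; first exact: sc_shift.
  move=> x xr; rewrite /mkern moll_far // normrZ normfV gtr0_norm //.
  rewrite ltr_pdivlMl // mulr1.
  have h1 : `|x - z0| <= `|x - y| + (`|y - z| + `|z - z0|).
    by rewrite -[x - z0](subrK (y - z0)) (le_trans (ler_normD _ _)) // [x - z0 - _](_ : _ = x - y) ?lerD2l //;
      [rewrite -[y - z0](subrK (z - z0)) (le_trans (ler_normD _ _)) // [y - z0 - _](_ : _ = y - z) //; rewrite opprB addrA subrK | rewrite opprB addrA subrK].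
  have h2 : `|y - z| + `|z - z0| < r / 4 + r / 4 by exact: ler_ltD.
  have h3 : r <= `|x - y| + (`|y - z| + `|z - z0|) by exact: le_trans xr h1.
  have h4 : r <= `|x - y| + (r / 4 + r / 4) by apply: le_trans h3 _; rewrite lerD2l ltW.
  move: h4; move: (`|x - y|) => t h4; lra.
pose D e := mol (r / 4) (mol e f) z - mol e f z.
have cD : {for 0, continuous D}.
  have cE : {for 0, continuous (fun e => mol e f z)}.
    by apply: (@continuous_comp _ _ _ (fun e : R => (e, z)) (fun p : R * V => mol p.1 f p.2)); [cont | exact: mol_cont].
  apply: (@cvgB _ _ _ (nbhs (0 : R))); last exact: cE.
  apply: (@cvgMl _ _ (nbhs (0 : R))).
  suff C : {for 0, continuous (fun e : R => I (fun w => moll w * mol e f (z + (r / 4) *: w)))} by exact: C.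
  apply: (@int_cont _ _ _ (fun (e : R) (w : V) => moll w * mol e f (z + (r / 4) *: w)) 0 1).
  - by move=> e; have [] := mol_cc_arg (r / 4) z (mol_contx (e := e) cf).
  - move=> w; apply: (@cvgM _ _ (nbhs ((0 : R), w))).
      by apply: (@continuous_comp _ _ _ snd (@moll R m)); [exact: cvg_snd | exact: moll_cont].
    apply: (@continuous_comp _ _ _ (fun p : R * V => (p.1, z + (r / 4) *: p.2)) (fun p : R * V => mol p.1 f p.2)); last exact: mol_cont.
    by cont.
  - by move=> e w w1; rewrite moll_far // mul0r.
have D0 : D 0 = 0.
  apply/eqP; rewrite -normr_le0; apply/ler_addgt0Pl => e e0; rewrite addr0.
  have /cvgrPdist_le/(_ e e0)/nbhs_ballP[d /= d0 dP] := cD.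
  pose t := Num.min d (r / 4) / 2.
  have m0 : 0 < Num.min d (r / 4) by rewrite lt_min d0.
  have t0 : 0 < t by rewrite divr_gt0.
  have tm : t < Num.min d (r / 4) by rewrite /t; lra.
  have := dP t; rewrite /ball /= sub0r normrN gtr0_norm // => /(_ _).
  rewrite {2}/D step ?subrr ?subr0 //; last by rewrite (lt_le_trans tm) // ge_min lexx orbT.
  by apply; rewrite (lt_le_trans tm) // ge_min lexx.
move: D0; rewrite /D; have -> : mol 0 f = f by apply/funext => x; exact: mol0.
by move/eqP; rewrite subr_eq0 => /eqP.
Qed.

Definition cutoff z0 (r : R) x : R := plateau 2 (r^-1 *: (x - z0)).

Lemma cutoff_cont z0 r : continuous (cutoff z0 r).
Proof.
by move=> x; apply: (cont_comp (f := fun x : V => r^-1 *: (x - z0)) (g := plateau 2)) ((@cc_plateau R V 2).1 _); cont.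
Qed.

Lemma cutoff1 z0 r x : 0 < r -> `|x - z0| <= 2 * r -> cutoff z0 r x = 1.
Proof.
move=> r0 xr; rewrite /cutoff plateau1 // normrZ normfV gtr0_norm //.
by rewrite ler_pdivrMl // mulrC.
Qed.

Lemma cutoff0 z0 r x : 0 < r -> 3 * r <= `|x - z0| -> cutoff z0 r x = 0.
Proof.
move=> r0 xr; rewrite /cutoff /plateau max_l // ge_min subr_le0 normrZ normfV gtr0_norm //.
by rewrite ler_pdivlMl // (_ : r * (2 + 1) = 3 * r) ?xr ?orbT //; ring.
Qed.

Lemma cutoff_cc (U : set V) f z0 r : open U -> 0 < r -> (forall x, `|x - z0| <= 3 * r -> U x) ->
  (forall x, U x -> {for x, continuous f}) -> cc ((fun x => f x * cutoff z0 r x) \_ U).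
Proof.
move=> oU r0 bU cf; split.
  apply: (ext_continuous (K := [set x | `|x - z0| <= 3 * r])) => //.
  - rewrite (_ : [set x | _] = (fun x : V => `|x - z0|) @^-1` [set y | y <= 3 * r]) //.
    apply: closed_comp; last exact: closed_le.
    by move=> x _; cont.
  - by move=> x Ux; apply: cont_mul; [exact: cf | exact: cutoff_cont].
  - move=> x Ux /negP; rewrite -ltNge => h; rewrite cutoff0 ?mulr0 // ltW //.
exists (3 * r + `|z0|) => x xB; rewrite patchE; case: ifP => // _.
rewrite cutoff0 ?mulr0 //; have := ler_normB x z0 => _.
have := ler_normD (x - z0) z0; rewrite subrK => h.
by rewrite ltW // -(ltrD2r `|z0|) (lt_le_trans xB).
Qed.

(** Near [z0] the function agrees with its cut-off version, which by [weyl_core] equals its own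
    mollification at the fixed radius r / 4 and is thus smooth. *)
Lemma weyl (U : set V) f : open U -> (forall x, U x -> {for x, continuous f}) ->
  (forall z0, U z0 -> exists2 r : R, 0 < r & (forall x, `|x - z0| <= 3 * r -> U x) /\
     forall g, sc g -> (forall x, r <= `|x - z0| -> g x = 0) ->
       I (fun x => ((fun x => f x * cutoff z0 r x) \_ U) x * laplace g x) = 0) ->
  smooth_on U f.
Proof.
move=> oU cf H; apply: smooth_local => z0 /H[r r0 [bU Hg]].
set ft := _ \_ U in Hg.
have cft : cc ft by exact: cutoff_cc.
have r4 : 0 < r / 4 by rewrite divr_gt0.
exists (ball z0 (r / 4)); first exact: ballxx.
have zz z : ball z0 (r / 4) z -> `|z - z0| < r / 4 by rewrite -ball_normE /= distrC.
apply: (@smooth_eq R m _ (mol (r / 4) ft)).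
- exact: ball_open.
- move=> z /zz h; rewrite (weyl_core cft r0 Hg h) /ft patchE mem_set; last by apply: bU; lra.
  by rewrite cutoff1 ?mulr1 //; lra.
- by apply: smooth_sub (subsetT _) _; apply: mol_smooth => //; rewrite gt_eqF.
Qed.

End Weyl.

Ltac cont_fact ::= first [exact: norm_continuous | exact: moll_cont
  | match goal with
    | H : cc ?f |- prop_for _ (inPhantom (forall y, continuous_at y ?f)) => exact: (proj1 H _)
    | H : smooth_on setT ?f |- prop_for _ (inPhantom (forall y, continuous_at y ?f)) => exact: (smooth_cont H Logic.I)
    | H : smooth_on setT ?f |- prop_for _ (inPhantom (forall y, continuous_at y (pderiv _ ?f))) =>
        exact: (smooth_cont (smooth_pderiv _ H) Logic.I)
    | H : sc ?f |- prop_for _ (inPhantom (forall y, continuous_at y ?f)) => exact: (sc_cont H)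
    | H : sc ?f |- prop_for _ (inPhantom (forall y, continuous_at y (pderiv _ ?f))) => exact: (sc_cont (sc_pderiv _ H))
    end].

(** * Wedge products of 2-forms *)

Section Wedge.
Variables (K : comNzRingType) (n : nat).
Local Notation m := (n * 2)%N.
Implicit Types (a : 'I_n -> 'M[K]_m) (s : 'S_m).

Definition xi (k : 'I_n) : 'I_m := mxvec_index k (0 : 'I_2).
Definition yi (k : 'I_n) : 'I_m := mxvec_index k (1 : 'I_2).

(** The sum in [wedge_top] without its factor 2 ^- n. It is taken over a commutative ring because
    matrices with complex and with polynomial entries occur in the stability argument. *)
Definition wt a : K :=
  \sum_(s : 'S_m) (-1) ^+ s * \prod_(k < n) a k (s (xi k)) (s (yi k)).

Definition unindex (q : 'I_m) : 'I_n * 'I_2 := enum_val (cast_ord (esym (mxvec_cast n 2)) q).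

Lemma mxvec_indexK k b : unindex (mxvec_index k b) = (k, b).
Proof. by rewrite /unindex /mxvec_index cast_ordK enum_rankK. Qed.

Lemma unindexK q : mxvec_index (unindex q).1 (unindex q).2 = q.
Proof. by case/mxvec_indexP: q => k b; rewrite mxvec_indexK. Qed.

Lemma xi_inj : injective xi.
Proof. by move=> k l /(congr1 unindex); rewrite !mxvec_indexK => -[]. Qed.

Lemma yi_inj : injective yi.
Proof. by move=> k l /(congr1 unindex); rewrite !mxvec_indexK => -[]. Qed.

Lemma xi_neq_yi k l : (xi k == yi l) = false.
Proof. by apply/eqP => /(congr1 unindex); rewrite !mxvec_indexK => -[]. Qed.

Lemma ord2_enum (T : Type) (op : T -> T -> T) (F : 'I_2 -> T) idx :
  \big[op/idx]_b F b = op (F 0) (op (F 1) idx).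
Proof.
rewrite !big_ord_recl big_ord0; congr (op (F _) (op (F _) _)); exact/val_inj.
Qed.

Lemma prod_positions (F : 'I_m -> K) : \prod_q F q = \prod_k (F (xi k) * F (yi k)).
Proof.
rewrite (reindex (uncurry (@mxvec_index n 2))) /=; last by exact: curry_mxvec_bij.
rewrite (eq_bigr (fun p => F (mxvec_index p.1 p.2))); last by case.
rewrite -(pair_bigA _ (fun k b => F (mxvec_index k b))) /=.
by apply: eq_bigr => k _; rewrite ord2_enum mulr1.
Qed.

Lemma sum_positions (F : 'I_m -> K) : \sum_q F q = \sum_k (F (xi k) + F (yi k)).
Proof.
rewrite (reindex (uncurry (@mxvec_index n 2))) /=; last by exact: curry_mxvec_bij.
rewrite (eq_bigr (fun p => F (mxvec_index p.1 p.2))); last by case.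
rewrite -(pair_bigA _ (fun k b => F (mxvec_index k b))) /=.
by apply: eq_bigr => k _; rewrite ord2_enum addr0.
Qed.

Lemma eq_wt a b : (forall k, a k = b k) -> wt a = wt b.
Proof. by move=> ab; apply: eq_bigr => s _; congr (_ * _); apply: eq_bigr => k _; rewrite ab. Qed.

Lemma wt_expand (T : finType) (c : 'I_n -> T -> K) (B : 'I_n -> T -> 'M[K]_m) :
  wt (fun k => \sum_p c k p *: B k p) =
  \sum_(g : {ffun 'I_n -> T}) (\prod_k c k (g k)) * wt (fun k => B k (g k)).
Proof.
rewrite /wt; under [RHS]eq_bigr do rewrite mulr_sumr.
rewrite exchange_big; apply: eq_bigr => s _ /=.
transitivity ((-1) ^+ s * \prod_k \sum_p c k p * B k p (s (xi k)) (s (yi k))).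
  by congr (_ * _); apply: eq_bigr => k _; rewrite summxE; apply: eq_bigr => p _; rewrite mxE.
rewrite bigA_distr_bigA mulr_sumr; apply: eq_bigr => g _.
by rewrite big_split /= mulrCA.
Qed.

Lemma wt_rank1 (w : 'I_m -> 'rV[K]_m) :
  wt (fun k => (w (xi k))^T *m w (yi k)) = \det (\matrix_q w q).
Proof.
apply: eq_bigr => s _; congr (_ * _); rewrite prod_positions.
by apply: eq_bigr => k _; rewrite !mxE big_ord1 !mxE.
Qed.

(** By multilinearity the forms may be taken of rank one, and for these the wedge product is a
    determinant. *)
Lemma wt_congr (P : 'M[K]_m) a : wt (fun k => P *m a k *m P^T) = \det P * wt a.
Proof.
pose B (p : 'I_m * 'I_m) : 'M[K]_m := ('e_p.1 : 'rV[K]_m)^T *m ('e_p.2 : 'rV[K]_m).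
have aE k : a k = \sum_p a k p.1 p.2 *: B p.
  rewrite [LHS]matrix_sum_delta pair_bigA; apply: eq_bigr => p _ /=.
  by rewrite /B trmx_delta mul_delta_mx.
have PaE k : P *m a k *m P^T = \sum_p a k p.1 p.2 *: (P *m B p *m P^T).
  rewrite {1}aE mulmx_sumr mulmx_suml; apply: eq_bigr => p _.
  by rewrite -scalemxAr -scalemxAl.
rewrite (eq_wt PaE) (eq_wt aE) !wt_expand mulr_sumr; apply: eq_bigr => g _.
rewrite mulrCA; congr (_ * _).
pose w (q : 'I_m) : 'rV[K]_m :=
  delta_mx 0 (if (unindex q).2 == 0 then (g (unindex q).1).1 else (g (unindex q).1).2).
have wE k : B (g k) = (w (xi k))^T *m w (yi k) by rewrite /B /w !mxvec_indexK.
rewrite (eq_wt wE) wt_rank1.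
rewrite (@eq_wt _ (fun k => (w (xi k) *m P^T)^T *m (w (yi k) *m P^T))); last first.
  by move=> k; rewrite wE trmx_mul trmxK !mulmxA.
rewrite (wt_rank1 (fun q => w q *m P^T)).
have -> : \matrix_q (w q *m P^T) = (\matrix_q w q) *m P^T.
  by apply/row_matrixP => q; rewrite row_mul !rowK.
by rewrite det_mulmx det_tr mulrC.
Qed.

(** Exchanging two 2-forms moves the positions by the product [p] of two transpositions, an even
    permutation. *)
Lemma wt_tperm a k l : wt (fun j => a (tperm k l j)) = wt a.
Proof.
have [->|kl] := eqVneq k l; first by apply: eq_wt => j; rewrite tperm1 perm1.
pose p : 'S_m := (tperm (xi k) (xi l) * tperm (yi k) (yi l))%g.
have px j : p (xi (tperm k l j)) = xi j.
  rewrite /p permM; have [->|jk] := eqVneq j k.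
    by rewrite tpermL tpermR tpermD // eq_sym xi_neq_yi.
  have [->|jl] := eqVneq j l.
    by rewrite tpermR tpermL tpermD // eq_sym xi_neq_yi.
  by rewrite (tpermD (x := k)) 1?eq_sym // !tpermD ?(inj_eq xi_inj) 1?eq_sym ?xi_neq_yi // eq_sym.
have py j : p (yi (tperm k l j)) = yi j.
  have yx r : tperm (xi k) (xi l) (yi r) = yi r by rewrite tpermD ?xi_neq_yi.
  rewrite /p permM yx; have [->|jk] := eqVneq j k; first by rewrite tpermL tpermR.
  have [->|jl] := eqVneq j l; first by rewrite tpermR tpermL.
  by rewrite (tpermD (x := k)) 1?eq_sym // !tpermD ?(inj_eq yi_inj) 1?eq_sym.
rewrite /wt (reindex_inj (mulgI p)) /=; apply: eq_bigr => s _.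
rewrite odd_permM {1}/p odd_permM !odd_tperm !(inj_eq xi_inj) !(inj_eq yi_inj) kl addTb /=; congr (_ * _).
rewrite [RHS](reindex_inj (@perm_inj _ (tperm k l))) /=; apply: eq_bigr => j _.
have px' : p (xi j) = xi (tperm k l j) by rewrite -(px (tperm k l j)) tpermK.
have py' : p (yi j) = yi (tperm k l j) by rewrite -(py (tperm k l j)) tpermK.
by rewrite (permM p s (xi j)) (permM p s (yi j)) px' py'.
Qed.

Lemma wt_perm a (p : 'S_n) : wt (fun j => a (p j)) = wt a.
Proof.
have [ts -> _] := prod_tpermP p; elim: ts a => [|t ts IH] a.
  by rewrite big_nil; apply: eq_wt => j; rewrite perm1.
rewrite big_cons -[RHS]IH -[RHS](wt_tperm _ t.1 t.2).
by apply: eq_wt => j; rewrite permM.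
Qed.

Definition upd a k b : 'I_n -> 'M[K]_m := fun j => if j == k then b else a j.

Lemma wt_upd_lin a k (c : K) b b' : wt (upd a k (c *: b + b')) = c * wt (upd a k b) + wt (upd a k b').
Proof.
rewrite /wt mulr_sumr -big_split; apply: eq_bigr => s _ /=.
have E d : \prod_i (upd a k d i) (s (xi i)) (s (yi i)) =
   d (s (xi k)) (s (yi k)) * \prod_(i < n | i != k) a i (s (xi i)) (s (yi i)).
  rewrite (bigD1 k) //= /upd eqxx; congr (_ * _).
  by apply: eq_bigr => i /negbTE ->.
by rewrite !E !mxE mulrDl mulrDr -!mulrA [in X in X + _]mulrCA.
Qed.

(* The off-diagonal terms of N cancel in pairs: exchanging the positions q and
   q' changes the sign of the permutation and nothing else. *)
Lemma wt_derivation a (N : 'M[K]_m) : GRing.lreg (2 : K) ->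
  \sum_k wt (upd a k (N *m a k + a k *m N^T)) = \tr N * wt a.
Proof.
move=> two.
pose G (f : 'I_m -> 'I_m) := \prod_k a k (f (xi k)) (f (yi k)).
(* [uf s q j] is [s] with the value at [q] replaced by [j]. Writing j = s q', the summand of the
   position q carries the entry of [N] at (s q, s q'). *)
pose uf (s : 'S_m) q j := fun q' : 'I_m => if q' == q then j else s q'.
pose T q q' := \sum_(s : 'S_m) (-1) ^+ s * (N (s q) (s q') * G (uf s q (s q'))).
have Gx (s : 'S_m) k j : G (uf s (xi k) j) = a k j (s (yi k)) * \prod_(l < n | l != k) a l (s (xi l)) (s (yi l)).
  rewrite /G (bigD1 k) //= /uf eqxx eq_sym xi_neq_yi; congr (_ * _).
  by apply: eq_bigr => l lk; rewrite (inj_eq xi_inj) (negbTE lk) eq_sym xi_neq_yi.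
have Gy (s : 'S_m) k j : G (uf s (yi k) j) = a k (s (xi k)) j * \prod_(l < n | l != k) a l (s (xi l)) (s (yi l)).
  rewrite /G (bigD1 k) //= /uf eqxx xi_neq_yi; congr (_ * _).
  by apply: eq_bigr => l lk; rewrite (inj_eq yi_inj) (negbTE lk) xi_neq_yi.
have step : \sum_k wt (upd a k (N *m a k + a k *m N^T)) = \sum_q \sum_q' T q q'.
  transitivity (\sum_q \sum_(s : 'S_m) (-1) ^+ s * \sum_j N (s q) j * G (uf s q j)); last first.
    apply: eq_bigr => q _; rewrite [RHS]exchange_big; apply: eq_bigr => s _ /=.
    by rewrite -mulr_sumr; congr (_ * _); rewrite (reindex_inj (@perm_inj _ s)).
  rewrite sum_positions; apply: eq_bigr => k _.
  rewrite -big_split; apply: eq_bigr => s _ /=; rewrite -mulrDr; congr (_ * _).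
  rewrite (bigD1 k) //= /upd eqxx !mxE.
  under eq_bigr => i ik do rewrite (negbTE ik).
  rewrite mulrDl !mulr_suml; congr (_ + _); apply: eq_bigr => j _.
    by rewrite Gx mulrA.
  by rewrite Gy mxE (mulrC (a k _ _)) mulrA.
have anti q q' : q != q' -> T q' q = - T q q'.
  move=> qq; rewrite /T (reindex_inj (mulgI (tperm q q'))) /= -sumrN; apply: eq_bigr => s _.
  rewrite odd_permM odd_tperm qq signr_addb expr1 !mulN1r mulNr !permM tpermL tpermR; congr (- (_ * (_ * _))).
  apply: eq_bigr => k _; rewrite /uf !permM.
  have E r : (if r == q' then s q' else s (tperm q q' r)) = (if r == q then s q' else s r).
    case: tpermP => [->|->|/eqP rq /eqP rq']; rewrite ?eqxx //.
    - by rewrite (negbTE qq).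
    - by rewrite eq_sym (negbTE qq).
    - by rewrite (negbTE rq) (negbTE rq').
  by rewrite !E.
rewrite step.
have -> : \sum_q \sum_q' T q q' = \sum_q T q q + \sum_q \sum_(q' | q' != q) T q q'.
  by rewrite -big_split; apply: eq_bigr => q _; rewrite (bigD1 q).
have -> : \sum_q \sum_(q' | q' != q) T q q' = 0.
  set O := \sum_q _; apply: two; rewrite mulr0 mulr_natl mulr2n -[X in _ + X]opprK; apply/eqP; rewrite subr_eq0; apply/eqP.
  rewrite -sumrN; under [RHS]eq_bigr do rewrite -sumrN.
  rewrite /O (exchange_big_dep xpredT) //=; apply: eq_bigr => q _.
  by apply: eq_big => [q'|q' qq]; [rewrite eq_sym | rewrite anti].
rewrite addr0 mulr_sumr exchange_big; apply: eq_bigr => s _ /=.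
rewrite -mulr_sumr mulrCA; congr (_ * _); rewrite /mxtrace.
rewrite mulr_suml [RHS](reindex_inj (@perm_inj _ s)) /=; apply: eq_bigr => q _; congr (_ * _).
have E q' : uf s q (s q) q' = s q' by rewrite /uf; case: eqP => [->|].
by apply: eq_bigr => k _; rewrite !E.
Qed.

Lemma wt_upd0 a k : wt (upd a k 0) = 0.
Proof.
have := wt_upd_lin a k 1 0 0; rewrite scaler0 addr0 mul1r => /eqP.
by rewrite -subr_eq0 opprD addNKr oppr_eq0 => /eqP.
Qed.

Lemma wt_upd_tr a k b : wt (upd a k b^T) = - wt (upd a k b).
Proof.
rewrite /wt (reindex_inj (mulgI (tperm (xi k) (yi k)))) /= -sumrN; apply: eq_bigr => s _.
rewrite odd_permM odd_tperm xi_neq_yi addTb signrN mulNr; congr (- (_ * _)); apply: eq_bigr => l _.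
rewrite /upd !permM; case: eqP => [->|/eqP lk]; first by rewrite tpermL tpermR mxE.
have -> : tperm (xi k) (yi k) (xi l) = xi l.
  by rewrite tpermD // ?(inj_eq xi_inj) eq_sym // xi_neq_yi.
by rewrite tpermD ?xi_neq_yi // (inj_eq yi_inj) eq_sym.
Qed.

Lemma wt_antisym a : wt (fun k => a k - (a k)^T) = 2 ^+ n * wt a.
Proof.
suff H i : (i <= n)%N -> wt (fun k : 'I_n => if (k < i)%N then a k - (a k)^T else a k) = 2 ^+ i * wt a.
  by rewrite -H //; apply: eq_wt => k; rewrite ltn_ord.
elim: i => [|i IH] ni; first by rewrite expr0 mul1r.
set b := fun k : 'I_n => if (k < i)%N then a k - (a k)^T else a k in IH.
have E c : (fun k : 'I_n => if (k < i)%N then a k - (a k)^T else if k == Ordinal ni then c else a k) =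
  upd b (Ordinal ni) c.
  by apply/funext => k; rewrite /upd /b; case: ltngtP => //; case: eqP => // -> /=; rewrite ltnn.
transitivity (wt (upd b (Ordinal ni) ((- 1) *: (a (Ordinal ni))^T + a (Ordinal ni)))).
  rewrite [_ + a _]addrC scaleN1r -E; apply: eq_wt => k; rewrite ltnS leq_eqVlt.
  case: eqP => [ki|ki] /=.
    by rewrite ki ltnn (_ : k = Ordinal ni) ?eqxx //; exact/val_inj.
  by rewrite -val_eqE /= (introF eqP ki); case: ifP.
rewrite wt_upd_lin wt_upd_tr mulrNN mul1r.
have -> : upd b (Ordinal ni) (a (Ordinal ni)) = b.
  by apply/funext => k; rewrite /upd; case: eqP => // ->; rewrite /b ltnn.
by rewrite (IH (ltnW ni)) exprS -mulrA mulr_natl mulr2n.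
Qed.

(** Lists make it easy to permute factors and to add copies of one form. Lists of length [n] are
    meant: shorter ones are padded with 0, and longer ones are cut. *)
Definition wl (s : seq 'M[K]_m) : K := wt (fun k => nth 0 s k).

Lemma wl_perm (s t : seq 'M[K]_m) : perm_eq s t -> size s = n -> wl s = wl t.
Proof.
move=> st sn; have tn : size t == n by rewrite -(perm_size st) sn.
have [p sE] := @tuple_permP _ _ s (Tuple tn) st.
rewrite -[RHS](wt_perm _ p); apply: eq_wt => k.
by rewrite sE (nth_map k) ?size_enum_ord // nth_ord_enum (tnth_nth 0).
Qed.

Lemma wl_set_nth (s : seq 'M[K]_m) (k : 'I_n) b : wl (set_nth 0 s k b) = wt (upd (fun k => nth 0 s k) k b).
Proof. by apply: eq_wt => l; rewrite nth_set_nth. Qed.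

Lemma wl_cons_lin (c : K) b b' (t : seq _) : (0 < n)%N ->
  wl (c *: b + b' :: t) = c * wl (b :: t) + wl (b' :: t).
Proof.
move=> n0; have E d : wl (d :: t) = wt (upd (fun k => nth 0 (0 :: t) k) (Ordinal n0) d).
  by rewrite -wl_set_nth.
by rewrite !E wt_upd_lin.
Qed.

Lemma wl_cons0 (t : seq _) : (0 < n)%N -> wl (0 :: t) = 0.
Proof.
move=> n0; have := wl_cons_lin 1 0 0 t n0; rewrite scaler0 addr0 mul1r => /eqP.
by rewrite -subr_eq0 opprD addNKr oppr_eq0 => /eqP.
Qed.

Lemma wl_consZ (c : K) b (t : seq _) : (0 < n)%N -> wl (c *: b :: t) = c * wl (b :: t).
Proof. by move=> n0; rewrite -[_ *: _]addr0 wl_cons_lin // wl_cons0 // addr0. Qed.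

Lemma perm_set_nth (T : eqType) (x0 : T) (s : seq T) k b : (k < size s)%N ->
  perm_eq (nth x0 s k :: set_nth x0 s k b) (b :: s).
Proof.
elim: s k => [|x s IH] [|k] //=; first by move=> _; apply/seq.permP => p /=; lia.
rewrite ltnS => /IH /seq.permP h; apply/seq.permP => p; have := h p; rewrite /=; lia.
Qed.

(** By symmetry of the wedge product the [d] slots holding the same [Z] contribute equal terms. *)
Lemma sum_wl_set_nth (F : 'M[K]_m -> 'M[K]_m) (bs : seq 'M[K]_m) d Z : (size bs + d = n)%N ->
  \sum_k wt (upd (fun k => nth 0 (bs ++ nseq d Z) k) k (F (nth 0 (bs ++ nseq d Z) k))) =
  \sum_(0 <= k < size bs) wl (set_nth 0 bs k (F (nth 0 bs k)) ++ nseq d Z) +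
  d%:R * wl (F Z :: bs ++ nseq d.-1 Z).
Proof.
move=> bn; set s := bs ++ nseq d Z; have sn : size s = n by rewrite size_cat size_nseq.
transitivity (\sum_(0 <= k < n) wl (set_nth 0 s k (F (nth 0 s k)))).
  by rewrite big_mkord; apply: eq_bigr => k _; rewrite wl_set_nth.
have bn' : (size bs <= n)%N by lia.
have dn : (n - size bs)%N = d by lia.
rewrite (@big_cat_nat _ _ _ (size bs)) //=.
congr (_ + _).
  rewrite !big_nat; apply: eq_bigr => k /andP[_ kb]; congr wl.
  rewrite {2}/s nth_cat kb {bn bn' dn sn}/s; elim: bs k kb => // x bs IH [|k] //= kb.
  by rewrite IH.
rewrite big_nat (eq_bigr (fun=> wl (F Z :: bs ++ nseq d.-1 Z))).
  by rewrite -big_nat sumr_const_nat dn mulr_natl.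
move=> k /andP[kb kn]; have nk : nth 0 s k = Z.
  by rewrite /s nth_cat ltnNge kb /= nth_nseq; case: ifP => //; lia.
have ks : (k < size s)%N by rewrite sn.
have d0 : (0 < d)%N by lia.
apply: wl_perm; last by rewrite size_set_nth sn; apply/maxn_idPr.
rewrite nk -(perm_cons Z) -{1}nk (perm_trans (perm_set_nth _ _ ks)) //.
apply/seq.permP => p; rewrite /s -(prednK d0) /= !count_cat /=; lia.
Qed.

End Wedge.

Section WedgeMorphism.

Lemma wt_map (K L : comNzRingType) (f : {rmorphism K -> L}) n (a : 'I_n -> 'M[K]_(n * 2)) :
  wt (fun k => map_mx f (a k)) = f (wt a).
Proof.
rewrite /wt rmorph_sum; apply: eq_bigr => s _; rewrite rmorphM rmorph_sign rmorph_prod.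
by congr (_ * _); apply: eq_bigr => k _; rewrite !mxE.
Qed.

Lemma wl_map (K L : comNzRingType) (f : {rmorphism K -> L}) n (s : seq 'M[K]_(n * 2)) :
  size s = n -> wl (map (map_mx f) s) = f (wl s).
Proof.
by move=> sn; rewrite -wt_map; apply: eq_wt => k; rewrite (nth_map 0) // sn.
Qed.

Lemma deriv_prod_ord (K : comNzRingType) n (F : 'I_n -> {poly K}) :
  (\prod_k F k)^`() = \sum_k (F k)^`() * \prod_(l | l != k) F l.
Proof.
elim: n F => [|n IH] F; first by rewrite !big_ord0 derivC.
rewrite !big_ord_recl derivM IH; congr (_ * _ + _).
  rewrite [RHS]big_mkcond big_ord_recl /= mul1r; apply: eq_bigr => k _.
  by rewrite /= .
rewrite mulr_sumr; apply: eq_bigr => k _.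
rewrite mulrCA; congr (_ * _); rewrite [RHS]big_mkcond big_ord_recl /=; congr (_ * _).
by rewrite [LHS]big_mkcond; apply: eq_bigr => l _; rewrite (inj_eq (@lift_inj _ ord0)).
Qed.

Lemma deriv_wt (K : comNzRingType) n (a : 'I_n -> 'M[{poly K}]_(n * 2)) :
  (wt a)^`() = \sum_k wt (upd a k (map_mx (@deriv K) (a k))).
Proof.
rewrite /wt raddf_sum exchange_big; apply: eq_bigr => s _ /=.
have E (b : bool) (p : {poly K}) : ((-1) ^+ b * p)^`() = (-1) ^+ b * p^`().
  by case: b; rewrite ?expr1 ?expr0 ?mul1r // !mulN1r derivN.
rewrite -mulr_sumr E; congr (_ * _); rewrite deriv_prod_ord; apply: eq_bigr => k _.
rewrite [RHS](bigD1 k) //= /upd eqxx mxE; congr (_ * _).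
by apply: eq_bigr => l /negbTE ->.
Qed.

End WedgeMorphism.

(** * The complex structure and its top power *)

Section StandardForm.
Variables (K : comNzRingType) (n : nat).
Local Notation m := (n * 2)%N.

(** Multiplication by i and at the same time the matrix of the flat Kaehler form, the sum of dx_p /\
    dy_p. By [imul_Jm] it is [imul] over the reals; the complex version is needed as well. *)
Definition Jm : 'M[K]_m :=
  \matrix_(p, q) (((unindex p).1 == (unindex q).1)%:R *
    (if ((unindex p).2 == 0) && ((unindex q).2 == 1) then 1
     else if ((unindex p).2 == 1) && ((unindex q).2 == 0) then -1 else 0)).

Lemma yi_neq_xi (k l : 'I_n) : (yi k == xi l) = false.
Proof. by rewrite eq_sym xi_neq_yi. Qed.

Definition position_eqE := (inj_eq (@xi_inj n), inj_eq (@yi_inj n), @xi_neq_yi n, yi_neq_xi).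

Lemma mulmx_Jm p (v : 'M[K]_(p, m)) i k :
  ((v *m Jm) i (xi k) = - v i (yi k)) * ((v *m Jm) i (yi k) = v i (xi k)).
Proof.
rewrite !mxE !sum_positions; split.
  rewrite (bigD1 k) //= big1 => [|l lk]; rewrite !mxE !mxvec_indexK /=; last first.
    by rewrite (negbTE lk) !mul0r !mulr0 addr0.
  by rewrite eqxx !mul1r mulr0 add0r addr0 mulrN1.
rewrite (bigD1 k) //= big1 => [|l lk]; rewrite !mxE !mxvec_indexK /=; last first.
  by rewrite (negbTE lk) !mul0r !mulr0 addr0.
by rewrite eqxx !mul1r mulr0 !addr0 mulr1.
Qed.

Lemma position_ind (P : 'I_m -> Prop) : (forall k, P (xi k)) -> (forall k, P (yi k)) -> forall q, P q.
Proof.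
move=> Px Py q; rewrite -(unindexK q); case: (unindex q) => k [[|[|//]] h] /=.
  by have := Px k; rewrite /xi; congr (P (mxvec_index _ _)); exact/val_inj.
by have := Py k; rewrite /yi; congr (P (mxvec_index _ _)); exact/val_inj.
Qed.

Lemma Jm_sqr : Jm *m Jm = - 1%:M.
Proof.
apply/matrixP => p q; elim/position_ind: q => k; rewrite !mulmx_Jm !mxE mxvec_indexK;
  elim/position_ind: p => l; rewrite !mxvec_indexK /= !position_eqE ?mulr0 ?mulr1 ?mulrN1 ?oppr0 //.
Qed.

Lemma Jm_tr : Jm^T = - Jm.
Proof.
apply/matrixP => p q; rewrite !mxE [_.1 == _.1]eq_sym -mulrN; congr (_ * _).
by elim/position_ind: q => k; elim/position_ind: p => l; rewrite !mxvec_indexK /= ?oppr0 ?opprK.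
Qed.

Definition basic_form (p : 'I_n) : 'M[K]_m :=
  ('e_(xi p) : 'rV[K]_m)^T *m ('e_(yi p) : 'rV[K]_m).

Lemma Jm_sum : Jm = \sum_p (1 : K) *: (basic_form p - (basic_form p)^T).
Proof.
apply/matrixP => p q; rewrite summxE /basic_form.
under eq_bigr => k _ do rewrite scale1r trmx_delta mul_delta_mx trmx_delta !mxE.
rewrite mxE; elim/position_ind: p => l; elim/position_ind: q => k; rewrite !mxvec_indexK /=.
- by rewrite mulr0 big1 // => j _; rewrite !position_eqE andbF subrr.
- rewrite mulr1 (bigD1 l) //= big1 ?addr0 => [|j jl]; rewrite !position_eqE /= subr0.
    by rewrite eqxx [k == l]eq_sym.
  by rewrite [l == j]eq_sym (negbTE jl).
- rewrite mulrN1 (bigD1 l) //= big1 ?addr0 => [|j jl]; rewrite !position_eqE /= sub0r.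
    by rewrite eqxx /= [k == l]eq_sym.
  by rewrite [l == j]eq_sym (negbTE jl) oppr0.
- by rewrite mulr0 big1 // => j _; rewrite !position_eqE andbF subrr.
Qed.

Lemma wt_basic (g : 'I_n -> 'I_n) : injective g -> wt (fun k => basic_form (g k)) = 1.
Proof.
move=> gI; pose p := perm gI.
rewrite (@eq_wt _ _ _ (fun k => basic_form (p k))); last by move=> k; rewrite permE.
rewrite wt_perm (wt_rank1 (fun q => 'e_q)) -[RHS](det1 K m); congr (\det _).
by apply/matrixP => i j; rewrite !mxE eqxx eq_sym.
Qed.

Lemma wt_basic0 (g : 'I_n -> 'I_n) : ~ injective g -> wt (fun k => basic_form (g k)) = 0.
Proof.
move=> gI; have [k [l [kl gkl]]] : exists k l, k != l /\ g k = g l.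
  have /injectivePn[k [l kl gkl]] : ~~ injectiveb g by apply/negP => /injectiveP.
  by exists k, l.
pose w (q : 'I_m) : 'rV[K]_m := delta_mx 0 (mxvec_index (g (unindex q).1) (unindex q).2).
rewrite (@eq_wt _ _ _ (fun k => (w (xi k))^T *m w (yi k))); last first.
  by move=> j; rewrite /w !mxvec_indexK.
rewrite wt_rank1; apply: (@determinant_alternate _ _ _ (xi k) (xi l)) => [|j]; first by rewrite (inj_eq (@xi_inj n)).
by rewrite !mxE !mxvec_indexK /= gkl.
Qed.

End StandardForm.

Arguments Jm {K n}.

Lemma imul_Jm (R : realType) n : imul R n = Jm.
Proof.
apply/matrixP => p q; rewrite -(unindexK p) -(unindexK q) !mxE !mxvec_indexK.
case: (unindex p) (unindex q) => k a [l b] /=.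
rewrite mxvecE /= vec_mx_delta.
rewrite mxE (bigD1 a) //= big1 => [|c ca].
  by rewrite addr0 !mxE eqxx andbT [k == l]eq_sym.
by rewrite [delta_mx _ _ _ _]mxE (negbTE ca) andbF mul0r.
Qed.

(** Expand each factor into the forms dx_p /\ dy_p. A choice of one form for each slot contributes a
    positive number if it is injective and 0 otherwise. *)
Lemma wl_Jm_gt0 (K : numDomainType) n : 0 < wl (nseq n (Jm : 'M[K]_(n * 2))).
Proof.
rewrite /wl (@eq_wt _ _ _ (fun k => \sum_p (1 : K) *: (basic_form K p - (basic_form K p)^T))); last first.
  by move=> k; rewrite nth_nseq ltn_ord Jm_sum.
rewrite wt_expand (bigD1 [ffun k => k]) //= ltr_pwDl //.
  rewrite big1 // mul1r (wt_antisym (fun k => basic_form K ([ffun k => k] k))) wt_basic ?mulr1 ?exprn_gt0 //.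
  by move=> k l; rewrite !ffunE.
apply: sumr_ge0 => g _; rewrite big1 // mul1r (wt_antisym (fun k => basic_form K (g k))) mulr_ge0 ?exprn_ge0 //.
have [/injectiveP gI|/injectiveP gI] := boolP (injectiveb g); first by rewrite wt_basic.
by rewrite wt_basic0.
Qed.

(* If wt vanishes at Z, then so do all its polarizations: move N Z + Z N^T with
   N = C Z^-1 / 2 through the derivation identity, one slot at a time. *)
Lemma wl_polarize0 (K : numFieldType) n (Z : 'M[K]_(n * 2)) : Z^T = - Z -> Z \in unitmx ->
  wl (nseq n Z) = 0 -> forall bs : seq 'M[K]_(n * 2), all (fun b => b^T == - b) bs ->
  (size bs <= n)%N -> wl (bs ++ nseq (n - size bs) Z) = 0.
Proof.
move=> ZT uZ Z0 bs; move: {2}(size bs) (erefl (size bs)) => k; elim: k bs => [|k IH] bs.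
  by case: bs => // _ _ _; rewrite subn0.
case: bs => // C bs [bk] /= /andP[/eqP CT abs] kn.
pose N := 2^-1 *: (C *m invmx Z); set d := (n - size bs)%N.
have NZ : N *m Z = 2^-1 *: C by rewrite /N -scalemxAl -mulmxA mulVmx // mulmx1.
have ZN : Z *m N^T = 2^-1 *: C.
  by apply: trmx_inj; rewrite trmx_mul trmxK ZT mulmxN NZ [RHS]linearZ /= CT scalerN.
have two : GRing.lreg (2 : K) by apply/lregP; rewrite pnatr_eq0.
have bd : (size bs + d = n)%N by rewrite /d; lia.
have := wt_derivation (fun k => nth 0 (bs ++ nseq d Z) k) N two.
rewrite (sum_wl_set_nth (fun b => N *m b + b *m N^T) Z bd).
rewrite -/(wl (bs ++ nseq d Z)) IH ?mulr0 //; last by lia.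
rewrite big_nat big1 ?add0r; last first.
  move=> j /andP[_ jb]; have sz : size (set_nth 0 bs j (N *m nth 0 bs j + nth 0 bs j *m N^T)) = size bs.
    by rewrite size_set_nth; apply/maxn_idPr.
  rewrite {1}/d -sz IH ?sz ?bk //; last by lia.
  apply/(all_nthP 0) => i; rewrite sz => ib; rewrite nth_set_nth /=; case: (i =P j) => _.
    rewrite linearD /= !trmx_mul trmxK; have /eqP -> := (all_nthP 0 abs) _ jb.
    by rewrite mulNmx mulmxN addrC opprD.
  by have := (all_nthP 0 abs) _ ib.
rewrite NZ ZN -scalerDl -mulr2n -[_ *+ 2]mulr_natl mulfV ?pnatr_eq0 // scale1r.
move/eqP; rewrite mulf_eq0 pnatr_eq0 => /orP[|]; first by rewrite /d; lia.
by rewrite /d subnS => /eqP.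
Qed.

(** Up to a constant this is the Pfaffian of [Z]. If it vanished, then by polarization so would the
    top power of [Jm]. *)
Lemma wl_unit_neq0 (K : numFieldType) n (Z : 'M[K]_(n * 2)) : Z^T = - Z -> Z \in unitmx ->
  wl (nseq n Z) != 0.
Proof.
move=> ZT uZ; apply/eqP => Z0.
have := wl_polarize0 ZT uZ Z0 (bs := nseq n Jm); rewrite size_nseq subnn cats0 => H.
have := wl_Jm_gt0 K n; rewrite H ?ltxx //.
by rewrite all_nseq Jm_tr eqxx orbT.
Qed.

(** * Stability of mixed wedge products of (1,1)-forms *)

Section Stability.
Variables (R : rcfType) (n : nat).
Local Notation m := (n * 2)%N.
Local Notation C := (R[i]).
Implicit Types (a b g : 'M[R]_m).

Definition form11 a := (a^T == - a) && (Jm *m a *m Jm^T == a).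

Lemma form11T a : form11 a -> a^T = - a. Proof. by case/andP => /eqP. Qed.

Lemma form11J a : form11 a -> Jm *m a *m Jm^T = a. Proof. by case/andP => _ /eqP. Qed.

Lemma form11_lin (c : R) a b : form11 a -> form11 b -> form11 (c *: a + b).
Proof.
case/andP => /eqP aT /eqP aJ /andP[/eqP bT /eqP bJ]; apply/andP; split; apply/eqP.
  by rewrite linearP /= aT bT scalerN opprD.
by rewrite mulmxDr mulmxDl -scalemxAr -scalemxAl aJ bJ.
Qed.

Lemma form11_0 : form11 0.
Proof. by rewrite /form11 trmx0 oppr0 mulmx0 mul0mx !eqxx. Qed.

Definition herm a (u v : 'rV[R]_m) : R := (u *m a *m (v *m Jm)^T) 0 0.

Definition pos11 a := forall v : 'rV[R]_m, v != 0 -> 0 < herm a v v.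

Lemma herm_sym a u v : form11 a -> herm a u v = herm a v u.
Proof.
move=> a11; have aJ : a *m Jm^T = Jm^T *m a.
  rewrite -[in LHS](form11J a11) Jm_tr !mulmxN !mulNmx -!mulmxA Jm_sqr !mulmxN !mulmx1.
  by rewrite opprK.
rewrite /herm; have tr1 (B : 'M[R]_1) : B 0 0 = B^T 0 0 by rewrite mxE.
have -> : v *m a *m (u *m Jm)^T = - (v *m Jm *m a *m u^T).
  by rewrite trmx_mul -mulmxA (mulmxA a) aJ Jm_tr !mulNmx mulmxN !mulmxA.
by rewrite tr1 !trmx_mul !trmxK form11T // mulNmx mulmxN !mulmxA.
Qed.

Lemma herm_lin a u v (c : R) b : herm (c *: a + b) u v = c * herm a u v + herm b u v.
Proof. by rewrite /herm mulmxDr mulmxDl -scalemxAr -scalemxAl !mxE. Qed.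

Lemma pos11_lin (c : R) a b : 0 <= c -> pos11 a -> pos11 b -> pos11 (c *: a + b).
Proof.
move=> c0 pa pb v v0; rewrite herm_lin ltr_wpDl ?pb // mulr_ge0 // ltW //; exact: pa.
Qed.

Definition cmx a b : 'M[C]_m := \matrix_(i, j) Complex (a i j) (b i j).

Lemma Re_sum (I : finType) (F : I -> C) : complex.Re (\sum_i F i) = \sum_i complex.Re (F i).
Proof. by apply: (big_morph (@complex.Re R)) => // -[? ?] [? ?]. Qed.

Lemma Im_sum (I : finType) (F : I -> C) : complex.Im (\sum_i F i) = \sum_i complex.Im (F i).
Proof. by apply: (big_morph (@complex.Im R)) => // -[? ?] [? ?]. Qed.

(** If p + iq annihilates a + ib, then p a = q b and p b = - q a. By symmetry of [herm a] this gives
    herm b p p + herm b q q = 0, which positivity of [b] forbids. *)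
Lemma cmx_unit a b : form11 a -> form11 b -> pos11 b -> cmx a b \in unitmx.
Proof.
move=> a11 b11 pb; rewrite unitmxE unitfE; apply/negP => /det0P[v v0 vZ].
pose p : 'rV[R]_m := \row_j complex.Re (v 0 j); pose q : 'rV[R]_m := \row_j complex.Im (v 0 j).
have vE j : v 0 j = Complex (p 0 j) (q 0 j) by rewrite !mxE; case: (v 0 j).
have re : p *m a = q *m b.
  apply/rowP => j; have /matrixP/(_ 0 j)/(congr1 (@complex.Re R)) := vZ.
  rewrite [in X in X -> _]mxE Re_sum [in X in _ = X -> _]mxE /= => h; apply/eqP; rewrite -subr_eq0 -[X in _ == X]h !mxE -sumrB.
  by apply/eqP; apply: eq_bigr => k _; rewrite vE !mxE /=.
have im : p *m b = - (q *m a).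
  apply/rowP => j; have /matrixP/(_ 0 j)/(congr1 (@complex.Im R)) := vZ.
  rewrite [in X in X -> _]mxE Im_sum [in X in _ = X -> _]mxE /= => h; apply/eqP; rewrite -subr_eq0 -[X in _ == X]h !mxE opprK -big_split /=.
  by apply/eqP; apply: eq_bigr => k _; rewrite vE !mxE /=.
have e : herm b p p + herm b q q = 0.
  by rewrite /herm im -re mulNmx mxE -/(herm a q p) -/(herm a p q) herm_sym // addrC subrr.
have pb' w : 0 <= herm b w w.
  by have [->|/pb/ltW //] := eqVneq w 0; rewrite /herm mul0mx mul0mx mxE.
have p0 : p = 0.
  apply/eqP/negP => /negP /pb h; have := pb' q; move: e h; lra.
have q0 : q = 0.
  apply/eqP/negP => /negP /pb h; have := pb' p; move: e h; lra.
by case/eqP: v0; apply/rowP => j; rewrite vE p0 q0 !mxE.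
Qed.

Lemma cmxT a b : form11 a -> form11 b -> (cmx a b)^T = - cmx a b.
Proof.
move=> /form11T/matrixP aT /form11T/matrixP bT; apply/matrixP => i j; have := aT i j; have := bT i j.
by rewrite !mxE => -> ->.
Qed.

(* The Gauss-Lucas argument at the single point 0. *)
Lemma log_deriv_lower (rs : seq C) : rs != [::] -> all (fun z => complex.Im z < 0) rs ->
  complex.Im ((\prod_(z <- rs) ('X - z%:P))^`().[0] / (\prod_(z <- rs) ('X - z%:P)).[0]) < 0.
Proof.
set p : {poly C} := \prod_(z <- rs) _.
move=> rs0 rsl; have : complex.Im (p^`().[0] / p.[0]) <= 0 /\ (rs != [::] -> complex.Im (p^`().[0] / p.[0]) < 0) /\ p.[0] != 0.
  rewrite {}/p; elim: rs {rs0} rsl => [|z rs IH] /=.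
    by move=> _; rewrite big_nil derivC horner0 mul0r /= lexx hornerC oner_eq0.
  case/andP => z0 /IH[h1 [h2 h3]]; set q := \prod_(_ <- _) _ in h1 h2 h3.
  rewrite big_cons -/q derivM derivXsubC mul1r hornerD !hornerM hornerXsubC sub0r.
  have zn : - z != 0 by rewrite oppr_eq0; apply: contraTneq z0 => ->; rewrite ltxx.
  have -> : (q.[0] + - z * q^`().[0]) / (- z * q.[0]) = (- z)^-1 + q^`().[0] / q.[0].
    by field; rewrite h3 -oppr_eq0 zn.
  have zi : complex.Im (- z)^-1 < 0.
    move: z z0 zn {h1 h2 h3 q} => [x y] /= y0 zn.
    have d0 : 0 < x ^+ 2 + y ^+ 2 by rewrite ltr_wpDl ?sqr_ge0 // exprn_even_gt0 //= lt_eqF.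
    by rewrite /= !sqrrN mulNr opprK nmulr_rlt0 ?invr_gt0.
  have -> : complex.Im ((- z)^-1 + q^`().[0] / q.[0]) = complex.Im (- z)^-1 + complex.Im (q^`().[0] / q.[0]).
    by case: (_^-1) (_ / _) => ? ? [? ?].
  have lt0 : complex.Im (- z)^-1 + complex.Im (q^`().[0] / q.[0]) < 0 by move: zi h1; lra.
  by rewrite ltW // lt0 mulf_neq0.
by case=> _ [h _]; exact: h.
Qed.

(** All roots lie in the open lower half plane, so the logarithmic derivative at 0 has negative
    imaginary part. *)
Lemma deriv0_neq0 (p : {poly C}) : (forall z : C, 0 <= complex.Im z -> p.[z] != 0) ->
  (1 < size p)%N -> p^`().[0] != 0.
Proof.
move=> pz sp; have [rs pE] := closed_field_poly_normal p.
have lp : lead_coef p != 0 by rewrite lead_coef_eq0 -size_poly_gt0; exact: leq_trans sp.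
have rsl : all (fun z => complex.Im z < 0) rs.
  apply/allP => z zr; rewrite ltNge; apply/negP => /pz; rewrite pE hornerZ mulf_eq0 negb_or => /andP[_].
  by rewrite -/(root _ _) root_prod_XsubC zr.
have rs0 : rs != [::].
  by apply: contraTneq sp => r0; rewrite pE r0 big_nil alg_polyC size_polyC lp.
have := log_deriv_lower rs0 rsl; rewrite pE derivZ !hornerZ => h.
rewrite mulf_neq0 //; apply: contraTneq h => ->; by rewrite mul0r /= ltxx.
Qed.

Local Notation toC := (map_mx (real_complex R)).

Lemma poly_line_horner (Z g : 'M[C]_m) (z : C) :
  map_mx (horner_eval z) (map_mx polyC Z + 'X *: map_mx polyC g) = Z + z *: g.
Proof.
by apply/matrixP => i j; rewrite !mxE /horner_eval hornerD hornerM hornerX !hornerC.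
Qed.

Lemma poly_line_deriv (Z g : 'M[C]_m) :
  map_mx (@deriv C) (map_mx polyC Z + 'X *: map_mx polyC g) = map_mx polyC g.
Proof. by apply/matrixP => i j; rewrite !mxE derivD derivM derivX !derivC mulr0 mul1r add0r addr0. Qed.

(** The form Z + z g in [d] slots, as a polynomial in z. By [wlp_deriv], differentiation moves a
    factor [g] into the list. *)
Definition wlp (bs : seq 'M[C]_m) d (Z g : 'M[C]_m) : {poly C} :=
  wl (map (map_mx polyC) bs ++ nseq d (map_mx polyC Z + 'X *: map_mx polyC g)).

Lemma wlp_horner bs d Z (g : 'M[C]_m) z : (size bs + d = n)%N -> (wlp bs d Z g).[z] = wl (bs ++ nseq d (Z + z *: g)).
Proof.
move=> sn; rewrite -[LHS]/(horner_eval z _) -wl_map ?size_cat ?size_map ?size_nseq //.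
rewrite map_cat map_nseq poly_line_horner -map_comp (@eq_map _ _ _ id) ?map_id // => B.
by apply/matrixP => i j; rewrite !mxE /= /horner_eval hornerC.
Qed.

Lemma wlp_deriv bs d Z (g : 'M[C]_m) : (0 < n)%N -> (size bs + d = n)%N ->
  (wlp bs d Z g)^`() = d%:R * wlp (g :: bs) d.-1 Z g.
Proof.
move=> n0 sn; rewrite deriv_wt.
have sn' : (size (map (map_mx (@polyC C)) bs) + d = n)%N by rewrite size_map.
rewrite (sum_wl_set_nth (map_mx (@deriv C)) _ sn') poly_line_deriv.
rewrite big_nat big1 ?add0r // => k /andP[_ kb].
rewrite (nth_map 0); last by rewrite size_map in kb.
have -> : map_mx (@deriv C) (map_mx polyC (nth 0 bs k)) = 0.
  by apply/matrixP => i j; rewrite !mxE derivC.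
have kn : (k < n)%N.
  have := kb; rewrite size_map => kb'; apply: (leq_trans kb').
  exact: leq_trans (leq_addr d _) (eq_leq sn).
rewrite -[RHS](wt_upd0 (fun k => nth 0 (map (map_mx polyC) bs ++ nseq d (map_mx polyC Z + 'X *: map_mx polyC g)) k) (Ordinal kn)).
rewrite -wl_set_nth /=; congr wl.
elim: (map _ bs) k kb {kn} => [//|x s IH] [|k] //= kb; by rewrite IH.
Qed.

(** Let p(z) be the wedge product in which one slot of [g] is released and a + ib is replaced by a +
    ib + z g. For Im z >= 0 the imaginary part of this form is still positive, so p has no zero
    there by induction. Hence p'(0) is not 0, and p'(0) is a multiple of the value sought. *)
Theorem wl_stable (gs : seq 'M[R]_m) : (size gs <= n)%N -> all form11 gs ->
  {in gs, forall g, pos11 g} -> forall a b, form11 a -> form11 b -> pos11 b ->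
  wl (map toC gs ++ nseq (n - size gs) (cmx a b)) != 0.
Proof.
elim: gs => [|g gs IH] sn /= => [_ _ a b a11 b11 pb|/andP[g11 gs11] gp a b a11 b11 pb].
  by rewrite subn0; apply: wl_unit_neq0; [exact: cmxT | exact: cmx_unit].
have n0 : (0 < n)%N by move: sn => /=; lia.
have pg : pos11 g by apply: gp; rewrite inE eqxx.
have {}IH := IH (ltnW sn) gs11 (fun h hg => gp h (mem_behead (s := g :: gs) hg)).
set d := (n - size gs)%N in IH.
have sd : (size (map toC gs) + d = n)%N by rewrite size_map /d; move: sn => /=; lia.
have d0 : (0 < d)%N by rewrite /d; move: sn => /=; lia.
pose p := wlp (map toC gs) d (cmx a b) (toC g).
have pz z : 0 <= complex.Im z -> p.[z] != 0.
  case: z => x y /= y0; rewrite wlp_horner //.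
  have -> : cmx a b + Complex x y *: toC g = cmx (x *: g + a) (y *: g + b).
    by apply/matrixP => i j; rewrite !mxE; congr Complex; rewrite /= ?mulr0 ?subr0 ?add0r addrC.
  apply: IH; [exact: form11_lin | exact: form11_lin | exact: pos11_lin].
have pd : p^`() = d%:R * wlp (toC g :: map toC gs) d.-1 (cmx a b) (toC g) by exact: wlp_deriv.
(* If p were constant, then all its derivatives would vanish, in particular the product of the
   remaining factors with [d] copies of [g]. The induction hypothesis for the form i g excludes
   this. *)
have sp : (1 < size p)%N.
  rewrite ltnNge; apply/negP => sp1.
  have p'0 : p^`() = 0 by rewrite (size1_polyC sp1) derivC.
  have all0 j : (j < d)%N -> wlp (nseq j.+1 (toC g) ++ map toC gs) (d - j.+1) (cmx a b) (toC g) = 0.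
    elim: j => [|j IHj] jd.
      move/eqP: p'0; rewrite pd mulf_eq0 -polyC_natr polyC_eq0 pnatr_eq0 subn1 => /orP[|/eqP //]; lia.
    have := wlp_deriv (cmx a b) (toC g) n0 (bs := nseq j.+1 (toC g) ++ map toC gs) (d := (d - j.+1)%N).
    rewrite IHj; last by lia.
    rewrite size_cat size_nseq deriv0 => /(_ _)/esym/eqP; rewrite mulf_eq0 -polyC_natr polyC_eq0 pnatr_eq0.
    rewrite (_ : (d - j.+1).-1 = (d - j.+2)%N); last by lia.
    move=> h; have /orP[|/eqP //] := h (etrans (etrans (addnAC _ _ _) (etrans (congr1 (addn^~ _) (subnKC (ltnW jd))) (addnC _ _))) sd); lia.
  have := IH 0 g form11_0 g11 pg; apply/negP; rewrite negbK.
  have -> : cmx 0 g = Complex 0 1 *: toC g.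
    by apply/matrixP => i j; rewrite !mxE; congr Complex; rewrite /= ?mul0r ?mulr0 ?subr0 ?add0r ?mul1r.
  have wlZ (c : C) (B : 'M[C]_m) (bs : seq 'M[C]_m) e : (size bs + e = n)%N -> wl (bs ++ nseq e (c *: B)) = c ^+ e * wl (bs ++ nseq e B).
    elim: e bs => [|e IHe] bs se; first by rewrite mul1r.
    rewrite (@wl_perm _ _ _ (c *: B :: bs ++ nseq e (c *: B))); last 2 first.
    - by apply/seq.permP => q; rewrite /= !count_cat /=; lia.
    - by rewrite size_cat /= size_nseq.
    rewrite wl_consZ // -cat_cons IHe; last by rewrite /=; lia.
    rewrite exprS -mulrA; congr (_ * (_ * _)); apply: wl_perm; last by rewrite /= size_cat size_nseq; lia.
    by apply/seq.permP => q; rewrite /= !count_cat /=; lia.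
  rewrite wlZ // mulf_eq0; apply/orP; right.
  have := all0 d.-1; rewrite prednK // subnn => /(_ (leqnn d))/(congr1 (fun p : {poly C} => p.[0])).
  rewrite wlp_horner ?horner0; last by rewrite size_cat size_nseq addn0 addnC.
  rewrite cats0 => h; apply/eqP; rewrite -[RHS]h; apply: wl_perm.
    by rewrite perm_catC.
  by rewrite size_cat size_nseq.
have := deriv0_neq0 pz sp; rewrite pd hornerM mulf_eq0 negb_or => /andP[_].
rewrite wlp_horner; last by rewrite /= addSnnS prednK.
by rewrite scale0r addr0 /d /= subnS.
Qed.

End Stability.

(** * Positivity and the pointwise Hodge index inequality *)

Section Positivity.
Variables (R : realType) (n : nat).
Local Notation m := (n * 2)%N.
Hypothesis n0 : (0 < n)%N.
Implicit Types (a b g : 'M[R]_m) (gs : seq 'M[R]_m).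
Local Notation toC := (map_mx (real_complex R)).

Definition kah g := form11 g /\ pos11 g.

Lemma herm_Jm (v : 'rV[R]_m) : herm Jm v v = sqn v.
Proof.
rewrite /herm trmx_mul mulmxA -[_ *m Jm *m Jm^T]mulmxA Jm_tr mulmxN Jm_sqr opprK mulmx1 mxE.
by apply: eq_bigr => j _; rewrite mxE.
Qed.

Lemma sqn_gt0 p (v : 'rV[R]_p) : v != 0 -> 0 < sqn v.
Proof.
move=> v0; apply: lt_le_trans (sqn_ge v); rewrite mulr_gt0 // normr_gt0 //.
Qed.

Lemma kah_Jm : kah Jm.
Proof.
split; last by move=> v v0; rewrite herm_Jm sqn_gt0.
by rewrite /form11 Jm_tr eqxx mulmxN Jm_sqr mulNmx mul1mx opprK eqxx.
Qed.

Lemma wl_kah_neq0 gs : size gs = n -> {in gs, forall g, kah g} -> wl gs != 0.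
Proof.
move=> sn kg; have := @wl_stable R n gs _ _ _ Jm Jm kah_Jm.1 kah_Jm.1 kah_Jm.2.
rewrite sn leqnn subnn cats0 wl_map // fmorph_eq0; apply=> //.
  by apply/allP => g /kg[].
by move=> g /kg[].
Qed.

(** The product is linear in its first factor. If the signs at [g] and [h] differed, it would vanish
    at an explicit convex combination of the two, which is again Kaehler. *)
Lemma wl_kah_step g h gs : size gs = n.-1 -> {in gs, forall g, kah g} -> kah g -> kah h ->
  0 < wl (g :: gs) -> 0 < wl (h :: gs).
Proof.
move=> sn kgs kg kh pg; rewrite ltNge; apply/negP => ph.
set A := wl (g :: gs) in pg; set B := wl (h :: gs) in ph.
have AB : 0 < A - B by lra.
have : wl ((A / (A - B)) *: h + (- B / (A - B)) *: g :: gs) != 0.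
  apply: wl_kah_neq0; first by rewrite /= sn prednK.
  move=> k; rewrite inE => /orP[/eqP -> {k}|/kgs //].
  have c1 : 0 < A / (A - B) by rewrite divr_gt0.
  have c2 : 0 <= - B / (A - B) by rewrite divr_ge0 ?oppr_ge0 // ltW.
  have [h1 ph1] := kh; have [g1 pg1] := kg; split.
    by apply: form11_lin => //; rewrite -[_ *: g]addr0; apply: form11_lin => //; exact: form11_0.
  move=> v v0; rewrite herm_lin -[_ *: g]addr0 herm_lin.
  have -> : herm (0 : 'M[R]_m) v v = 0 by rewrite /herm mulmx0 mul0mx mxE.
  by rewrite addr0; apply: ltr_pwDl; [rewrite mulr_gt0 // ph1 | rewrite mulr_ge0 // ltW // pg1].
rewrite wl_cons_lin // wl_consZ // -/A -/B; apply/negP; rewrite negbK.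
by apply/eqP; field; rewrite gt_eqF.
Qed.

Lemma wl_kah_gt0 gs : size gs = n -> {in gs, forall g, kah g} -> 0 < wl gs.
Proof.
suff H k (hs : seq 'M[R]_m) : (k + size hs)%N = n -> {in hs, forall g, kah g} -> 0 < wl (hs ++ nseq k Jm).
  by move=> sn kg; rewrite -[gs]cats0; apply: (H 0%N).
elim: hs k => [|g hs IH] k /= kn kg; first by rewrite addn0 in kn; rewrite kn wl_Jm_gt0.
have kg' : {in hs ++ nseq k Jm, forall g, kah g}.
  move=> h; rewrite mem_cat mem_nseq => /orP[hh|/andP[_ /eqP ->]]; last exact: kah_Jm.
  by apply: kg; rewrite inE hh orbT.
apply: (@wl_kah_step Jm) => //.
- by rewrite size_cat size_nseq; lia.
- exact: kah_Jm.
- by apply: kg; rewrite inE eqxx.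
rewrite (@wl_perm _ _ _ (hs ++ nseq k.+1 Jm)); last by rewrite /= size_cat size_nseq; lia.
  by apply: IH; [lia | move=> h hh; apply: kg; rewrite inE hh orbT].
by apply/seq.permP => p; rewrite /= !count_cat /=; lia.
Qed.

Lemma wl_swap (x y : 'M[R]_m) gs : (size gs + 2 = n)%N -> wl (x :: y :: gs) = wl (y :: x :: gs).
Proof.
move=> sn; apply: wl_perm; last by rewrite /=; lia.
by apply/seq.permP => p /=; lia.
Qed.

Lemma wl_lin2 (c : R) (x y z : 'M[R]_m) gs : (size gs + 2 = n)%N ->
  wl (z :: c *: x + y :: gs) = c * wl (z :: x :: gs) + wl (z :: y :: gs).
Proof. by move=> sn; rewrite !(wl_swap z _ sn) wl_cons_lin. Qed.

(** Let A be the part of [a] orthogonal to [b]. If the inequality failed, A would have positive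
    square, and with y^2 = Q A A / Q b b the square of A + i y b would be 0. This contradicts
    [wl_stable]. *)
Lemma wl_hodge_index a b gs : (size gs + 2 = n)%N -> {in gs, forall g, kah g} -> form11 a -> kah b ->
  wl (a :: a :: gs) * wl (b :: b :: gs) <= wl (a :: b :: gs) ^+ 2.
Proof.
move=> sn kgs a1 [b1 pb]; have sn1 : (size gs <= n)%N by lia.
set Q := fun x y => wl (x :: y :: gs).
have Qs x y : Q x y = Q y x by exact: wl_swap.
have Ql c x y z : Q (c *: x + y) z = c * Q x z + Q y z by exact: wl_cons_lin.
have Qr c x y z : Q z (c *: x + y) = c * Q z x + Q z y by exact: wl_lin2.
have Qb : 0 < Q b b.
  apply: wl_kah_gt0; first by rewrite /=; lia.
  by move=> h; rewrite !inE => /or3P[/eqP -> //|/eqP -> //|/kgs].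
rewrite leNgt; apply/negP => D; rewrite -/(Q a a) -/(Q b b) -/(Q a b) in D.
pose A := - (Q a b / Q b b) *: b + a.
have A1 : form11 A by exact: form11_lin.
have QAb : Q A b = 0 by rewrite /A Ql; field; rewrite gt_eqF.
have QAA : Q A A = (Q a a * Q b b - Q a b ^+ 2) / Q b b.
  rewrite {2}/A Qr QAb mulr0 add0r /A Ql [Q b a]Qs.
  by field; rewrite gt_eqF.
have pA : 0 < Q A A by rewrite QAA divr_gt0 // subr_gt0.
pose y := Num.sqrt (Q A A / Q b b).
have y0 : 0 < y by rewrite sqrtr_gt0 divr_gt0.
have pB : pos11 (y *: b).
  by move=> v v0; rewrite -[_ *: b]addr0 herm_lin [herm 0 v v](_ : _ = 0) ?addr0 ?mulr_gt0 ?pb // /herm mulmx0 mul0mx mxE.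
have B1 : form11 (y *: b).
  by rewrite -[_ *: b]addr0; apply: form11_lin => //; exact: form11_0.
have : wl (map toC gs ++ nseq (n - size gs) (cmx A (y *: b))) != 0.
  by apply: wl_stable => //; [apply/allP => g /kgs[] | move=> g /kgs[]].
apply/negP; rewrite negbK (_ : (n - size gs)%N = 2); last by lia.
set Z := cmx _ _; have ZE : Z = Complex 0 y *: toC b + toC A.
  by apply/matrixP => i j; rewrite !mxE; congr Complex; rewrite /= ?mul0r ?mulr0 ?subr0 ?add0r ?addr0.
have toCl x z : wl (toC x :: toC z :: map toC gs) = (Q x z)%:C%C.
  by rewrite -(@wl_map _ _ _ _ (x :: z :: gs)) //=; lia.
rewrite (@wl_perm _ _ _ (Z :: Z :: map toC gs)); last by rewrite size_cat size_map /=; lia.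
  rewrite {1}ZE wl_cons_lin //.
  have sw x : wl (toC x :: Z :: map toC gs) = wl (Z :: toC x :: map toC gs).
    apply: wl_perm; last by rewrite /= size_map; lia.
    by apply/seq.permP => p /=; lia.
  rewrite !sw ZE !wl_cons_lin // !toCl [Q b A]Qs QAb.
  apply/eqP; congr Complex; rewrite /= ?(mul0r, mulr0, subr0, sub0r, add0r, addr0, oppr0) //.
  have -> : y * (y * Q b b) = Q A A; last by rewrite addNr.
  rewrite mulrA -expr2 sqr_sqrtr; first by rewrite mulfVK // gt_eqF.
  by rewrite divr_ge0 // ltW.
by apply/seq.permP => p; rewrite !count_cat /=; lia.
Qed.

End Positivity.

(** * Coercivity and ellipticity of the complex Hessian *)

Section Coercivity.
Context {R : realType}.

Lemma sphere_compact m : compact [set x : 'rV[R]_m | `|x| = 1].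
Proof.
apply: (@subclosed_compact _ _ [set x : 'rV[R]_m | `|x| <= 1]); last 2 first.
- exact: compact_norm_row.
- by move=> x /= ->.
rewrite (_ : [set x | _] = (fun x : 'rV[R]_m => `|x|) @^-1` [set 1]) //.
by apply: closed_comp => [x _|]; [exact: norm_continuous | exact: closed_eq].
Qed.

(** Homogeneity reduces the bound to the unit sphere, where a continuous positive function on a
    compact set has a positive minimum. *)
Lemma quad_coercive (T : topologicalType) m (K : set T) (F : T * 'rV[R]_m -> R) : compact K ->
  (forall x v, K x -> {for (x, v), continuous F}) ->
  (forall x s v, K x -> F (x, s *: v) = s ^+ 2 * F (x, v)) ->
  (forall x v, K x -> v != 0 -> 0 < F (x, v)) ->
  exists2 c : R, 0 < c & forall x v, K x -> c * `|v| ^+ 2 <= F (x, v).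
Proof.
move=> cK cF hF pF; pose A := K `*` [set v : 'rV[R]_m | `|v| = 1].
have hA x v : K x -> v != 0 -> A (x, `|v|^-1 *: v).
  by move=> Kx v0; split => //=; rewrite normrZ normfV normr_id mulVf // normr_eq0.
have F0 x : K x -> F (x, 0) = 0.
  by move=> Kx; rewrite -[0](scale0r (0 : 'rV[R]_m)) hF // expr0n mul0r.
have red c x v : 0 < c -> (forall p, A p -> c <= F p) -> K x -> c * `|v| ^+ 2 <= F (x, v).
  move=> c0 cA Kx; have [->|v0] := eqVneq v 0; first by rewrite normr0 expr0n mulr0 F0.
  have := cA _ (hA _ _ Kx v0); rewrite hF // exprVn mulrC ler_pdivlMr ?exprn_gt0 ?normr_gt0 //.
(* If [K] is empty or [m] is 0, there is no minimum to take, and any constant will do. *)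
have [[p Ap]|nA] := pselect (A !=set0); last first.
  exists 1 => // x v Kx; apply: red => // p Ap; case: nA; by exists p.
have [|c cA cmin] := compact_EVT_min (ex_intro _ p Ap) (compact_setX cK (@sphere_compact m)) (f := F).
  by apply: continuous_in_subspaceT => -[x v] /set_mem [Kx _]; exact: cF.
have {cA} [Kc /= c1] : A c by exact: set_mem.
have Fc : 0 < F c.
  by rewrite [c]surjective_pairing; apply: pF => //; rewrite -normr_gt0 c1.
exists (F c) => // x v Kx; apply: red => // q Aq; apply: cmin; exact: mem_set.
Qed.

End Coercivity.

Section Elliptic.
Variables (R : realType) (n : nat).
Local Notation m := (n * 2)%N.
Hypothesis n0 : (0 < n)%N.
Implicit Types (a b g : 'M[R]_m) (gs : seq 'M[R]_m).

Lemma kah_sub_Jm g : kah g -> exists2 c : R, 0 < c & kah (g - c *: Jm).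
Proof.
move=> [g1 pg].
have [||||c c0 cP] := @quad_coercive R 'rV[R]_m m [set 0] (fun p => herm g p.2 p.2).
- exact: compact_set1.
- move=> x v _; apply: (@continuous_comp _ _ _ snd (fun v => herm g v v)); first exact: cvg_snd.
  have -> : (fun v : 'rV[R]_m => herm g v v) = (fun v => \sum_j (v *m g) 0 j * (v *m Jm) 0 j).
    by apply/funext => w; rewrite /herm mxE; apply: eq_bigr => j _; rewrite [_^T _ _]mxE.
  apply: (@cvg_sumr _ _ _ (nbhs v) (nbhs_filter v)) => j _; apply: (@cvgM _ _ (nbhs v));
    apply: (@continuous_comp _ _ _ (fun v : 'rV[R]_m => v *m _) (fun w : 'rV[R]_m => w 0 j));
    solve [exact: mulmx_rV_continuous | exact: coord_continuous].
- by move=> _ s v _ /=; rewrite /herm -!scalemxAl linearZ /= -scalemxAr scalerA mxE expr2.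
- by move=> x v _ v0; exact: pg.
(* [sqn v] is at most [m] times the square of the norm; m + 1 makes the inequality strict. *)
exists (c / (m%:R + 1)); first by rewrite divr_gt0 // ltr_wpDl.
split.
  by rewrite -scaleNr addrC; apply: form11_lin => //; exact: (kah_Jm R n).1.
move=> v v0; rewrite -scaleNr addrC herm_lin herm_Jm mulNr addrC subr_gt0.
apply: lt_le_trans (cP 0 v erefl); rewrite -mulrA ltr_pM2l // mulrC ltr_pdivrMr ?ltr_wpDl //.
apply: (@le_lt_trans _ _ (\sum_(j < m) `|v| ^+ 2)).
  apply: ler_sum => j _; rewrite -expr2 -real_normK ?num_real // lerXn2r ?nnegrE //.
  exact: row_norm_ge.
by rewrite sumr_const card_ord mulrDr mulr1 mulr_natr ltrDl exprn_gt0 // normr_gt0.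
Qed.

(* The coefficients of dd^c u at a point where u has Hessian H. *)
Definition ddc (H : 'M[R]_m) : 'M[R]_m := Jm *m H + H *m Jm.

Lemma ddc_form11 H : H^T = H -> form11 (ddc H).
Proof.
move=> HT; apply/andP; split; apply/eqP; rewrite /ddc.
  by rewrite linearD /= !trmx_mul HT Jm_tr mulmxN mulNmx opprD addrC.
rewrite mulmxDr mulmxDl Jm_tr !mulmxN -!mulmxA Jm_sqr !mulmxN !mulmx1 opprK.
by rewrite !mulmxA Jm_sqr !mulNmx mul1mx opprK addrC.
Qed.

(** [x^T *m x] is the Hessian of half the square of a linear form; its dd^c is semipositive, being a
    sum of two squares. *)
Lemma herm_ddc1 (x v : 'rV[R]_m) :
  herm (ddc (x^T *m x)) v v = ((v *m x^T) 0 0) ^+ 2 + ((v *m Jm *m x^T) 0 0) ^+ 2.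
Proof.
have sq (A : 'M[R]_1) : (A *m A^T) 0 0 = A 0 0 ^+ 2 by rewrite mxE big_ord1 mxE expr2.
rewrite /herm /ddc mulmxDr mulmxDl mxE addrC -!sq !trmx_mul !trmxK; congr (_ + _).
  rewrite !mulmxA; congr ((_ *m _) 0 0); rewrite -!mulmxA; congr (_ *m (_ *m _)).
  rewrite [_ *m Jm^T](_ : _ = 1%:M) ?mulmx1 // Jm_tr mulmxN Jm_sqr opprK //.
by rewrite !mulmxA.
Qed.

Lemma wl_psd_ge0 a gs : size gs = n.-1 -> {in gs, forall g, kah g} -> form11 a ->
  (forall v, 0 <= herm a v v) -> 0 <= wl (a :: gs).
Proof.
move=> sn kgs a1 pa; rewrite leNgt; apply/negP => neg.
have pJ : 0 < wl (Jm :: gs).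
  apply: wl_kah_gt0 => //; [by rewrite /= sn prednK | move=> g; rewrite inE => /orP[/eqP ->|/kgs //]; exact: kah_Jm].
have [e e0 ee] : exists2 e : R, 0 < e & e * wl (Jm :: gs) + wl (a :: gs) < 0.
  exists (- wl (a :: gs) / (2 * wl (Jm :: gs))).
    by rewrite divr_gt0 ?mulr_gt0 ?oppr_gt0.
  move: neg pJ; move: (wl (a :: gs)) (wl (Jm :: gs)) => y w y0 w0.
  rewrite (_ : - y / (2 * w) * w = - y / 2); last by field; rewrite gt_eqF.
  lra.
move: ee; rewrite -wl_cons_lin // ltNge => /negP; apply; apply/ltW/wl_kah_gt0 => //; first by rewrite /= sn prednK.
move=> g; rewrite inE => /orP[/eqP -> {g}|/kgs //]; split; first by apply: form11_lin => //; exact: (kah_Jm R n).1.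
by move=> v v0; rewrite herm_lin ltr_pwDl // mulr_gt0 // (kah_Jm R n).2.
Qed.

(** [N] is chosen so that N Jm + Jm N^T is [ddc H] and its trace is that of [H]; the derivation
    identity does the rest. Against the flat form, dd^c is thus a multiple of the Laplacian. *)
Lemma wl_ddc_Jm H : H^T = H -> n%:R * wl (ddc H :: nseq n.-1 Jm) = \tr H * wl (nseq n (Jm : 'M[R]_m)).
Proof.
move=> HT; have two : GRing.lreg (2 : R) by apply/lregP; rewrite pnatr_eq0.
pose N : 'M[R]_m := - 2^-1 *: (ddc H *m Jm).
have dJ : ddc H *m Jm = Jm *m H *m Jm - H.
  by rewrite /ddc mulmxDl -[H *m Jm *m Jm]mulmxA Jm_sqr mulmxN mulmx1.
have trN : \tr N = \tr H.
  rewrite /N linearZ /= dJ linearB /= -mulmxA mxtrace_mulC -mulmxA Jm_sqr mulmxN mulmx1 linearN /=.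
  by field.
have := wt_derivation (fun k => nth 0 ([::] ++ nseq n (Jm : 'M[R]_m)) k) N two.
rewrite (sum_wl_set_nth (fun b => N *m b + b *m N^T) Jm (bs := [::]) (d := n)) //= big_nil add0r trN => <-.
congr (_ * wl (_ :: _)).
have NJ : N *m Jm = 2^-1 *: ddc H.
  by rewrite /N -scalemxAl -mulmxA Jm_sqr mulmxN mulmx1 scalerN scaleNr opprK.
have JN : Jm *m N^T = 2^-1 *: ddc H.
  apply: trmx_inj; rewrite trmx_mul trmxK Jm_tr mulmxN NJ [RHS]linearZ /= form11T ?scalerN //.
  exact: ddc_form11.
by rewrite NJ JN -scalerDl -[_ + _]mulr2n -[_ *+ 2]mulr_natl mulfV ?scale1r // pnatr_eq0.
Qed.

(** Ellipticity of u |-> dd^c u /\ G. Starting from flat factors, each [Jm] is replaced by a given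
    [g]: write g = c Jm + (g - c Jm) with g - c Jm still Kaehler. The first term gives a positive
    contribution by induction, the second a nonnegative one. *)
Lemma wl_ddc_gt0 (x : 'rV[R]_m) gs : size gs = n.-1 -> {in gs, forall g, kah g} -> x != 0 ->
  0 < wl (ddc (x^T *m x) :: gs).
Proof.
move=> sn kgs x0; set a := ddc _; have HT : (x^T *m x)^T = x^T *m x by rewrite trmx_mul trmxK.
have a1 : form11 a by exact: ddc_form11.
have pa v : 0 <= herm a v v by rewrite herm_ddc1 addr_ge0 // sqr_ge0.
suff H k (hs : seq 'M[R]_m) : (k + size hs)%N = n.-1 -> {in hs, forall g, kah g} -> 0 < wl (a :: hs ++ nseq k Jm).
  by rewrite -[gs]cats0; apply: (H 0%N).
elim: hs k => [|g hs IH] k /= kn kg.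
  rewrite addn0 in kn; rewrite kn; have : 0 < n%:R * wl (a :: nseq n.-1 Jm).
    rewrite wl_ddc_Jm // mulr_gt0 ?wl_Jm_gt0 // mxtrace_mulC trace_mx11 mxE.
    apply: lt_le_trans (sqn_gt0 x0) _; rewrite le_eqVlt; apply/orP; left; apply/eqP.
    by apply: eq_bigr => j _; rewrite mxE.
  by rewrite pmulr_rgt0 // ltr0n.
have kg' : {in hs ++ nseq k Jm, forall g, kah g}.
  move=> h; rewrite mem_cat mem_nseq => /orP[hh|/andP[_ /eqP ->]]; last exact: kah_Jm.
  by apply: kg; rewrite inE hh orbT.
have sp (b c : 'M[R]_m) : wl (b :: c :: hs ++ nseq k Jm) = wl (c :: b :: hs ++ nseq k Jm).
  apply: wl_perm; last by rewrite /= size_cat size_nseq; lia.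
  by apply/seq.permP => p /=; lia.
have [|c c0 kc] := @kah_sub_Jm g; first by apply: kg; rewrite inE eqxx.
rewrite -[g](subrK (c *: Jm)) addrC sp wl_cons_lin // -!(sp a) ltr_pwDl //.
  rewrite mulr_gt0 //; have := IH k.+1 ltac:(lia) (fun h hh => kg h (mem_behead (s := g :: hs) hh)).
  congr (0 < _); apply: wl_perm; last by rewrite /= size_cat /= size_nseq; lia.
  by apply/seq.permP => p; rewrite /= !count_cat /=; lia.
apply: wl_psd_ge0 => //; first by rewrite /= size_cat size_nseq; lia.
by move=> h; rewrite inE => /orP[/eqP -> //|/kg'].
Qed.

End Elliptic.

(** * Transition maps *)

Lemma nbhs_open (T : topologicalType) (A : set T) : (forall x, A x -> nbhs x A) -> open A.
Proof. by move=> h; rewrite openE. Qed.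

(** * The Cauchy-Riemann equations in the weak sense *)

Section WeakCauchyRiemann.
Context {R : realType}.
Local Notation I := (@integral_rV R _).
Variable m : nat.
Local Notation V := 'rV[R]_m.
Implicit Types (u v h : V -> R) (x z : V).

Lemma difference_quotient_le u (e : V) x (s L : R) : s != 0 ->
  (forall t : R, `|t| <= `|s| -> derivable u (x + t *: e) e /\ `|'D_e u (x + t *: e)| <= L) ->
  `|(u (x + s *: e) - u x) / s| <= L.
Proof.
move=> s0 du.
have [t ts _|t [ts _]] := @mvt_signed R (fun t => u (x + t *: e)) (fun t => 'D_e u (x + t *: e)) s.
  by apply: is_derive_line; apply: derivableP; have [] := du t ts.
rewrite scale0r addr0 => ->; rewrite mulfK //; have [] := du t ts; exact.
Qed.

Lemma difference_quotient_cvg u (e : V) x (s : nat -> R) : derivable u x e ->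
  (forall k, s k != 0) -> s k @[k --> \oo] --> (0 : R) ->
  (u (x + s k *: e) - u x) / s k @[k --> \oo] --> 'D_e u x.
Proof.
move=> du s0 sc; have sd : s k @[k --> \oo] --> (0 : R)^'.
  move=> A [d /= d0 dA]; have /cvgrPdist_lt/(_ _ d0) := sc; rewrite !near_simpl.
  by apply: filterS => k; rewrite /= => kd; apply: dA.
rewrite (_ : (fun k => _) = (fun t : R => t^-1 *: ((u \o shift x) (t *: e) - u x)) \o s); last first.
  by apply/funext => k /=; rewrite addrC [RHS]mulrC [x + _]addrC addrC.
by apply: cvg_comp; [exact: sd | exact: du].
Qed.

Lemma sc_pderiv_bound h p : sc h -> exists2 L : R, 0 <= L & forall x, `|'D_'e_p h x| <= L.
Proof. by move=> sh; apply: cc_bounded; [exact: compact_norm_row | exact: sc_cc (sc_pderiv p sh)]. Qed.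

(** The derivatives of [u] and [v] may be discontinuous and are never integrated. Only difference
    quotients are: translation moves them to [h], and the difference of the two quotients tends to 0
    pointwise and boundedly. *)
Lemma weak_CR u v h p q z0 (r L : R) : cc u -> cc v -> sc h -> 0 < r -> 0 <= L ->
  (forall x, r <= `|x - z0| -> h x = 0) ->
  (forall x, `|x - z0| < 2 * r -> [/\ derivable u x 'e_p, derivable v x 'e_q,
     `|'D_'e_p u x| <= L, `|'D_'e_q v x| <= L &
     'D_'e_p u x = 'D_'e_q v x]) ->
  I (fun x => u x * 'D_'e_p h x) = I (fun x => v x * 'D_'e_q h x).
Proof.
move=> ccu ccv sh r0 L0 hr H; have cch := sc_cc sh; have [ch [Bh hB]] := cch; have [[cu _] [cv _]] := (ccu, ccv).
pose s (k : nat) : R := r / (k.+1)%:R.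
have s0 k : 0 < s k by rewrite divr_gt0.
have sn k : s k != 0 by rewrite gt_eqF.
have sr k : s k <= r by rewrite ler_pdivrMr // ler_peMr ?ler1n // ltW.
have sc0 : s k @[k --> \oo] --> (0 : R).
  rewrite -(mulr0 r); apply: cvgM; first exact: cvg_cst.
  exact: (@cvg_harmonic R).
pose dq (f : V -> R) (j : 'I_m) k x := (f (x + s k *: 'e_j) - f x) / s k.
pose dm (j : 'I_m) k x := (h (x + - s k *: 'e_j) - h x) / - s k.
have cdq f j k : continuous f -> continuous (dq f j k) by move=> cf; rewrite /dq; cont.
have cdm j k : continuous (dm j k) by rewrite /dm; cont.
have parts f j k : cc f -> I (fun x => dq f j k x * h x) = - I (fun x => f x * dm j k x).
  move=> ccf; have [cf _] := ccf.
  pose F1 x := f x * h (x + - s k *: 'e_j).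
  have -> : (fun x => dq f j k x * h x) = (fun x => (s k)^-1 * (F1 (x + s k *: 'e_j) - f x * h x)).
    by apply/funext => x /=; rewrite /dq /F1 -addrA -scalerDl subrr scale0r addr0; ring.
  have c1 : cc F1 by apply: ccMr => //; exact: (proj1 (cc_shift _ cch)).
  have c1s := cc_shift (s k *: 'e_j) c1.
  have c2 : cc (fun x => f x * h x) by apply: ccMr.
  rewrite intZ; last exact: ccB.
  rewrite intB // (int_shift _ c1) -intB // -intZ; last exact: ccB.
  rewrite -intN; last by apply: ccMr => //; exact: cdm.
  by congr (I _); apply/funext => x; rewrite /F1 /dm invrN; ring.
have lim f j : cc f -> I (fun x => dq f j k x * h x) @[k --> \oo] --> - I (fun x => f x * 'D_'e_j h x).
  move=> ccf; under eq_fun do rewrite parts //; apply: cvgN.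
  have [Lj _ bD] := sc_pderiv_bound j sh; have [Mf _ bf] := cc_bounded (@compact_norm_row R m) ccf.
  have [_ [B fB]] := ccf; have dh x : derivable h x 'e_j by exact: smooth_derivable (proj1 sh) Logic.I.
  apply: (int_cvg (B := B) (M := Mf * Lj)) => [k||k x xB|k x|x].
  - exact: ccMr ccf (cdm j k).
  - exact: ccMr ccf (sc_cont (sc_pderiv j sh)).
  - by rewrite fB // mul0r.
  - rewrite normrM; apply: ler_pM; [exact: normr_ge0 | exact: normr_ge0 | exact: bf |].
    by apply: difference_quotient_le => [|t _]; [rewrite oppr_eq0 | split; [exact: dh | exact: bD]].
  - apply: cvgM; first exact: cvg_cst.
    by apply: difference_quotient_cvg; [exact: dh | move=> k; rewrite oppr_eq0 | rewrite -oppr0; apply: cvgN].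
have dqb f j k x : (forall x, `|x - z0| < 2 * r -> derivable f x 'e_j /\ `|'D_'e_j f x| <= L) ->
    `|x - z0| < r -> `|dq f j k x| <= L.
  move=> Hf xr; apply: difference_quotient_le => [|t ts]; first exact: sn.
  apply: Hf; rewrite addrAC (le_lt_trans (ler_normD _ _)) // normrZ mulr_natl mulr2n ltr_leD //.
  by rewrite (le_trans (_ : _ <= `|t|)) ?ler_piMr ?delta_norm // (le_trans ts) // gtr0_norm.
have Hu x : `|x - z0| < 2 * r -> derivable u x 'e_p /\ `|'D_'e_p u x| <= L by case/H.
have Hv x : `|x - z0| < 2 * r -> derivable v x 'e_q /\ `|'D_'e_q v x| <= L by case/H.
have [Mh Mh0 bh] := cc_bounded (@compact_norm_row R m) cch.
have : I (fun x => (dq u p k x - dq v q k x) * h x) @[k --> \oo] --> I (fun _ : V => 0 : R).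
  apply: (int_cvg (B := Bh) (M := (L + L) * Mh)) => [k||k x xB|k x|x].
  - have [cu' cv'] := (cdq u p k cu, cdq v q k cv); apply: ccMl cch; exact: (fun x => cont_sub (cu' x) (cv' x)).
  - exact: cc0.
  - by rewrite hB // mulr0.
  - have [yr|yr] := lerP r `|x - z0|; first by rewrite hr // mulr0 normr0 mulr_ge0 // addr_ge0.
    rewrite normrM; apply: ler_pM; [exact: normr_ge0 | exact: normr_ge0 | | exact: bh].
    by apply: (le_trans (ler_normB _ _)); apply: lerD; [exact: dqb Hu yr | exact: dqb Hv yr].
  - have [yr|yr] := lerP r `|x - z0|; first by under eq_fun do rewrite (hr _ yr) mulr0; exact: cvg_cst.
    rewrite -(mul0r (h x)); apply: cvgM; last exact: cvg_cst.
    have [|du dv _ _ E] := H x; first by apply: lt_le_trans yr _; rewrite mulr_natl mulr2n lerDl ltW.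
    by rewrite -(subrr ('D_'e_p u x)) {2}E; apply: cvgB; apply: difference_quotient_cvg.
have E k : I (fun x => (dq u p k x - dq v q k x) * h x) = I (fun x => dq u p k x * h x) - I (fun x => dq v q k x * h x).
  rewrite -intB; [|exact: ccMl (cdq u p k cu) cch|exact: ccMl (cdq v q k cv) cch].
  by congr (I _); apply/funext => x; rewrite mulrBl.
under eq_fun do rewrite E; rewrite int0 => l0.
move: l0 => /(cvg_unique (@norm_hausdorff _ _) (cvgB (lim u p ccu) (lim v q ccv)))/eqP.
by rewrite opprK addrC subr_eq0 => /eqP ->.
Qed.

End WeakCauchyRiemann.

Lemma pderiv_out_ball {R : realType} m (g : 'rV[R]_m -> R) z0 (r : R) : sc g -> 0 < r ->
  (forall x, r <= `|x - z0| -> g x = 0) ->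
  forall q x, r <= `|x - z0| -> 'D_'e_q g x = 0.
Proof.
move=> sg r0 gr q; have far x : r < `|x - z0| -> 'D_'e_q g x = 0.
  move=> xr; rewrite -[RHS](@derive_cst R _ _ (0 : R) x 'e_q).
  apply: near_eq_derive; near=> y; apply: gr; rewrite ltW //; near: y.
  have c : continuous (fun y : 'rV[R]_m => `|y - z0|).
    by cont.
  exact: (c x _ (open_nbhs_nbhs (conj (@open_gt _ r) xr))).
(* On the sphere itself the derivative vanishes by continuity: [x] is approached along its ray from
   outside. *)
move=> x xr; apply/eqP; rewrite -normr_le0; apply/ler_addgt0Pl => e e0; rewrite addr0.
have /cvgrPdist_le/(_ e e0)/nbhs_ballP[d /= d0 dP] := sc_cont (sc_pderiv q sg) (x := x).
have N0 : 0 < `|x - z0| by apply: lt_le_trans xr.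
pose t := d / (2 * `|x - z0|); have t0 : 0 < t by rewrite divr_gt0 // mulr_gt0.
have := dP (x + t *: (x - z0)); rewrite -ball_normE /= opprD addNKr normrN normrZ gtr0_norm //.
have -> : 'D_'e_q g (x + t *: (x - z0)) = 0.
  apply: far; rewrite addrAC -[X in X + _]scale1r -scalerDl normrZ ger0_norm ?addr_ge0 ?ltW //.
  by apply: le_lt_trans xr _; rewrite mulrDl mul1r ltrDl mulr_gt0.
have tN (N : R) : 0 < N -> d / (2 * N) * N = d / 2 by move=> h; field; rewrite gt_eqF.
rewrite subr0; apply; rewrite /t tN //.
by rewrite ltr_pdivrMr // ltr_pMr // ltr1n.
Unshelve. all: by end_near. Qed.

Section Charts.
Context {R : realType} {n : nat} {M : topologicalType} (X : complex_manifold R n M).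
Local Notation m := (n * 2)%N.
Local Notation V := 'rV[R]_m.
Implicit Types (i j : chart_index X) (z : V) (p : M).

Lemma image_open i : open (U i). Proof. exact: chart_open. Qed.

Lemma chart_sgen i (h : V -> R) : sgen (U i) h -> smooth_on (U i) h.
Proof. by move=> sh; apply: sgen_smooth sh; exact: image_open. Qed.

Lemma chart_inv_dom i z : U i z -> dom i (inv i z).
Proof. by case=> p dp <-; rewrite chartK. Qed.

Lemma chart_invK i z : U i z -> chart i (inv i z) = z.
Proof. by case=> p dp <-; rewrite chartK. Qed.

Lemma chart_imageP i p : dom i p -> U i (chart i p).
Proof. by move=> dp; exists p. Qed.

Lemma dom_chart p : exists2 i : chart_index X, dom i p & U i (chart i p).
Proof. by have [i di] := dom_cover X p; exists i => //; exact: chart_imageP. Qed.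

Definition overlap i j : set V := [set z | U i z /\ dom j (inv i z)].

Lemma overlap_open i j : open (overlap i j).
Proof.
apply: nbhs_open => z [Uz dz]; apply: filterI; first by apply: open_nbhs_nbhs; split => //; exact: image_open.
apply: (chart_inv_continuous (c := X) Uz); by apply: open_nbhs_nbhs; split => //; exact: dom_open.
Qed.

Lemma transition_inv i j z : overlap i j z -> inv j (T i j z) = inv i z.
Proof. by case=> Uz dz; rewrite /transition /= chartK. Qed.

Lemma transition_overlap i j z : overlap i j z -> overlap j i (T i j z).
Proof.
move=> o; have [Uz dz] := o; split; first exact: chart_imageP.
by rewrite transition_inv //; exact: chart_inv_dom.
Qed.

Lemma transitionK i j z : overlap i j z -> T j i (T i j z) = z.
Proof. by move=> o; rewrite {1}/transition /= transition_inv // chart_invK //; case: o. Qed.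

Lemma chart_overlap i j p : dom i p -> dom j p -> overlap i j (chart i p).
Proof. by move=> di dj; split; [exact: chart_imageP | rewrite chartK]. Qed.

Lemma transition_differentiable i j z : overlap i j z -> differentiable (T i j) z.
Proof. by case=> Uz dz; have [] := transition_holomorphic Uz dz. Qed.

Lemma transition_Jm i j z : overlap i j z -> Jm *m 'J (T i j) z = 'J (T i j) z *m Jm.
Proof. by case=> Uz dz; have [_] := transition_holomorphic Uz dz; rewrite imul_Jm. Qed.

Lemma transition_continuous i j z : overlap i j z -> {for z, continuous (T i j)}.
Proof. by move=> o; apply: differentiable_continuous; exact: transition_differentiable. Qed.

Lemma derivable_row (f : V -> V) z v l : differentiable f z -> derivable (fun x => f x 0 l) z v.
Proof. by move=> df; have /derivable_mxP : derivable f z v by [exact: diff_derivable]; apply. Qed.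

Lemma jacobianE (f : V -> V) z k l : differentiable f z ->
  'J f z k l = 'D_'e_k (fun x => f x 0 l) z.
Proof.
move=> df; have d : derivable f z 'e_k by exact: diff_derivable.
have := deriveEjacobian 'e_k df; rewrite derive_mx // -rowE => /rowP/(_ l).
by rewrite !mxE => ->.
Qed.

Lemma transition_CR i j z k l : overlap i j z ->
  ('D_'e_(xi k) (fun x => T i j x 0 (xi l)) z = 'D_'e_(yi k) (fun x => T i j x 0 (yi l)) z) *
  ('D_'e_(xi k) (fun x => T i j x 0 (yi l)) z = - 'D_'e_(yi k) (fun x => T i j x 0 (xi l)) z).
Proof.
move=> o; have df := transition_differentiable o; rewrite -!jacobianE //.
move: ('J (T i j) z) (transition_Jm o) => J E.
have JmE (A : 'M[R]_m) a b : (Jm *m A) a b = - (A^T *m Jm) b a.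
  by rewrite -[in LHS](trmxK (Jm *m A)) [LHS]mxE trmx_mul Jm_tr mulmxN mxE.
have r a b : - (J^T *m Jm) b a = (J *m Jm) a b by rewrite -JmE E.
have := r (yi k) (yi l); rewrite !mulmx_Jm !mxE => h1.
have := r (xi k) (yi l); rewrite !mulmx_Jm !mxE opprK => h2.
have := r (yi k) (xi l); rewrite !mulmx_Jm !mxE => /oppr_inj h3.
by rewrite h2 -h1 opprK.
Qed.

Section Smoothness.
Variable w : coef2 X.
Hypothesis kw : kahler_form w.

Lemma kahler_kah i z : U i z -> kah (w i z).
Proof.
case: kw => -[[_ wT wJ] w11 _] pw Uz; split.
  by apply/andP; split; apply/eqP; [exact: wT | rewrite -imul_Jm; exact: w11].
by move=> v v0; rewrite /herm -imul_Jm; exact: pw.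
Qed.

Lemma herm_continuous (Y : topologicalType) (f : Y -> V) i y (v : Y -> V) : {for y, continuous f} -> U i (f y) ->
  {for y, continuous v} -> {for y, continuous (fun x => herm (w i (f x)) (v x) (v x))}.
Proof.
move=> cf Ufy cv.
have -> : (fun x => herm (w i (f x)) (v x) (v x)) =
    (fun x => \sum_l (\sum_k v x 0 k * w i (f x) k l) * (\sum_k v x 0 k * Jm k l)).
  by apply/funext => x; rewrite /herm mxE; apply: eq_bigr => l _; rewrite [_^T _ _]mxE !mxE.
have ww k l : {for y, continuous (fun x => w i (f x) k l)}.
  apply: (cont_comp (g := fun z => w i z k l)) => //.
  by case: kw => -[[sw _ _] _ _] _; exact: smooth_cont (sw i k l) Ufy.
apply: cont_sum => l _; apply: cont_mul; apply: cont_sum => k _; apply: cont_mul; try exact: cont_coord.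
  exact: ww.
by cont.
Qed.

Lemma closed_ball_in (W : set V) z : open W -> W z -> exists2 r : R, 0 < r & forall x, `|x - z| <= r -> W x.
Proof.
move=> oW Wz; have /nbhs_ballP[r /= r0 rW] := open_nbhs_nbhs (conj oW Wz).
exists (r / 2); first by rewrite divr_gt0.
move=> x xz; apply: rW; rewrite -ball_normE /= distrC; apply: le_lt_trans xz _.
by rewrite ltr_pdivrMr // ltr_pMr // ltr1n.
Qed.

(* The Kahler forms in the two charts are related by the differential of the
   transition map, which is thus bounded by their ellipticity constants. *)
Lemma transition_bounded i j z0 : overlap i j z0 -> exists2 r : R, 0 < r & exists L : R,
  forall z, `|z - z0| <= r -> overlap i j z /\
    forall k l, `|'D_'e_k (fun x => T i j x 0 l) z| <= L.
Proof.
move=> o; have [r r0 rO] := closed_ball_in (@overlap_open i j) o.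
pose K := [set z : V | `|z - z0| <= r].
have cK : compact K.
  have -> : K = (fun z => z + z0) @` [set z : V | `|z| <= r].
    apply/seteqP; split => [z /= zr|_ [z /= zr] <-]; last by rewrite /K /= addrK.
    by exists (z - z0); rewrite ?subrK.
  apply: continuous_compact; last exact: compact_norm_row.
  apply: continuous_subspaceT => z; cont.
have KO z : K z -> overlap i j z by exact: rO.
have [|||c c0 cP] := @quad_coercive R V m K (fun p : V * V => herm (w j (T i j p.1)) p.2 p.2) cK.
- move=> z v /KO oz; apply: herm_continuous; last exact: cvg_snd.
    by apply: (cont_comp (g := T i j)); [exact: cvg_fst | exact: transition_continuous].
  by have [] := transition_overlap oz.
- by move=> z s v _ /=; rewrite /herm -!scalemxAl linearZ /= -scalemxAr scalerA mxE expr2.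
- move=> z v /KO oz v0 /=; apply: (kahler_kah _).2 => //; by have [] := transition_overlap oz.
have [L LP] : exists L : R, forall z k, K z -> herm (w i z) 'e_k 'e_k <= L.
  have H k : exists L : R, forall z, K z -> herm (w i z) 'e_k 'e_k <= L.
    have [||] := @compact_EVT_max V R (fun z => herm (w i z) 'e_k 'e_k) K _ cK.
    - by exists z0; rewrite /K /= subrr normr0 ltW.
    - apply: continuous_in_subspaceT => z /set_mem /KO [Uz _].
      by apply: herm_continuous; [exact: cvg_id | exact: Uz | exact: cont_cst].
    by move=> a _ aP; exists (herm (w i a) 'e_k 'e_k) => z Kz; apply: aP; exact: mem_set.
  have [L LP] := choice H; exists (\big[Order.max/0]_k L k) => z k Kz.
  by apply: le_trans (LP k z Kz) _; exact: (le_bigmax _ L k).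
exists r => //; exists (Num.sqrt (L / c)) => z Kz; have oz := KO z Kz; split => // k l.
have df := transition_differentiable oz; rewrite -jacobianE //; set J := 'J _ _.
have E : herm (w j (T i j z)) (row k J) (row k J) = herm (w i z) 'e_k 'e_k.
  case: kw => -[[_ _ wJ] _ _] _; rewrite {2}/herm (wJ i j z oz.1 oz.2) -/J rowE /herm.
  by rewrite !trmx_mul !mulmxA; congr ((_ *m _) 0 0); rewrite -!mulmxA -!trmx_mul transition_Jm.
have h : c * `|row k J| ^+ 2 <= L by apply: le_trans (cP _ _ Kz) _; rewrite /= E LP.
have h2 : `|J k l| <= `|row k J| by have := row_norm_ge (row k J) l; rewrite mxE.
rewrite -(ger0_norm (normr_ge0 (J k l))) -sqrtr_sqr ler_wsqrtr // ler_pdivlMr // mulrC.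
by apply: le_trans h; rewrite ler_wpM2l ?(ltW c0) // lerXn2r ?nnegrE.
Qed.

(** In each complex coordinate the two equations turn u (g_xx + g_yy) into v (g_xy - g_yx) under the
    integral, and this is 0 by Schwarz's theorem. *)
Lemma weak_harmonic (u v : V -> R) (z0 : V) (r L : R) (g : V -> R) : cc u -> cc v -> sc g -> 0 < r -> 0 <= L ->
  (forall x, r <= `|x - z0| -> g x = 0) ->
  (forall x k, `|x - z0| < 2 * r -> [/\ forall q, derivable u x 'e_q, forall q, derivable v x 'e_q,
     forall q, `|'D_'e_q u x| <= L, forall q, `|'D_'e_q v x| <= L &
     'D_'e_(xi k) u x = 'D_'e_(yi k) v x /\
     'D_'e_(xi k) v x = - 'D_'e_(yi k) u x]) ->
  integral_rV (fun x => u x * laplace g x) = 0.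
Proof.
move=> ccu ccv sg r0 L0 gr H.
have out q x : r <= `|x - z0| -> 'D_'e_q g x = 0.
  exact: pderiv_out_ball.
have D2 q k : sc ('D_'e_k ('D_'e_q g)) by apply: sc_pderiv; exact: sc_pderiv.
have cD2 q k : continuous ('D_'e_k ('D_'e_q g)) by exact: sc_cont.
have cu2 f q k : cc f -> cc (fun x => f x * 'D_'e_k ('D_'e_q g) x) by move=> cf; exact: ccMr.
rewrite /laplace; under eq_fun do rewrite sum_positions mulr_sumr.
rewrite int_sum; last by move=> k _; under eq_fun do rewrite mulrDr; apply: ccD; exact: cu2.
rewrite big1 // => k _; under eq_fun do rewrite mulrDr.
rewrite intD; [|exact: cu2 | exact: cu2].
have E1 : integral_rV (fun x => u x * 'D_'e_(xi k) ('D_'e_(xi k) g) x) =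
    integral_rV (fun x => v x * 'D_'e_(yi k) ('D_'e_(xi k) g) x).
  apply: (@weak_CR R m u v _ (xi k) (yi k) z0 r L ccu ccv _ r0 L0); [exact: sc_pderiv | exact: out |].
  by move=> x xr; have [a1 a2 a3 a4 [a5 a6]] := H x k xr; split.
have E2 : integral_rV (fun x => u x * 'D_'e_(yi k) ('D_'e_(yi k) g) x) =
    integral_rV (fun x => (- 1 * v x) * 'D_'e_(xi k) ('D_'e_(yi k) g) x).
  apply: (@weak_CR R m u (fun x => - 1 * v x) _ (yi k) (xi k) z0 r L ccu _ _ r0 L0); [exact: ccZ | exact: sc_pderiv | exact: out |].
  move=> x xr; have [a1 a2 a3 a4 [a5 a6]] := H x k xr.
  have dN : 'D_'e_(xi k) (fun x => - 1 * v x) x = - 'D_'e_(xi k) v x.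
    by have := deriveZ (-1) (a2 (xi k)); rewrite scaleN1r.
  split; [exact: a1 | by apply: (@derivableZ _ _ _ v (-1)); exact: a2 | exact: a3 | by rewrite dN normrN | by rewrite dN a6 opprK].
apply: (etrans (congr2 +%R E1 E2)).
have E3 : integral_rV (fun x => (- 1 * v x) * 'D_'e_(xi k) ('D_'e_(yi k) g) x) =
    - 1 * integral_rV (fun x => v x * 'D_'e_(yi k) ('D_'e_(xi k) g) x).
  rewrite -intZ; last exact: cu2.
  have S x : 'D_'e_(xi k) ('D_'e_(yi k) g) x = 'D_'e_(yi k) ('D_'e_(xi k) g) x.
    exact: (@schwarz R m setT g x _ _ openT (proj1 sg) Logic.I).
  apply: (congr1 (@integral_rV R m)); apply/funext => x.
  exact: (etrans (esym (mulrA _ _ _)) (congr1 (fun t => - 1 * (v x * t)) (S x))).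
by apply: (etrans (congr2 +%R erefl E3)); rewrite mulN1r subrr.
Qed.

(** Real and imaginary part of a component satisfy the Cauchy-Riemann equations and have locally
    bounded derivatives. They are therefore weakly harmonic, and Weyl's lemma applies. *)
Lemma transition_smooth i j l : smooth_on (overlap i j) (fun x => T i j x 0 l).
Proof.
have cT k x : overlap i j x -> {for x, continuous (fun x => T i j x 0 k)}.
  by move=> ox; apply: cont_coord; exact: transition_continuous.
apply: weyl => [|x ox|z0 o]; [exact: overlap_open | exact: cT |].
have [r0 r00 [L H]] := transition_bounded o.
(* [weyl] asks for the ball of radius [3 * r] inside the domain. *)
pose r := r0 / 3; have r_gt0 : 0 < r by rewrite divr_gt0.
have r3 : 3 * r = r0 by rewrite /r; field.
have Hr x : `|x - z0| <= 3 * r -> overlap i j x by rewrite r3 => /H[].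
exists r => //; split => // g sg gr.
pose f k := (fun x => T i j x 0 k * cutoff z0 r x) \_ (overlap i j).
have ccf k : cc (f k) by apply: cutoff_cc => //; [exact: overlap_open | exact: cT].
have fE k x : `|x - z0| < 2 * r -> {near x, f k =1 (fun x => T i j x 0 k)}.
  move=> xr; near=> y.
  have yr : `|y - z0| < 2 * r.
    near: y; have c : continuous (fun y : V => `|y - z0|).
      by cont.
    exact: (c x _ (open_nbhs_nbhs (conj (@open_lt _ (2 * r)) xr))).
  rewrite /f patchE mem_set ?cutoff1 ?mulr1 // ?ltW //; apply: Hr; lra.
have L0 : 0 <= L.
  have h : `|z0 - z0| <= r0 by rewrite subrr normr0 ltW.
  by have [_ /(_ l l) h2] := H z0 h; exact: le_trans h2.
have fd k q x : `|x - z0| < 2 * r -> derivable (f k) x 'e_q /\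
    'D_'e_q (f k) x = 'D_'e_q (fun x => T i j x 0 k) x.
  move=> xr; have ox : overlap i j x by apply: Hr; lra.
  split; last by apply: near_eq_derive; exact: fE.
  apply: (@near_eq_derivable _ _ _ (fun x => T i j x 0 k)).
    by have := fE k x xr; apply: filterS => y ->.
  by apply: derivable_row; exact: transition_differentiable.
have bd k q x : `|x - z0| < 2 * r -> `|'D_'e_q (f k) x| <= L.
  by move=> xr; rewrite (fd k q x xr).2; have [|_] := H x; [rewrite -r3; lra | apply].
have CR k a x : `|x - z0| < 2 * r ->
  ('D_'e_(xi a) (f (xi k)) x = 'D_'e_(yi a) (f (yi k)) x) *
  ('D_'e_(xi a) (f (yi k)) x = - 'D_'e_(yi a) (f (xi k)) x).
  move=> xr; have ox : overlap i j x by apply: Hr; lra.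
  by rewrite !(fd _ _ x xr).2; split; have [h1 h2] := transition_CR a k ox.
rewrite -/(f l); elim/position_ind: l => k.
  apply: (@weak_harmonic (f (xi k)) (f (yi k)) z0 r L) => // x a xr; split.
  - by move=> q; have [] := fd (xi k) q x xr.
  - by move=> q; have [] := fd (yi k) q x xr.
  - by move=> q; exact: bd.
  - by move=> q; exact: bd.
  - by have [h1 h2] := CR k a x xr.
(* The harmonic conjugate of an imaginary part is minus the real part. *)
apply: (@weak_harmonic (f (yi k)) (fun x => - 1 * f (xi k) x) z0 r L) => //; first exact: ccZ.
move=> x a xr; have dx q := (fd (xi k) q x xr).1.
have dN q : 'D_'e_q (fun x => - 1 * f (xi k) x) x = - 'D_'e_q (f (xi k)) x.
  by have := deriveZ (-1) (dx q); rewrite scaleN1r.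
split.
- by move=> q; have [] := fd (yi k) q x xr.
- by move=> q; apply: (@derivableZ _ _ _ (f (xi k)) (-1)).
- by move=> q; exact: bd.
- by move=> q; rewrite dN normrN; exact: bd.
- by have [h1 h2] := CR k a x xr; rewrite !dN h1 h2.
Unshelve. all: by end_near. Qed.

Hypothesis n0 : (0 < n)%N.

Lemma kahler_top_gt0 i z : U i z -> 0 < wl (nseq n (w i z)).
Proof.
move=> Uz; apply: wl_kah_gt0 => //; first by rewrite size_nseq.
by move=> g; rewrite mem_nseq => /andP[_ /eqP ->]; exact: kahler_kah.
Qed.

(** The top power of the Kaehler form is positive in both charts, and the determinant is their
    ratio. *)
Lemma transition_det_gt0 i j z : overlap i j z -> 0 < \det ('J (T i j) z).
Proof.
move=> o; have h1 : 0 < wl (nseq n (w i z)) by apply: kahler_top_gt0; case: o.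
have h2 : 0 < wl (nseq n (w j (T i j z))) by apply: kahler_top_gt0; have [] := transition_overlap o.
move: h1; case: kw => -[[_ _ wJ] _ _] _; rewrite (wJ i j z o.1 o.2).
rewrite /wl (@eq_wt _ _ _ (fun k => 'J (T i j) z *m nth 0 (nseq n (w j (T i j z))) k *m ('J (T i j) z)^T)).
  by rewrite wt_congr pmulr_lgt0.
by move=> k; rewrite !nth_nseq ltn_ord.
Qed.

End Smoothness.

End Charts.

Arguments image_open {R n M X} i.

From mathcomp Require Import finmap.

(** * Integration on the manifold *)

Section Push.
Context {R : realType} {n : nat} {M : topologicalType} (X : complex_manifold R n M).
Local Notation m := (n * 2)%N.
Local Notation V := 'rV[R]_m.
Local Notation smooth := (smooth_function X).
Implicit Types (i j : chart_index X) (z : V) (p : M) (f g : M -> R) (h : V -> R).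
Variable w : coef2 X.
Hypothesis kw : kahler_form w.

Definition push i h : M -> R := (h \o chart i) \_ (dom i).

Lemma push_in i h p : dom i p -> push i h p = h (chart i p).
Proof. by move=> dp; rewrite /push patchE mem_set. Qed.

Lemma push_out i h p : ~ dom i p -> push i h p = 0.
Proof. by move=> dp; rewrite /push patchE memNset. Qed.

Lemma push_inv i h z : U i z -> push i h (inv i z) = h z.
Proof. by move=> Uz; rewrite push_in ?chart_invK //; exact: chart_inv_dom. Qed.

Lemma inv_compact i (K : set V) : compact K -> K `<=` U i -> compact (inv i @` K).
Proof.
move=> cK KU; apply: continuous_compact => //; apply: continuous_in_subspaceT => z /set_mem /KU Uz.
exact: chart_inv_continuous.
Qed.

Lemma chart_compact i (A : set M) : compact A -> A `<=` dom i -> compact (chart i @` A).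
Proof.
move=> cA Ad; apply: continuous_compact => //; apply: continuous_in_subspaceT => p /set_mem /Ad dp.
exact: chart_continuous.
Qed.

Lemma compact_closedM (A : set M) : compact A -> closed A.
Proof. exact: compact_closed (manifold_hausdorff X). Qed.

Lemma compact_closedV (K : set V) : compact K -> closed K.
Proof. exact: compact_closed (@norm_hausdorff _ _). Qed.

Lemma inv_image_dom i (K : set V) : K `<=` U i -> inv i @` K `<=` dom i.
Proof. by move=> KU _ [z /KU Uz <-]; exact: chart_inv_dom. Qed.

Lemma notin_inv_image i (K : set V) p : dom i p -> ~ (inv i @` K) p -> ~ K (chart i p).
Proof. by move=> dp nK Kz; apply: nK; exists (chart i p) => //; rewrite chartK. Qed.

Lemma push_continuous i h (K : set V) : compact K -> K `<=` U i ->
  (forall z, U i z -> {for z, continuous h}) -> (forall z, U i z -> ~ K z -> h z = 0) ->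
  continuous (push i h).
Proof.
move=> cK KU ch hK; apply: (@ext_continuous R M (dom i) (inv i @` K)).
- exact: dom_open.
- by apply: compact_closedM; exact: inv_compact.
- exact: inv_image_dom.
- move=> p dp; apply: cont_comp; first exact: chart_continuous.
  by apply: ch; exact: chart_imageP.
- by move=> p dp nK; apply: hK; [exact: chart_imageP | exact: notin_inv_image].
Qed.

(** In another chart the function is a composition with a transition map on the overlap. Near a
    point outside [dom i] it vanishes, because the image of [K] in [M] is compact and so closed. *)
Lemma push_smooth i h (K : set V) : compact K -> K `<=` U i -> smooth_on (U i) h ->
  (forall z, U i z -> ~ K z -> h z = 0) -> smooth (push i h).
Proof.
move=> cK KU sh hK j; apply: smooth_local => z Uz.
have [dz|ndz] := pselect (dom i (inv j z)).
  exists (overlap j i) => //; apply: (@smooth_eq R m _ (fun x => h (T j i x))).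
  - exact: overlap_open.
  - by move=> x [Ux dx]; rewrite /= push_in.
  - apply: sgen_smooth; first exact: overlap_open.
    apply: (@sg_compn R m _ m (U i) h (T j i)) => //; first exact: image_open.
      by move=> x /transition_overlap[].
    by move=> l; apply: sg_base; exact: transition_smooth kw j i l.
pose W := [set x | U j x /\ (~` (inv i @` K)) (inv j x)].
exists W; first by split => // -[x Kx E]; apply: ndz; rewrite -E; apply: chart_inv_dom; exact: KU.
have oW : open W.
  apply: nbhs_open => x [Ux nx]; apply: filterI.
    by apply: open_nbhs_nbhs; split => //; exact: image_open.
  apply: (chart_inv_continuous (c := X) Ux); apply: open_nbhs_nbhs; split => //.
  by rewrite openC; apply: compact_closedM; exact: inv_compact.
apply: (@smooth_eq R m _ (fun=> 0)) => //; last by apply: sgen_smooth => //; exact: sg_cst.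
move=> x [Ux nx] /=; have [dx|ndx] := pselect (dom i (inv j x)); last by rewrite push_out.
by rewrite push_in // hK //; [exact: chart_imageP | exact: notin_inv_image].
Qed.

Lemma smooth_fun_sgen i f : smooth f -> sgen (U i) (f \o inv i).
Proof. by move=> sf; apply: sg_base; exact: sf. Qed.

Lemma smooth_fun_cst (c : R) : smooth (fun=> c).
Proof. by move=> i; apply: sgen_smooth; [exact: image_open | exact: sg_cst]. Qed.

Lemma smooth_funD f g : smooth f -> smooth g -> smooth (fun p => f p + g p).
Proof.
move=> sf sg i; apply: chart_sgen; apply: sg_add; exact: smooth_fun_sgen.
Qed.

Lemma smooth_funM f g : smooth f -> smooth g -> smooth (fun p => f p * g p).
Proof.
move=> sf sg i; apply: chart_sgen; apply: sg_mul; exact: smooth_fun_sgen.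
Qed.

Lemma smooth_fun_lin (a : R) f g : smooth f -> smooth g -> smooth (fun p => a * f p + g p).
Proof. by move=> sf sg; apply: smooth_funD => //; apply: smooth_funM => //; exact: smooth_fun_cst. Qed.

Lemma smooth_funV f : smooth f -> (forall p, f p != 0) -> smooth (fun p => (f p)^-1).
Proof.
move=> sf f0 i; apply: chart_sgen; apply: sg_inv => [|z _]; [exact: smooth_fun_sgen | exact: f0].
Qed.

Lemma smooth_fun_sum (I : Type) (s : seq I) (F : I -> M -> R) : (forall k, smooth (F k)) ->
  smooth (fun p => \sum_(k <- s) F k p).
Proof.
move=> sF i; apply: chart_sgen; apply: sgen_sum => k _; exact: smooth_fun_sgen.
Qed.

Lemma inv_continuous_fun f : (forall i z, U i z -> {for z, continuous (f \o inv i)}) -> continuous f.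
Proof.
move=> cf; apply: cont_at => p; have [i dp] := dom_cover X p.
apply: (@near_continuous _ _ ((f \o inv i) \o chart i)).
  near=> q; rewrite /= chartK //; near: q; apply: open_nbhs_nbhs; split => //; exact: dom_open.
apply: cont_comp; first exact: chart_continuous.
by apply: cf; exact: chart_imageP.
Unshelve. all: by end_near. Qed.

Lemma smooth_fun_continuous f : smooth f -> continuous f.
Proof. by move=> sf; apply: inv_continuous_fun => i z Uz; exact: smooth_cont (sf i) Uz. Qed.

Lemma pull_continuous f i z : continuous f -> U i z -> {for z, continuous (f \o inv i)}.
Proof. by move=> cf Uz; apply: continuous_comp; [exact: chart_inv_continuous | exact: cf]. Qed.

Definition dens i z : R := wedge_top (fun _ : 'I_n => w i z).

Lemma wedge_topE (a : 'I_n -> 'M[R]_m) : wedge_top a = 2 ^- n * wt a. Proof. by []. Qed.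

Lemma wedge_smooth (a : 'I_n -> coef2 X) i : (forall k, two_form (a k)) ->
  smooth_on (U i) (fun z => wedge_top (fun k => a k i z)).
Proof.
move=> ta; apply: chart_sgen; apply: sg_mul; first exact: sg_cst.
apply: sgen_sum => s _; apply: sg_mul; first exact: sg_cst.
by apply: sgen_prod => k _; apply: sg_base; have [sa _ _] := ta k; exact: sa.
Qed.

Lemma wedge_law (a : 'I_n -> coef2 X) i j z : (forall k, two_form (a k)) -> overlap i j z ->
  wedge_top (fun k => a k i z) = \det ('J (T i j) z) * wedge_top (fun k => a k j (T i j z)).
Proof.
move=> ta o; rewrite !wedge_topE mulrCA -wt_congr; congr (_ * _); apply: eq_wt => k.
by have [_ _ aJ] := ta k; exact: aJ o.1 o.2.
Qed.

Lemma kahler_two_form : two_form w. Proof. by case: kw => -[]. Qed.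

Lemma dens_smooth i : smooth_on (U i) (dens i).
Proof. exact: (@wedge_smooth (fun _ => w) i (fun _ => kahler_two_form)). Qed.

Lemma dens_law i j z : overlap i j z -> dens i z = \det ('J (T i j) z) * dens j (T i j z).
Proof. exact: (@wedge_law (fun _ => w) i j z (fun _ => kahler_two_form)). Qed.

Hypothesis n0 : (0 < n)%N.

Lemma dens_gt0 i z : U i z -> 0 < dens i z.
Proof.
move=> Uz; rewrite /dens wedge_topE mulr_gt0 ?invr_gt0 ?exprn_gt0 //.
rewrite (@eq_wt _ _ _ (fun k => nth 0 (nseq n (w i z)) k)); first exact: kahler_top_gt0 kw n0 _ _ Uz.
by move=> k; rewrite nth_nseq ltn_ord.
Qed.

Lemma dens_cont i z : U i z -> {for z, continuous (dens i)}.
Proof. by move=> Uz; exact: smooth_cont (dens_smooth i) Uz. Qed.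

Definition local_int i f : R := integral_rV ((fun z => f (inv i z) * dens i z) \_ (U i)).

Lemma local_cc i f (A : set M) : continuous f -> compact A -> A `<=` dom i -> (forall p, ~ A p -> f p = 0) ->
  cc ((fun z => f (inv i z) * dens i z) \_ (U i)).
Proof.
move=> cf cA Ad fA; have cK := chart_compact cA Ad; set K := chart i @` A in cK.
have KU : K `<=` U i by move=> _ [p /Ad dp <-]; exact: chart_imageP.
have fK z : U i z -> ~ K z -> f (inv i z) * dens i z = 0.
  move=> Uz nK; rewrite fA ?mul0r // => Ap; apply: nK; exists (inv i z) => //; exact: chart_invK.
split.
  apply: (@ext_continuous R V (U i) K) => //; [exact: image_open | exact: compact_closedV |].
  by move=> z Uz; apply: cont_mul; [exact: pull_continuous | exact: dens_cont].
have /compact_bounded [B [_ BP]] := cK; exists (B + 1) => z zB; rewrite patchE; case: ifP => // /set_mem Uz.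
apply: fK => // Kz; have := BP (B + 1) _ z Kz; rewrite ltrDl ltr01 => /(_ isT) /=; by rewrite leNgt zB.
Qed.

(** The absolute value in the change of variables disappears by [transition_det_gt0], and the
    determinant combines with the density [dens]. *)
Lemma local_int_change i j f (A : set M) : continuous f -> compact A -> A `<=` dom i -> A `<=` dom j ->
  (forall p, ~ A p -> f p = 0) -> local_int i f = local_int j f.
Proof.
move=> cf cA Ai Aj fA; have cK := chart_compact cA Aj.
pose g := (fun z => f (inv j z) * dens j z) \_ (U j).
have [cg _] := local_cc cf cA Aj fA.
have gK z : ~ (chart j @` A) z -> g z = 0.
  rewrite /g patchE => nK; case: ifP => // /set_mem Uz; rewrite fA ?mul0r // => Ap.
  by apply: nK; exists (inv j z) => //; exact: chart_invK.
have KW : chart j @` A `<=` overlap j i.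
  by move=> _ [p Ap <-]; apply: chart_overlap; [exact: Aj | exact: Ai].
have := @change_of_variables R m (overlap i j) (overlap j i) (T i j) (T j i) (chart j @` A) g
  (@overlap_open _ _ _ _ _ _) (@overlap_open _ _ _ _ _ _).
rewrite -/(local_int j f) => H.
rewrite -[RHS]H //.
- congr (integral_rV _); apply/funext => z; rewrite !patchE.
  case: ifPn => [/set_mem Uz|/negP nU]; last first.
    by rewrite memNset // => -[Uz _]; apply: nU; exact: mem_set.
  have [dz|ndz] := pselect (dom j (inv i z)); last first.
    rewrite memNset => [|[_ //]]; rewrite fA ?mul0r // => Ap; apply: ndz; exact: Aj.
  have o : overlap i j z by [].
  rewrite mem_set // /g patchE mem_set; last by have [] := transition_overlap o.
  rewrite (transition_inv o) -mulrA; congr (_ * _); rewrite (dens_law o) mulrC; congr (_ * _).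
  rewrite (_ : (\matrix_(_, _) _) = 'J (T i j) z); first by rewrite gtr0_norm // (transition_det_gt0 kw n0 o).
  by apply/matrixP => k l; rewrite mxE jacobianE //; exact: transition_differentiable.
- by move=> x o; split; [exact: transition_overlap | exact: transitionK].
- by move=> x o; split; [exact: transition_overlap | exact: transitionK].
- by move=> l; exact: transition_smooth kw i j l.
- by move=> l; exact: transition_smooth kw j i l.
Qed.

End Push.

Lemma ball_compact {R : realType} m (x : 'rV[R]_m) (r : R) : compact [set z | `|z - x| <= r].
Proof.
have -> : [set z | `|z - x| <= r] = (fun z => z + x) @` [set z | `|z| <= r].
  apply/seteqP; split => [z /= zr|_ [z /= zr] <-]; last by rewrite /= addrK.
  by exists (z - x); rewrite ?subrK.
apply: continuous_compact; last exact: compact_norm_row.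
apply: continuous_subspaceT => z; cont.
Qed.

(* Finitely many coordinate balls, each small compared with its chart, whose
   bump functions have no common zero. *)
Record bump_atlas {R : realType} {n : nat} {M : topologicalType} (X : complex_manifold R n M) := BumpAtlas {
  ball_index : finType;
  bchart : ball_index -> chart_index X;
  bcenter : ball_index -> 'rV[R]_(n * 2);
  bradius : ball_index -> R;
  bradius_gt0 : forall k, 0 < bradius k;
  bball_in : forall k z, `|z - bcenter k| <= 10 * bradius k -> chart_image (bchart k) z;
  bball_cover : forall p, exists2 k, Defs.dom (bchart k) p &
    sqn ((bradius k)^-1 *: (chart (bchart k) p - bcenter k)) < 1 }.

(** The factor 10 leaves room around each unit ball for the nested cutoffs used later; the widest
    one, [ccut k 7], vanishes outside 10 radii. *)
Lemma bump_atlas_exists {R : realType} {n : nat} {M : topologicalType} (X : complex_manifold R n M) :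
  compact [set: M] -> inhabited (bump_atlas X).
Proof.
move=> cM; pose P (p : M) (t : chart_index X * R) := [/\ Defs.dom t.1 p, 0 < t.2 &
  forall z, `|z - chart t.1 p| <= 10 * t.2 -> chart_image t.1 z].
have HP p : exists t, P p t.
  have [i di] := dom_cover X p.
  have [r r0 rU] := closed_ball_in (image_open i) (chart_imageP di).
  exists (i, r / 10); split => //=; first by rewrite divr_gt0.
  by move=> z; rewrite mulrC divfK //; exact: rU.
have [t tP] := choice HP.
pose O p : set M := [set q | Defs.dom (t p).1 q /\ sqn ((t p).2^-1 *: (chart (t p).1 q - chart (t p).1 p)) < 1].
have Oo p : open (O p).
  apply: nbhs_open => q [dq sq]; apply: filterI.
    by apply: open_nbhs_nbhs; split => //; exact: dom_open.
  have c : {for q, continuous (fun q => sqn ((t p).2^-1 *: (chart (t p).1 q - chart (t p).1 p)))}.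
    apply: (cont_comp (f := chart (t p).1) (g := fun x => sqn ((t p).2^-1 *: (x - chart (t p).1 p)))); first exact: chart_continuous.
    apply: cont_sum => j _; cont.
  exact: (c _ (open_nbhs_nbhs (conj (@open_lt _ 1) sq))).
(* The filter of finite sets of points, directed by inclusion: near-covering compactness with
   respect to it yields a finite subcover. *)
pose F : set_system {fset M} := [set S | exists D0 : {fset M}, forall D : {fset M}, {subset D0 <= D} -> S D].
have FF : Filter F.
  apply: Build_Filter.
  - by exists fset0.
  - move=> S1 S2 [D1 h1] [D2 h2]; exists (D1 `|` D2)%fset => D DD; split.
      by apply: h1 => q qD; apply: DD; rewrite inE qD.
    by apply: h2 => q qD; apply: DD; rewrite inE qD orbT.
  - by move=> S1 S2 S12 [D1 h1]; exists D1 => D /h1; exact: S12.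
have /compact_near_coveringP/(_ _ F (fun (D : {fset M}) q => exists2 p, p \in D & O p q) FF) [|D' D'c] := cM.
  move=> p _; exists (O p, [set D : {fset M} | p \in D]) => /=.
    split; last by exists [fset p]%fset => D; apply; rewrite inE.
    apply: open_nbhs_nbhs; split => //; have [dp t0 _] := tP p; split => //.
    by rewrite subrr scaler0 sqn0 ltr01.
  by move=> [q D] /= [Oq pD]; exists p.
have {}D'c q : exists2 p, p \in D' & O p q by apply: (D'c D').
constructor; apply: (@BumpAtlas _ _ _ X D' (fun k => (t (val k)).1) (fun k => chart (t (val k)).1 (val k)) (fun k => (t (val k)).2)).
- by move=> k; have [] := tP (val k).
- by move=> k z; have [_ _] := tP (val k); apply.
- move=> p; have [q qD [dq sq]] := D'c p.
  by exists [` qD]%fset.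
Qed.

(** * Integration against the volume form of a Kaehler form *)

Section Measure.
Context {R : realType} {n : nat} {M : topologicalType} (X : complex_manifold R n M).
Local Notation m := (n * 2)%N.
Local Notation V := 'rV[R]_m.
Local Notation smooth := (smooth_function X).
Implicit Types (i j : chart_index X) (z : V) (p : M) (f g : M -> R) (h : V -> R).
Variable w : coef2 X.
Hypothesis kw : kahler_form w.
Hypothesis n0 : (0 < n)%N.
Variable A : bump_atlas X.
Local Notation c := (@bchart _ _ _ _ A).
Local Notation x0 := (@bcenter _ _ _ _ A).
Local Notation r := (@bradius _ _ _ _ A).
Local Notation N := (ball_index A).
Implicit Types k : N.

Definition cball k (s : R) : set V := [set z | `|z - x0 k| <= s * r k].

Lemma cball_sub k s : s <= 10 -> cball k s `<=` U (c k).
Proof.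
move=> s1 z zr; apply: bball_in; apply: le_trans zr _; rewrite ler_wpM2r //.
exact/ltW/bradius_gt0.
Qed.

Lemma cball_compact k s : compact (cball k s).
Proof. exact: ball_compact. Qed.

Lemma cball_mono k s t : s <= t -> cball k s `<=` cball k t.
Proof. by move=> st z zs; apply: le_trans zs _; rewrite ler_wpM2r // ltW // bradius_gt0. Qed.

Definition bump k z : R := moll ((r k)^-1 *: (z - x0 k)).

Lemma bump_smooth k : smooth_on setT (bump k).
Proof.
apply: sgen_smooth openT _.
apply: (@sg_compn R m setT m setT (@moll R m) (fun z => (r k)^-1 *: (z - x0 k))) => //.
- exact: openT.
- exact: smooth_bmp.
- by move=> j; under eq_fun do rewrite !mxE; apply: sg_mul; [exact: sg_cst | apply: sg_add; [exact: sg_coord | exact: sg_cst]].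
Qed.

Lemma bump_ge0 k z : 0 <= bump k z. Proof. exact: moll_ge0. Qed.

Lemma bump_out k z : ~ cball k 1 z -> bump k z = 0.
Proof.
have r0 := bradius_gt0 k; rewrite /cball /= mul1r => /negP; rewrite -ltNge => zr; apply: moll_far.
by rewrite normrZ normfV gtr0_norm // ltr_pdivlMl // mulr1.
Qed.

Definition bfun k : M -> R := push (c k) (bump k).

Lemma le1_10 : (1 : R) <= 10. Proof. by rewrite ler1n. Qed.

Lemma bfun_smooth k : smooth (bfun k).
Proof.
apply: (push_smooth kw (K := cball k 1)).
- exact: cball_compact.
- exact: cball_sub le1_10.
- by apply: smooth_sub (@bump_smooth k).
- by move=> z _; exact: bump_out.
Qed.

Lemma bfun_ge0 k p : 0 <= bfun k p.
Proof. by rewrite /bfun /push patchE; case: ifP => // _; exact: bump_ge0. Qed.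

Definition bsum p := \sum_k bfun k p.

Lemma bfun_cover p : exists k, 0 < bfun k p.
Proof. by have [k dk sk] := bball_cover A p; exists k; rewrite /bfun push_in //; exact: moll_gt0. Qed.

Lemma bsum_gt0 p : 0 < bsum p.
Proof.
have [k pk] := bfun_cover p; rewrite /bsum (bigD1 k) //=.
by apply: ltr_pwDl => //; apply: sumr_ge0 => l _; exact: bfun_ge0.
Qed.

Lemma bsum_smooth : smooth bsum.
Proof. by apply: smooth_fun_sum => k; exact: bfun_smooth. Qed.

Definition rho k p := bfun k p / bsum p.

Lemma rho_smooth k : smooth (rho k).
Proof.
apply: smooth_funM; first exact: bfun_smooth.
by apply: smooth_funV; [exact: bsum_smooth | move=> p; rewrite gt_eqF // bsum_gt0].
Qed.

Lemma rho_cont k : continuous (rho k).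
Proof. by apply: smooth_fun_continuous; exact: rho_smooth. Qed.

Lemma rho_ge0 k p : 0 <= rho k p.
Proof. by rewrite divr_ge0 ?bfun_ge0 // ltW // bsum_gt0. Qed.

Lemma sum_rho p : \sum_k rho k p = 1.
Proof. by rewrite -mulr_suml mulfV // gt_eqF // bsum_gt0. Qed.

Definition bset k : set M := inv (c k) @` cball k 1.

Lemma bset_compact k : compact (bset k).
Proof. by apply: inv_compact; [exact: cball_compact | exact: cball_sub le1_10]. Qed.

Lemma bset_dom k : bset k `<=` dom (c k).
Proof. by apply: inv_image_dom; exact: cball_sub le1_10. Qed.

Lemma bfun_out k p : ~ bset k p -> bfun k p = 0.
Proof.
move=> np; have [dp|ndp] := pselect (dom (c k) p); last exact: push_out.
by rewrite /bfun push_in // bump_out //; exact: notin_inv_image.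
Qed.

Lemma rho_out k p : ~ bset k p -> rho k p = 0.
Proof. by move=> np; rewrite /rho bfun_out // mul0r. Qed.

Local Notation local_int := (local_int w).

(** The integral of [f] against the volume form w^n. Every integral of a top form is reduced to one
    of a function by dividing the form by w^n, see [quot]. *)
Definition mu f : R := \sum_k local_int (c k) (fun p => rho k p * f p).

Lemma rho_f_cont k f : continuous f -> continuous (fun p => rho k p * f p).
Proof. by move=> cf; apply: cont_at => p; apply: cont_mul; [exact: rho_cont | exact: cf]. Qed.

Lemma rho_f_cc k f : continuous f -> cc ((fun z => rho k (inv (c k) z) * f (inv (c k) z) * dens w (c k) z) \_ (U (c k))).
Proof.
move=> cf; apply: (local_cc kw (f := fun p => rho k p * f p) (A := bset k)).
- exact: rho_f_cont.
- exact: bset_compact.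
- exact: bset_dom.
- by move=> p /rho_out ->; rewrite mul0r.
Qed.

Lemma muL (a : R) f g : continuous f -> continuous g -> mu (fun p => a * f p + g p) = a * mu f + mu g.
Proof.
move=> cf cg; rewrite /mu mulr_sumr -big_split; apply: eq_bigr => k _ /=.
rewrite /local_int -((posfun_int m).1 a _ _ (rho_f_cc k cf) (rho_f_cc k cg)).
congr (integral_rV _); apply/funext => z; rewrite !patchE; case: ifP => _; last by rewrite mulr0 addr0.
ring.
Qed.

Lemma mu_ge0 f : continuous f -> (forall p, 0 <= f p) -> 0 <= mu f.
Proof.
move=> cf f0; apply: sumr_ge0 => k _; apply: (posfun_int m).2; first exact: rho_f_cc.
move=> z; rewrite patchE; case: ifP => // /set_mem Uz.
by rewrite mulr_ge0 ?(ltW (dens_gt0 kw n0 Uz)) // mulr_ge0 ?rho_ge0.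
Qed.

Lemma mu_gt0 f p : continuous f -> (forall q, 0 <= f q) -> 0 < f p -> 0 < mu f.
Proof.
move=> cf f0 fp; have [k pk] := bfun_cover p.
have dk : dom (c k) p by apply: contrapT => nd; move: pk; rewrite /bfun push_out // ltxx.
rewrite /mu (bigD1 k) //= ltr_pwDl //; last first.
  apply: sumr_ge0 => l _; apply: (posfun_int m).2; first exact: rho_f_cc.
  move=> z; rewrite patchE; case: ifP => // /set_mem Uz.
  by rewrite mulr_ge0 ?(ltW (dens_gt0 kw n0 Uz)) // mulr_ge0 ?rho_ge0.
apply: (@int_gt0 R m _ (chart (c k) p)); first exact: rho_f_cc.
  move=> z; rewrite patchE; case: ifP => // /set_mem Uz.
  by rewrite mulr_ge0 ?(ltW (dens_gt0 kw n0 Uz)) // mulr_ge0 ?rho_ge0.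
rewrite patchE mem_set; last exact: chart_imageP.
rewrite chartK // mulr_gt0 ?(dens_gt0 kw n0 (chart_imageP dk)) // mulr_gt0 //.
by rewrite /rho divr_gt0 // bsum_gt0.
Qed.

Lemma muD f g : continuous f -> continuous g -> mu (fun p => f p + g p) = mu f + mu g.
Proof. by move=> cf cg; have := muL 1 cf cg; under eq_fun do rewrite mul1r; rewrite mul1r. Qed.

Lemma mu0 : mu (fun=> 0) = 0.
Proof.
have := muD (@cst_continuous _ _ (0 : R)) (@cst_continuous _ _ (0 : R)).
under eq_fun do rewrite addr0; move/eqP; rewrite -subr_eq0 opprD addNKr oppr_eq0 => /eqP; exact.
Qed.

Lemma muZ (a : R) f : continuous f -> mu (fun p => a * f p) = a * mu f.
Proof.
move=> cf; have := muL a cf (@cst_continuous _ _ (0 : R)); under eq_fun do rewrite addr0.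
by rewrite mu0 addr0.
Qed.

Lemma muN f : continuous f -> mu (fun p => - f p) = - mu f.
Proof. by move=> cf; rewrite -mulN1r -muZ //; congr mu; apply/funext => p; rewrite mulN1r. Qed.

Lemma muB f g : continuous f -> continuous g -> mu (fun p => f p - g p) = mu f - mu g.
Proof.
move=> cf cg; have cN : continuous (fun p => - g p) by cont.
by rewrite muD // muN.
Qed.

Lemma mu_le f g : continuous f -> continuous g -> (forall p, f p <= g p) -> mu f <= mu g.
Proof.
move=> cf cg fg; rewrite -subr_ge0 -muB //; apply: mu_ge0 => [|p]; last by rewrite subr_ge0.
by cont.
Qed.

Lemma mu_sum (I : Type) (s : seq I) (F : I -> M -> R) : (forall k : I, continuous (F k)) ->
  mu (fun p => \sum_(k <- s) F k p) = \sum_(k <- s) mu (F k).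
Proof.
move=> cF; elim: s => [|k s IH]; first by rewrite [RHS]big_nil -[RHS]mu0; congr (mu _); apply/funext => p; rewrite big_nil.
rewrite big_cons -IH -muD //; first by congr (mu _); apply/funext => p; rewrite big_cons.
by cont.
Qed.

(** Each [rho k * f] is supported in two charts, and its integral is moved from chart [c k] to chart
    [i]; then the partition of unity sums to 1. *)
Lemma mu_local i f (B : set M) : continuous f -> compact B -> B `<=` dom i -> (forall p, ~ B p -> f p = 0) ->
  mu f = local_int i f.
Proof.
move=> cf cB Bi fB.
have E k : local_int (c k) (fun p => rho k p * f p) = local_int i (fun p => rho k p * f p).
  apply: (local_int_change kw n0 (A := B `&` bset k)).
  - exact: rho_f_cont.
  - apply: compact_closedI => //; apply: (compact_closedM X); exact: bset_compact.
  - by move=> p [_ /bset_dom].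
  - by move=> p [/Bi].
  - move=> p nB; have [Bp|/fB ->] := pselect (B p); last by rewrite mulr0.
    by rewrite rho_out ?mul0r // => bp; apply: nB.
rewrite /mu (eq_bigr _ (fun k _ => E k)) /local_int -int_sum.
  congr (integral_rV _); apply/funext => z; rewrite patchE; case: ifPn => [zU|zU].
    under eq_bigr do rewrite patchE zU.
    by rewrite -mulr_suml -mulr_suml sum_rho mul1r.
  by rewrite big1 // => k _; rewrite patchE (negbTE zU).
move=> k _; apply: (local_cc kw (f := fun p => rho k p * f p) (A := B)) => //; first exact: rho_f_cont.
by move=> p /fB ->; rewrite mulr0.
Qed.

Definition top_form (tau : chart_index X -> V -> R) :=
  (forall i z, U i z -> {for z, continuous (tau i)}) /\
  (forall i j z, overlap i j z -> tau i z = \det ('J (T i j) z) * tau j (T i j z)).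

Definition cover_chart p : chart_index X := projT1 (cid (dom_cover X p)).

Lemma cover_chartP p : dom (cover_chart p) p. Proof. exact: (projT2 (cid (dom_cover X p))). Qed.

(** The ratio of a top form to w^n, computed in a chosen chart at [p]; both transform by the same
    determinant, so by [quotE] any chart may be used. *)
Definition quot tau p : R := tau (cover_chart p) (chart (cover_chart p) p) / dens w (cover_chart p) (chart (cover_chart p) p).

Lemma quotE tau i z : top_form tau -> U i z -> quot tau (inv i z) = tau i z / dens w i z.
Proof.
move=> [_ tl] Uz; set p := inv i z; set j := cover_chart p.
have dj : dom j p := cover_chartP p.
have di : dom i p by exact: chart_inv_dom.
have o : overlap i j z by [].
have -> : quot tau p = tau j (T i j z) / dens w j (T i j z) by [].
have d0 : \det ('J (T i j) z) != 0 by rewrite gt_eqF // (transition_det_gt0 kw n0 o).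
by rewrite (tl i j z o) (dens_law kw o) -mulf_div mulfV // mul1r.
Qed.

Lemma quot_cont tau : top_form tau -> continuous (quot tau).
Proof.
move=> tt; apply: (inv_continuous_fun (X := X)) => i z Uz.
apply: (@near_continuous _ _ (fun z => tau i z / dens w i z)).
  near=> y; rewrite /= quotE //; near: y; apply: open_nbhs_nbhs; split => //; exact: image_open.
apply: cont_mul; first exact: tt.1.
by apply: cont_inv; [rewrite gt_eqF // (dens_gt0 kw n0 Uz) | exact: dens_cont].
Unshelve. all: by end_near. Qed.

Hypothesis cM : compact [set: M].

(** The right hand side does not mention the partition of unity, so [integral_wrt] does not depend
    on it. *)
Lemma integral_wrt_mu N' (c' : 'I_N' -> chart_index X) rho' tau : partition_of_unity c' rho' -> top_form tau ->
  integral_wrt c' rho' tau = mu (quot tau).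
Proof.
move=> [s1 s2 s3 s4] tt; have cq := quot_cont tt.
have cr (k : 'I_N') : continuous (rho' k) by apply: (smooth_fun_continuous (X := X)); exact: s1.
have crq (k : 'I_N') : continuous (fun p => rho' k p * quot tau p).
  by cont.
have -> : quot tau = (fun p => \sum_(k < N') rho' k p * quot tau p).
  by apply/funext => p; rewrite -mulr_suml s4 mul1r.
rewrite mu_sum //; apply: eq_bigr => k _.
rewrite (@mu_local (c' k) _ (closure [set x | rho' k x != 0])) //; last 2 first.
- apply: (@subclosed_compact _ _ setT) => //; exact: closed_closure.
- move=> p np; case: (eqVneq (rho' k p) 0) => [->|rp]; first by rewrite mul0r.
  by case: np; apply: subset_closure.
congr (integral_rV _); apply/funext => z; rewrite !patchE; case: ifP => // /set_mem Uz.
by rewrite quotE // -mulrA mulfVK // gt_eqF // (dens_gt0 kw n0 Uz).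
Qed.

Lemma integral_topE tau : top_form tau -> integral_top tau = mu (quot tau).
Proof.
move=> tt; rewrite /integral_top; case: xgetP => [_ -> [N' [c' [rho' [pu ->]]]]|np]; first exact: integral_wrt_mu.
(* The partition of unity [rho] shows that the set is not empty, which excludes the default value 0
   of [xget]. *)
pose e : 'I_#|N| -> N := enum_val.
have pu : partition_of_unity (fun k : 'I_#|N| => c (e k)) (fun k : 'I_#|N| => rho (e k)).
  split => [k|k p|k|p].
  - exact: (rho_smooth (e k)).
  - exact: rho_ge0.
  - apply: (subset_trans (B := bset (e k))); last exact: bset_dom.
    rewrite closureE; apply: smallest_sub; first by apply: (compact_closedM X); exact: bset_compact.
    by move=> p /= /eqP rp; apply: contrapT => /rho_out.
  - rewrite -(sum_rho p) [RHS](reindex e) //=; exists enum_rank => k _; [exact: enum_valK | exact: enum_rankK].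
case: (np (integral_wrt (fun k : 'I_#|N| => c (e k)) (fun k : 'I_#|N| => rho (e k)) tau)); exists #|N|, (fun k : 'I_#|N| => c (e k)), (fun k : 'I_#|N| => rho (e k)); split => //.
Qed.

End Measure.

(** * Exterior derivative and Stokes' theorem *)

Section WedgeCalculus.
Context {R : realType}.

Lemma is_derive_prod (V : normedModType R) n (F : 'I_n -> V -> R) (dF : 'I_n -> R) x v :
  (forall k, is_derive x v (F k) (dF k)) ->
  is_derive x v (fun y => \prod_k F k y) (\sum_k dF k * \prod_(l | l != k) F l x).
Proof.
elim: n F dF => [|n IH] F dF H.
  rewrite big_ord0; have -> : (fun y => \prod_k F k y) = cst 1 by apply/funext => y; rewrite big_ord0.
  exact: is_derive_cst.
have -> : (fun y => \prod_k F k y) = F ord0 * (fun y => \prod_k F (lift ord0 k) y).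
  by apply/funext => y; rewrite big_ord_recl.
have := is_deriveM (H ord0) (IH _ _ (fun k => H (lift ord0 k))).
move=> h; apply: (is_derive_eq h); rewrite big_ord_recl addrC; congr (_ + _).
  rewrite -[LHS]/(_ * _) mulrC; congr (_ * _).
  by rewrite [RHS]big_mkcond big_ord_recl /= mul1r.
rewrite -[LHS]/(_ * _) mulr_sumr; apply: eq_bigr => k _.
rewrite mulrCA; congr (_ * _); rewrite [RHS]big_mkcond big_ord_recl /=; congr (_ * _).
by rewrite [LHS]big_mkcond; apply: eq_bigr => l _; rewrite (inj_eq (@lift_inj _ ord0)).
Qed.

Lemma is_derive_sumf (V : normedModType R) (I : Type) (r : seq I) (F : I -> V -> R) (dF : I -> R) x v :
  (forall k, is_derive x v (F k) (dF k)) ->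
  is_derive x v (fun y => \sum_(k <- r) F k y) (\sum_(k <- r) dF k).
Proof.
move=> H; elim: r => [|k r IH].
  rewrite big_nil; have -> : (fun y => \sum_(k <- [::]) F k y) = cst 0 by apply/funext => y; rewrite big_nil.
  exact: is_derive_cst.
rewrite big_cons; have -> : (fun y => \sum_(j <- k :: r) F j y) = F k + (fun y => \sum_(j <- r) F j y).
  by apply/funext => y; rewrite big_cons.
exact: is_deriveD.
Qed.

Lemma pderiv_lin m (U : set 'rV[R]_m) f g (a : R) q y : smooth_on U f -> smooth_on U g -> U y ->
  pderiv q (fun z => a * f z + g z) y = a * pderiv q f y + pderiv q g y.
Proof.
move=> sf sg Uy; exact: (derive_val (is_derive := is_deriveD (is_deriveZl a (smooth_on_is_derive q sf Uy)) (smooth_on_is_derive q sg Uy))).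
Qed.

Lemma pderiv2_lin m (U : set 'rV[R]_m) f g (a : R) q q' y : open U -> smooth_on U f -> smooth_on U g -> U y ->
  pderiv q' (pderiv q (fun z => a * f z + g z)) y = a * pderiv q' (pderiv q f) y + pderiv q' (pderiv q g) y.
Proof.
move=> oU sf sg Uy; rewrite -(pderiv_lin a q' (smooth_pderiv q sf) (smooth_pderiv q sg) Uy); apply: near_eq_derive.
by apply: filterS (open_nbhs_nbhs (conj oU Uy)) => z Uz; exact: pderiv_lin sf sg Uz.
Qed.

Lemma is_derive_wt (V : normedModType R) n (a : 'I_n -> V -> 'M[R]_(n * 2)) (da : 'I_n -> 'M[R]_(n * 2)) x v :
  (forall k i j, is_derive x v (fun y => a k y i j) (da k i j)) ->
  is_derive x v (fun y => wt (fun k => a k y)) (\sum_k wt (upd (fun k => a k x) k (da k))).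
Proof.
move=> H; rewrite /wt exchange_big; apply: is_derive_sumf => s /=.
rewrite -mulr_sumr; apply: is_deriveZl.
have := is_derive_prod (fun k => H k (s (xi k)) (s (yi k))) => h; apply: (is_derive_eq h).
apply: eq_bigr => k _; rewrite [RHS](bigD1 k) //= /upd eqxx; congr (_ * _).
by apply: eq_bigr => l /negbTE ->.
Qed.

(* The positions x_k0, x_k and y_k are permuted cyclically. *)
Lemma wt_closed n (a : 'I_n -> 'M[R]_(n * 2)) (k0 k : 'I_n) (q : 'I_(n * 2)) (t : 'I_(n * 2) -> 'M[R]_(n * 2)) :
  k != k0 -> (forall i j l, t i j l + t j l i + t l i j = 0) ->
  \sum_p wt (upd (upd a k0 (delta_mx p q)) k (t p)) = 0.
Proof.
move=> kk tc; pose P (s : 'S_(n * 2)) := (s (yi k0) == q)%:R * \prod_(l | (l != k) && (l != k0)) a l (s (xi l)) (s (yi l)).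
pose F (s : 'S_(n * 2)) := t (s (xi k0)) (s (xi k)) (s (yi k)).
have -> : \sum_p wt (upd (upd a k0 (delta_mx p q)) k (t p)) = \sum_(s : 'S_(n * 2)) (-1) ^+ s * (F s * P s).
  rewrite exchange_big; apply: eq_bigr => s _ /=; rewrite -mulr_sumr; congr (_ * _).
  have E p : \prod_k1 upd (upd a k0 (delta_mx p q)) k (t p) k1 (s (xi k1)) (s (yi k1)) =
      (p == s (xi k0))%:R * (t p (s (xi k)) (s (yi k)) * P s).
    rewrite (bigD1 k) //= (bigD1 k0) 1?eq_sym //= /upd !eqxx eq_sym (negbTE kk) mxE /P [s (xi k0) == p]eq_sym -mulnb natrM.
    rewrite (eq_bigr (fun l => a l (s (xi l)) (s (yi l)))); last first.
      by move=> l /andP[/negbTE -> /negbTE ->].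
    by rewrite -mulrA [LHS]mulrCA.
  under eq_bigr do rewrite E.
  rewrite (bigD1 (s (xi k0))) //= eqxx mul1r big1 ?addr0 // => p /negbTE ->; by rewrite mul0r.
pose c : 'S_(n * 2) := (tperm (xi k0) (xi k) * tperm (xi k0) (yi k))%g.
have kk' : k0 != k by rewrite eq_sym.
have c1 : c (xi k0) = xi k.
  by rewrite /c permM tpermL tpermD // ?(inj_eq (@xi_inj n)) // eq_sym xi_neq_yi.
have c2 : c (xi k) = yi k by rewrite /c permM tpermR tpermL.
have c3 : c (yi k) = xi k0 by rewrite /c permM (@tpermD _ (xi k0) (xi k)) ?xi_neq_yi // tpermR.
have cx l : l != k -> l != k0 -> c (xi l) = xi l.
  move=> lk lk0; have e1 : tperm (xi k0) (xi k) (xi l) = xi l.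
    by rewrite tpermD // (inj_eq (@xi_inj n)) eq_sym.
  by rewrite /c permM e1 tpermD // ?(inj_eq (@xi_inj n)) eq_sym // xi_neq_yi.
have cy l : l != k -> c (yi l) = yi l.
  move=> lk; rewrite /c permM tpermD ?xi_neq_yi // tpermD ?xi_neq_yi //.
  by rewrite (inj_eq (@yi_inj n)) eq_sym.
have oc : odd_perm c = false.
  by rewrite /c odd_permM !odd_tperm xi_neq_yi (inj_eq (@xi_inj n)) kk'.
have Pc s : P (c * s)%g = P s.
  rewrite /P permM cy //; congr (_ * _); apply: eq_bigr => l /andP[lk lk0].
  by rewrite (permM c s (xi l)) (permM c s (yi l)) cx // cy.
have sh (G : 'S_(n * 2) -> R) : \sum_(s : 'S_(n * 2)) (-1) ^+ s * (G s * P s) =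
    \sum_(s : 'S_(n * 2)) (-1) ^+ s * (G (c * s)%g * P s).
  rewrite (reindex_inj (mulgI c)) /=; apply: eq_bigr => s _.
  by rewrite odd_permM oc addFb Pc.
set S := \sum_s _; have S1 := sh F; have S2 := sh (fun s => F (c * s)%g).
suff : S + S + S = 0 by move=> h; lra.
transitivity (S + \sum_(s : 'S_(n * 2)) (-1) ^+ s * (F (c * s)%g * P s) +
  \sum_(s : 'S_(n * 2)) (-1) ^+ s * (F (c * (c * s))%g * P s)); first by rewrite -S2 -S1.
rewrite /S -!big_split big1 // => s _ /=.
rewrite -!mulrDr -!mulrDl /F !(permM c) !(c1, c2, c3) tc mul0r mulr0 //.
Qed.

End WedgeCalculus.

Section Stokes.
Context {R : realType} {n : nat} {M : topologicalType} (X : complex_manifold R n M).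
Local Notation m := (n * 2)%N.
Local Notation V := 'rV[R]_m.
Local Notation smooth := (smooth_function X).
Implicit Types (i j : chart_index X) (z : V) (f g : M -> R) (h : V -> R).
Variable w : coef2 X.
Hypothesis kw : kahler_form w.
Hypothesis n0 : (0 < n)%N.

Local Notation smooth2 a := (forall i k l, smooth_on (U i) (fun z => a i z k l)).
Local Notation pulls a := (forall i j z, overlap i j z -> a i z = 'J (T i j) z *m a j (T i j z) *m ('J (T i j) z)^T).

(** Lists of forms are read with default [w]. As [w] is itself closed and Kaehler, a condition on
    all [nth w s k] is a condition on the members of [s] only. *)
Definition wedge (s : seq (coef2 X)) i z : R := 2 ^- n * wl [seq (a : coef2 X) i z | a <- s].

Lemma wedgeE s i z : size s = n -> wedge s i z = wedge_top (fun k : 'I_n => nth w s k i z).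
Proof.
by move=> sn; rewrite /wedge wedge_topE; congr (_ * _); apply: eq_wt => k; rewrite (nth_map w) // sn.
Qed.

Lemma wedge_smooth_on s i : size s = n -> (forall k, smooth2 (nth w s k)) -> smooth_on (U i) (wedge s i).
Proof.
move=> sn ss; apply: (smooth_eq (f := fun z => wedge_top (fun k : 'I_n => nth w s k i z))).
- exact: image_open.
- by move=> z _; rewrite wedgeE.
- apply: chart_sgen; apply: sg_mul; first exact: sg_cst.
  apply: sgen_sum => t _; apply: sg_mul; first exact: sg_cst.
  by apply: sgen_prod => k _; apply: sg_base; exact: ss.
Qed.

Lemma wedge_pulls s i j z : size s = n -> (forall k, pulls (nth w s k)) -> overlap i j z ->
  wedge s i z = \det ('J (T i j) z) * wedge s j (T i j z).
Proof.
move=> sn sp o; rewrite !wedgeE // !wedge_topE mulrCA -wt_congr; congr (_ * _); apply: eq_wt => k.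
exact: sp.
Qed.

Lemma wedge_top_form s : size s = n -> (forall k, smooth2 (nth w s k)) -> (forall k, pulls (nth w s k)) ->
  top_form (wedge s).
Proof.
move=> sn ss sp; split => [i z Uz|i j z o]; last exact: wedge_pulls.
exact: smooth_cont (wedge_smooth_on i sn ss) Uz.
Qed.

Definition dform (e : Defs.coef1 X) : coef2 X := fun i z => \matrix_(k, l)
  (pderiv k (fun z => e i z 0 l) z - pderiv l (fun z => e i z 0 k) z).

Local Notation smooth1 e := (forall i k, smooth_on (U i) (fun z => e i z 0 k)).

Lemma dform_smooth (e : Defs.coef1 X) : smooth1 e -> smooth2 (dform e).
Proof.
move=> se i k l; have -> : (fun z => dform e i z k l) =
    (fun z => 'D_'e_k (fun z => e i z 0 l) z + (- 1) * 'D_'e_l (fun z => e i z 0 k) z).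
  by apply/funext => z; rewrite mxE mulN1r.
apply: chart_sgen; apply: sg_add; first by apply: sg_base; exact: smooth_pderiv.
by apply: sg_mul; [exact: sg_cst | apply: sg_base; exact: smooth_pderiv].
Qed.

Lemma pderiv_transition i j z (h : V -> R) k : overlap i j z -> smooth_on (U j) h ->
  is_derive z 'e_k (fun x => h (T i j x)) (\sum_p 'J (T i j) z k p * pderiv p h (T i j z)).
Proof.
move=> o sh; have Tz : U j (T i j z) by have [] := transition_overlap o.
have [dh vh] := smooth_differentiable (image_open j) sh Tz.
have dq q : derivable (fun y => T i j y 0 q) z 'e_k.
  by apply: derivable_row; exact: transition_differentiable.
have H := is_derive_compn dq dh.
apply: (is_derive_eq H); rewrite vh; apply: eq_bigr => p _; congr (_ * _).
by rewrite mxE jacobianE //; exact: transition_differentiable.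
Qed.

Lemma pderiv_jacobian i j z k l p : overlap i j z ->
  is_derive z 'e_k (fun x => 'J (T i j) x l p) ('D_'e_k ('D_'e_l (fun x => T i j x 0 p)) z).
Proof.
move=> o; have E : {near z, (fun x => 'J (T i j) x l p) =1 'D_'e_l (fun x => T i j x 0 p)}.
  near=> x; apply: jacobianE; apply: transition_differentiable.
  by near: x; apply: open_nbhs_nbhs; split => //; exact: overlap_open.
split; last exact: near_eq_derive.
apply: (near_eq_derivable (f := 'D_'e_l (fun x => T i j x 0 p))).
  by apply: filterS E => x ->.
exact: (smooth_derivable (smooth_pderiv l (@transition_smooth _ _ _ _ _ kw i j p)) o).
Unshelve. all: by end_near. Qed.

(** The terms with second derivatives of the transition map are symmetric in the two indices and
    cancel on antisymmetrization. *)
Lemma dform_pulls (e : Defs.coef1 X) : one_form e -> pulls (dform e).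
Proof.
move=> [se le] i j z o; have Tz : U j (T i j z) by have [] := transition_overlap o.
have d1 k l : pderiv k (fun x => e i x 0 l) z =
    \sum_q (e j (T i j z) 0 q * 'D_'e_k ('D_'e_l (fun x => T i j x 0 q)) z +
            'J (T i j) z l q * \sum_p 'J (T i j) z k p * pderiv p (fun y => e j y 0 q) (T i j z)).
  have E : {near z, (fun x => e i x 0 l) =1 (fun x => \sum_q e j (T i j x) 0 q * 'J (T i j) x l q)}.
    near=> x; have ox : overlap i j x by near: x; apply: open_nbhs_nbhs; split => //; exact: overlap_open.
    by rewrite /= (le i j x ox.1 ox.2) mxE; apply: eq_bigr => q _; rewrite [_^T _ _]mxE.
  transitivity ('D_'e_k (fun x => \sum_q e j (T i j x) 0 q * 'J (T i j) x l q) z); first exact: near_eq_derive.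
  have H q := is_deriveM (pderiv_transition k o (se j q)) (pderiv_jacobian k l q o).
  exact: (derive_val (is_derive := is_derive_sumf _ H)).
apply/matrixP => k l; rewrite mxE !d1 !mxE -sumrB.
under [RHS]eq_bigr do rewrite mxE mulr_suml.
have S q : 'D_'e_k ('D_'e_l (fun x => T i j x 0 q)) z =
  'D_'e_l ('D_'e_k (fun x => T i j x 0 q)) z.
  exact: (schwarz _ _ (@overlap_open _ _ _ _ i j) (@transition_smooth _ _ _ _ _ kw i j q) o).
rewrite (eq_bigr (fun q => \sum_p 'J (T i j) z k p * pderiv p (fun y => e j y 0 q) (T i j z) * 'J (T i j) z l q -
  \sum_p 'J (T i j) z l p * pderiv p (fun y => e j y 0 q) (T i j z) * 'J (T i j) z k q)); last first.
  move=> q _; rewrite S opprD addrACA subrr add0r -!mulr_suml [_ * \sum_p _]mulrC; congr (_ - _).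
  by rewrite mulrC.
rewrite sumrB [X in _ - X]exchange_big -sumrB; apply: eq_bigr => q _; rewrite -sumrB; apply: eq_bigr => p _.
rewrite [('J _ _)^T _ _]mxE [dform _ _ _ _ _]mxE; ring.
Unshelve. all: by end_near. Qed.

Lemma sc_ext (W K : set V) h : open W -> compact K -> K `<=` W -> smooth_on W h ->
  (forall z, W z -> ~ K z -> h z = 0) -> sc (h \_ W) /\
  forall k, 'D_'e_k (h \_ W) = ('D_'e_k h) \_ W.
Proof.
move=> oW cK KW sh hK.
have oK : open (~` K) by rewrite openC; exact: compact_closed (@norm_hausdorff _ _) cK.
have inW z : W z -> {near z, h \_ W =1 h}.
  move=> Wz; near=> y; rewrite patchE mem_set //; near: y; exact: open_nbhs_nbhs.
have outK z : ~ K z -> {near z, h \_ W =1 cst 0}.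
  move=> nKz; near=> y; have nKy : ~ K y by near: y; exact: open_nbhs_nbhs.
  by rewrite patchE; case: ifP => // /set_mem Wy; rewrite hK.
split.
  split.
    apply: smooth_local => z _; have [Wz|nWz] := pselect (W z).
      by exists W => //; apply: (smooth_eq oW _ sh) => y Wy; rewrite patchE mem_set.
    exists (~` K); first by move=> /KW.
    apply: (smooth_eq (f := fun=> 0) oK); last by apply: sgen_smooth => //; exact: sg_cst.
    by move=> y nKy; rewrite patchE; case: ifP => // /set_mem Wy; rewrite hK.
  have /compact_bounded [B [_ BP]] := cK; exists (B + 1) => z zB; rewrite patchE; case: ifP => // /set_mem Wz.
  by apply: hK => // Kz; have := BP (B + 1) _ z Kz; rewrite ltrDl ltr01 => /(_ isT) /=; rewrite leNgt zB.
move=> k; apply/funext => z; rewrite patchE; case: ifPn => [/set_mem Wz|/negP nW].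
  by apply: near_eq_derive; exact: inW.
have nKz : ~ K z by move=> /KW Wz; apply: nW; exact: mem_set.
rewrite (_ : 'D_'e_k (h \_ W) z = 'D_'e_k (cst 0) z); last by apply: near_eq_derive; exact: outK.
exact: derive_cst.
Unshelve. all: by end_near. Qed.

Section Primitive.
Variable G : seq (coef2 X).
Hypothesis Gn : size G = n.-1.
Hypothesis Gc : forall k, two_form (nth w G k) /\ closed_form (nth w G k).

(** The coefficients of the linear functional b |-> b /\ G on 2-forms, see [wedge_cons]. *)
Definition cof i z (p q : 'I_m) : R := wedge ((fun _ _ => delta_mx p q) :: G) i z.

Lemma wedge_cons (b : coef2 X) i z : wedge (b :: G) i z = \sum_p \sum_q b i z p q * cof i z p q.
Proof.
rewrite /cof /wedge /=; set S := [seq _ | _ <- G].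
have lin (I : finType) (c : I -> R) (B : I -> 'M[R]_m) : wl (\sum_t c t *: B t :: S) = \sum_t c t * wl (B t :: S).
  elim: (index_enum I) => [|t r IH]; first by rewrite !big_nil wl_cons0.
  by rewrite !big_cons wl_cons_lin // IH.
have bE : b i z = \sum_(t : 'I_m * 'I_m) b i z t.1 t.2 *: delta_mx t.1 t.2.
  by rewrite [LHS]matrix_sum_delta pair_bigA.
rewrite {1}bE lin [RHS]pair_bigA mulr_sumr; apply: eq_bigr => t _.
by rewrite mulrCA.
Qed.

Lemma wl_tr (b : 'M[R]_m) (S : seq 'M[R]_m) : wl (b^T :: S) = - wl (b :: S).
Proof.
have E d : wl (d :: S) = wt (upd (fun k => nth 0 (0 :: S) k) (Ordinal n0) d) by rewrite -wl_set_nth.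
by rewrite !E wt_upd_tr.
Qed.

Lemma cof_tr i z p q : cof i z q p = - cof i z p q.
Proof. by rewrite /cof /wedge /= -trmx_delta wl_tr mulrN. Qed.

Lemma G_smooth k i a b : smooth_on (U i) (fun z => nth w G k i z a b).
Proof. by have [[s _ _] _] := Gc k; exact: s. Qed.

Lemma delta_smooth2 p q : smooth2 (fun (_ : chart_index X) (_ : V) => delta_mx p q : 'M[R]_m).
Proof. by move=> i k l; apply: sgen_smooth; [exact: image_open | exact: sg_cst]. Qed.

Lemma cof_smooth i p q : smooth_on (U i) (fun z => cof i z p q).
Proof.
apply: wedge_smooth_on => [|[|k]]; first by rewrite /= Gn prednK.
  exact: delta_smooth2.
by move=> j a b; exact: G_smooth.
Qed.

(** This is closedness of the product of the forms in [G]. The product rule gives one term for each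
    factor, and [wt_closed] makes each of them vanish. *)
Lemma cof_divergence i z q : U i z -> \sum_p pderiv p (fun z => cof i z p q) z = 0.
Proof.
move=> Uz; pose k0 := Ordinal n0.
pose a k : V -> 'M[R]_m := fun z => nth 0 (0 :: [seq (b : coef2 X) i z | b <- G]) k.
have cofE p y : cof i y p q = 2 ^- n * wt (fun k : 'I_n => upd (fun k => a k y) k0 (delta_mx p q) k).
  by rewrite /cof /wedge; congr (_ * _); rewrite -[X in wt X]/(upd _ _ _) -wl_set_nth.
(* Slot 0 is taken by the elementary matrix, so slot [k] holds the factor [k.-1] of [G]. *)
have aE (k : 'I_n) y : k != k0 -> a k y = nth w G k.-1 i y.
  case: k => [[|k] kn] //= _; rewrite /a /= (nth_map w) // Gn; lia.
pose t (k : 'I_n) p : 'M[R]_m := \matrix_(b, d) pderiv p (fun z => nth w G k.-1 i z b d) z.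
have D p : is_derive z 'e_p (fun z => cof i z p q)
    (2 ^- n * \sum_(k | k != k0) wt (upd (upd (fun k => a k z) k0 (delta_mx p q)) k (t k p))).
  have -> : (fun z => cof i z p q) = (fun y => 2 ^- n * wt (fun k : 'I_n => upd (fun k => a k y) k0 (delta_mx p q) k)).
    by apply/funext => y; exact: cofE.
  apply: is_deriveZl.
  have H := @is_derive_wt R V n (fun k y => upd (fun k => a k y) k0 (delta_mx p q) k)
    (fun k => if k == k0 then 0 else t k p) z 'e_p.
  apply: (is_derive_eq (H _)) => [k b d|]; last first.
    by rewrite (bigD1 k0) //= wt_upd0 add0r; apply: eq_bigr => k /negbTE ->.
  case: eqP => [->|/eqP kk].
    rewrite [X in is_derive _ _ _ X]mxE.
    have -> : (fun y => upd (fun k1 : 'I_n => a k1 y) k0 (delta_mx p q) k0 b d) = cst (delta_mx p q b d).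
      by apply/funext => y; rewrite /upd eqxx.
    exact: is_derive_cst.
  rewrite /upd (negbTE kk) mxE.
  have -> : (fun y => a k y b d) = (fun y => nth w G k.-1 i y b d) by apply/funext => y; rewrite aE.
  by apply: smooth_on_is_derive Uz; exact: G_smooth.
have {}D p : pderiv p (fun z => cof i z p q) z = _ := derive_val (is_derive := D p).
under eq_bigr do rewrite D.
rewrite -mulr_sumr exchange_big big1 ?mulr0 //= => k kk; apply: wt_closed => // b d l; rewrite !mxE.
by have [_ cl] := Gc k.-1; exact: cl.
Qed.

Lemma wedge_dform (e : Defs.coef1 X) i z : wedge (dform e :: G) i z =
  2 * \sum_p \sum_q cof i z p q * pderiv p (fun z => e i z 0 q) z.
Proof.
rewrite wedge_cons mulr2n mulrDl mul1r.
under eq_bigr => p _ do under eq_bigr => q _ do rewrite mxE mulrBl.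
under eq_bigr do rewrite sumrB; rewrite sumrB; congr (_ + _).
  by apply: eq_bigr => p _; apply: eq_bigr => q _; rewrite mulrC.
rewrite [RHS]exchange_big -sumrN; apply: eq_bigr => p _ /=; rewrite -sumrN; apply: eq_bigr => q _.
by rewrite [cof i z q p]cof_tr mulNr mulrC.
Qed.

(** The vector field that represents the form e /\ G of degree 2n - 1; its divergence represents d e
    /\ G. *)
Definition flux (e : Defs.coef1 X) i p z : R := \sum_q cof i z p q * e i z 0 q.

Lemma flux_smooth (e : Defs.coef1 X) i p : smooth1 e -> smooth_on (U i) (flux e i p).
Proof.
move=> se; apply: chart_sgen; apply: sgen_sum => q _; apply: sg_mul; apply: sg_base; [exact: cof_smooth | exact: se].
Qed.

Lemma wedge_divergence (e : Defs.coef1 X) i z : smooth1 e -> U i z ->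
  wedge (dform e :: G) i z = 2 * \sum_p pderiv p (flux e i p) z.
Proof.
move=> se Uz; rewrite wedge_dform; congr (_ * _).
have D p : pderiv p (flux e i p) z =
    \sum_q (cof i z p q * pderiv p (fun z => e i z 0 q) z + e i z 0 q * pderiv p (fun z => cof i z p q) z).
  have H q := is_deriveM (smooth_on_is_derive p (cof_smooth i p q) Uz) (smooth_on_is_derive p (se i q) Uz).
  exact: (derive_val (is_derive := is_derive_sumf _ H)).
rewrite (eq_bigr _ (fun p _ => D p)).
under [RHS]eq_bigr do rewrite big_split /=.
rewrite big_split /= [X in _ = _ + X]exchange_big /= [X in _ = _ + X]big1 ?addr0 // => q _.
by rewrite -mulr_sumr cof_divergence // mulr0.
Qed.

Variable A : bump_atlas X.
Local Notation mu := (@mu _ _ _ _ w A).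
Local Notation qt := (quot w).

Lemma flux_local i (e : Defs.coef1 X) (K : set V) : smooth1 e -> compact K -> K `<=` U i ->
  (forall z, U i z -> ~ K z -> e i z = 0) ->
  integral_rV ((fun z => wedge (dform e :: G) i z) \_ (U i)) = 0.
Proof.
move=> se cK KU eK.
have H p : sc (flux e i p \_ (U i)) /\
    forall k, 'D_'e_k (flux e i p \_ (U i)) = ('D_'e_k (flux e i p)) \_ (U i).
  apply: (sc_ext (image_open i) cK KU); first exact: flux_smooth.
  by move=> z Uz nK; rewrite /flux big1 // => q _; rewrite eK // mxE mulr0.
have -> : (fun z => wedge (dform e :: G) i z) \_ (U i) =
    (fun z => 2 * \sum_p 'D_'e_p (flux e i p \_ (U i)) z).
  apply/funext => z.
  have D p : 'D_'e_p (flux e i p \_ (U i)) z = (('D_'e_p (flux e i p)) \_ (U i)) z.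
    exact: (congr1 (fun F => F z) ((H p).2 p)).
  under eq_bigr do rewrite D; rewrite patchE; case: ifPn => [zU|zU].
    rewrite wedge_divergence ?(set_mem zU) //; last exact: set_mem.
    by congr (_ * _); apply: eq_bigr => p _; rewrite patchE zU.
  by rewrite big1 ?mulr0 // => p _; rewrite patchE (negbTE zU).
rewrite intZ; last by apply: cc_sum => p _; exact: sc_cc (sc_pderiv p (H p).1).
rewrite int_sum => [|p _]; last exact: sc_cc (sc_pderiv p (H p).1).
by rewrite big1 ?mulr0 // => p _; exact: int_pderiv_sc (H p).1.
Qed.

Definition scale1 f (e : Defs.coef1 X) : Defs.coef1 X := fun i z => f (inv i z) *: e i z.

Lemma scale1_form f e : smooth f -> one_form e -> one_form (scale1 f e).
Proof.
move=> sf [se le]; split => [i k|i j z Uz dz].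
  apply: (smooth_eq (f := fun z => f (inv i z) * e i z 0 k)); first exact: image_open.
    by move=> z _; rewrite mxE.
  apply: chart_sgen; apply: sg_mul; apply: sg_base; [exact: sf | exact: se].
by rewrite /scale1 (le i j z Uz dz) -scalemxAl transition_inv.
Qed.

Lemma dform_G_smooth e k : one_form e -> smooth2 (nth w (dform e :: G) k).
Proof.
by move=> [se le]; case: k => [|k] i a b; [exact: dform_smooth | exact: G_smooth].
Qed.

Lemma dform_G_pulls e k : one_form e -> pulls (nth w (dform e :: G) k).
Proof.
move=> oe; case: k => [|k] i j z o; first exact: dform_pulls.
by have [[_ _ aJ] _] := Gc k; exact: aJ o.1 o.2.
Qed.

Lemma dform_G_top e : one_form e -> top_form (wedge (dform e :: G)).
Proof.
move=> oe; apply: wedge_top_form => [|k|k]; first by rewrite /= Gn prednK.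
  exact: dform_G_smooth.
exact: dform_G_pulls.
Qed.

(** The partition of unity cuts [e] into pieces [e' k] with support in one chart. In a chart the
    integrand is a divergence of a compactly supported field, whose integral is 0 by translation
    invariance. *)
Theorem stokes e : one_form e -> mu (qt (wedge (dform e :: G))) = 0.
Proof.
move=> oe; have se := oe.1.
pose e' (k : ball_index A) := scale1 (rho k) e.
have oe' k : one_form (e' k) by apply: scale1_form => //; exact: rho_smooth kw A k.
have E : qt (wedge (dform e :: G)) = (fun p => \sum_k qt (wedge (dform (e' k) :: G)) p).
  apply/funext => p; rewrite /quot -mulr_suml; congr (_ / _).
  set i := cover_chart _ _; set z := chart _ _.
  have Uz : U i z by apply: chart_imageP; exact: cover_chartP.
  rewrite wedge_dform (eq_bigr _ (fun k _ => wedge_dform (e' k) i z)).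
  rewrite -mulr_sumr; congr (_ * _); rewrite [RHS]exchange_big; apply: eq_bigr => a _.
  rewrite [RHS]exchange_big; apply: eq_bigr => b _ /=; rewrite -mulr_sumr; congr (_ * _).
  have H k := smooth_on_is_derive a ((oe' k).1 i b) Uz.
  rewrite -[RHS](derive_val (is_derive := is_derive_sumf _ H)); congr ('D__ _ _); apply/funext => y.
  by under eq_bigr do rewrite mxE; rewrite -mulr_suml sum_rho mul1r.
have sup k i z : U i z -> ~ bset k (inv i z) -> wedge (dform (e' k) :: G) i z = 0.
  move=> Uz nb; rewrite wedge_dform big1 ?mulr0 // => a _; rewrite big1 // => b _.
  rewrite [X in _ * X](_ : _ = 0) ?mulr0 //.
  rewrite /pderiv (_ : 'D_'e_a _ z = 'D_'e_a (cst 0) z); first exact: derive_cst.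
  apply: near_eq_derive; have : \near z, (~` bset k) (inv i z).
    apply: (chart_inv_continuous (c := X) Uz); apply: open_nbhs_nbhs; split => //.
    by rewrite openC; apply: (compact_closedM X); exact: bset_compact.
  by apply: filterS => y ny; rewrite mxE rho_out // mul0r.
have ct k : continuous (qt (wedge (dform (e' k) :: G))) by apply: (quot_cont kw n0); exact: dform_G_top.
rewrite E (mu_sum kw) // big1 // => k _.
rewrite (mu_local kw n0 A (i := bchart k) (B := bset k)).
- rewrite /local_int -[RHS](@flux_local (bchart k) (e' k) (cball k 1)).
  + congr (integral_rV _); apply/funext => z; rewrite !patchE; case: ifP => // /set_mem Uz.
    rewrite (quotE kw n0) ?mulfVK //; first by rewrite gt_eqF // (dens_gt0 kw n0 Uz).
    exact: dform_G_top.
  + by have [] := oe' k.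
  + exact: cball_compact.
  + by apply: cball_sub; exact: le1_10.
  + move=> z Uz nK; rewrite /e' /scale1 rho_out ?scale0r // => -[y Ky E'].
    by apply: nK; rewrite -(chart_invK Uz) -E' chart_invK //; apply: (cball_sub _ Ky); exact: le1_10.
- exact: ct.
- exact: bset_compact.
- exact: bset_dom.
- move=> p np; have dp := cover_chartP X p; rewrite /quot sup ?mul0r //; first exact: chart_imageP.
  by rewrite chartK.
Qed.

End Primitive.

End Stokes.

(** * Estimates for mollifiers *)

Section CauchySchwarz.
Context {R : realType}.

Lemma discriminant_le (a b c : R) : 0 <= a -> (forall t, 0 <= t ^+ 2 * a + 2 * t * b + c) -> b ^+ 2 <= a * c.
Proof.
rewrite le_eqVlt => /predU1P[<-|a0] H.
  have [->|b0] := eqVneq b 0; first by rewrite expr0n mul0r.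
  (* For [a = 0] the polynomial is linear in [t], and at this point it equals -1. *)
  have := H (- (c + 1) / (2 * b)).
  rewrite mulr0 add0r (_ : 2 * _ * b = - (c + 1)); first by lra.
  by field.
have := H (- b / a); rewrite (_ : _ + c = (a * c - b ^+ 2) / a); last by field; rewrite gt_eqF.
by rewrite pmulr_lge0 ?invr_gt0 // subr_ge0.
Qed.

Lemma posfun_cs (V : normedModType R) (J : (V -> R) -> R) (h f g : V -> R) : posfun J -> cc h -> (forall x, 0 <= h x) ->
  continuous f -> continuous g ->
  J (fun x => h x * (f x * g x)) ^+ 2 <= J (fun x => h x * f x ^+ 2) * J (fun x => h x * g x ^+ 2).
Proof.
move=> pJ ch h0 cf cg.
have [c1 [c2 c3]] : continuous (fun x => f x ^+ 2) /\ continuous (fun x => g x ^+ 2) /\ continuous (fun x => f x * g x).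
  by do !split; cont.
apply: discriminant_le => [|t].
  by apply: (proj2 pJ) => [|x]; [exact: ccMr | rewrite mulr_ge0 ?sqr_ge0].
rewrite -addrA -!(posfunZ pJ) -?(posfunD pJ); try by do ?[apply: ccD | apply: ccZ]; exact: ccMr.
apply: (proj2 pJ) => [|x]; first by do ?[apply: ccD | apply: ccZ]; exact: ccMr.
rewrite (_ : _ + _ = h x * (t * f x + g x) ^+ 2); last by ring.
by rewrite mulr_ge0 // sqr_ge0.
Qed.

End CauchySchwarz.

Section MollifierEstimates.
Context {R : realType} {m : nat}.
Local Notation V := 'rV[R]_m.
Local Notation moll := (@moll R m).
Local Notation I := (@integral_rV R _).
Implicit Types (f g b a : V -> R) (x y z w : V) (e : R).

Lemma kav_far psi e f B C x : (forall w, B < `|w| -> psi w = 0) -> (forall w, C < `|w| -> f w = 0) ->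
  C + `|e| * B < `|x| -> kav psi e f x = 0.
Proof.
move=> pB fC xBC; rewrite /kav (_ : (fun w => _) = fun=> 0); first exact: int0.
apply/funext => w; have [wB|/pB ->] := leP `|w| B; last by rewrite mul0r.
rewrite fC ?mulr0 //; have := lerB_normD x (e *: w); rewrite normrZ.
by have := ler_wpM2l (normr_ge0 e) wB; lra.
Qed.

Lemma kav_cc psi e f : cc psi -> cc f -> cc (kav psi e f).
Proof.
move=> cp cf; split; first exact: kav_contx (proj1 cf).
by have [[_ [B pB]] [_ [C fC]]] := (cp, cf); exists (C + `|e| * B) => x; exact: kav_far.
Qed.

Lemma int_kav psi e f : cc psi -> cc f -> I (kav psi e f) = I psi * I f.
Proof.
move=> cp cf; have [[_ [B pB]] [_ [C fC]]] := (cp, cf).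
rewrite -(@int_swap R m V (@integral_rV R m) (fun x w => psi w * f (x + e *: w)) (Num.max B (C + `|e| * B)) (posfun_int m) (@compact_norm_row R m)).
- rewrite mulrC -intZ //; congr (I _); apply/funext => w.
  by rewrite intZ ?int_shift 1?mulrC //; exact: cc_shift.
- by have [c1 c2] := (proj1 cp, proj1 cf); cont.
- move=> x w; rewrite gt_max => /andP[_ xB]; have [wB|/pB ->] := leP `|w| B; last by rewrite mul0r.
  rewrite fC ?mulr0 //; have := lerB_normD x (e *: w); rewrite normrZ.
  by have := ler_wpM2l (normr_ge0 e) wB; lra.
- by move=> x w; rewrite gt_max => /andP[wB _]; rewrite pB ?mul0r.
Qed.

Lemma kav_sq psi e f x : cc psi -> (forall w, 0 <= psi w) -> continuous f ->
  kav psi e f x ^+ 2 <= I psi * kav psi e (fun y => f y ^+ 2) x.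
Proof.
move=> cp p0 cf.
have := @posfun_cs R V _ psi (fun=> 1) (fun w => f (x + e *: w)) (posfun_int m) cp p0.
have E1 : (fun w => psi w * 1 ^+ 2) = psi by apply/funext => w; rewrite expr1n mulr1.
rewrite E1; under [X in I X ^+ 2]eq_fun do rewrite mul1r; apply; first exact: cst_continuous.
by cont.
Qed.

Lemma cc_sqr f : cc f -> cc (fun x => f x ^+ 2).
Proof. by move=> cf; apply: ccMr => //; case: cf. Qed.

(** Young's inequality for L^1 against L^2: the Cauchy-Schwarz inequality inside the average, then
    translation invariance. The bound is uniform in [e]. *)
Lemma int_kav_sq psi e f : cc psi -> (forall w, 0 <= psi w) -> cc f ->
  I (fun x => kav psi e f x ^+ 2) <= I psi ^+ 2 * I (fun x => f x ^+ 2).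
Proof.
move=> cp p0 cf; have c2 := cc_sqr cf.
have E : I psi ^+ 2 * I (fun x => f x ^+ 2) = I (fun x => I psi * kav psi e (fun y => f y ^+ 2) x).
  by rewrite intZ ?int_kav // ?expr2 ?mulrA //; exact: kav_cc.
rewrite E; apply: int_le => [||x].
- by apply: cc_sqr; exact: kav_cc.
- by apply: ccZ; exact: kav_cc.
- by apply: kav_sq => //; case: cf.
Qed.

Lemma mol_cc e f : cc f -> cc (mol e f).
Proof.
move=> cf; apply: (ccMr (g := fun=> (I moll)^-1)); last exact: cst_continuous.
by apply: kav_cc => //; exact: moll_cc.
Qed.

Lemma mol_far e f C x : 0 <= e -> (forall w, C < `|w| -> f w = 0) -> C + e < `|x| -> mol e f x = 0.
Proof.
move=> e0 fC xC; rewrite /mol (@kav_far _ e f 1 C) ?mul0r //; first by move=> w; exact: moll_far.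
by rewrite mulr1 ger0_norm.
Qed.

Lemma int_mol_sq e f : cc f -> I (fun x => mol e f x ^+ 2) <= I (fun x => f x ^+ 2).
Proof.
move=> cf; have Z0 := @int_moll_gt0 R m.
rewrite -(ler_pM2l (exprn_gt0 2 Z0)); apply: le_trans (int_kav_sq e (moll_cc m) (@moll_ge0 R m) cf).
rewrite -intZ; last by apply: cc_sqr; exact: mol_cc.
rewrite le_eqVlt; apply/predU1P; left; congr (I _); apply/funext => x.
by rewrite /mol -exprMn mulrC divfK // gt_eqF.
Qed.

Lemma sc_lipschitz a : sc a -> exists2 L : R, 0 <= L & forall x y, `|a x - a y| <= L * `|x - y|.
Proof.
move=> sa.
have Dj j := sc_pderiv_bound j sa.
pose L j := s2val (cid2 (Dj j)).
have L0 j : 0 <= L j by exact: (s2valP (cid2 (Dj j))).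
have LP j x : `|'D_'e_j a x| <= L j by exact: (s2valP' (cid2 (Dj j))).
exists ((\sum_j L j) * m%:R) => [|x y]; first by rewrite mulr_ge0 // sumr_ge0.
have := @mean_value_coord R m a y (`|x - y| + 1) (fun=> 0) (\sum_j L j) _ y x.
rewrite (_ : \sum_j (x - y) 0 j * 0 = 0); last by apply: big1 => j _; rewrite mulr0.
rewrite subr0 mulrA; apply; rewrite ?subrr ?normr0 ?ltrDl ?ltr01 ?ltr_wpDl //.
move=> z _ j; split; first by apply: smooth_derivable (proj1 sa) _.
by rewrite subr0 (le_trans (LP j z)) // (bigD1 j) //= lerDl sumr_ge0.
Qed.

(* Integrating by parts in w moves the derivative off h; the factor 1/e is
   absorbed by the oscillation of a over a distance e. *)
Lemma friedrichs a i : sc a -> exists2 C : R, 0 <= C & forall e h, 0 < e -> sc h ->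
  I (fun x => (a x * mol e (pderiv i h) x - mol e (fun y => a y * pderiv i h y) x) ^+ 2) <= C * I (fun x => h x ^+ 2).
Proof.
move=> sa; have [L L0 aL] := sc_lipschitz sa; have [D D0 aD] := sc_pderiv_bound i sa.
have sm := @sc_moll R m; have Z0 := @int_moll_gt0 R m.
(* This kernel dominates the commutator: [D] bounds the derivative of [a], and [L] its oscillation
   divided by the distance. *)
pose psi w := D * moll w + L * `|pderiv i moll w|.
have cm := sc_cc (sc_pderiv i sm).
have cp : cc psi by apply: ccD; [apply: ccZ; exact: sc_cc | apply: ccZ; exact: cc_norm].
have p0 w : 0 <= psi w by rewrite addr_ge0 // mulr_ge0 // moll_ge0.
exists ((I psi / I moll) ^+ 2) => [|e h e0 sh]; first exact: sqr_ge0.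
have cn := cc_norm (sc_cc sh); have sd := sc_pderiv i sh.
have cad : cc (fun y => a y * pderiv i h y) by apply: ccMl; [exact: sc_cont | exact: sc_cc].
pose T x := a x * mol e (pderiv i h) x - mol e (fun y => a y * pderiv i h y) x.
have cT : cc T by apply: ccB; [apply: ccMl; [exact: sc_cont | apply: mol_cc; exact: sc_cc] | exact: mol_cc].
have bT x : `|T x| <= kav psi e (fun y => `|h y|) x / I moll.
  (* The derivative of [F] in [w] has integral 0. This trades [e * I A], which contains a derivative
     of [h], for [I B], which contains none. *)
  pose F w := ((a x - a (x + e *: w)) * h (x + e *: w)) * moll w.
  have sF : sc F.
    apply: sc_mul => //; apply: sgen_smooth openT _; apply: sg_mul; last by apply: sg_base; apply: smooth_affine; case: sh.
    apply: sg_add; first exact: sg_cst.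
    rewrite (_ : (fun w => _) = fun w => -1 * a (x + e *: w)); last by apply/funext => w; rewrite mulN1r.
    by apply: sg_mul; [exact: sg_cst | apply: sg_base; apply: smooth_affine; case: sa].
  pose A w := moll w * ((a x - a (x + e *: w)) * pderiv i h (x + e *: w)).
  pose B w := e * (moll w * pderiv i a (x + e *: w) * h (x + e *: w)) -
    (a x - a (x + e *: w)) * h (x + e *: w) * pderiv i moll w.
  have dF w : pderiv i F w = A w * e - B w.
    have D1 := is_derive_affine x e w i (proj1 sa); have D2 := is_derive_affine x e w i (proj1 sh).
    have D3 := smooth_is_derive w i (proj1 sm).
    have D4 := is_deriveM (is_deriveM (is_deriveB (is_derive_cst (a x) w 'e_i) D1) D2) D3.
    have := derive_val (is_derive := D4); rewrite -/(pderiv i F w) /pderiv /F => ->.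
    rewrite [LHS](_ : _ = (a x - a (x + e *: w)) * h (x + e *: w) * pderiv i moll w + moll w *
      ((a x - a (x + e *: w)) * (e * pderiv i h (x + e *: w)) + h (x + e *: w) * (0 - e * pderiv i a (x + e *: w)))) //.
    by rewrite /A /B /pderiv; ring.
  have [ca ch cdh] := And3 (sc_cont sa) (sc_cont sh) (sc_cont sd).
  have cA : cc A by apply: ccMr; [exact: moll_cc | rewrite /A; cont].
  have cAe : cc (fun w => A w * e) by apply: (ccMr cA); cont.
  have cB : cc B.
    rewrite (_ : B = fun w => A w * e - pderiv i F w); last by apply/funext => w; rewrite dF subKr.
    by apply: ccB cAe _; apply: sc_cc; exact: sc_pderiv.
  have E : T x = I A / I moll.
    rewrite /T /mol mulrA -mulrBl; congr (_ / _).
    rewrite -intZ -?intB.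
    - by congr (I _); apply/funext => w; rewrite /A; ring.
    - by apply: ccZ; apply: mol_cc_arg; exact: sc_cont.
    - exact: (mol_cc_arg e x (proj1 cad)).
    - by apply: mol_cc_arg; exact: sc_cont.
  have IF : e * I A = I B.
    rewrite -intZ //; under eq_fun do rewrite mulrC.
    apply/eqP; rewrite -subr_eq0 -intB // -(int_pderiv_sc i sF); apply/eqP; congr (I _); apply/funext => w.
    by rewrite -/(pderiv i F w) dF.
  rewrite E normrM normfV (gtr0_norm Z0) ler_pM2r ?invr_gt0 //.
  rewrite -(ler_pM2l e0) -[X in X * _](gtr0_norm e0) -normrM IF.
  have -> : e * kav psi e (fun y => `|h y|) x = I (fun w => e * (psi w * `|h (x + e *: w)|)).
    by rewrite intZ //; exact: (kav_cc_arg e x cp (proj1 cn)).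
  apply: int_norm => // [|w]; first by apply: ccZ; exact: (kav_cc_arg e x cp (proj1 cn)).
  rewrite /B mulrA; apply: le_trans (ler_normB _ _) _.
  rewrite !normrM (gtr0_norm e0) (ger0_norm (moll_ge0 w)) [X in _ + X]mulrAC -mulrDl [leRHS]mulrA ler_wpM2r // /psi mulrDr.
  apply: lerD; first by rewrite ler_pM2l // mulrC ler_wpM2r ?moll_ge0 //; exact: aD.
  have [w1|w1] := leP `|w| 1.
    rewrite mulrA ler_wpM2r // (le_trans (aL _ _)) // opprD addNKr normrN normrZ (gtr0_norm e0).
    by rewrite mulrCA ler_pM2l // -[leRHS]mulr1 ler_wpM2l.
  suff -> : pderiv i moll w = 0 by rewrite normr0 !mulr0.
  by apply: (pderiv_out (B := 1)) => // y /moll_far.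
have -> : (I psi / I moll) ^+ 2 * I (fun x => h x ^+ 2) =
    (I moll ^- 2) * (I psi ^+ 2 * I (fun x => `|h x| ^+ 2)).
  under [X in _ = _ * (_ * I X)]eq_fun do rewrite real_normK ?num_real //.
  by rewrite expr_div_n; ring.
apply: le_trans (_ : _ <= (I moll ^- 2) * I (fun x => kav psi e (fun y => `|h y|) x ^+ 2)) _; last first.
  by rewrite ler_pM2l ?invr_gt0 ?exprn_gt0 //; exact: int_kav_sq.
have cK := cc_sqr (kav_cc e cp cn).
rewrite -intZ //; apply: int_le => [||x].
- exact: cc_sqr.
- exact: ccZ.
- rewrite -[leLHS]real_normK ?num_real //.
  have -> : I moll ^- 2 * kav psi e (fun y => `|h y|) x ^+ 2 = (kav psi e (fun y => `|h y|) x / I moll) ^+ 2.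
    by rewrite exprMn exprVn mulrC.
  by rewrite lerXn2r ?nnegrE ?(le_trans (normr_ge0 _) (bT x)) //; exact: bT.
Qed.

Lemma cvg_mol (a f : V -> R) (d : R) : continuous a -> cc f -> 0 < d ->
  exists2 c : R, 0 < c & forall e, 0 <= e -> e < c -> I (fun x => (a x * mol e f x - a x * f x) ^+ 2) < d.
Proof.
move=> ca [cf [B fB]] d0.
(* Truncating the radius keeps the supports uniformly bounded, as continuity of the integral in [e]
   requires. *)
pose cl (e : R) := Num.min 1 `|e|.
have ccl : continuous cl.
  by apply: cont_at => e; apply: continuous_min; [exact: cst_continuous | exact: norm_continuous].
pose F (e : R) x := (a x * mol (cl e) f x - a x * f x) ^+ 2.
have FB e x : B + 1 < `|x| -> F e x = 0.
  move=> xB; rewrite /F (@mol_far _ _ B) ?fB ?mulr0 ?subrr ?expr0n //; first by lra.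
    by rewrite le_min ler01 normr_ge0.
  by apply: le_lt_trans xB; rewrite lerD2l ge_min lexx.
have cF : continuous (fun p : R * V => F p.1 p.2).
  have [cm ccf] := (mol_cont cf, ccl).
  have c3 : continuous (fun p : R * V => mol (cl p.1) f p.2).
    by move=> p; apply: (cont_comp (f := fun p : R * V => (cl p.1, p.2))) (cm _); cont.
  by rewrite /F; apply: cont_at => p; apply: cont_exp; apply: cont_sub; apply: cont_mul; [cont | exact: c3 | cont | cont].
have := @int_cont _ _ _ F 0 (B + 1) _ (fun y => cF (0, y)) FB.
have cFe e : continuous (F e).
  exact: cont_slice cF.
move=> /(_ cFe) /cvgrPdist_lt /(_ d d0) /nbhs_ballP[c /= c0 cP].
have F0 : I (F 0) = 0.
  rewrite /F (_ : cl 0 = 0); last by rewrite /cl normr0 min_r.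
  under [X in I X]eq_fun do rewrite mol0 subrr expr0n.
  exact: int0.
exists (Num.min 1 c) => [|e e0]; first by rewrite lt_min ltr01.
rewrite lt_min => /andP[e1 ec]; have := cP e; rewrite /ball /= sub0r normrN ger0_norm // => /(_ ec).
rewrite F0 sub0r normrN /F (_ : cl e = e); last by rewrite /cl ger0_norm // min_r // ltW.
exact: le_lt_trans (ler_norm _).
Qed.

(* In the sup norm, B + 2 leaves room for the mollification by a radius 1. *)
Definition scut (B : R) : V -> R := mol 1 (plateau (B + 1)).

Lemma sc_scut B : sc (scut B).
Proof.
split; first by apply: mol_smooth (oner_neq0 _) _; exact: cc_plateau.
exists (B + 3) => x xB; apply: (@mol_far _ _ (B + 2)) => [||]; [exact: ler01 | | by lra].
by move=> w wB; rewrite /plateau max_l // ge_min; apply/orP; right; lra.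
Qed.

Lemma scut_far B x : B + 3 < `|x| -> scut B x = 0.
Proof.
move=> xB; apply: (@mol_far _ _ (B + 2)) => [||]; [exact: ler01 | | by lra].
by move=> w wB; rewrite /plateau max_l // ge_min; apply/orP; right; lra.
Qed.

Lemma mol_eq e f g x : (forall w, `|w| <= 1 -> f (x + e *: w) = g (x + e *: w)) -> mol e f x = mol e g x.
Proof.
move=> fg; rewrite /mol; congr (I _ / _); apply/funext => w.
by have [/fg ->|/moll_far ->] := leP `|w| 1; rewrite ?mul0r.
Qed.

Lemma mol_cst e (c : R) x : mol e (fun=> c) x = c.
Proof.
rewrite /mol; under [X in I X / _]eq_fun do rewrite mulrC.
by rewrite intZ ?mulfK // ?gt_eqF ?int_moll_gt0 //; exact: moll_cc.
Qed.

Lemma scut1 B x : `|x| <= B -> scut B x = 1.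
Proof.
move=> xB; rewrite /scut (@mol_eq _ _ (fun=> 1)) ?mol_cst // => w w1; apply: plateau1.
by rewrite scale1r (le_trans (ler_normD _ _)) // lerD.
Qed.

Lemma scut_itv B x : 0 <= scut B x <= 1.
Proof.
have P y : 0 <= plateau (B + 1) y <= 1 by rewrite plateau_ge0 ge_max ler01 ge_min lexx.
have cP := (proj1 (cc_plateau (V := V) (B + 1))).
have Z0 := @int_moll_gt0 R m; have cM e y := mol_cc_arg e y cP.
rewrite /scut /mol ler_pdivrMr // mul1r divr_ge0 ?(ltW Z0) //=; last first.
  by apply: int_ge0 => // w; rewrite mulr_ge0 ?moll_ge0 //; have /andP[] := P (x + 1 *: w).
apply: int_le => // [|w]; first exact: moll_cc.
by rewrite -[leRHS]mulr1 ler_wpM2l ?moll_ge0 //; have /andP[] := P (x + 1 *: w).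
Qed.

End MollifierEstimates.

(** * A Poincare inequality for two weights in one chart *)

Section LocalPoincare.
Context {R : realType} {m : nat}.
Local Notation V := 'rV[R]_m.
Local Notation I := (@integral_rV R _).
Implicit Types (f g b v chi : V -> R) (x y z w h : V).

Definition gsq v x : R := \sum_j pderiv j v x ^+ 2.

Lemma gsq_ge0 v x : 0 <= gsq v x.
Proof. by apply: sumr_ge0 => j _; exact: sqr_ge0. Qed.

Lemma gsq_cont v : smooth_on setT v -> continuous (gsq v).
Proof. by rewrite /gsq; cont. Qed.

Lemma sqr_sum_le (K : finType) (f : K -> R) : (\sum_k f k) ^+ 2 <= #|K|%:R * \sum_k f k ^+ 2.
Proof.
have -> : #|K|%:R * \sum_k f k ^+ 2 = \sum_k \sum_l (f k ^+ 2 + f l ^+ 2) / 2.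
  set S := \sum_k f k ^+ 2; transitivity ((#|K|%:R * S + #|K|%:R * S) / 2); first by field.
  under [RHS]eq_bigr do rewrite -mulr_suml big_split /= sumr_const.
  by rewrite -mulr_suml big_split /= sumrMnl sumr_const !mulr_natl.
rewrite expr2 mulr_suml; apply: ler_sum => k _; rewrite mulr_sumr; apply: ler_sum => l _.
by rewrite ler_pdivlMr //; have := sqr_ge0 (f k - f l); nra.
Qed.

Lemma directional_sq v h x : (\sum_j h 0 j * pderiv j v x) ^+ 2 <= m%:R * `|h| ^+ 2 * gsq v x.
Proof.
apply: le_trans (sqr_sum_le _) _; rewrite card_ord -mulrA ler_wpM2l // /gsq mulr_sumr.
apply: ler_sum => j _; rewrite exprMn ler_wpM2r ?sqr_ge0 //.
by rewrite -[leLHS]real_normK ?num_real // lerXn2r ?nnegrE //; exact: row_norm_ge.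
Qed.

(* Gronwall for t |-> I (b (v (. + t h) - v)^2). *)
Lemma translation_estimate b chi v h (s : R) : cc b -> (forall x, 0 <= b x) -> cc chi ->
  (forall x y, `|y| <= s -> b (x - y) <= chi x) -> smooth_on setT v -> `|h| <= s ->
  I (fun x => b x * (v (x + h) - v x) ^+ 2) <= expR 1 * (m%:R * s ^+ 2 * I (fun x => chi x * gsq v x)).
Proof.
move=> cb b0 cchi bchi sv hs; have s0 : 0 <= s := le_trans (normr_ge0 h) hs.
pose D y := \sum_j h 0 j * pderiv j v y.
have cD : continuous D by rewrite /D; cont.
have cv : continuous v by cont.
pose F t x := b x * (v (x + t *: h) - v x) ^+ 2.
pose F' t x := b x * (2 * (v (x + t *: h) - v x) * D (x + t *: h)).
have [B bB] := proj2 cb.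
have cG := gsq_cont sv.
set G := _ * I _.
have cF t : cc (F t) by apply: ccMr cb _; cont.
have cF'j : continuous (fun p : R * V => F' p.1 p.2) by rewrite /F'; cont.
have cF' t : cc (F' t) by split; [exact: cont_slice cF'j | exists B => x xB; rewrite /F' bB ?mul0r].
have dF (t : R) : is_derive t (1 : R) (fun t => I (F t)) (I (F' t)).
  apply: (@int_derive _ _ F F' B) => //.
  - by move=> u; case: (cF u).
  - move=> u x; have dv : is_derive u (1 : R) (fun u => v (x + u *: h)) (D (x + u *: h)).
      apply: is_derive_line; have [df E] := smooth_differentiable openT sv (z := x + u *: h) Logic.I.
      by rewrite /D -[X in is_derive _ _ _ X]E; apply: derivableP; exact: diff_derivable.
    have dw := is_deriveB dv (is_derive_cst (v x) u (1 : R)).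
    have H := is_deriveZl (b x) (is_deriveM dw dw); rewrite subr0 in H.
    rewrite [F' u x](_ : _ = b x * ((v (x + u *: h) - v x) * D (x + u *: h) + (v (x + u *: h) - v x) * D (x + u *: h))).
      exact: H.
    by rewrite /F'; ring.
  - by move=> u x xB; rewrite /F bB ?mul0r.
have bF (t : R) : 0 <= t <= 1 -> I (F' t) <= I (F t) + G.
  move=> /andP[t0 t1].
  have c1 : cc (fun x => b x * D (x + t *: h) ^+ 2) by apply: ccMr cb _; cont.
  apply: le_trans (_ : _ <= I (F t) + I (fun x => b x * D (x + t *: h) ^+ 2)) _.
    rewrite -intD //; apply: int_le => // [|x]; first exact: ccD.
    by rewrite -mulrDr ler_wpM2l //; have := sqr_ge0 (v (x + t *: h) - v x - D (x + t *: h)); nra.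
  rewrite lerD2l /G -intZ; last exact: ccMr.
  have c2 : cc (fun x => b (x - t *: h) * D x ^+ 2) by apply: ccMr; [exact: cc_shift | cont].
  rewrite -(int_shift (- (t *: h)) c1); under [X in I X]eq_fun do rewrite subrK.
  apply: int_le => // [|x]; first by apply: ccZ; exact: ccMr.
  have th : `|t *: h| <= s by rewrite normrZ ger0_norm // (le_trans _ hs) // ler_piMl.
  have bc := bchi x _ th; have ds := directional_sq v h x.
  apply: le_trans (_ : _ <= chi x * (m%:R * `|h| ^+ 2 * gsq v x)) _.
    by apply: ler_pM => //; exact: sqr_ge0.
  rewrite mulrCA mulrA [leRHS]mulrA ler_wpM2r ?gsq_ge0 // mulrC [leRHS]mulrC ler_wpM2l ?(le_trans (b0 _) bc) //.
  rewrite mulrC [leRHS]mulrC ler_wpM2r //.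
  by rewrite lerXn2r ?nnegrE.
pose g t := expR (- t) * (I (F t) + G).
have dg (t : R) : is_derive t (1 : R) g (expR (- t) * (I (F' t) - (I (F t) + G))).
  have d1 : is_derive t (1 : R) (fun t : R => expR (- t)) (- expR (- t)).
    have [dE _] := is_derive_expR (- t); have := is_derive_comp1 (is_deriveN (is_derive_id t (1 : R))) dE.
    by rewrite (derive_val (is_derive := is_derive_expR (- t))) mulrN1; exact.
  have H := is_deriveM d1 (is_deriveD (dF t) (is_derive_cst G t (1 : R))).
  rewrite (_ : expR (- t) * _ = expR (- t) * (I (F' t) + 0) + (I (F t) + G) * - expR (- t)); first exact: H.
  by ring.
have [u [u1 u0 gu]] := mvt_signed (a := 1) (fun u _ _ => dg u).
have u01 : 0 <= u <= 1 by rewrite mulr1 in u0; rewrite u0; rewrite normr1 in u1; exact: le_trans (ler_norm _) u1.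
have : g 1 <= g 0 by rewrite -subr_le0 gu mulr1 pmulr_rle0 ?expR_gt0 // subr_le0; exact: bF.
have F0 : I (F 0) = 0.
  rewrite /F; under [X in I X]eq_fun do rewrite scale0r addr0 subrr expr0n mulr0.
  exact: int0.
have G0 : 0 <= G.
  rewrite /G mulr_ge0 ?mulr_ge0 ?sqr_ge0 //; apply: int_ge0 => [|x]; first exact: ccMr.
  by rewrite mulr_ge0 ?gsq_ge0 // (le_trans (b0 (x - 0))) // bchi // normr0.
rewrite /g F0 oppr0 expR0 mul1r add0r expRN -(ler_pM2l (expR_gt0 1)) mulVKf ?gt_eqF ?expR_gt0 //.
rewrite /F scale1r => H; apply: le_trans H; by rewrite lerDl.
Qed.

(** The left hand side is the double integral of b(x) b'(y) (v(y) - v(x))^2. After the substitution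
    y = x + h only shifts of length at most [s] contribute, and for each of them
    [translation_estimate] applies. *)
Lemma local_poincare b b' chi (s beta : R) : 0 <= s -> cc b -> (forall x, 0 <= b x) -> cc b' -> (forall x, 0 <= b' x) ->
  cc chi -> (forall x y, `|y| <= s -> b (x - y) <= chi x) -> (forall x h, s < `|h| -> b x * b' (x + h) = 0) ->
  (forall x, b' x <= beta) -> exists2 C : R, 0 <= C & forall v, smooth_on setT v ->
  I b * I (fun x => b' x * v x ^+ 2) - 2 * I (fun x => b x * v x) * I (fun x => b' x * v x)
    + I b' * I (fun x => b x * v x ^+ 2) <= C * I (fun x => chi x * gsq v x).
Proof.
move=> s0 cb b0 cb' b'0 cchi bchi far b'b; have beta0 : 0 <= beta := le_trans (b'0 0) (b'b 0).
have cP := cc_plateau (V := V) s.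
exists (beta * (expR 1 * (m%:R * s ^+ 2)) * I (plateau (V := V) s)) => [|v sv].
  rewrite !mulr_ge0 ?sqr_ge0 ?expR_ge0 //; exact: int_ge0 cP (plateau_ge0 s).
have cv : continuous v by cont.
have cv2 : continuous (fun x => v x ^+ 2) by cont.
have [B bB] := proj2 cb.
pose K h x := b x * (b' (x + h) * (v (x + h) - v x) ^+ 2).
have K0 h x : 0 <= K h x by rewrite mulr_ge0 // mulr_ge0 // sqr_ge0.
have Kx h x : B < `|x| -> K h x = 0 by move=> xB; rewrite /K bB ?mul0r.
have Kh h x : s < `|h| -> K h x = 0 by move=> hs; rewrite /K mulrA far ?mul0r.
have cK : continuous (fun p : V * V => K p.1 p.2) by rewrite /K; cont.
have cKh h : cc (K h) by split; [exact: cont_slice cK | exists B => x; exact: Kx].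
have cIK : cc (fun h => I (K h)).
  split => [h|]; last by exists s => h hs; rewrite (_ : K h = fun=> 0) ?int0 //; apply/funext => x; exact: Kh.
  apply: (@int_cont _ _ _ K h B) => [h'|y|h' x]; [by case: (cKh h') | exact: cK | exact: Kx].
have S := @int_swap R m V (@integral_rV R m) K (Num.max B s) (posfun_int m) (@compact_norm_row R m) cK.
have {}S := S (fun h x => _) (fun h x => _).
have E x : I (K ^~ x) = b x * I (fun y => b' y * v y ^+ 2) - b x * v x * (2 * I (fun y => b' y * v y)) + b x * v x ^+ 2 * I b'.
  have c1 : cc (fun y => b' y * v y ^+ 2) by exact: ccMr.
  have c3 : cc (fun y => b' y * v y) by exact: ccMr.
  have c4 : cc (fun y => b' y * v y ^+ 2 - 2 * v x * (b' y * v y)) by apply: ccB => //; exact: ccZ.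
  have c5 : cc (fun y => b' y * v y ^+ 2 - 2 * v x * (b' y * v y) + v x ^+ 2 * b' y) by apply: ccD => //; exact: ccZ.
  transitivity (b x * I (fun y => b' y * v y ^+ 2 - 2 * v x * (b' y * v y) + v x ^+ 2 * b' y)).
    rewrite -(int_shift x c5) -intZ; last exact: (cc_shift x c5).
    by congr (I _); apply/funext => h; rewrite /K addrC; ring.
  rewrite intD ?intB ?intZ //; try exact: ccZ.
  by ring.
apply: le_trans (_ : _ <= I (fun h => I (K h))) _.
  rewrite -S; last 2 first.
  - by move=> h x; rewrite gt_max => /andP[_]; exact: Kh.
  - by move=> h x; rewrite gt_max => /andP[xB _]; exact: Kx.
  under [X in _ <= I X]eq_fun do rewrite E.
  have c1 : cc (fun x => b x * I (fun y => b' y * v y ^+ 2)) by apply: ccMr => //; exact: cst_continuous.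
  have c3 : cc (fun x => b x * v x) by exact: ccMr.
  have c4 : cc (fun x => b x * v x ^+ 2) by exact: ccMr.
  under [X in _ <= I X]eq_fun do rewrite mulrC [_ * (2 * _)]mulrC [_ * I b']mulrC.
  rewrite intD ?intB ?intZ //; try by do ?[apply: ccB | apply: ccZ].
  by rewrite le_eqVlt; apply/predU1P; left; ring.
set G := I (fun x => chi x * gsq v x).
have -> : beta * (expR 1 * (m%:R * s ^+ 2)) * I (plateau (V := V) s) * G = I (fun h => beta * (expR 1 * (m%:R * s ^+ 2)) * G * plateau s h).
  by rewrite intZ //; ring.
apply: int_le => // [|h]; first exact: ccZ.
have G0 : 0 <= G.
  apply: int_ge0 => [|x]; first by apply: ccMr => //; exact: gsq_cont.
  by rewrite mulr_ge0 ?gsq_ge0 // (le_trans (b0 (x - 0))) // bchi // normr0.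
have [hs|hs] := leP `|h| s; last first.
  rewrite (_ : K h = fun=> 0); last by apply/funext => x; exact: Kh.
  rewrite int0 mulr_ge0 ?plateau_ge0 // !mulr_ge0 ?sqr_ge0 ?expR_ge0 //.
rewrite plateau1 // mulr1; have := translation_estimate cb b0 cchi bchi sv hs; rewrite -/G => T.
apply: le_trans (_ : _ <= beta * I (fun x => b x * (v (x + h) - v x) ^+ 2)) _; last first.
  by rewrite -mulrA ler_wpM2l // -mulrA.
have c6 : cc (fun x => b x * (v (x + h) - v x) ^+ 2) by apply: ccMr cb _; cont.
rewrite -intZ //; apply: int_le => // [|x]; first exact: ccZ.
by rewrite /K mulrCA ler_wpM2r // mulr_ge0 ?sqr_ge0.
Qed.

End LocalPoincare.

(** * The operator u |-> dd^c u /\ G and its Dirichlet form *)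

Section Energy.
Context {R : realType} {n : nat} {M : topologicalType} (X : complex_manifold R n M).
Local Notation m := (n * 2)%N.
Local Notation V := 'rV[R]_m.
Local Notation smooth := (smooth_function X).
Local Notation Jm := (@Jm R n).
Implicit Types (i j : chart_index X) (z : V) (u v f g : M -> R).

Variable w : coef2 X.
Hypothesis kw : kahler_form w.
Hypothesis n0 : (0 < n)%N.
Variable G : seq (coef2 X).
Hypothesis Gn : size G = n.-1.
Hypothesis Gk : forall k, kahler_form (nth w G k).

Lemma G_closed k : two_form (nth w G k) /\ closed_form (nth w G k).
Proof. by have [[]] := Gk k. Qed.

Let Gc := G_closed.
Local Notation cof := (cof G).

Definition grad u i z : V := \row_k pderiv k (u \o inv i) z.

Definition dcf u : Defs.coef1 X := fun i z => grad u i z *m Jm.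

Lemma grad_smooth u i k : smooth u -> smooth_on (U i) (fun z => grad u i z 0 k).
Proof. by move=> su; under eq_fun do rewrite mxE; apply: smooth_pderiv; exact: su. Qed.

Lemma grad_pull u i j z : smooth u -> overlap i j z -> grad u i z = grad u j (T i j z) *m ('J (T i j) z)^T.
Proof.
move=> su o; apply/rowP => k; rewrite !mxE.
have H := pderiv_transition k o (su j).
have E : {near z, u \o inv i =1 (fun x => (u \o inv j) (T i j x))}.
  near=> x; rewrite /= transition_inv //; near: x; apply: open_nbhs_nbhs; split => //; exact: (@overlap_open _ _ _ _ i j).
have -> : pderiv k (u \o inv i) z = pderiv k (fun x => (u \o inv j) (T i j x)) z by exact: near_eq_derive.
rewrite [LHS](derive_val (is_derive := H)).
by apply: eq_bigr => p _; rewrite !mxE mulrC.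
Unshelve. all: by end_near. Qed.

Lemma dcf_form u : smooth u -> one_form (dcf u).
Proof.
move=> su; split=> [i k|i j z Uz dz].
  under eq_fun do rewrite mxE; apply: chart_sgen; apply: sgen_sum => p _; apply: sg_mul; [apply: sg_base; exact: grad_smooth | exact: sg_cst].
have o : overlap i j z by [].
rewrite /dcf (grad_pull su o) -!mulmxA; congr (_ *m _).
have := congr1 trmx (transition_Jm o); rewrite !trmx_mul Jm_tr mulmxN mulNmx => /oppr_inj ->.
by [].
Qed.

Definition cofmx i z : 'M[R]_m := \matrix_(p, q) cof i z p q.

(** Congruence by [Jm] fixes the form [Jm], whose top power is not 0. *)
Lemma det_Jm : \det Jm = 1.
Proof.
have H := wl_Jm_gt0 R n; have := wt_congr Jm (fun k : 'I_n => nth 0 (nseq n Jm) k).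
rewrite /wl in H; rewrite (@eq_wt _ _ _ (fun k : 'I_n => nth 0 (nseq n Jm) k)); last first.
  by move=> k; rewrite nth_nseq ltn_ord Jm_tr mulmxN -mulmxA Jm_sqr mulmxN mulmx1 opprK.
by move=> E; apply: (mulIf (negbT (gt_eqF H))); rewrite mul1r.
Qed.

Lemma G_form11 k i z : U i z -> form11 (nth w G k i z).
Proof. by move=> Uz; have [] := kahler_kah (Gk k) Uz. Qed.

(** The forms in [G] are of type (1,1), so congruence by [Jm], of determinant 1, leaves them and
    hence the functional b |-> b /\ G unchanged. *)
Lemma cof_Jm i z : U i z -> cofmx i z *m Jm = Jm *m cofmx i z.
Proof.
move=> Uz.
have E : Jm^T *m cofmx i z *m Jm = cofmx i z.
  apply/matrixP => p q; rewrite [RHS]mxE.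
  have <- : wedge ((fun _ _ => Jm *m delta_mx p q *m Jm^T) :: G) i z = cof i z p q.
    rewrite /cof /wedge /=; congr (_ * _); rewrite -[RHS]mul1r -det_Jm -wt_congr; apply: eq_wt => -[[|k] kn] //=.
    have kG : (k < size G)%N by rewrite Gn; lia.
    by rewrite (nth_map w) // form11J //; exact: G_form11.
  rewrite wedge_cons // mxE exchange_big; apply: eq_bigr => b _ /=; rewrite mxE mulr_suml; apply: eq_bigr => a _.
  have -> : (Jm *m delta_mx p q *m Jm^T) a b = Jm a p * Jm b q.
    by rewrite -(mul_delta_mx (0 : 'I_1)) mulmxA -mulmxA -colE -rowE mxE big_ord1 !mxE.
  by rewrite !mxE; ring.
by rewrite -{1}E Jm_tr !mulNmx -!mulmxA Jm_sqr !mulmxN mulmx1 opprK.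
Qed.

(** The coefficient matrix of u |-> dd^c u /\ G, an operator without terms of lower order. It is
    symmetric because [cofmx] is antisymmetric and commutes with [Jm]. The factor 2 comes from the
    antisymmetrization in [dform]. *)
Definition symb i z : 'M[R]_m := 2 *: (cofmx i z *m Jm^T).

Lemma symb_tr i z : U i z -> (symb i z)^T = symb i z.
Proof.
move=> Uz; have cT : (cofmx i z)^T = - cofmx i z.
  by apply/matrixP => p q; rewrite !mxE (cof_tr n0).
by rewrite /symb linearZ /= trmx_mul trmxK cT mulmxN -cof_Jm // Jm_tr mulmxN.
Qed.

Lemma symbC i z p q : U i z -> symb i z p q = symb i z q p.
Proof. by move=> Uz; have := congr1 (fun B : 'M[R]_m => B q p) (symb_tr Uz); rewrite mxE. Qed.

Lemma symbE i z p k : symb i z p k = 2 * \sum_q cof i z p q * Jm k q.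
Proof. by rewrite !mxE; congr (_ * _); apply: eq_bigr => q _; rewrite [cofmx _ _ _ _]mxE [Jm^T _ _]mxE. Qed.

Lemma symb_smooth i p q : smooth_on (U i) (fun z => symb i z p q).
Proof.
under eq_fun do rewrite symbE; apply: chart_sgen; apply: sg_mul; first exact: sg_cst.
apply: sgen_sum => k _; apply: sg_mul; last exact: sg_cst.
by apply: sg_base; apply: (cof_smooth n0 Gn Gc).
Qed.

Lemma symb_gt0 i z (x : V) : U i z -> x != 0 -> 0 < \sum_p \sum_q symb i z p q * (x 0 p * x 0 q).
Proof.
move=> Uz x0.
have : 0 < wedge ((fun _ _ => ddc (x^T *m x)) :: G) i z.
  rewrite /wedge /= mulr_gt0 ?invr_gt0 ?exprn_gt0 // wl_ddc_gt0 // ?size_map //.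
  move=> g /(nthP 0)[k]; rewrite size_map => kG <-; rewrite (nth_map w) //; exact: kahler_kah.
suff -> : wedge ((fun _ _ => ddc (x^T *m x)) :: G) i z = \sum_p \sum_q symb i z p q * (x 0 p * x 0 q) by [].
rewrite wedge_cons //.
have tr (B C : 'M[R]_m) : \sum_p \sum_q B p q * C p q = \tr (B^T *m C).
  by rewrite exchange_big; apply: eq_bigr => q _; rewrite mxE; apply: eq_bigr => p _; rewrite mxE.
transitivity (\sum_p \sum_q ddc (x^T *m x) p q * cofmx i z p q).
  by apply: eq_bigr => p _; apply: eq_bigr => q _; rewrite [cofmx _ _ _ _]mxE.
transitivity (\sum_p \sum_q (x^T *m x) p q * symb i z p q); last first.
  by apply: eq_bigr => p _; apply: eq_bigr => q _; rewrite mulrC [(x^T *m x) _ _]mxE big_ord1 [x^T _ _]mxE.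
rewrite !tr /ddc linearD /= mulmxDl linearD /= !trmx_mul trmxK -!mulmxA [X in _ + X]mxtrace_mulC -!mulmxA -linearD /=.
rewrite -mulmxDr -mulmxDr /symb scaler_nat mulr2n Jm_tr !mulmxN !mulNmx -cof_Jm //.
Qed.

(* In a chart, d (v d^c u) /\ G is v times the operator plus the carre du champ. *)
Lemma wedge_dcf v u i z : smooth v -> smooth u -> U i z ->
  wedge (dform (scale1 v (dcf u)) :: G) i z =
    v (inv i z) * (\sum_p \sum_q symb i z p q * pderiv p (pderiv q (u \o inv i)) z)
    + \sum_p \sum_q symb i z p q * (pderiv p (v \o inv i) z * pderiv q (u \o inv i) z).
Proof.
move=> sv su Uz; rewrite wedge_dform //.
have d p q : pderiv p (fun y => scale1 v (dcf u) i y 0 q) z =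
    \sum_k (pderiv p (v \o inv i) z * pderiv k (u \o inv i) z + v (inv i z) * pderiv p (pderiv k (u \o inv i)) z) * Jm k q.
  have Du k := smooth_on_is_derive p (smooth_pderiv k (su i)) Uz.
  have H := is_derive_sumf (index_enum 'I_m) (fun k => is_deriveZl (Jm k q) (is_deriveM (smooth_on_is_derive p (sv i) Uz) (Du k))).
  rewrite /pderiv [X in 'D__ X _ = _](_ : _ = (fun y => \sum_k Jm k q * ((v \o inv i) * pderiv k (u \o inv i)) y)).
    rewrite (derive_val (is_derive := H)); apply: eq_bigr => k _; rewrite mulrC; congr (_ * _).
    by rewrite addrC [LHS](_ : _ = pderiv k (u \o inv i) z * pderiv p (v \o inv i) z + v (inv i z) * pderiv p (pderiv k (u \o inv i)) z) // [X in X + _]mulrC.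
  apply/funext => y; rewrite /scale1 /dcf !mxE mulr_sumr; apply: eq_bigr => k _; rewrite !mxE /= [RHS]mulrC -mulrA.
  by [].
have E (g : 'I_m -> 'I_m -> R) : 2 * \sum_p \sum_q cof i z p q * (\sum_k g p k * Jm k q) = \sum_p \sum_k symb i z p k * g p k.
  rewrite mulr_sumr; apply: eq_bigr => p _; under eq_bigr do rewrite mulr_sumr.
  rewrite exchange_big mulr_sumr; apply: eq_bigr => k _; rewrite symbE -mulrA mulr_suml; congr (_ * _).
  by apply: eq_bigr => q _; ring.
under eq_bigr do under eq_bigr do rewrite d; rewrite E mulr_sumr -big_split; apply: eq_bigr => p _ /=.
by rewrite mulr_sumr -big_split; apply: eq_bigr => q _ /=; ring.
Qed.

Variable A : bump_atlas X.
Local Notation mu := (@mu _ _ _ _ w A).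
Local Notation qt := (quot w).

Definition lap u : M -> R := qt (wedge (dform (dcf u) :: G)).

(** The function dv /\ d^c u /\ G divided by w^n. Defining it as a difference of two quotients makes
    it global at once and gives Green's formula directly from Stokes' theorem. *)
Definition carre v u : M -> R := fun p => qt (wedge (dform (scale1 v (dcf u)) :: G)) p - v p * lap u p.

Lemma scale_dcf_form v u : smooth v -> smooth u -> one_form (scale1 v (dcf u)).
Proof. by move=> sv su; apply: scale1_form => //; exact: dcf_form. Qed.

Lemma lap_cont u : smooth u -> continuous (lap u).
Proof. by move=> su; apply: (quot_cont kw n0); apply: (dform_G_top kw n0 Gn Gc); exact: dcf_form. Qed.

Lemma carre_cont v u : smooth v -> smooth u -> continuous (carre v u).
Proof.
move=> sv su; apply: cont_at => p; apply: cont_sub.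
  by apply: (quot_cont kw n0); apply: (dform_G_top kw n0 Gn Gc); exact: scale_dcf_form.
by apply: cont_mul; [exact: (smooth_fun_continuous sv) | exact: lap_cont].
Qed.

Lemma lapE u i z : smooth u -> U i z ->
  lap u (inv i z) = (\sum_p \sum_q symb i z p q * pderiv p (pderiv q (u \o inv i)) z) / dens w i z.
Proof.
move=> su Uz; rewrite /lap (quotE kw n0) //; last by apply: (dform_G_top kw n0 Gn Gc); exact: dcf_form.
congr (_ / _); have := wedge_dcf (smooth_fun_cst (X := X) 1) su Uz.
have -> : scale1 (fun=> 1) (dcf u) = dcf u by apply/funext => j; apply/funext => y; rewrite /scale1 scale1r.
move=> ->; rewrite mul1r [X in _ + X]big1 ?addr0 // => p _; rewrite big1 // => q _.
by rewrite (_ : pderiv p _ z = 0) ?mul0r ?mulr0 //; exact: derive_cst.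
Qed.

Lemma carreE v u i z : smooth v -> smooth u -> U i z ->
  carre v u (inv i z) = (\sum_p \sum_q symb i z p q * (pderiv p (v \o inv i) z * pderiv q (u \o inv i) z)) / dens w i z.
Proof.
move=> sv su Uz; rewrite /carre lapE // (quotE kw n0) //; last first.
  by apply: (dform_G_top kw n0 Gn Gc); exact: scale_dcf_form.
by rewrite wedge_dcf // mulrDl mulrA addrAC subrr add0r.
Qed.

Lemma green v u : smooth v -> smooth u -> mu (carre v u) = - mu (fun p => v p * lap u p).
Proof.
move=> sv su; have c1 : continuous (fun p => v p * lap u p).
  by apply: cont_at => p; apply: cont_mul; [exact: (smooth_fun_continuous sv) | exact: lap_cont].
rewrite /carre (muB kw) //; first by rewrite (stokes kw n0 Gn Gc) ?sub0r //; exact: scale_dcf_form.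
by apply: (quot_cont kw n0); apply: (dform_G_top kw n0 Gn Gc); exact: scale_dcf_form.
Qed.

Lemma carreC v u p : smooth v -> smooth u -> carre v u p = carre u v p.
Proof.
move=> sv su; have [i di Uz] := dom_chart X p.
rewrite -(chartK di) !carreE //; congr (_ / _); rewrite exchange_big; apply: eq_bigr => k _; apply: eq_bigr => l _.
by rewrite (symbC l k Uz) [X in _ * X = _]mulrC.
Qed.

End Energy.

(** * Poincare inequality *)

Section Poincare.
Context {R : realType} {n : nat} {M : topologicalType} (X : complex_manifold R n M).
Local Notation m := (n * 2)%N.
Local Notation V := 'rV[R]_m.
Local Notation I := (@integral_rV R _).
Local Notation smooth := (smooth_function X).

Variable w : coef2 X.
Hypothesis kw : kahler_form w.
Hypothesis n0 : (0 < n)%N.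
Variable G : seq (coef2 X).
Hypothesis Gn : size G = n.-1.
Hypothesis Gk : forall k, kahler_form (nth w G k).
Variable A : bump_atlas X.
Local Notation c := (@bchart _ _ _ _ A).
Local Notation x0 := (@bcenter _ _ _ _ A).
Local Notation r := (@bradius _ _ _ _ A).
Local Notation mu := (@mu _ _ _ _ w A).
Local Notation carre := (carre w G).
Local Notation symb := (symb G).
Implicit Types (k l : ball_index A) (z : V) (u v f g b : M -> R) (h chi : V -> R).

Local Notation off k s h := (forall z, ~ cball k s z -> h z = 0).

Definition ccut k (s : R) z : R := scut s ((r k)^-1 *: (z - x0 k)).

Lemma rescaled_norm k (s : R) z : (`|(r k)^-1 *: (z - x0 k)| <= s) <-> cball k s z.
Proof. by have r0 := bradius_gt0 k; rewrite /cball /= normrZ normfV gtr0_norm // ler_pdivrMl // mulrC. Qed.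

Lemma ccut_smooth k s : smooth_on setT (ccut k s).
Proof.
apply: sgen_smooth openT _; apply: (@sg_compn R m setT m setT (@scut R m s) (fun z => (r k)^-1 *: (z - x0 k))) => //.
- exact: openT.
- by case: (sc_scut (m := m) s).
- by move=> j; under eq_fun do rewrite !mxE; apply: sg_mul; [exact: sg_cst | apply: sg_add; [exact: sg_coord | exact: sg_cst]].
Qed.

Lemma ccut1 k s z : cball k s z -> ccut k s z = 1.
Proof. by move=> /rescaled_norm; exact: scut1. Qed.

Lemma ccut_far k s z : ~ cball k (s + 3) z -> ccut k s z = 0.
Proof. by move=> nz; apply: scut_far; rewrite ltNge; apply/negP => /rescaled_norm. Qed.

Lemma ccut_itv k s z : 0 <= ccut k s z <= 1. Proof. exact: scut_itv. Qed.

Lemma cball_bounded k s : exists B, forall z, B < `|z| -> ~ cball k s z.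
Proof.
have /compact_bounded [B [_ BP]] := @cball_compact _ _ _ _ A k s; exists (B + 1) => z zB Kz.
by have := BP (B + 1) _ z Kz; rewrite ltrDl ltr01 => /(_ isT) /=; rewrite leNgt zB.
Qed.

Lemma cball_cc k s h : continuous h -> off k s h -> cc h.
Proof. by move=> ch hf; split => //; have [B BP] := cball_bounded k s; exists B => z /BP /hf. Qed.

Lemma cball1_sub k : cball k 1 `<=` U (c k). Proof. by apply: cball_sub; exact: le1_10. Qed.

Lemma cball1_bset k z : U (c k) z -> bset k (inv (c k) z) -> cball k 1 z.
Proof.
move=> Uz [y Ky E]; rewrite -(chart_invK Uz) -E chart_invK //; exact: cball1_sub.
Qed.

Lemma ccut3_cont k : continuous (ccut k 3). Proof. by move=> z; exact: (smooth_cont (ccut_smooth k 3)). Qed.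

Lemma ccut3_far k z : ~ cball k 6 z -> ccut k 3 z = 0.
Proof. by move=> nK; apply: ccut_far; rewrite (_ : 3 + 3 = 6 :> R) //; lra. Qed.

Lemma ccut3_cc k : cc (ccut k 3). Proof. exact: (cball_cc (@ccut3_cont k) (@ccut3_far k)). Qed.

Lemma ccut3_ge0 k z : 0 <= ccut k 3 z. Proof. by have /andP[] := ccut_itv k 3 z. Qed.

(** A function on a chart made into a test function on the whole space. It agrees with [h] on 7
    radii, so its first derivatives agree on 6 and its second ones on 5, with room for
    neighbourhoods. *)
Definition glob k h : V -> R := (fun z => ccut k 7 z * h z) \_ (U (c k)).

Lemma seven_three : (7 + 3 : R) = 10. Proof. lra. Qed.

Lemma glob_sc k h : smooth_on (U (c k)) h -> sc (glob k h).
Proof.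
move=> sh; have sg : smooth_on (U (c k)) (fun z => ccut k 7 z * h z).
  by apply: chart_sgen; apply: sg_mul; apply: sg_base => //; apply: smooth_sub (ccut_smooth k 7).
apply: (proj1 (sc_ext (image_open (c k)) (@cball_compact _ _ _ _ A k 10) (@cball_sub _ _ _ _ A k 10 (lexx _)) sg _)).
by move=> z _ nz; rewrite ccut_far ?mul0r // seven_three.
Qed.

Lemma globE k h z : cball k 7 z -> glob k h z = h z.
Proof. by move=> Kz; rewrite /glob patchE mem_set ?ccut1 ?mul1r //; apply: cball_sub Kz; lra. Qed.

Lemma near_cball k (s t : R) z : s < t -> cball k s z -> \near z, cball k t z.
Proof.
move=> st Kz; have r0 := bradius_gt0 k.
have d0 : 0 < (t - s) * r k by rewrite mulr_gt0 // subr_gt0.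
apply/nbhs_ballP; exists ((t - s) * r k) => // y; rewrite -ball_normE /= => yz.
rewrite /cball /= -(subrKA z); have := ler_normD (y - z) (z - x0 k); rewrite distrC in yz; rewrite /cball /= in Kz; move=> H; apply: le_trans H _; have -> : t * r k = (t - s) * r k + s * r k by ring.
by apply: lerD => //; exact: ltW.
Qed.

Lemma pderiv_glob k h p z : cball k 6 z -> pderiv p (glob k h) z = pderiv p h z.
Proof.
move=> Kz; apply: near_eq_derive; have H : (6 : R) < 7 by lra.
by apply: filterS (near_cball H Kz) => y; exact: globE.
Qed.

Lemma sc_bounded h : sc h -> exists2 C : R, 0 <= C & forall z, `|h z| <= C.
Proof. by move=> sh; apply: cc_bounded; [exact: compact_norm_row | exact: sc_cc]. Qed.

Lemma chart_mul_cc k chi h : continuous chi -> off k 6 chi ->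
  (forall z, U (c k) z -> {for z, continuous h}) -> cc (fun z => chi z * h z).
Proof.
move=> cchi fchi ch; apply: (cball_cc (k := k) (s := 6)); last by move=> z /fchi ->; rewrite mul0r.
have -> : (fun z => chi z * h z) = (fun z => chi z * h z) \_ (U (c k)).
  apply/funext => z; rewrite patchE; case: ifPn => // /negP nU; rewrite fchi ?mul0r // => Kz; apply: nU.
  by apply: mem_set; apply: cball_sub Kz; lra.
apply: (@ext_continuous R V (U (c k)) (cball k 6)).
- exact: image_open.
- by apply: compact_closedV; exact: cball_compact.
- by apply: cball_sub; lra.
- by move=> z Uz; cont.
- by move=> z _ /fchi ->; rewrite mul0r.
Qed.

Lemma push_chi_cont k chi : continuous chi -> off k 6 chi -> continuous (push (X := X) (c k) chi).
Proof.
move=> cchi fchi; apply: (push_continuous (K := cball k 6)); first exact: cball_compact.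
- by apply: cball_sub; lra.
- by cont.
- by move=> z _; exact: fchi.
Qed.

Lemma push_chi_smooth k chi : smooth_on setT chi -> off k 6 chi -> smooth (push (c k) chi).
Proof.
move=> cchi fchi; apply: (push_smooth kw (K := cball k 6)) => //; first exact: cball_compact.
- by apply: cball_sub; lra.
- exact: smooth_sub cchi.
- by move=> z _; exact: fchi.
Qed.

Lemma push_out6 k chi p : off k 6 chi -> ~ (inv (c k) @` cball k 6) p -> push (X := X) (c k) chi p = 0.
Proof.
move=> fchi np; have [dp|ndp] := pselect (dom (c k) p); last by rewrite push_out.
by rewrite push_in //; apply: fchi => Kp; apply: np; exists (chart (c k) p) => //; exact: chartK.
Qed.

Lemma mu_chart k chi f h : continuous chi -> off k 6 chi -> continuous f ->
  (forall z, cball k 6 z -> h z = f (inv (c k) z) * dens w (c k) z) ->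
  mu (fun p => push (c k) chi p * f p) = I (fun z => chi z * h z).
Proof.
move=> cchi fchi cf hE; have s6 : (6 : R) <= 10 by lra.
rewrite (mu_local kw n0 A (i := c k) (B := inv (c k) @` cball k 6)).
- rewrite /local_int; congr (I _); apply/funext => z; rewrite patchE; case: ifPn => [/set_mem Uz|/negP nU].
    rewrite push_inv //; have [Kz|nK] := pselect (cball k 6 z); first by rewrite hE // mulrA.
    by rewrite fchi ?mul0r.
  by rewrite fchi ?mul0r // => Kz; apply: nU; apply: mem_set; exact: cball_sub Kz.
- by apply: cont_at => p; apply: cont_mul; [exact: push_chi_cont | exact: cf].
- apply: inv_compact; [exact: cball_compact | exact: cball_sub].
- by apply: inv_image_dom; exact: cball_sub.
- by move=> p np; rewrite (push_out6 fchi np) mul0r.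
Qed.

Lemma mu_chart_le k chi f h : continuous chi -> (forall z, 0 <= chi z <= 1) -> off k 6 chi ->
  continuous f -> (forall p, 0 <= f p) -> (forall z, cball k 6 z -> h z = f (inv (c k) z) * dens w (c k) z) ->
  I (fun z => chi z * h z) <= mu f.
Proof.
move=> cchi ichi fchi cf f0 hE; rewrite -(mu_chart cchi fchi cf hE); apply: (mu_le kw n0) => // [|p].
  by apply: cont_at => p; apply: cont_mul; [exact: push_chi_cont | exact: cf].
have [dp|ndp] := pselect (dom (c k) p); last by rewrite push_out ?mul0r.
by rewrite push_in // ler_piMl //; have /andP[] := ichi (chart (c k) p).
Qed.

Lemma symb_cont i p q z : U i z -> {for z, continuous (fun z => symb i z p q)}.
Proof. exact: smooth_cont (symb_smooth n0 Gn Gk i p q). Qed.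

Lemma symb_coercive k : exists2 e : R, 0 < e & forall h z, cball k 6 z ->
  e * gsq h z <= \sum_p \sum_q symb (c k) z p q * (pderiv p h z * pderiv q h z).
Proof.
have s6 : (6 : R) <= 10 by lra.
have [x v Kz|x s v Kz|x v Kz v0|e e0 eP] := @quad_coercive R V m (cball k 6)
  (fun zv => \sum_p \sum_q symb (c k) zv.1 p q * (zv.2 0 p * zv.2 0 q)) (@cball_compact _ _ _ _ A k 6).
- have Ux : U (c k) x by exact: cball_sub Kz.
  change {for (x, v), continuous (fun zv : V * V => \sum_p \sum_q symb (c k) zv.1 p q * (zv.2 0 p * zv.2 0 q))}.
  apply: cont_sum => p _; apply: cont_sum => q _; apply: cont_mul.
    by apply: (@continuous_comp _ _ _ fst (fun z => symb (c k) z p q)); [exact: cvg_fst | exact: symb_cont].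
  by cont.
- rewrite mulr_sumr; apply: eq_bigr => p _; rewrite mulr_sumr; apply: eq_bigr => q _; rewrite /= !mxE; ring.
- by apply: (symb_gt0 n0 Gn Gk) => //; exact: cball_sub Kz.
have m0 : 0 < m%:R :> R by rewrite ltr0n muln_gt0 n0.
exists (e / m%:R) => [|h z Kz]; first by rewrite divr_gt0.
apply: le_trans (_ : _ <= e * `|\row_p pderiv p h z : V| ^+ 2) _; last first.
  apply: le_trans (eP z (\row_p pderiv p h z) Kz) _; rewrite le_eqVlt; apply/predU1P; left.
  by apply: eq_bigr => p _; apply: eq_bigr => q _; congr (_ * (_ * _)); rewrite mxE.
rewrite -mulrA ler_pM2l // mulrC ler_pdivrMr // mulr_natr -[X in _ *+ X]card_ord -sumr_const.
apply: ler_sum => p _; rewrite -[leLHS]real_normK ?num_real // lerXn2r ?nnegrE //.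
by apply: le_trans (row_norm_ge _ p); rewrite mxE.
Qed.

Definition energy u := mu (carre u u).

Lemma carre_chart k u z : smooth u -> cball k 6 z ->
  carre u u (inv (c k) z) * dens w (c k) z =
    \sum_p \sum_q symb (c k) z p q * (pderiv p (glob k (u \o inv (c k))) z * pderiv q (glob k (u \o inv (c k))) z).
Proof.
move=> su Kz; have Uz : U (c k) z by apply: cball_sub Kz; lra.
rewrite (carreE kw n0 Gn Gk) // divfK ?gt_eqF ?(dens_gt0 kw n0 Uz) //.
by apply: eq_bigr => p _; apply: eq_bigr => q _; rewrite !pderiv_glob.
Qed.

Lemma carre_ge0 u p : smooth u -> 0 <= carre u u p.
Proof.
move=> su; have [k dk pk] := bball_cover A p; set z := chart (c k) p.
have Kz : cball k 6 z.
  apply/rescaled_norm; rewrite leNgt; apply/negP => zr.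
  have := sqn_ge ((r k)^-1 *: (z - x0 k)); rewrite -/z in pk; have := normr_ge0 ((r k)^-1 *: (z - x0 k)); nra.
have Uz : U (c k) z by apply: cball_sub Kz; lra.
have [e e0 eP] := symb_coercive k.
rewrite -(chartK dk) -(pmulr_lge0 _ (dens_gt0 kw n0 Uz)) carre_chart //.
by apply: le_trans (eP _ z Kz); rewrite mulr_ge0 ?gsq_ge0 // ltW.
Qed.

Lemma energy_ge0 u : smooth u -> 0 <= energy u.
Proof. by move=> su; apply: (mu_ge0 kw n0) => [|p]; [exact: carre_cont | exact: carre_ge0]. Qed.

(** By ellipticity the squared gradient in a chart is dominated pointwise by the density of the
    energy. *)
Lemma energy_local k : exists2 C : R, 0 <= C & forall u, smooth u ->
  I (fun z => ccut k 3 z * gsq (glob k (u \o inv (c k))) z) <= C * energy u.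
Proof.
have [e e0 eP] := symb_coercive k; exists e^-1 => [|u su]; first by rewrite invr_ge0 ltW.
have [ccut3 far3] := (@ccut3_cont k, @ccut3_far k).
have sg : sc (glob k (u \o inv (c k))) by apply: glob_sc; exact: su.
rewrite ler_pdivlMl // -intZ; last first.
  by apply: ccMr; [exact: ccut3_cc | apply: gsq_cont; case: sg].
pose h z := \sum_p \sum_q symb (c k) z p q * (pderiv p (glob k (u \o inv (c k))) z * pderiv q (glob k (u \o inv (c k))) z).
have cd p : continuous (pderiv p (glob k (u \o inv (c k)))) by apply: sc_cont; exact: sc_pderiv.
have H := mu_chart_le (h := h) ccut3 (ccut_itv k 3) far3 (carre_cont kw n0 Gn Gk su su) (fun p => carre_ge0 p su).
apply: le_trans (H _); last by move=> z Kz; rewrite /h carre_chart.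
apply: int_le => [||z].
- by apply: ccZ; apply: ccMr; [exact: ccut3_cc | apply: gsq_cont; case: sg].
- apply: (chart_mul_cc (k := k)) => // z Uz; apply: cont_sum => p _; apply: cont_sum => q _.
  by apply: cont_mul; [exact: symb_cont | cont].
have [Kz|nK] := pselect (cball k 6 z); last by rewrite far3 ?mul0r ?mulr0.
by rewrite mulrCA ler_wpM2l ?eP ?ccut3_ge0.
Qed.

Lemma mu_cs b f g : continuous b -> (forall p, 0 <= b p) -> continuous f -> continuous g ->
  mu (fun p => b p * (f p * g p)) ^+ 2 <= mu (fun p => b p * f p ^+ 2) * mu (fun p => b p * g p ^+ 2).
Proof.
move=> cb b0 cf cg.
have c2 f1 g1 : continuous f1 -> continuous g1 -> continuous (fun p => b p * (f1 p * g1 p)).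
  by cont.
have E1 : mu (fun p => b p * f p ^+ 2) = mu (fun p => b p * (f p * f p)) by [].
apply: discriminant_le => [|t].
  by apply: (mu_ge0 kw n0) => [|p]; [exact: c2 | rewrite mulr_ge0 ?sqr_ge0].
have cz a f1 g1 : continuous f1 -> continuous g1 -> continuous (fun p => a * (b p * (f1 p * g1 p))).
  by move=> c1 c3; cont.
have -> : t ^+ 2 * mu (fun p => b p * f p ^+ 2) + 2 * t * mu (fun p => b p * (f p * g p)) + mu (fun p => b p * g p ^+ 2) =
    mu (fun p => t ^+ 2 * (b p * (f p * f p)) + (2 * t * (b p * (f p * g p)) + b p * (g p * g p))).
  rewrite (muD kw); [|exact: cz|]; last by apply: cont_at => p; cont.
  rewrite (muD kw); [|exact: cz|exact: c2].
  by rewrite !(muZ kw) ?addrA //; exact: c2.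
apply: (mu_ge0 kw n0) => [|p].
  by apply: cont_at => p; cont.
rewrite (_ : _ + _ = b p * (t * f p + g p) ^+ 2); last by ring.
by rewrite mulr_ge0 ?sqr_ge0.
Qed.

(** The numbers [e], [a], [s] are mass, first and second moment of a function under three weights.
    The inequality is (v(x) - v(z))^2 <= 2 (v(x) - v(y))^2 + 2 (v(y) - v(z))^2 integrated; it is
    proved by centring at the mean [d] of the middle weight. *)
Lemma spread_triangle (e0 e1 e2 a0 a1 a2 s0 s1 s2 : R) : 0 <= e0 -> 0 < e1 -> 0 <= e2 ->
  a0 ^+ 2 <= e0 * s0 -> a1 ^+ 2 <= e1 * s1 -> a2 ^+ 2 <= e2 * s2 -> 0 <= s0 -> 0 <= s2 ->
  e1 * (e0 * s2 - 2 * a0 * a2 + e2 * s0) <=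
    2 * (e2 * (e0 * s1 - 2 * a0 * a1 + e1 * s0) + e0 * (e1 * s2 - 2 * a1 * a2 + e2 * s1)).
Proof.
move=> p0 p1 p2 H0 H1 H2 q0 q2; pose d := a1 / e1; have a1E : a1 = d * e1 by rewrite divfK // gt_eqF.
have H1' : 0 <= s1 - d ^+ 2 * e1.
  by rewrite subr_ge0 -(ler_pM2l p1); move: H1; rewrite a1E => H; apply: le_trans _ H; rewrite le_eqVlt; apply/predU1P; left; ring.
pose S0 := s0 - 2 * d * a0 + d ^+ 2 * e0; pose S2 := s2 - 2 * d * a2 + d ^+ 2 * e2.
pose A0 := a0 - d * e0; pose A2 := a2 - d * e2.
have HA0 : A0 ^+ 2 <= e0 * S0 by rewrite -subr_ge0 (_ : _ - _ = e0 * s0 - a0 ^+ 2) ?subr_ge0 // /A0 /S0; ring.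
have HA2 : A2 ^+ 2 <= e2 * S2 by rewrite -subr_ge0 (_ : _ - _ = e2 * s2 - a2 ^+ 2) ?subr_ge0 // /A2 /S2; ring.
have S_ge0 e a s : 0 <= e -> 0 <= s -> a ^+ 2 <= e * s -> 0 <= s - 2 * d * a + d ^+ 2 * e.
  rewrite le_eqVlt => /predU1P[<-|e_gt0] s_ge0 H.
    have -> : a = 0 by apply/eqP; rewrite -sqrf_eq0 eq_le sqr_ge0 andbT; rewrite mul0r in H.
    by rewrite !mulr0 subr0 addr0.
  rewrite -(pmulr_rge0 _ e_gt0); have := sqr_ge0 (a - d * e); nra.
have HS0 : 0 <= S0 by exact: S_ge0.
have HS2 : 0 <= S2 by exact: S_ge0.
have K : 0 <= e2 * S0 + e0 * S2 + 2 * (A0 * A2).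
  have pq : (A0 * A2) ^+ 2 <= (e2 * S0) * (e0 * S2).
    rewrite exprMn (_ : e2 * S0 * _ = (e0 * S0) * (e2 * S2)); last by ring.
    by apply: ler_pM; rewrite ?sqr_ge0.
  have u0 : 0 <= e2 * S0 + e0 * S2 by rewrite addr_ge0 ?mulr_ge0.
  have : `|2 * (A0 * A2)| <= e2 * S0 + e0 * S2.
    rewrite -ler_sqr ?nnegrE // real_normK ?num_real //.
    by have := sqr_ge0 (e2 * S0 - e0 * S2); nra.
  by rewrite ler_norml => /andP[H _]; rewrite addrC -lerBlDr sub0r.
rewrite -subr_ge0 (_ : _ - _ = e1 * (e2 * S0 + e0 * S2 + 2 * (A0 * A2)) + 4 * (e0 * e2 * (s1 - d ^+ 2 * e1))); last first.
  by rewrite /S0 /S2 /A0 /A2 a1E; ring.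
by rewrite addr_ge0 // ?mulr_ge0 // ltW.
Qed.

(* For continuous weights b and b' this is the double integral of
   b(x) b'(y) (v(x) - v(y))^2. *)
Definition spread b b' v := mu b * mu (fun p => b' p * v p ^+ 2)
  - 2 * mu (fun p => b p * v p) * mu (fun p => b' p * v p) + mu b' * mu (fun p => b p * v p ^+ 2).

(** A Poincare inequality between two weights; [linked_trans] carries it along chains of weights. *)
Definition linked b b' := exists2 C : R, 0 <= C & forall v, smooth v -> spread b b' v <= C * energy v.

Lemma linkedC b b' : linked b b' -> linked b' b.
Proof. by move=> [C C0 CP]; exists C => // v /CP; rewrite /spread; congr (_ <= _); ring. Qed.

Lemma linked_trans b0 b1 b2 : continuous b0 -> continuous b1 -> continuous b2 ->
  (forall p, 0 <= b0 p) -> (forall p, 0 <= b1 p) -> (forall p, 0 <= b2 p) -> 0 < mu b1 ->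
  linked b0 b1 -> linked b1 b2 -> linked b0 b2.
Proof.
move=> c0 c1 c2 p0 p1 p2 m1 [C C0 CP] [D D0 DP].
have z0 : 0 <= mu b0 by exact: (mu_ge0 kw n0).
have z2 : 0 <= mu b2 by exact: (mu_ge0 kw n0).
exists (2 * (mu b2 * C + mu b0 * D) / mu b1) => [|v sv].
  by rewrite divr_ge0 ?mulr_ge0 ?addr_ge0 ?mulr_ge0 // ltW.
have cv := smooth_fun_continuous sv.
have cs b : continuous b -> (forall p, 0 <= b p) -> mu (fun p => b p * v p) ^+ 2 <= mu b * mu (fun p => b p * v p ^+ 2).
  move=> cb pb; have := mu_cs cb pb (fun p => @cst_continuous _ _ (1 : R) p) cv.
  under [X in mu X ^+ 2]eq_fun do rewrite mul1r.
  by under [X in mu X * _]eq_fun do rewrite expr1n mulr1.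
have := CP v sv; have := DP v sv; have := cs _ c0 p0; have := cs _ c1 p1; have := cs _ c2 p2.
have cv2 b : continuous b -> (forall p, 0 <= b p) -> 0 <= mu (fun p => b p * v p ^+ 2).
  move=> cb pb; apply: (mu_ge0 kw n0) => [|p]; last by rewrite mulr_ge0 ?sqr_ge0.
  by cont.
move=> H2 H1 H0 D12 D01; have T := spread_triangle z0 m1 z2 H0 H1 H2 (cv2 _ c0 p0) (cv2 _ c2 p2).
rewrite [leRHS]mulrAC ler_pdivlMr // [leLHS]mulrC; apply: le_trans T _; rewrite -[leRHS]mulrA ler_pM2l //.
by rewrite [leRHS]mulrDl; apply: lerD; rewrite -[leRHS]mulrA; apply: ler_wpM2l.
Qed.

Lemma bset_linked k b b' : continuous b -> (forall p, 0 <= b p) -> (forall p, ~ bset k p -> b p = 0) ->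
  continuous b' -> (forall p, 0 <= b' p) -> (forall p, ~ bset k p -> b' p = 0) -> linked b b'.
Proof.
move=> cb b0 bf cb' b'0 b'f; have r0 := bradius_gt0 k.
pose t (b : M -> R) : V -> R := (fun z => b (inv (c k) z) * dens w (c k) z) \_ (U (c k)).
have ct (f : M -> R) : continuous f -> (forall p, ~ bset k p -> f p = 0) -> cc (t f).
  move=> cf ff; apply: (local_cc kw (A := bset k)) => //; [exact: bset_compact | exact: bset_dom].
have tf (f : M -> R) z : (forall p, ~ bset k p -> f p = 0) -> ~ cball k 1 z -> t f z = 0.
  move=> ff nK; rewrite /t patchE; case: ifP => // /set_mem Uz; by rewrite ff ?mul0r // => /(cball1_bset Uz).
have t0 (f : M -> R) z : (forall p, 0 <= f p) -> 0 <= t f z.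
  by move=> f0; rewrite /t patchE; case: ifP => // /set_mem Uz; rewrite mulr_ge0 // ltW // (dens_gt0 kw n0 Uz).
have muE (f g : M -> R) (h : V -> R) : continuous f -> (forall p, ~ bset k p -> f p = 0) -> continuous g ->
    (forall z, cball k 1 z -> h z = g (inv (c k) z)) -> mu (fun p => f p * g p) = I (fun z => t f z * h z).
  move=> cf ff cg hE; rewrite (mu_local kw n0 A (i := c k) (B := bset k)).
  - rewrite /local_int; congr (I _); apply/funext => z; have [Kz|nK] := pselect (cball k 1 z).
      have Uz := cball1_sub Kz.
      by rewrite hE // /t !patchE mem_set // mulrAC.
    by rewrite tf // mul0r patchE; case: ifP => // /set_mem Uz; rewrite ff ?mul0r // => /(cball1_bset Uz).
  - by cont.
  - exact: bset_compact.
  - exact: bset_dom.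
  - by move=> p /ff ->; rewrite mul0r.
have [beta beta0 betaP] := cc_bounded (@compact_norm_row R m) (ct _ cb bf).
have [beta' _ beta'P] := cc_bounded (@compact_norm_row R m) (ct _ cb' b'f).
have [C C0 CP] := energy_local k.
(* Two points of the unit ball differ by at most two radii, and a translate of [b] by that much
   stays within three radii, where [ccut k 3] is 1. *)
pose chi z := beta * ccut k 3 z.
have cchi : cc chi by apply: ccZ; exact: ccut3_cc.
have bchi x y : `|y| <= 2 * r k -> t b (x - y) <= chi x.
  move=> yr; rewrite /chi; have [Kx|nK] := pselect (cball k 3 x).
    by rewrite ccut1 // mulr1; exact: le_trans (ler_norm _) (betaP _).
  rewrite tf //; first by rewrite mulr_ge0 // ccut3_ge0.
  move=> K1; apply: nK; rewrite /cball /= in K1 *; rewrite (_ : x - x0 k = (x - y - x0 k) + y); last by rewrite addrAC subrK.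
  by apply: le_trans (ler_normD _ _) _; rewrite (_ : 3 * r k = 1 * r k + 2 * r k); [exact: lerD | ring].
have far x (y : V) : 2 * r k < `|y| -> t b x * t b' (x + y) = 0.
  move=> yr; have [Kx|nK] := pselect (cball k 1 x); last by rewrite tf ?mul0r.
  rewrite [t b' _]tf ?mulr0 // => K1; rewrite /cball /= in K1 Kx; move: yr; rewrite ltNge => /negP; apply.
  rewrite (_ : y = (x + y - x0 k) - (x - x0 k)); last by rewrite opprB addrA subrK addrAC subrr add0r.
  by apply: le_trans (ler_normB _ _) _; rewrite (_ : 2 * r k = 1 * r k + 1 * r k); [exact: lerD | ring].
have r2 : 0 <= 2 * r k by rewrite mulr_ge0 // ltW.
have [D D0 DP] := local_poincare r2 (ct _ cb bf) (fun z => t0 b z b0) (ct _ cb' b'f) (fun z => t0 b' z b'0) cchi bchi far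
  (fun z => le_trans (ler_norm _) (beta'P z)).
exists (D * (beta * C)) => [|v sv]; first by rewrite !mulr_ge0.
have sg : sc (glob k (v \o inv (c k))) by apply: glob_sc; exact: sv.
have cv := smooth_fun_continuous sv.
have gE z : cball k 1 z -> glob k (v \o inv (c k)) z = v (inv (c k) z).
  by move=> Kz; rewrite globE //; apply: cball_mono Kz; lra.
have cv2 : continuous (fun p => v p ^+ 2) by cont.
have c1 (f : M -> R) : mu f = mu (fun p => f p * 1) by congr mu; apply/funext => p; rewrite mulr1.
rewrite /spread (c1 b) (c1 b').
rewrite (muE b (fun=> 1) (fun=> 1)) ?(muE b' (fun=> 1) (fun=> 1)) //; try exact: cst_continuous.
rewrite (muE b v _ cb bf cv gE) (muE b' v _ cb' b'f cv gE).
rewrite (muE b _ (fun z => glob k (v \o inv (c k)) z ^+ 2) cb bf cv2); last by move=> z Kz; rewrite gE.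
rewrite (muE b' _ (fun z => glob k (v \o inv (c k)) z ^+ 2) cb' b'f cv2); last by move=> z Kz; rewrite gE.
under [X in I X * _ - _]eq_fun do rewrite mulr1.
under [X in _ + I X * _]eq_fun do rewrite mulr1.
apply: le_trans (DP _ (proj1 sg)) _; rewrite -!mulrA ler_wpM2l //.
under [X in I X]eq_fun do rewrite /chi -mulrA.
rewrite intZ; first by rewrite ler_wpM2l //; exact: CP.
by apply: ccMr; [exact: ccut3_cc | apply: gsq_cont; case: sg].
Qed.

Lemma bset_center k : exists p, 0 < bfun k p.
Proof.
have Uz : U (c k) (x0 k) by apply: bball_in; rewrite subrr normr0 mulr_ge0 // ltW // bradius_gt0.
exists (inv (c k) (x0 k)); rewrite /bfun (push_inv _ Uz).
by rewrite -[ltRHS]/(moll ((r k)^-1 *: (x0 k - x0 k))) subrr scaler0 moll_gt0 // sqn0.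
Qed.

Lemma rho_gt0 k p : 0 < bfun k p -> 0 < rho k p.
Proof. by move=> H; rewrite /rho divr_gt0 // bsum_gt0. Qed.

Let rc k : continuous (rho k) := @rho_cont _ _ _ _ _ kw A k.

(** The product of the two weights lives in both balls and has positive mass, so it links them. *)
Lemma overlap_linked k l p : 0 < bfun k p -> 0 < bfun l p -> linked (rho k) (rho l).
Proof.
move=> /rho_gt0 kp /rho_gt0 lp; pose b q := rho k q * rho l q.
have cb : continuous b by apply: cont_at => q; apply: cont_mul; exact: rc.
have b0 q : 0 <= b q by rewrite mulr_ge0 ?rho_ge0.
have bf (j : ball_index A) : (forall q, ~ bset j q -> b q = 0) -> linked b (rho j).
  by move=> H; apply: (bset_linked (k := j) cb b0 H); [exact: rc | exact: rho_ge0 | exact: rho_out].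
apply: (linked_trans (b1 := b) (@rc k) cb (@rc l) (rho_ge0 k) b0 (rho_ge0 l)).
- by apply: (mu_gt0 kw n0 A (p := p) cb b0); exact: mulr_gt0 kp lp.
- by apply: linkedC; apply: bf => q nq; rewrite /b rho_out ?mul0r.
- by apply: bf => q nq; rewrite /b [rho l q]rho_out ?mulr0.
Qed.

Hypothesis conM : connected [set: M].

(** The balls linked to [k] cover an open set, the other balls cover an open set, and by
    [overlap_linked] the two are disjoint; connectedness leaves only the first. *)
Lemma rho_linked k l : linked (rho k) (rho l).
Proof.
pose S := \bigcup_(j in [set j : ball_index A | linked (rho k) (rho j)]) [set p | 0 < bfun j p].
pose S' := \bigcup_(j in [set j : ball_index A | ~ linked (rho k) (rho j)]) [set p | 0 < bfun j p].
have oB (j : ball_index A) : open [set p | 0 < bfun j p].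
  have -> : [set p | 0 < bfun j p] = bfun j @^-1` [set x | 0 < x] by [].
  by apply: (open_comp (f := bfun j)) => [p _|]; [exact: (smooth_fun_continuous (X := X) (bfun_smooth kw j)) | exact: open_gt].
have mu_rho (j : ball_index A) : 0 < mu (rho j).
  have [p pp] := bset_center j.
  by apply: (mu_gt0 kw n0 A (p := p) (@rc j) (rho_ge0 j)); exact: rho_gt0.
have tr (j j' : ball_index A) p : linked (rho k) (rho j) -> 0 < bfun j p -> 0 < bfun j' p -> linked (rho k) (rho j').
  move=> L jp jp'; apply: (linked_trans (@rc k) (@rc j) (@rc j') (rho_ge0 k) (rho_ge0 j) (rho_ge0 j') (mu_rho j) L).
  exact: overlap_linked jp jp'.
have SC : S = ~` S'.
  apply/seteqP; split => [p [j Lj jp] [j' nLj' jp']|p nS]; first by apply: nLj'; exact: tr Lj jp jp'.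
  have [j jp] := bfun_cover A p; exists j => //=; apply: contrapT => nL; apply: nS; by exists j.
have oS : open S by exact: bigcup_open.
have oS' : open S' by exact: bigcup_open.
have [pk ppk] := bset_center k.
have Lk : linked (rho k) (rho k) by apply: (overlap_linked (p := pk)).
have ST : S = setT.
  apply: conM; first by exists pk; exists k.
    by exists S => //; rewrite setTI.
  by exists S; rewrite ?setTI // SC closedC.
have [pl ppl] := bset_center l; have : S pl by rewrite ST.
by case=> j Lj jp; exact: tr Lj jp ppl.
Qed.

(** Summed over all pairs of weights, the spreads add up to twice the total mass times the integral
    of v^2, because [v] has mean zero. *)
Theorem poincare : exists2 C : R, 0 <= C & forall v, smooth v -> mu v = 0 ->
  mu (fun p => v p ^+ 2) <= C * energy v.
Proof.
have [[p0 _]|noM] := pselect (exists p : M, True); last first.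
  exists 0 => // v _ _; rewrite (_ : (fun p => v p ^+ 2) = fun=> 0) ?(mu0 kw) ?mul0r //.
  by apply/funext => p; case: noM; exists p.
have mu1 : 0 < mu (fun=> 1) by apply: (mu_gt0 kw n0 A (p := p0)) => //; exact: cst_continuous.
pose C (k l : ball_index A) := s2val (cid2 (rho_linked k l)).
have C0 k l : 0 <= C k l by exact: (s2valP (cid2 (rho_linked k l))).
have CP k l : forall v, smooth v -> spread (rho k) (rho l) v <= C k l * energy v by exact: (s2valP' (cid2 (rho_linked k l))).
exists ((2 * mu (fun=> 1))^-1 * \sum_(k : ball_index A) \sum_(l : ball_index A) C k l) => [|v sv v0].
  rewrite mulr_ge0 ?invr_ge0 ?mulr_ge0 ?(ltW mu1) //; apply: sumr_ge0 => k _; exact: sumr_ge0.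
have cv := smooth_fun_continuous sv.
have cv2 : continuous (fun p => v p ^+ 2) by cont.
have crf (k : ball_index A) (f : M -> R) : continuous f -> continuous (fun p => rho k p * f p).
  by cont.
have S (f : M -> R) : continuous f -> \sum_(k : ball_index A) mu (fun p => rho k p * f p) = mu f.
  move=> cf; rewrite -(mu_sum kw); last by move=> k; exact: crf.
  by congr mu; apply/funext => p; rewrite -mulr_suml sum_rho mul1r.
have S1 : \sum_(k : ball_index A) mu (rho k) = mu (fun=> 1).
  rewrite -(S (fun=> 1)); last exact: cst_continuous.
  by apply: eq_bigr => k _; congr mu; apply/funext => p; rewrite mulr1.
have inner (k : ball_index A) : \sum_(l : ball_index A) spread (rho k) (rho l) v =
    mu (rho k) * mu (fun p => v p ^+ 2) + mu (fun=> 1) * mu (fun p => rho k p * v p ^+ 2).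
  transitivity (mu (rho k) * (\sum_(l : ball_index A) mu (fun p => rho l p * v p ^+ 2))
      - 2 * mu (fun p => rho k p * v p) * (\sum_(l : ball_index A) mu (fun p => rho l p * v p))
      + (\sum_(l : ball_index A) mu (rho l)) * mu (fun p => rho k p * v p ^+ 2)).
    by rewrite mulr_sumr [_ * \sum_l mu (fun p => rho l p * v p)]mulr_sumr mulr_suml -sumrB -big_split.
  by rewrite (S _ cv2) (S _ cv) S1 v0 mulr0 subr0.
have E : \sum_(k : ball_index A) \sum_(l : ball_index A) spread (rho k) (rho l) v = 2 * mu (fun=> 1) * mu (fun p => v p ^+ 2).
  rewrite (eq_bigr _ (fun k _ => inner k)) big_split -mulr_suml -mulr_sumr /= S1 (S _ cv2); ring.
rewrite -mulrA ler_pdivlMl ?mulr_gt0 // -E mulr_suml.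
by apply: ler_sum => k _; rewrite mulr_suml; apply: ler_sum => l _; exact: CP.
Qed.

(** * The operator in charts and its commutators with localization and mollification *)

Local Notation lap := (lap w G).
Implicit Type e : R.

Lemma lap_lin (a : R) u v p : smooth u -> smooth v ->
  lap (fun p => a * u p + v p) p = a * lap u p + lap v p.
Proof.
move=> su sv; have [i di Uz] := dom_chart X p.
rewrite -(chartK di) !(lapE kw n0 Gn Gk) //; last exact: smooth_fun_lin.
set z := chart i p in Uz *.
have dd q q' : pderiv q' (pderiv q ((fun p => a * u p + v p) \o inv i)) z =
    a * pderiv q' (pderiv q (u \o inv i)) z + pderiv q' (pderiv q (v \o inv i)) z.
  exact: pderiv2_lin (image_open i) (su i) (sv i) Uz.
rewrite mulrA -mulrDl; congr (_ / _); rewrite mulr_sumr -big_split; apply: eq_bigr => q _ /=.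
by rewrite mulr_sumr -big_split; apply: eq_bigr => q' _ /=; rewrite dd mulrDr mulrCA.
Qed.

Lemma lap_sum (K : finType) (u : K -> M -> R) p : (forall t : K, smooth (u t)) ->
  lap (fun p => \sum_(t : K) u t p) p = \sum_(t : K) lap (u t) p.
Proof.
move=> su; have l0 : lap (fun=> 0) p = 0.
  have s0 := smooth_fun_cst (X := X) 0; have := lap_lin (-1) p s0 s0.
  by rewrite (_ : (fun p => _) = (fun=> 0)) ?mulN1r ?addNr //; apply/funext => q; rewrite mulr0 addr0.
elim: (index_enum K) => [|t s IH]; first by rewrite big_nil (_ : (fun p => _) = fun=> 0) //; apply/funext => q; rewrite big_nil.
have E : (fun p => \sum_(t <- t :: s) u t p) = (fun p => 1 * u t p + \sum_(t <- s) u t p).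
  by apply/funext => q; rewrite big_cons mul1r.
by rewrite E big_cons lap_lin ?IH ?mul1r //; exact: smooth_fun_sum.
Qed.

Lemma carre_lin (a : R) u v g p : smooth u -> smooth v -> smooth g ->
  carre (fun p => a * u p + v p) g p = a * carre u g p + carre v g p.
Proof.
move=> su sv sg; have [i di Uz] := dom_chart X p.
rewrite -(chartK di) !(carreE kw n0 Gn Gk) //; last exact: smooth_fun_lin.
set z := chart i p in Uz *.
have d q : pderiv q ((fun p => a * u p + v p) \o inv i) z = a * pderiv q (u \o inv i) z + pderiv q (v \o inv i) z.
  exact: pderiv_lin (su i) (sv i) Uz.
rewrite mulrA -mulrDl; congr (_ / _); rewrite mulr_sumr -big_split; apply: eq_bigr => q _ /=.
by rewrite mulr_sumr -big_split; apply: eq_bigr => q' _ /=; rewrite d; ring.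
Qed.

Lemma energy_lin (a : R) u v : smooth u -> smooth v ->
  energy (fun p => a * u p + v p) = a ^+ 2 * energy u + 2 * a * mu (carre u v) + energy v.
Proof.
move=> su sv; have suv := smooth_fun_lin a su sv.
have cc1 f g : smooth f -> smooth g -> continuous (carre f g) by exact: carre_cont.
set s := fun p => a * u p + v p.
have -> : energy s = mu (fun p => a ^+ 2 * carre u u p + (2 * a * carre u v p + carre v v p)).
  congr mu; apply/funext => p.
  have E1 := carre_lin a p su sv suv; have E2 := carreC kw n0 Gn Gk p su suv; have E3 := carre_lin a p su sv su.
  have E4 := carreC kw n0 Gn Gk p sv suv; have E5 := carre_lin a p su sv sv; have E6 := carreC kw n0 Gn Gk p sv su.
  by rewrite /s E1 E2 E3 E4 E5 E6; move: (carre u u p) (carre u v p) (carre v v p) => x y z; ring.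
rewrite (muL kw); [|exact: cc1|]; last first.
  by apply: cont_at => p; apply: cont_add; [cont | exact: cc1].
by rewrite (muL kw) ?addrA //; exact: cc1.
Qed.

Definition piece k f : V -> R := (fun z => rho k (inv (c k) z) * f (inv (c k) z)) \_ (U (c k)).

Lemma piece_out k f z : ~ cball k 1 z -> piece k f z = 0.
Proof.
move=> nK; rewrite /piece patchE; case: ifP => // /set_mem Uz.
by rewrite rho_out ?mul0r // => /(cball1_bset Uz).
Qed.

Lemma piece_cc k f : continuous f -> cc (piece k f).
Proof.
move=> cf; apply: (cball_cc (k := k) (s := 1)) => [|z]; last exact: piece_out.
apply: (@ext_continuous R V (U (c k)) (cball k 1)).
- exact: image_open.
- by apply: compact_closedV; exact: cball_compact.
- exact: cball1_sub.
- move=> z Uz; apply: (cont_mul (f := rho k \o inv (c k)) (g := f \o inv (c k))).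
    by apply: pull_continuous => //; exact: (rho_cont kw).
  exact: pull_continuous.
- by move=> z Uz nK; rewrite rho_out ?mul0r // => /(cball1_bset Uz).
Qed.

Lemma piece_sc k f : smooth f -> sc (piece k f).
Proof.
move=> sf; have sg : smooth_on (U (c k)) (fun z => rho k (inv (c k) z) * f (inv (c k) z)).
  apply: chart_sgen; apply: sg_mul; apply: sg_base; [exact: (rho_smooth kw k) | exact: sf].
apply: (proj1 (sc_ext (image_open (c k)) (@cball_compact _ _ _ _ A k 1) (@cball1_sub k) sg _)).
by move=> z Uz nK; rewrite rho_out ?mul0r // => /(cball1_bset Uz).
Qed.

Lemma push_piece k f p : push (c k) (piece k f) p = rho k p * f p.
Proof.
have [dp|ndp] := pselect (dom (c k) p).
  by rewrite push_in // /piece patchE mem_set ?chartK //; exact: chart_imageP.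
by rewrite push_out // rho_out ?mul0r // => /bset_dom.
Qed.

Definition coefa k p q : V -> R := glob k (fun z => symb (c k) z p q / dens w (c k) z).

Lemma dens_inv_smooth k : smooth_on (U (c k)) (fun z => (dens w (c k) z)^-1).
Proof.
by apply: chart_sgen; apply: sg_inv => [|z Uz]; [apply: sg_base; exact: dens_smooth | rewrite gt_eqF // (dens_gt0 kw n0 Uz)].
Qed.

Lemma coefa_sc k p q : sc (coefa k p q).
Proof.
apply: glob_sc; apply: chart_sgen; apply: sg_mul; apply: sg_base; [exact: (symb_smooth n0 Gn Gk) | exact: dens_inv_smooth].
Qed.

Lemma lap_local u p : smooth u -> (\near p, u p = 0) -> lap u p = 0.
Proof.
move=> su u0; have [i di Uz] := dom_chart X p.
rewrite -(chartK di) (lapE kw n0 Gn Gk) //; set z := chart i p in Uz *.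
have nz : \near z, u (inv i z) = 0.
  have H : nbhs (inv i z) [set q | u q = 0] by rewrite /z chartK.
  exact: (chart_inv_continuous (c := X) Uz H).
have dz q : \near z, pderiv q (u \o inv i) z = 0.
  move/nbhs_interior : nz; apply: filterS => y ny.
  by rewrite -[RHS](derive_cst (0 : R) y 'e_q); apply: near_eq_derive.
rewrite big1 ?mul0r // => a _; rewrite big1 // => b _.
rewrite [X in _ * X](_ : _ = 0) ?mulr0 //.
by rewrite -[RHS](derive_cst (0 : R) z 'e_a); apply: near_eq_derive; exact: dz.
Qed.

Definition lap_chart k h z : R := \sum_p \sum_q coefa k p q z * pderiv p (pderiv q h) z.

Lemma vanish_pderiv k (s : R) p h : off k s h -> forall z, ~ cball k s z -> pderiv p h z = 0.
Proof.
move=> fh z nK; rewrite -[RHS](derive_cst (0 : R) z 'e_p); apply: near_eq_derive.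
have : \near z, (~` cball k s) z.
  apply: open_nbhs_nbhs; split => //; rewrite openC; apply: compact_closedV; exact: cball_compact.
by apply: filterS => y; exact: fh.
Qed.

Lemma lap_chart_out k h : off k 6 h -> forall z, ~ cball k 6 z -> lap_chart k h z = 0.
Proof.
move=> fh z nK; rewrite /lap_chart big1 // => a _; rewrite big1 // => b _.
rewrite [X in _ * X](_ : _ = 0) ?mulr0 //; exact: (vanish_pderiv a (vanish_pderiv b fh) nK).
Qed.

Lemma pderiv2_glob k h p q z : cball k 5 z -> pderiv p (pderiv q (glob k h)) z = pderiv p (pderiv q h) z.
Proof.
move=> Kz; apply: near_eq_derive; have H : (5 : R) < 6 by lra.
by apply: filterS (near_cball H Kz) => y; exact: pderiv_glob.
Qed.

Lemma lap_push k h : smooth_on setT h -> off k 6 h ->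
  lap (push (c k) h) = push (c k) (lap_chart k h).
Proof.
move=> sh fh; have sp := push_chi_smooth sh fh; have s6 : (6 : R) <= 10 by lra.
have out := lap_chart_out fh.
apply/funext => p; have [[z Kz <-]|np] := pselect ((inv (c k) @` cball k 6) p); last first.
  rewrite (push_out6 out np) lap_local //.
  have : \near p, (~` (inv (c k) @` cball k 6)) p.
    apply: open_nbhs_nbhs; split => //; rewrite openC; apply: (compact_closedM X).
    by apply: inv_compact; [exact: cball_compact | exact: cball_sub].
  by apply: filterS => q nq; exact: push_out6 fh nq.
have Uz : U (c k) z by exact: cball_sub Kz.
rewrite push_inv // (lapE kw n0 Gn Gk) // /lap_chart mulr_suml; apply: eq_bigr => a _.
rewrite mulr_suml; apply: eq_bigr => b _.
rewrite /coefa globE; last by apply: cball_mono Kz; lra.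
have nU : \near z, U (c k) z by apply: open_nbhs_nbhs; split => //; exact: (image_open (c k)).
have E : pderiv a (pderiv b (push (c k) h \o inv (c k))) z = pderiv a (pderiv b h) z.
  apply: near_eq_derive; move/nbhs_interior : nU; apply: filterS => y ny.
  by apply: near_eq_derive; apply: filterS ny => y' Uy'; rewrite /= push_inv.
apply: (etrans (congr1 (fun t => symb (c k) z a b * t / dens w (c k) z) E)).
by move: (pderiv a (pderiv b h) z) => t; ring.
Qed.

(* Operators bounded from the H^1 norm on M to L^2 in a chart, uniformly in e. *)
Definition bdd (F : R -> (M -> R) -> V -> R) := exists2 C : R, 0 <= C & forall e v, 0 < e -> smooth v ->
  cc (F e v) /\ I (fun z => F e v z ^+ 2) <= C * (energy v + mu (fun p => v p ^+ 2)).

Lemma int_sqr_add (f g : V -> R) : cc f -> cc g ->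
  I (fun z => (f z + g z) ^+ 2) <= 2 * (I (fun z => f z ^+ 2) + I (fun z => g z ^+ 2)).
Proof.
move=> cf cg; have [c1 c2] := (cc_sqr cf, cc_sqr cg).
rewrite -intD // -intZ; last exact: ccD.
apply: int_le => [||z]; first by apply: cc_sqr; exact: ccD.
  by apply: ccZ; exact: ccD.
by have := sqr_ge0 (f z - g z); nra.
Qed.

Lemma int_sqr_ge0 (f : V -> R) : cc f -> 0 <= I (fun z => f z ^+ 2).
Proof. by move=> cf; apply: int_ge0 (cc_sqr cf) _ => z; exact: sqr_ge0. Qed.

Lemma bdd_add F F' : bdd F -> bdd F' -> bdd (fun e v z => F e v z + F' e v z).
Proof.
move=> [C C0 CP] [D D0 DP]; exists (2 * (C + D)) => [|e v e0 sv]; first by rewrite mulr_ge0 ?addr_ge0.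
have [[c1 i1] [c2 i2]] := (CP e v e0 sv, DP e v e0 sv); split; first exact: ccD.
by apply: le_trans (int_sqr_add c1 c2) _; rewrite -[leRHS]mulrA [(C + D) * _]mulrDl ler_pM2l // lerD.
Qed.

Lemma H1_ge0 v : smooth v -> 0 <= energy v + mu (fun p => v p ^+ 2).
Proof.
move=> sv; have cv := smooth_fun_continuous sv; rewrite addr_ge0 ?energy_ge0 //.
by apply: (mu_ge0 kw n0) => [|p]; [cont | exact: sqr_ge0].
Qed.

Lemma bdd_sum (K : finType) (F : K -> R -> (M -> R) -> V -> R) : (forall t, bdd (F t)) ->
  bdd (fun e v z => \sum_t F t e v z).
Proof.
move=> bF; elim: (index_enum K) => [|t s IH].
  exists 0 => // e v _ _; under eq_fun do rewrite big_nil; split; first exact: cc0.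
  by under eq_fun do rewrite big_nil expr0n; rewrite mul0r int0.
have [C C0 CP] := bdd_add (bF t) IH; exists C => // e v e0 sv.
by under eq_fun do rewrite big_cons; under [X in I X]eq_fun do rewrite big_cons; exact: CP.
Qed.

Lemma bdd_ext F F' : (forall e v z, 0 < e -> smooth v -> F e v z = F' e v z) -> bdd F -> bdd F'.
Proof.
move=> E [C C0 CP]; exists C => // e v e0 sv.
have <- : F e v = F' e v by apply/funext => z; exact: E.
exact: CP.
Qed.

Local Notation chartf k v := (glob k (v \o inv (c k))).

Lemma sc_vanish_dominated k a : sc a -> off k 1 a ->
  exists2 C : R, 0 <= C & forall z, a z ^+ 2 <= C * ccut k 3 z.
Proof.
move=> sa fa; have [C C0 aC] := sc_bounded sa; exists (C ^+ 2) => [|z]; first exact: sqr_ge0.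
have [Kz|nK] := pselect (cball k 1 z); last by rewrite fa // expr0n mulr_ge0 ?sqr_ge0 //; have /andP[] := ccut_itv k 3 z.
rewrite ccut1 ?mulr1; last by apply: cball_mono Kz; lra.
by rewrite -[leLHS]real_normK ?num_real // lerXn2r ?nnegrE.
Qed.

Lemma chartf_sc k v : smooth v -> sc (chartf k v).
Proof. by move=> sv; apply: glob_sc; exact: sv. Qed.

(* The dominating function h is either the value or the squared gradient. *)
Lemma dominated_bound k a (h : (M -> R) -> V -> R) (D : R) : 0 <= D -> (forall v, smooth v -> continuous (h v)) ->
  sc a -> off k 1 a ->
  (forall v, smooth v -> I (fun z => ccut k 3 z * h v z ^+ 2) <= D * (energy v + mu (fun p => v p ^+ 2))) ->
  bdd (fun _ v z => a z * h v z).
Proof.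
move=> D0 ch sa fa hD; have [C C0 aC] := sc_vanish_dominated sa fa.
exists (C * D) => [|e v _ sv]; first exact: mulr_ge0.
have cah : cc (fun z => a z * h v z) by apply: ccMr; [exact: sc_cc | exact: ch].
have cch : cc (fun z => ccut k 3 z * h v z ^+ 2) by apply: ccMr; [exact: ccut3_cc | cont].
split=> //; apply: le_trans (_ : _ <= C * I (fun z => ccut k 3 z * h v z ^+ 2)) _; last by rewrite -mulrA ler_wpM2l // hD.
rewrite -intZ //; apply: int_le => [||z]; first exact: cc_sqr.
  exact: ccZ.
by rewrite exprMn mulrA ler_wpM2r ?sqr_ge0.
Qed.

Lemma bdd_value k a : sc a -> off k 1 a -> bdd (fun _ v z => a z * chartf k v z).
Proof.
move=> sa fa; have [D D0 DP] := sc_bounded (glob_sc (dens_inv_smooth k)).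
apply: (dominated_bound D0 _ sa fa) => v sv; first by apply: sc_cont; exact: chartf_sc.
have cv := smooth_fun_continuous sv; have cg := sc_cont (chartf_sc k sv).
have cv2 : continuous (fun p => v p ^+ 2) by cont.
have cg2 : continuous (fun z => chartf k v z ^+ 2) by apply: cont_at => p; cont.
have H := mu_chart_le (h := fun z => chartf k v z ^+ 2 * dens w (c k) z)
  (@ccut3_cont k) (ccut_itv k 3) (@ccut3_far k) cv2 (fun p => sqr_ge0 _).
have E z : cball k 6 z -> chartf k v z ^+ 2 * dens w (c k) z = v (inv (c k) z) ^+ 2 * dens w (c k) z.
  by move=> Kz; rewrite globE //; apply: cball_mono Kz; lra.
apply: le_trans (_ : _ <= D * mu (fun p => v p ^+ 2)) _; last by rewrite ler_wpM2l // lerDr energy_ge0.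
apply: le_trans (ler_wpM2l D0 (H E)).
have cgd : cc (fun z => ccut k 3 z * (chartf k v z ^+ 2 * dens w (c k) z)).
  apply: (chart_mul_cc (@ccut3_cont k) (@ccut3_far k)) => z Uz.
  by apply: cont_mul; [exact: cg2 | exact: (dens_cont kw)].
rewrite -intZ //; apply: int_le => [||z].
- by apply: ccMr => //; exact: ccut3_cc.
- exact: ccZ.
have [Kz|nK] := pselect (cball k 6 z); last by rewrite ccut3_far // !mul0r mulr0.
have Uz : U (c k) z by apply: cball_sub Kz; lra.
rewrite [leRHS]mulrCA ler_wpM2l //; first exact: ccut3_ge0.
rewrite [leRHS]mulrCA -[leLHS]mulr1 ler_wpM2l ?sqr_ge0 // -ler_pdivrMr ?(dens_gt0 kw n0 Uz) // mul1r.
have := DP z; rewrite globE; last by apply: cball_mono Kz; lra.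
exact: le_trans (ler_norm _).
Qed.

Lemma bdd_deriv k a p : sc a -> off k 1 a -> bdd (fun _ v z => a z * pderiv p (chartf k v) z).
Proof.
move=> sa fa; have [D D0 DP] := energy_local k.
have cd v : smooth v -> continuous (pderiv p (chartf k v)).
  by move=> sv; apply: sc_cont; apply: sc_pderiv; exact: chartf_sc.
apply: (dominated_bound D0 cd sa fa) => v sv.
have cv := smooth_fun_continuous sv.
have cg : continuous (gsq (chartf k v)) by apply: gsq_cont; case: (chartf_sc k sv).
apply: le_trans (_ : _ <= D * energy v) _; last first.
  rewrite ler_wpM2l // lerDl (mu_ge0 kw n0) // => [|q]; last exact: sqr_ge0.
  by cont.
apply: le_trans (DP v sv); apply: int_le => [||z].
- by apply: ccMr; [exact: ccut3_cc | cont].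
- by apply: ccMr => //; exact: ccut3_cc.
rewrite ler_wpM2l //; first exact: ccut3_ge0.
by rewrite /gsq (bigD1 p) //= lerDl sumr_ge0 // => q _; exact: sqr_ge0.
Qed.

Lemma pderiv_mul p (f g : V -> R) z : smooth_on setT f -> smooth_on setT g ->
  pderiv p (fun z => f z * g z) z = pderiv p f z * g z + f z * pderiv p g z.
Proof.
move=> sf sg; rewrite [LHS](derive_val (is_derive := is_deriveM (smooth_is_derive z p sf) (smooth_is_derive z p sg))).
by rewrite addrC [pderiv p f z * _]mulrC.
Qed.

Lemma mol_lin e (a : R) (f g : V -> R) z : continuous f -> continuous g ->
  mol e (fun z => a * f z + g z) z = a * mol e f z + mol e g z.
Proof.
move=> cf cg; rewrite /mol mulrA -mulrDl; congr (_ / _).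
rewrite -(proj1 (posfun_int m)); [|exact: mol_cc_arg|exact: mol_cc_arg].
by congr (I _); apply/funext => y; ring.
Qed.

Lemma mol_sum e (K : finType) (F : K -> V -> R) z : (forall t, cc (F t)) ->
  mol e (fun z => \sum_t F t z) z = \sum_t mol e (F t) z.
Proof.
move=> cF; elim: (index_enum K) => [|t s IH].
  by rewrite big_nil (@mol_eq _ _ _ _ (fun=> 0)) ?mol_cst // => y _; rewrite big_nil.
rewrite big_cons -IH -[mol e (F t) z]mul1r -mol_lin; [|by case: (cF t)|exact: (proj1 (cc_sum s (P := xpredT) (fun t _ => cF t)))].
by apply: mol_eq => y _; rewrite big_cons mul1r.
Qed.

Lemma pderiv_molE e h p : sc h -> pderiv p (mol e h) = mol e (pderiv p h).
Proof. by move=> sf; apply/funext => z; exact: (derive_val (is_derive := pderiv_mol e p z sf)). Qed.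

Local Notation unit_piece k := (piece k (fun=> 1)).

Lemma unit_piece_sc k : sc (unit_piece k). Proof. by apply: piece_sc; exact: smooth_fun_cst. Qed.

Lemma pieceE k v z : piece k v z = unit_piece k z * chartf k v z.
Proof.
have [Kz|nK] := pselect (cball k 1 z); last by rewrite !piece_out ?mul0r.
have Uz := cball1_sub Kz; rewrite globE; last by apply: cball_mono Kz; lra.
by rewrite /piece !patchE mem_set // mulr1.
Qed.

Lemma pderiv_pieceE k q v z : smooth v ->
  pderiv q (piece k v) z = pderiv q (unit_piece k) z * chartf k v z + unit_piece k z * pderiv q (chartf k v) z.
Proof.
move=> sv; rewrite (_ : piece k v = fun z => unit_piece k z * chartf k v z); last by apply/funext => y; exact: pieceE.
by rewrite pderiv_mul //; [case: (unit_piece_sc k) | case: (chartf_sc k sv)].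
Qed.

Lemma bdd_pderiv_piece k q : bdd (fun _ v => pderiv q (piece k v)).
Proof.
have u0 := @piece_out k (fun=> 1); have su := unit_piece_sc k.
apply: (bdd_ext (F := fun e v z => pderiv q (unit_piece k) z * chartf k v z + unit_piece k z * pderiv q (chartf k v) z)).
  by move=> e v z _ sv; exact: esym (pderiv_pieceE k q z sv).
by apply: bdd_add; [apply: bdd_value; [exact: sc_pderiv | exact: vanish_pderiv] | exact: bdd_deriv].
Qed.

(** The commutator of the operator with multiplication by [rho k]. The second derivatives of [v]
    cancel, so it is bounded in the H^1 norm; by [defect_sum] the sum over [k] vanishes. *)
Definition defect k v z := lap_chart k (piece k v) z - piece k (lap v) z.

Lemma bdd_defect k : bdd (fun _ v => defect k v).
Proof.
have u0 := @piece_out k (fun=> 1); have su := unit_piece_sc k.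
pose F p q (e : R) v z := coefa k p q z * pderiv p (pderiv q (unit_piece k)) z * chartf k v z
  + (coefa k p q z * pderiv q (unit_piece k) z * pderiv p (chartf k v) z
  + coefa k p q z * pderiv p (unit_piece k) z * pderiv q (chartf k v) z).
apply: (bdd_ext (F := fun e v z => \sum_p \sum_q F p q e v z)); last first.
  apply: bdd_sum => p; apply: bdd_sum => q.
  have sa h : sc h -> sc (fun z => coefa k p q z * h z) by move=> sh; apply: sc_mul => //; case: (coefa_sc k p q).
  have va h : off k 1 h -> forall z, ~ cball k 1 z -> coefa k p q z * h z = 0.
    by move=> vh z /vh ->; rewrite mulr0.
  apply: bdd_add; first by apply: bdd_value; [apply: sa; do 2!apply: sc_pderiv | apply: va; do 2!apply: vanish_pderiv].
  by apply: bdd_add; apply: bdd_deriv; by [apply: sa; apply: sc_pderiv | apply: va; apply: vanish_pderiv].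
move=> e v z _ sv; have sg := chartf_sc k sv.
have E2 p q : pderiv p (pderiv q (piece k v)) z = pderiv p (pderiv q (unit_piece k)) z * chartf k v z
    + pderiv q (unit_piece k) z * pderiv p (chartf k v) z
    + (pderiv p (unit_piece k) z * pderiv q (chartf k v) z + unit_piece k z * pderiv p (pderiv q (chartf k v)) z).
  rewrite (_ : pderiv q (piece k v) = fun z => pderiv q (unit_piece k) z * chartf k v z + unit_piece k z * pderiv q (chartf k v) z).
    have D (f g : V -> R) : sc f -> sc g -> is_derive z 'e_p (fun z => f z * g z) (pderiv p f z * g z + f z * pderiv p g z).
      move=> [sf _] [sgg _]; rewrite -pderiv_mul //; apply: smooth_is_derive.
      by apply: sgen_smooth openT _; apply: sg_mul; exact: sg_base.
    exact: (derive_val (is_derive := is_deriveD (D _ _ (sc_pderiv q su) sg) (D _ _ su (sc_pderiv q sg)))).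
  by apply/funext => y; exact: pderiv_pieceE.
have L : piece k (lap v) z = \sum_p \sum_q unit_piece k z * (coefa k p q z * pderiv p (pderiv q (chartf k v)) z).
  under eq_bigr do rewrite -mulr_sumr; rewrite -mulr_sumr.
  have [Kz|nK] := pselect (cball k 1 z); last by rewrite !piece_out ?mul0r.
  have Uz := cball1_sub Kz; rewrite /piece !patchE mem_set // mulr1; congr (_ * _).
  rewrite (lapE kw n0 Gn Gk) // mulr_suml; apply: eq_bigr => p _; rewrite mulr_suml; apply: eq_bigr => q _.
  rewrite /coefa globE; last by apply: cball_mono Kz; lra.
  have K5 : cball k 5 z by apply: cball_mono Kz; lra.
  have E := pderiv2_glob (v \o inv (c k)) p q K5.
  apply: etrans (congr1 (fun t => symb (c k) z p q / dens w (c k) z * t) (esym E)).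
  by move: (pderiv p (pderiv q (v \o inv (c k))) z) => t; ring.
rewrite /defect L /lap_chart -sumrB; apply: eq_bigr => p _; rewrite -sumrB; apply: eq_bigr => q _.
have := congr1 (fun t => coefa k p q z * t - unit_piece k z * (coefa k p q z * pderiv p (pderiv q (chartf k v)) z)) (E2 p q).
move=> /esym; apply: etrans; rewrite /F.
move: (pderiv p (pderiv q (unit_piece k)) z) (pderiv p (pderiv q (chartf k v)) z) => s t.
move: (pderiv p (chartf k v) z) (pderiv q (chartf k v) z) (pderiv p (unit_piece k) z) (pderiv q (unit_piece k) z) => s1 s2 s3 s4.
ring.
Qed.

Lemma bdd_mol F : bdd F -> bdd (fun e v => mol e (F e v)).
Proof.
move=> [C C0 CP]; exists C => // e v e0 sv; have [cF iF] := CP e v e0 sv.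
by split; [exact: mol_cc | apply: le_trans iF; exact: int_mol_sq].
Qed.

(** The commutator of the operator with localization followed by mollification. It is bounded on H^1
    uniformly in [e] ([bdd_error]) and tends to [defect] for fixed smooth [v] ([small_error]). *)
Definition error k e v z := lap_chart k (mol e (piece k v)) z - mol e (piece k (lap v)) z.

Lemma lap_chart_cc k h : sc h -> cc (lap_chart k h).
Proof.
move=> sh; apply: cc_sum => p _; apply: cc_sum => q _; apply: ccMl; first by apply: sc_cont; exact: coefa_sc.
by apply: sc_cc; do 2!apply: sc_pderiv.
Qed.

Lemma lap_chart_mol k e h z : sc h -> lap_chart k (mol e h) z = \sum_p \sum_q coefa k p q z * mol e (pderiv p (pderiv q h)) z.
Proof.
move=> sh; apply: eq_bigr => p _; apply: eq_bigr => q _.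
by rewrite (pderiv_molE e q sh) (pderiv_molE e p (sc_pderiv q sh)).
Qed.

(** The leading terms are Friedrichs commutators applied to the first derivatives of the localized
    function, which are bounded in L^2 by the H^1 norm; what remains is the mollified [defect]. *)
Lemma bdd_error k : bdd (fun e v => error k e v).
Proof.
pose F p q e v z := coefa k p q z * mol e (pderiv p (pderiv q (piece k v))) z
  - mol e (fun z => coefa k p q z * pderiv p (pderiv q (piece k v)) z) z.
apply: (bdd_ext (F := fun e v z => (\sum_p \sum_q F p q e v z) + mol e (defect k v) z)); last first.
  apply: bdd_add; last exact: bdd_mol (bdd_defect k).
  apply: bdd_sum => p; apply: bdd_sum => q.
  have [C C0 CP] := friedrichs p (coefa_sc k p q); have [D D0 DP] := bdd_pderiv_piece k q.
  exists (C * D) => [|e v e0 sv]; first exact: mulr_ge0.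
  have sd : sc (pderiv q (piece k v)) by apply: sc_pderiv; exact: piece_sc.
  have sdd := sc_pderiv p sd; have ca := sc_cont (coefa_sc k p q).
  split; first by apply: ccB; [apply: ccMl => //; apply: mol_cc; exact: sc_cc | apply: mol_cc; apply: ccMl => //; exact: sc_cc].
  apply: le_trans (CP e _ e0 sd) _; rewrite -mulrA ler_wpM2l //; exact: (DP e v e0 sv).2.
move=> e v z _ sv; have sp := piece_sc k sv; rewrite /error lap_chart_mol //.
have cpl : continuous (piece k (lap v)) by case: (piece_cc k (lap_cont kw n0 Gn Gk sv)).
have cpp p q : cc (fun z => coefa k p q z * pderiv p (pderiv q (piece k v)) z).
  by apply: ccMl; [apply: sc_cont; exact: coefa_sc | apply: sc_cc; do 2!apply: sc_pderiv].
have -> : mol e (defect k v) z = (\sum_p \sum_q mol e (fun z => coefa k p q z * pderiv p (pderiv q (piece k v)) z) z) - mol e (piece k (lap v)) z.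
  have := mol_lin e (-1) z cpl (proj1 (lap_chart_cc k sp)); rewrite mulN1r addrC => H.
  transitivity (mol e (lap_chart k (piece k v)) z - mol e (piece k (lap v)) z).
    by rewrite -H; apply: mol_eq => y _; rewrite /defect mulN1r addrC.
  congr (_ - _); rewrite /lap_chart mol_sum; last by move=> p; exact: cc_sum.
  by apply: eq_bigr => p _; rewrite mol_sum.
rewrite addrA -big_split; congr (_ - _); apply: eq_bigr => p _; rewrite -big_split; apply: eq_bigr => q _ /=.
by rewrite /F subrK.
Qed.

(** The inverse of one plus the sum of the inverses is a lower bound, also when [K] is empty. *)
Lemma finite_min (K : finType) (d : K -> R) : (forall t, 0 < d t) -> exists2 d0 : R, 0 < d0 & forall t, d0 <= d t.
Proof.
move=> dt; have S0 : 0 <= \sum_t (d t)^-1 by apply: sumr_ge0 => t _; rewrite invr_ge0 ltW.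
have S1 : 0 < 1 + \sum_t (d t)^-1 by lra.
exists (1 + \sum_t (d t)^-1)^-1 => [|t]; first by rewrite invr_gt0.
rewrite -[leRHS]invrK lef_pV2 ?posrE ?invr_gt0 // (bigD1 t) //= addrCA lerDl addr_ge0 // sumr_ge0 // => s _.
by rewrite invr_ge0 ltW.
Qed.

Lemma push_sqr k : exists2 D : R, 0 <= D & forall h, continuous h -> off k 6 h ->
  mu (fun p => push (c k) h p ^+ 2) <= D * I (fun z => h z ^+ 2).
Proof.
have sd : sc (glob k (dens w (c k))) by apply: glob_sc; exact: (dens_smooth kw).
have [D D0 DP] := sc_bounded sd; exists D => // h ch fh.
rewrite (_ : mu _ = mu (fun p => push (c k) h p * push (c k) h p)) //.
rewrite (mu_chart (h := fun z => h z * glob k (dens w (c k)) z) ch fh (push_chi_cont ch fh)); last first.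
  move=> z Kz; have Uz : U (c k) z by apply: cball_sub Kz; lra.
  by rewrite push_inv // globE //; apply: cball_mono Kz; lra.
have cch := cball_cc ch fh; rewrite -intZ; last exact: cc_sqr.
apply: int_le => [||z].
- by apply: ccMr => //; cont.
- by apply: ccZ; exact: cc_sqr.
by rewrite mulrA mulrC ler_wpM2r ?sqr_ge0 //; exact: le_trans (ler_norm _) (DP z).
Qed.

Lemma push_sum_sqr : exists2 D : R, 0 <= D & forall H : ball_index A -> V -> R, (forall k, continuous (H k)) ->
  (forall k z, ~ cball k 6 z -> H k z = 0) ->
  mu (fun p => (\sum_k push (c k) (H k) p) ^+ 2) <= D * \sum_k I (fun z => H k z ^+ 2).
Proof.
pose D k := s2val (cid2 (push_sqr k)).
have D0 k : 0 <= D k by exact: (s2valP (cid2 (push_sqr k))).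
have DP k := s2valP' (cid2 (push_sqr k)).
exists (#|ball_index A|%:R * \sum_k D k) => [|H cH fH]; first by rewrite mulr_ge0 // sumr_ge0.
have cp k : continuous (push (c k) (H k)) by exact: (push_chi_cont (@cH k) (fH k)).
have cp2 k : continuous (fun p => push (c k) (H k) p ^+ 2) by cont.
have cs : continuous (fun p => \sum_k push (c k) (H k) p) by cont.
apply: le_trans (_ : _ <= mu (fun p => #|ball_index A|%:R * \sum_k push (c k) (H k) p ^+ 2)) _.
  apply: (mu_le kw n0) => [||p]; last exact: sqr_sum_le.
    by cont.
  by cont.
rewrite (muZ kw); last by cont.
rewrite (mu_sum kw) // -mulrA ler_wpM2l // mulr_sumr; apply: ler_sum => k _.
apply: le_trans (DP k (H k) (@cH k) (fH k)) _; rewrite ler_wpM2r ?(int_sqr_ge0 (cball_cc (@cH k) (fH k))) //.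
by rewrite (bigD1 k) //= lerDl sumr_ge0.
Qed.

Lemma mol_piece_out k e f z : 0 <= e -> e <= r k -> ~ cball k 2 z -> mol e (piece k f) z = 0.
Proof.
move=> e0 er nK; rewrite (@mol_eq _ _ _ _ (fun=> 0)) ?mol_cst // => y y1; apply: piece_out => K1; apply: nK.
rewrite /cball /= in K1 *; rewrite (_ : z - x0 k = (z + e *: y - x0 k) - e *: y); last by rewrite addrAC addrK.
apply: le_trans (ler_normB _ _) _; rewrite (_ : 2 * r k = 1 * r k + r k); last by ring.
by apply: lerD => //; rewrite normrZ ger0_norm // (le_trans _ er) // ler_piMr.
Qed.

Definition small (F : R -> V -> R) := forall d, 0 < d -> exists2 e0 : R, 0 < e0 & forall e, 0 < e -> e < e0 ->
  cc (F e) /\ I (fun z => F e z ^+ 2) < d.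

Lemma small_add F F' : small F -> small F' -> small (fun e z => F e z + F' e z).
Proof.
move=> sF sF' d d0; have d4 : 0 < d / 4 by rewrite divr_gt0.
have [e1 e1_0 P1] := sF _ d4; have [e2 e2_0 P2] := sF' _ d4.
exists (Num.min e1 e2) => [|e e0]; first by rewrite lt_min e1_0.
rewrite lt_min => /andP[/(P1 _ e0)[c1 i1] /(P2 _ e0)[c2 i2]]; split; first exact: ccD.
by apply: le_lt_trans (int_sqr_add c1 c2) _; lra.
Qed.

Lemma small_sum (K : finType) (F : K -> R -> V -> R) : (forall t, small (F t)) -> small (fun e z => \sum_t F t e z).
Proof.
move=> sF; elim: (index_enum K) => [|t s IH] d d0.
  exists 1 => // e _ _; under eq_fun do rewrite big_nil; split; first exact: cc0.
  by under eq_fun do rewrite big_nil expr0n; rewrite int0.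
have [e0 e0_0 P] := small_add (sF t) IH d0; exists e0 => // e e1 e2.
by under eq_fun do rewrite big_cons; under [X in I X]eq_fun do rewrite big_cons; exact: P.
Qed.

Lemma small_mol (a h : V -> R) : continuous a -> cc h -> small (fun e z => a z * mol e h z - a z * h z).
Proof.
move=> ca ch d d0; have [e0 e0_0 P] := cvg_mol ca ch d0; exists e0 => // e e1 e2; split; last exact: P (ltW e1) e2.
by apply: ccB; apply: ccMl => //; exact: mol_cc.
Qed.

Lemma small_error k u : smooth u -> small (fun e z => error k e u z - defect k u z).
Proof.
move=> su; have sp := piece_sc k su.
pose F p q e z := coefa k p q z * mol e (pderiv p (pderiv q (piece k u))) z - coefa k p q z * pderiv p (pderiv q (piece k u)) z.
pose F0 e z := (-1) * mol e (piece k (lap u)) z - (-1) * piece k (lap u) z.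
have -> : (fun e z => error k e u z - defect k u z) = (fun e z => (\sum_p \sum_q F p q e z) + F0 e z).
  apply/funext => e; apply/funext => z; rewrite /error lap_chart_mol // /defect /lap_chart /F /F0.
  under [in RHS]eq_bigr do rewrite sumrB; rewrite sumrB; ring.
apply: small_add; last by apply: small_mol; [exact: cst_continuous | apply: piece_cc; exact: (lap_cont kw n0 Gn Gk)].
apply: small_sum => p; apply: small_sum => q; apply: small_mol; first by apply: sc_cont; exact: coefa_sc.
by apply: sc_cc; do 2!apply: sc_pderiv.
Qed.

Definition ubd (F : V -> V -> R) := exists2 B : R, 0 <= B & forall z y, `|F z y| <= B.

Lemma ubd_mul F F' : ubd F -> ubd F' -> ubd (fun z y => F z y * F' z y).
Proof. by move=> [B B0 BP] [C C0 CP]; exists (B * C) => [|z y]; [exact: mulr_ge0 | rewrite normrM ler_pM]. Qed.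

Lemma ubd_add F F' : ubd F -> ubd F' -> ubd (fun z y => F z y + F' z y).
Proof.
move=> [B B0 BP] [C C0 CP]; exists (B + C) => [|z y]; first exact: addr_ge0.
by apply: le_trans (ler_normD _ _) _; exact: lerD.
Qed.

Lemma ubd_sum (K : finType) (F : K -> V -> V -> R) : (forall t, ubd (F t)) -> ubd (fun z y => \sum_t F t z y).
Proof.
move=> bF; elim: (index_enum K) => [|t s [B B0 BP]]; first by exists 0 => // z y; rewrite big_nil normr0.
have [C C0 CP] := bF t; exists (C + B) => [|z y]; first exact: addr_ge0.
by rewrite big_cons (le_trans (ler_normD _ _)) // lerD.
Qed.

Lemma ubd_sc (h : V -> R) : sc h -> ubd (fun _ y => h y).
Proof. by move=> /sc_bounded[B B0 BP]; exists B. Qed.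

Lemma ubd_shift (h : V -> R) : sc h -> ubd (fun z y => h (y - z)).
Proof. by move=> /sc_bounded[B B0 BP]; exists B. Qed.

Lemma pderiv2_kernel p q (a h : V -> R) z y : sc a -> sc h ->
  pderiv p (pderiv q (fun y => a (y - z) * h y)) y = pderiv p (pderiv q a) (y - z) * h y + pderiv q a (y - z) * pderiv p h y
    + (pderiv p a (y - z) * pderiv q h y + a (y - z) * pderiv p (pderiv q h) y).
Proof.
have D p' (a' h' : V -> R) y' : sc a' -> sc h' -> is_derive y' 'e_p' (fun y => a' (y - z) * h' y)
    (pderiv p' a' (y' - z) * h' y' + a' (y' - z) * pderiv p' h' y').
  move=> sa' sh'; have sz := sc_shift (- z) sa'.
  have H := is_derive_affine (- z) 1 y' p' (proj1 sa'); rewrite mul1r in H.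
  have E : (fun y => a' (- z + 1 *: y)) = (fun y => a' (y - z)) by apply/funext => x; rewrite scale1r addrC.
  have -> : pderiv p' a' (y' - z) = pderiv p' (fun y => a' (y - z)) y'.
    by rewrite -E [RHS](derive_val (is_derive := H)) scale1r addrC.
  rewrite -(pderiv_mul p' y' (proj1 sz) (proj1 sh')).
  apply: smooth_is_derive; apply: sgen_smooth openT _; apply: sg_mul; apply: sg_base; [exact: (proj1 sz) | exact: (proj1 sh')].
move=> sa sh; rewrite (_ : pderiv q _ = fun y => pderiv q a (y - z) * h y + a (y - z) * pderiv q h y); last first.
  by apply/funext => y'; exact: (derive_val (is_derive := D q a h y' sa sh)).
exact: (derive_val (is_derive := is_deriveD (D p _ _ y (sc_pderiv q sa) sh) (D p _ _ y sa (sc_pderiv q sh)))).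
Qed.

(** The weight [rho k] divided by the volume density: the division compensates for the density
    contained in [mu]. *)
Definition sigma k : V -> R := fun y => unit_piece k y * glob k (fun z => (dens w (c k) z)^-1) y.

Lemma sigma_sc k : sc (sigma k).
Proof.
have sg : sc (glob k (fun z => (dens w (c k) z)^-1)) by apply: glob_sc; exact: (dens_inv_smooth).
by apply: sc_mul sg; case: (unit_piece_sc k).
Qed.

Lemma sigma_dens k y : cball k 6 y -> sigma k y * dens w (c k) y = unit_piece k y.
Proof.
move=> Ky; have Uy : U (c k) y by apply: cball_sub Ky; lra.
rewrite /sigma globE; last by apply: cball_mono Ky; lra.
by rewrite -mulrA mulVf ?mulr1 // gt_eqF // (dens_gt0 kw n0 Uy).
Qed.

Lemma sigma_out k y : ~ cball k 1 y -> sigma k y = 0.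
Proof. by move=> nK; rewrite /sigma piece_out // mul0r. Qed.

(** The mollification at [z] is a pairing of [f] with a test function, the kernel about [z] times
    [sigma]. At a fixed radius the energy of this test function is bounded uniformly in [z], so weak
    smallness becomes pointwise smallness. *)
Lemma mol_weak k e : 0 < e -> exists2 C : R, 0 <= C & forall f (d : R), continuous f -> 0 <= d ->
  (forall v, smooth v -> mu (fun p => v p * f p) ^+ 2 <= d * energy v) -> forall z, mol e (piece k f) z ^+ 2 <= C * d.
Proof.
move=> e0; have en : e != 0 by rewrite gt_eqF.
have sk : sc (mkern (R := R) (m := m) e) by exact: sc_mkern.
have ss := sigma_sc k; set ce := (lc ((e^-1)%:M : 'M[R]_m))^-1 / I (@moll R m).
pose chi z y := mkern e (y - z) * sigma k y.
have sh z := sc_shift (- z) sk.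
have schi z : sc (chi z) by apply: sc_mul ss; case: (sh z).
have fchi z y : ~ cball k 6 y -> chi z y = 0.
  by move=> nK; rewrite /chi sigma_out ?mulr0 // => K1; apply: nK; apply: cball_mono K1; lra.
have sv z : smooth (push (c k) (chi z)) by exact: (push_chi_smooth (proj1 (schi z)) (fchi z)).
have [B B0 BP] : ubd (fun z y => mkern e (y - z) * lap_chart k (chi z) y).
  apply: ubd_mul; first exact: ubd_shift.
  rewrite (_ : (fun z y => _) = fun z y => \sum_p \sum_q coefa k p q y *
     (pderiv p (pderiv q (mkern e)) (y - z) * sigma k y + pderiv q (mkern e) (y - z) * pderiv p (sigma k) y
    + (pderiv p (mkern e) (y - z) * pderiv q (sigma k) y + mkern e (y - z) * pderiv p (pderiv q (sigma k)) y))).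
    apply: ubd_sum => p; apply: ubd_sum => q; apply: ubd_mul; first by apply: ubd_sc; exact: coefa_sc.
    have [s1 s2] : sc (pderiv q (mkern e)) /\ sc (pderiv p (mkern (R := R) (m := m) e)) by split; exact: sc_pderiv.
    have [t1 t2] : sc (pderiv q (sigma k)) /\ sc (pderiv p (sigma k)) by split; exact: sc_pderiv.
    by apply: ubd_add; apply: ubd_add; apply: ubd_mul; do ?[exact: ubd_sc | exact: ubd_shift | apply: ubd_shift; exact: sc_pderiv | apply: ubd_sc; exact: sc_pderiv].
  apply/funext => z; apply/funext => y; apply: eq_bigr => p _; apply: eq_bigr => q _; congr (_ * _).
  exact: pderiv2_kernel.
have cu := sc_cc (unit_piece_sc k).
have cabs : cc (fun y => B * `|unit_piece k y|) by apply: ccZ; exact: cc_norm.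
pose C1 := I (fun y => B * `|unit_piece k y|).
have C10 : 0 <= C1 by apply: int_ge0 cabs _ => y; rewrite mulr_ge0.
(* By Green's formula the energy is minus the pairing of the test function with its image under the
   operator, and [B] bounds the integrand uniformly in [z]. *)
have en_chi z : energy (push (c k) (chi z)) <= C1.
  rewrite /energy (green kw n0 Gn Gk) //.
  rewrite (mu_chart (h := fun y => lap_chart k (chi z) y * dens w (c k) y) (sc_cont (schi z)) (fchi z) (lap_cont kw n0 Gn Gk (sv z))); last first.
    move=> y Ky; rewrite (lap_push (proj1 (schi z)) (fchi z)) push_inv //.
    by apply: cball_sub Ky; lra.
  apply: le_trans (ler_norm _) _; rewrite normrN.
  have E : (fun y => chi z y * (lap_chart k (chi z) y * dens w (c k) y)) = (fun y => unit_piece k y * (mkern e (y - z) * lap_chart k (chi z) y)).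
    apply/funext => y; have [Ky|nK] := pselect (cball k 6 y).
      by rewrite -(sigma_dens Ky) /chi; move: (lap_chart k _ y) => t; ring.
    by rewrite fchi // piece_out ?mul0r // => K1; apply: nK; apply: cball_mono K1; lra.
  rewrite E; apply: int_norm => // [|y].
    apply: ccMr => //; apply: cont_at => y; apply: cont_mul; first exact: (sc_cont (sh z)).
    exact: (proj1 (lap_chart_cc k (schi z))).
  by rewrite normrM mulrC ler_wpM2r.
exists (ce ^+ 2 * C1) => [|f d cf d0 wf z]; first by rewrite mulr_ge0 ?sqr_ge0.
rewrite mol_kconv //; last exact: piece_cc.
have -> : kconv (mkern e) (piece k f) z = mu (fun p => push (c k) (chi z) p * f p).
  rewrite (mu_chart (h := fun y => f (inv (c k) y) * dens w (c k) y) (sc_cont (schi z)) (fchi z) cf) //.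
  rewrite /kconv; congr (I _); apply/funext => y; rewrite /chi.
  have [Ky|nK] := pselect (cball k 1 y); last by rewrite piece_out // sigma_out // !mulr0 mul0r.
  have K6 : cball k 6 y by apply: cball_mono Ky; lra.
  have E : piece k f y = unit_piece k y * f (inv (c k) y).
    by rewrite /piece !patchE mem_set ?mulr1 //; exact: cball1_sub.
  by rewrite E -(sigma_dens K6); ring.
rewrite exprMn -[leRHS]mulrA ler_wpM2l ?sqr_ge0 //; apply: le_trans (wf _ (sv z)) _.
by rewrite mulrC ler_wpM2r.
Qed.

Lemma lap_chart_lin k (a : R) (f g : V -> R) z : smooth_on setT f -> smooth_on setT g ->
  lap_chart k (fun z => a * f z + g z) z = a * lap_chart k f z + lap_chart k g z.
Proof.
move=> sf sg; rewrite /lap_chart mulr_sumr -big_split; apply: eq_bigr => p _ /=; rewrite mulr_sumr -big_split; apply: eq_bigr => q _ /=.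
have E : pderiv p (pderiv q (fun z => a * f z + g z)) z = a * pderiv p (pderiv q f) z + pderiv p (pderiv q g) z.
  exact: pderiv2_lin openT sf sg Logic.I.
apply: (etrans (congr1 (fun t => _ * t) E)).
by move: (pderiv p (pderiv q f) z) (pderiv p (pderiv q g) z) => s t; ring.
Qed.

Lemma mol_piece_lin k e (a : R) u v : continuous u -> continuous v ->
  mol e (piece k (fun p => a * u p + v p)) = (fun z => a * mol e (piece k u) z + mol e (piece k v) z).
Proof.
move=> cu cv; apply/funext => z; rewrite -mol_lin; [|by case: (piece_cc k cu)|by case: (piece_cc k cv)].
apply: mol_eq => y _; rewrite /piece !patchE; case: ifP => _; last by rewrite mulr0 addr0.
by ring.
Qed.

Lemma error_lin k e (a : R) u v z : 0 < e -> smooth u -> smooth v ->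
  error k e (fun p => a * u p + v p) z = a * error k e u z + error k e v z.
Proof.
move=> e0 su sv; have en : e != 0 by rewrite gt_eqF.
have [cu cv] := (smooth_fun_continuous su, smooth_fun_continuous sv).
have lin : lap (fun p => a * u p + v p) = (fun p => a * lap u p + lap v p).
  by apply/funext => p; exact: lap_lin.
rewrite /error lin !mol_piece_lin //; try exact: (lap_cont kw n0 Gn Gk).
rewrite lap_chart_lin; try by apply: mol_smooth en _; exact: piece_cc.
have lem (s1 s2 s3 s4 : R) : a * s1 + s2 - (a * s3 + s4) = a * (s1 - s3) + (s2 - s4) by ring.
exact: lem.
Qed.

Lemma defect_sum u p : smooth u -> \sum_k push (c k) (defect k u) p = 0.
Proof.
move=> su; have sp k := piece_sc k su.
have E k : push (c k) (defect k u) p = lap (fun p => rho k p * u p) p - rho k p * lap u p.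
  have <- : push (c k) (piece k u) = (fun p => rho k p * u p) by apply/funext => q; exact: push_piece.
  rewrite (lap_push (proj1 (sp k))) -?push_piece; last first.
    by move=> z nK; apply: piece_out => K1; apply: nK; apply: cball_mono K1; lra.
  by have [dp|ndp] := pselect (dom (c k) p); [rewrite !push_in | rewrite !push_out // subrr].
transitivity (\sum_(k : ball_index A) lap (fun p => rho k p * u p) p - (\sum_(k : ball_index A) rho k p) * lap u p).
  by rewrite mulr_suml -sumrB; exact: eq_bigr.
rewrite sum_rho mul1r.
rewrite -lap_sum => [|k]; last by apply: smooth_funM => //; exact: (rho_smooth kw).
by apply/eqP; rewrite subr_eq0; apply/eqP; congr (lap _ p); apply/funext => q; rewrite -mulr_suml sum_rho mul1r.
Qed.

(** * Almost minimizers of the Dirichlet functional *)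

Variable f : M -> R.
Hypotheses (cf : continuous f) (mf : mu f = 0).

(** Its first variation at [u] in the direction [v] is the integral of v (f - lap u), so critical
    points solve lap u = f. *)
Definition functional u := energy u / 2 + mu (fun p => f p * u p).

Lemma functional_line t d v : smooth d -> smooth v ->
  functional (fun p => t * d p + v p) = t ^+ 2 * (energy d / 2) + t * (mu (carre d v) + mu (fun p => f p * d p)) + functional v.
Proof.
move=> sd sv; rewrite /functional energy_lin //; have [cd cv] := (smooth_fun_continuous sd, smooth_fun_continuous sv).
have -> : mu (fun p => f p * (t * d p + v p)) = t * mu (fun p => f p * d p) + mu (fun p => f p * v p).
  rewrite -(muL kw); [|by cont|by cont].
  by congr mu; apply/funext => p; ring.
by move: (energy d) (mu (carre d v)) (energy v) (mu _) (mu _) => s1 s2 s3 s4 s5; field.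
Qed.

Lemma carre_cst u (a : R) p : smooth u -> carre u (fun=> a) p = 0.
Proof.
move=> su; have [i di Uz] := dom_chart X p.
rewrite -(chartK di) (carreE kw n0 Gn Gk) //; last exact: smooth_fun_cst.
rewrite big1 ?mul0r // => q _; rewrite big1 // => q' _.
by rewrite (_ : pderiv q' _ _ = 0) ?mulr0 //; exact: derive_cst.
Qed.

Lemma functional_addc u (a : R) : smooth u -> functional (fun p => u p + a) = functional u.
Proof.
move=> su; have sa := smooth_fun_cst (X := X) a.
have z : mu (carre u (fun=> a)) = 0 by rewrite (_ : carre u _ = fun=> 0) ?(mu0 kw) //; apply/funext => p; exact: carre_cst.
have z' : energy (fun=> a) = 0.
  by rewrite /energy (_ : carre _ _ = fun=> 0) ?(mu0 kw) //; apply/funext => p; apply: carre_cst; exact: smooth_fun_cst.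
have cu := smooth_fun_continuous su.
transitivity (functional (fun p => 1 * u p + a)); first by congr functional; apply/funext => p; rewrite mul1r.
rewrite functional_line // z /functional z' (_ : mu (fun p => f p * a) = 0).
  by move: (energy u) (mu _) => s1 s2; field.
by rewrite (_ : (fun p => f p * a) = (fun p => a * f p)) ?(muZ kw) ?mf ?mulr0 //; apply/funext => p; rewrite mulrC.
Qed.

Lemma centre u : smooth u -> exists a : R, mu (fun p => u p + a) = 0.
Proof.
move=> su; have cu := smooth_fun_continuous su.
have [[p0 _]|noM] := pselect (exists p : M, True); last first.
  by exists 0; rewrite (_ : (fun p => _) = fun=> 0) ?(mu0 kw) //; apply/funext => p; case: noM; exists p.
have mu1 : 0 < mu (fun=> 1) by apply: (mu_gt0 kw n0 A (p := p0)) => //; exact: cst_continuous.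
exists (- mu u / mu (fun=> 1)); rewrite (muD kw) //; last exact: cst_continuous.
rewrite [X in _ + X](_ : _ = - mu u); first by rewrite subrr.
rewrite (_ : (fun=> _) = (fun p : M => - mu u / mu (fun=> 1) * 1)); last by apply/funext => p; rewrite mulr1.
by rewrite (muZ kw) ?divfK ?gt_eqF //; exact: cst_continuous.
Qed.

(** As [f] has mean zero, [u] may be centred. Then the square of the linear term is at most [K]
    times the energy, with [K] from the Poincare inequality, and half the energy absorbs the linear
    term up to [K]. *)
Lemma functional_bound : exists K : R, forall u, smooth u -> K <= functional u.
Proof.
have [C C0 CP] := poincare.
have F0 : 0 <= mu (fun p => f p ^+ 2).
  by apply: (mu_ge0 kw n0) => [|p]; [by cont | exact: sqr_ge0].
exists (- (mu (fun p => f p ^+ 2) * C)) => u su; have [a ma] := centre su.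
rewrite -(functional_addc a su); set v := fun p => u p + a in ma *.
have sv : smooth v by apply: smooth_funD => //; exact: smooth_fun_cst.
have cv := smooth_fun_continuous sv; have E0 := energy_ge0 sv.
have := mu_cs (@cst_continuous _ _ (1 : R)) (fun _ => ler01) cf cv.
have E g : mu (fun p => 1 * g p) = mu g by congr mu; apply/funext => p; rewrite mul1r.
rewrite !E.
move=> H; have {}H := le_trans H (ler_wpM2l F0 (CP v sv ma)).
rewrite /functional; set x := mu (fun p => f p * v p) in H *; set K := mu _ * C; rewrite mulrA -/K in H.
have K0 : 0 <= K by exact: mulr_ge0.
have : `|x| <= (energy v + 2 * K) / 2.
  rewrite -ler_sqr ?nnegrE ?divr_ge0 ?addr_ge0 ?mulr_ge0 // real_normK ?num_real //.
  by apply: le_trans H _; have := sqr_ge0 (energy v); have := mulr_ge0 K0 E0; have := sqr_ge0 (energy v - 2 * K); nra.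
by rewrite ler_norml => /andP[H1 _]; lra.
Qed.

Let inf_f := inf [set functional u | u in smooth].

Definition near_min d u := [/\ smooth u, mu u = 0 & functional u < inf_f + d].

Lemma inf_le u : smooth u -> inf_f <= functional u.
Proof.
move=> su; apply: ge_inf; last by exists u.
by have [K KP] := functional_bound; exists K => _ [v sv <-]; exact: KP.
Qed.

Lemma near_min_exists d : 0 < d -> exists u, near_min d u.
Proof.
move=> d0; have hi : has_inf [set functional u | u in smooth].
  split; first by exists (functional (fun=> 0)); exists (fun=> 0) => //; exact: smooth_fun_cst.
  by have [K KP] := functional_bound; exists K => _ [v sv <-]; exact: KP.
have [_ [u su <-] Ju] := inf_adherent d0 hi; have [a ma] := centre su.
exists (fun p => u p + a); split => //; last by rewrite functional_addc.
by apply: smooth_funD => //; exact: smooth_fun_cst.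
Qed.

(** By the parallelogram law the functional at the midpoint is the mean of its two values minus one
    eighth of the energy of the difference, and it is not below the infimum. *)
Lemma near_min_close d u v : near_min d u -> near_min d v -> energy (fun p => (-1) * v p + u p) <= 8 * d.
Proof.
move=> [su _ Ju] [sv _ Jv]; set w' := fun p => _.
have sw : smooth w' by exact: smooth_fun_lin.
have sh t : smooth (fun p => t * w' p + v p) by exact: smooth_fun_lin.
have uE : u = (fun p => 1 * w' p + v p) by apply/funext => p; rewrite /w'; ring.
have := inf_le (sh (2^-1)); rewrite functional_line // => Jh.
rewrite uE functional_line // expr1n !mul1r in Ju; rewrite expr2 in Jh.
by move: Ju Jv Jh; move: (energy w') (mu (carre w' v)) (mu _) (functional v) (inf_f) => e1 e2 e3 e4 e5; lra.
Qed.

(** Along the line u + t v the functional is quadratic in [t] and never falls by more than [d]; the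
    bound is the discriminant condition. *)
Lemma near_min_weak d u : near_min d u -> forall v, smooth v ->
  mu (fun p => v p * (lap u p - f p)) ^+ 2 <= 2 * d * energy v.
Proof.
move=> [su _ Ju] v sv; set L := mu (carre v u) + mu (fun p => f p * v p).
have cv := smooth_fun_continuous sv.
have -> : mu (fun p => v p * (lap u p - f p)) = - L.
  have cl := lap_cont kw n0 Gn Gk su.
  rewrite /L (green kw n0 Gn Gk) // opprD opprK -(muB kw); [|by cont|by cont].
  by congr mu; apply/funext => p; rewrite mulrBr [v p * f p]mulrC.
have H : (L / 2) ^+ 2 <= energy v / 2 * d.
  apply: discriminant_le => [|t]; first by rewrite divr_ge0 // energy_ge0.
  have st : smooth (fun p => t * v p + u p) by exact: smooth_fun_lin.
  by have := inf_le st; rewrite functional_line // -/L => Jt; lra.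
by rewrite sqrrN; lra.
Qed.

Lemma ccut3_int_ge0 k : 0 <= I (ccut k 3).
Proof. by apply: int_ge0 (ccut3_cc k) _ => z; have /andP[] := ccut_itv k 3 z. Qed.

(** The solution is [smear], the sum over the charts of mollified localizations of an almost
    minimizer. In each chart its residual splits into four parts, each of which has square integral
    at most [tau] for a reason of its own. *)
Theorem approximate_solution eta : 0 < eta ->
  exists2 u, smooth u & mu (fun p => (lap u p - f p) ^+ 2) < eta.
Proof.
move=> eta0; have [D D0 DP] := push_sum_sqr; have [CP CP0 poin] := poincare.
pose N : R := #|ball_index A|%:R; have N0 : 0 <= N by rewrite ler0n.
(* Four parts of square integral at most [tau] give at most [16 * tau] in each of the [N] charts,
   and [push_sum_sqr] contributes the factor [D]. *)
pose tau := eta / (16 * (D * N + 1)).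
have DN0 : 0 <= D * N by exact: mulr_ge0.
have q0 : 0 < 16 * (D * N + 1) by rewrite mulr_gt0 //; lra.
have tau0 : 0 < tau by rewrite divr_gt0.
pose Ck k := s2val (cid2 (bdd_error k)).
have Ck0 k : 0 <= Ck k by exact: (s2valP (cid2 (bdd_error k))).
have CkP k := s2valP' (cid2 (bdd_error k)).
pose S1 := \sum_k Ck k.
have S10 : 0 <= S1 by apply: sumr_ge0.
have CkS k : Ck k <= S1 by rewrite /S1 (bigD1 k) //= lerDl sumr_ge0.
(* Two almost minimizers at level [del] differ by an energy of at most [8 * del]. With the Poincare
   constant [CP] and the commutator bound [S1] this yields at most [tau]. *)
pose del := tau / (8 * (S1 + 1) * (1 + CP)).
have q1 : 0 < 8 * (S1 + 1) * (1 + CP) by rewrite mulr_gt0 // ?mulr_gt0 //; lra.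
have del0 : 0 < del by rewrite divr_gt0.
have [u0 nu0] := near_min_exists del0; have [su0 mu0 _] := nu0.
have ek k : exists2 e0 : R, 0 < e0 & forall e, 0 < e -> e < e0 -> [/\ e <= r k,
    I (fun z => (error k e u0 z - defect k u0 z) ^+ 2) < tau & I (fun z => (mol e (piece k f) z - piece k f z) ^+ 2) < tau].
  have [e1 e1_0 P1] := small_error k su0 tau0.
  have [e2 e2_0 P2] := cvg_mol (@cst_continuous _ _ (1 : R)) (piece_cc k cf) tau0.
  exists (Num.min (r k) (Num.min e1 e2)) => [|e e_0]; first by rewrite !lt_min e1_0 e2_0 (bradius_gt0 k).
  rewrite !lt_min => /and3P[er l1 l2]; split; [exact: ltW | exact: (P1 e e_0 l1).2 |].
  by have := P2 e (ltW e_0) l2; under [X in I X]eq_fun do rewrite !mul1r.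
pose e_ k := s2val (cid2 (ek k)).
have e_P k := s2valP' (cid2 (ek k)).
have [e' e'0 e'P] := finite_min (fun k => s2valP (cid2 (ek k)) : 0 < e_ k).
pose e := e' / 2; have e0 : 0 < e by rewrite divr_gt0.
have {}e_P k := e_P k e e0 (lt_le_trans (_ : e < e') (e'P k)).
have {}e_P k : [/\ e <= r k, I (fun z => (error k e u0 z - defect k u0 z) ^+ 2) < tau &
    I (fun z => (mol e (piece k f) z - piece k f z) ^+ 2) < tau] by apply: e_P; rewrite /e; lra.
have en : e != 0 by rewrite gt_eqF.
pose Wk k := s2val (cid2 (mol_weak k e0)).
have Wk0 k : 0 <= Wk k by exact: (s2valP (cid2 (mol_weak k e0))).
have WkP k := s2valP' (cid2 (mol_weak k e0)).
pose S2 := \sum_k Wk k * I (ccut k 3).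
have S20 : 0 <= S2 by apply: sumr_ge0 => k _; rewrite mulr_ge0 ?ccut3_int_ge0.
have WkS k : Wk k * I (ccut k 3) <= S2.
  by rewrite /S2 (bigD1 k) //= lerDl sumr_ge0 // => l _; rewrite mulr_ge0 ?ccut3_int_ge0.
(* [S2] depends on the radius [e], fixed before. The first bound keeps [u] close to [u0], the second
   makes its mollified residual small. *)
pose del2 := Num.min del (tau / (2 * (S2 + 1))).
have q2 : 0 < 2 * (S2 + 1) by rewrite mulr_gt0 //; lra.
have del20 : 0 < del2 by rewrite lt_min del0 divr_gt0.
have [u nu] := near_min_exists del20; have [su mu_u Ju] := nu.
have nu' : near_min del u by split => //; apply: lt_le_trans Ju _; rewrite lerD2l ge_min lexx.
pose d p := (-1) * u0 p + u p.
have sd : smooth d by exact: smooth_fun_lin.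
have [cu cu0] := (smooth_fun_continuous su, smooth_fun_continuous su0).
have Ed : energy d <= 8 * del by exact: near_min_close nu' nu0.
have md : mu d = 0 by rewrite /d (muL kw) // mu0 mu_u mulr0 addr0.
have clu := lap_cont kw n0 Gn Gk su.
pose g p := lap u p - f p.
have cg : continuous g by apply: cont_at => p; apply: cont_sub; [exact: clu | exact: cf].
(* The terms are the commutator on u - u0, small in H^1; the commutator on [u0] minus its limit; the
   mollified residual of [u]; and the mollification error of [f]. Subtracting the limit
   [defect k u0] costs nothing, since its sum over the charts is 0. *)
pose H k z := (error k e d z + (error k e u0 z - defect k u0 z)) + (mol e (piece k g) z + (mol e (piece k f) z - piece k f z)).
have H1E k z : H k z = lap_chart k (mol e (piece k u)) z - piece k f z - defect k u0 z.
  have E1 : error k e d z = (-1) * error k e u0 z + error k e u z by exact: error_lin.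
  have E2 : mol e (piece k (lap u)) z = 1 * mol e (piece k g) z + mol e (piece k f) z.
    rewrite -(congr1 (@^~ z) (mol_piece_lin k e 1 cg cf)); congr (mol e (piece k _) z); apply/funext => p.
    by rewrite /g mul1r subrK.
  have E3 : error k e u z = lap_chart k (mol e (piece k u)) z - mol e (piece k (lap u)) z by [].
  have lem (s1 s2 s3 s4 s5 s6 s7 s8 : R) : s1 = -1 * s2 + s3 -> s3 = s4 - s5 -> s5 = 1 * s6 + s7 ->
    (s1 + (s2 - s8)) + (s6 + (s7 - piece k f z)) = s4 - piece k f z - s8 by move=> -> -> ->; ring.
  exact: lem E1 E3 E2.
have smol k : smooth_on setT (mol e (piece k u)) by apply: mol_smooth en _; exact: piece_cc.
have mol_out k (h : M -> R) : forall z, ~ cball k 6 z -> mol e (piece k h) z = 0.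
  move=> z nK; have [er _ _] := e_P k; apply: mol_piece_out (ltW e0) er _ => K2; apply: nK.
  by apply: cball_mono K2; lra.
have fmol k := mol_out k u.
pose smear p := \sum_k push (c k) (mol e (piece k u)) p.
have ssm : smooth smear by apply: smooth_fun_sum => k; exact: (push_chi_smooth (smol k) (fmol k)).
have pushE p : lap smear p - f p = \sum_k push (c k) (H k) p.
  have E1 : lap smear p = \sum_k push (c k) (lap_chart k (mol e (piece k u))) p.
    rewrite /smear lap_sum => [|k]; last exact: (push_chi_smooth (smol k) (fmol k)).
    by apply: eq_bigr => k _; rewrite (lap_push (smol k) (fmol k)).
  have E2 : f p = \sum_k push (c k) (piece k f) p.
    by under eq_bigr do rewrite push_piece; rewrite -mulr_suml sum_rho mul1r.
  transitivity (\sum_k push (c k) (lap_chart k (mol e (piece k u))) p - \sum_k push (c k) (piece k f) p - \sum_k push (c k) (defect k u0) p).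
    by rewrite (defect_sum p su0) subr0 -E1 -E2.
  rewrite -!sumrB; apply: eq_bigr => k _.
  by have [dp|ndp] := pselect (dom (c k) p); [rewrite !push_in // H1E | rewrite !push_out // !subr0].
have cer k v : smooth v -> cc (error k e v) by move=> sv; exact: (CkP k e v e0 sv).1.
have cdef k v : smooth v -> cc (defect k v).
  move=> sv; apply: ccB; first by apply: lap_chart_cc; exact: piece_sc.
  by apply: piece_cc; exact: lap_cont.
have c1 k : cc (fun z => error k e d z + (error k e u0 z - defect k u0 z)) by apply: ccD; [exact: cer | apply: ccB; [exact: cer | exact: cdef]].
have c2 k : cc (fun z => mol e (piece k g) z + (mol e (piece k f) z - piece k f z)).
  by apply: ccD; [apply: mol_cc; exact: piece_cc | apply: ccB; [apply: mol_cc; exact: piece_cc | exact: piece_cc]].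
exists smear => //; under [X in mu X]eq_fun do rewrite pushE.
have cH k : continuous (H k) by case: (ccD (c1 k) (c2 k)).
have fH k z : ~ cball k 6 z -> H k z = 0.
  have o1 (v : M -> R) y : ~ cball k 6 y -> piece k v y = 0.
    by move=> nK; apply: piece_out => K1; apply: nK; apply: cball_mono K1; lra.
  move=> nK; rewrite H1E (lap_chart_out (fmol k) nK) o1 // /defect (lap_chart_out (o1 u0) nK) o1 //.
  by rewrite !subrr.
apply: le_lt_trans (DP H cH fH) _.
have IH k : I (fun z => H k z ^+ 2) <= 16 * tau.
  apply: le_trans (int_sqr_add (c1 k) (c2 k)) _.
  have i1 : I (fun z => error k e d z ^+ 2) <= tau.
    apply: le_trans (CkP k e d e0 sd).2 _.
    have P := poin d sd md; apply: le_trans (_ : _ <= S1 * ((1 + CP) * (8 * del))) _.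
      apply: ler_pM; [exact: Ck0 | exact: (H1_ge0) | exact: CkS |].
      by rewrite mulrDl mul1r; apply: lerD => //; apply: le_trans P _; exact: ler_wpM2l.
    rewrite /del (_ : S1 * _ = tau * (S1 / (S1 + 1))); last first.
      have [s1 s2] : 0 < S1 + 1 /\ 0 < 1 + CP by split; lra.
      by field; rewrite !gt_eqF.
    by rewrite ler_piMr ?(ltW tau0) // ler_pdivrMr ?mul1r ?lerDl //; lra.
  have [_ i2 i4] := e_P k.
  have i3 : I (fun z => mol e (piece k g) z ^+ 2) <= tau.
    have W := WkP k g (2 * del2) cg (mulr_ge0 (ler0n _ 2) (ltW del20)) (near_min_weak nu).
    apply: le_trans (_ : _ <= I (fun z => Wk k * (2 * del2) * ccut k 3 z)) _.
      apply: int_le => [||z].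
      - by apply: cc_sqr; apply: mol_cc; exact: piece_cc.
      - by apply: ccZ; exact: ccut3_cc.
      have [K2|nK] := pselect (cball k 2 z); first by rewrite ccut1 ?mulr1 ?W //; apply: cball_mono K2; lra.
      have [er _ _] := e_P k; rewrite (mol_piece_out _ (ltW e0) er nK) expr0n; apply: mulr_ge0; last exact: ccut3_ge0.
      by apply: mulr_ge0 => //; apply: mulr_ge0 => //; exact: ltW.
    rewrite intZ; last exact: ccut3_cc.
    rewrite mulrAC; apply: le_trans (_ : _ <= S2 * (2 * (tau / (2 * (S2 + 1))))) _.
      apply: ler_pM; [by rewrite mulr_ge0 ?ccut3_int_ge0 | by rewrite mulr_ge0 // ltW | exact: WkS |].
      by rewrite ler_pM2l // ge_min lexx orbT.
    rewrite (_ : S2 * _ = tau * (S2 / (S2 + 1))); last by field; rewrite gt_eqF //; lra.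
    by rewrite ler_piMr ?(ltW tau0) // ler_pdivrMr ?mul1r ?lerDl //; lra.
  have j1 := int_sqr_add (cer k d sd) (ccB (cer k u0 su0) (cdef k u0 su0)).
  have j2 := int_sqr_add (mol_cc e (piece_cc k cg)) (ccB (mol_cc e (piece_cc k cf)) (piece_cc k cf)).
  lra.
apply: le_lt_trans (_ : _ <= D * (N * (16 * tau))) _.
  rewrite ler_wpM2l // /N mulr_natl -sumr_const; apply: ler_sum => k _; exact: IH.
rewrite (_ : D * _ = 16 * (D * N) * tau); last by ring.
rewrite mulrC [tau * _]mulrAC ltr_pdivrMr // ltr_pM2l // ltr_pM2l //; lra.
Qed.

End Poincare.

(** * Determinants of positive semidefinite matrices *)

Section Determinants.
Context {R : realType}.

Lemma det_continuous p (F : R -> 'M[R]_p) s : (forall i j, {for s, continuous (fun s => F s i j)}) ->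
  {for s, continuous (fun s => \det (F s))}.
Proof.
move=> cF; apply: cont_sum => t _; cont.
by apply: cont_prod => i _; exact: cF.
Qed.

(* Join the matrix to the identity by a segment of positive definite matrices. *)
Lemma psd_det_ge0 p (Q : 'M[R]_p) : (forall x : 'rV[R]_p, 0 <= (x *m Q *m x^T) 0 0) -> 0 <= \det Q.
Proof.
move=> psd; rewrite leNgt; apply/negP => dQ.
pose F (s : R) : 'M[R]_p := s%:M + (1 - s) *: Q.
have cF (s : R) : {for s, continuous (fun s => \det (F s))}.
  apply: det_continuous => i j; rewrite (_ : (fun s => F s i j) = fun s => s * (i == j)%:R + (1 - s) * Q i j).
    apply: cont_add; apply: cont_mul; try exact: cont_cst; first exact: cvg_id.
    by apply: cont_sub; [exact: cont_cst | exact: cvg_id].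
  by apply/funext => t; rewrite !mxE mulr_natr.
have d0 : \det (F 0) < 0 by rewrite /F subr0 scale1r -[0%:M]/(scalar_mx 0) (_ : scalar_mx 0 = 0) ?add0r //; apply/matrixP => i j; rewrite !mxE mul0rn.
have d1 : \det (F 1) = 1 by rewrite /F subrr scale0r addr0 det1.
have [||s s01 ds] := @IVT R (fun s => \det (F s)) 0 1 0 ler01.
- by apply: continuous_subspaceT => s; exact: cF.
- by rewrite d1 min_l ?max_r ?(ltW d0) ?ler01 // (le_trans (ltW d0)).
move: s01; rewrite in_itv /= => /andP[]; rewrite le_eqVlt => /predU1P[s0|s0 s1].
  by move=> _; move: ds d0; rewrite -s0 => ->; rewrite ltxx.
have /det0P[x x0 xF] : \det (F s) == 0 by rewrite ds.
have E : (x *m F s *m x^T) 0 0 = s * (x *m x^T) 0 0 + (1 - s) * (x *m Q *m x^T) 0 0.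
  by rewrite /F mulmxDr mulmxDl mul_mx_scalar -scalemxAr -!scalemxAl [LHS]mxE; congr (_ + _); rewrite [LHS]mxE.
rewrite xF mul0mx mxE in E.
have xx : 0 < (x *m x^T) 0 0.
  have := sqn_gt0 x0; rewrite /sqn mxE; congr (_ < _); apply: eq_bigr => i _; by rewrite mxE.
have := psd x; have := mulr_gt0 s0 xx; have := mulr_ge0 (_ : 0 <= 1 - s) (psd x).
by rewrite subr_ge0 => /(_ s1); lra.
Qed.

(** The matrix on the right is minus the corner entry times the Schur complement of that entry,
    which accounts for the sign and for the power in the denominator. *)
Lemma schur_det r (d : 'M[R]_(r.+1)) : d ord0 ord0 != 0 ->
  (- 1) ^+ r * \det d = d ord0 ord0 / d ord0 ord0 ^+ r *
   \det (\matrix_(i < r, j < r) (d (lift ord0 i) ord0 * d ord0 (lift ord0 j) - d ord0 ord0 * d (lift ord0 i) (lift ord0 j))).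
Proof.
move=> d0; set a := d ord0 ord0 in d0 *; set S := \matrix_(i, j) _.
pose L : 'M[R]_(1 + r) := block_mx 1 0 (- a^-1 *: dlsubmx (d : 'M[R]_(1 + r))) 1%:M.
have dE : (d : 'M[R]_(1 + r)) = block_mx a%:M (ursubmx (d : 'M[R]_(1 + r))) (dlsubmx (d : 'M[R]_(1 + r))) (drsubmx (d : 'M[R]_(1 + r))).
  apply: etrans (esym (submxK (d : 'M[R]_(1 + r)))) _; congr block_mx; apply/matrixP => i j; rewrite !ord1 !mxE mulr1n; congr (d _ _); exact: val_inj.
have LD : L *m (d : 'M[R]_(1 + r)) = block_mx a%:M (ursubmx (d : 'M[R]_(1 + r))) 0 (- a^-1 *: S).
  rewrite [in LHS]dE mulmx_block !mul1mx !mul0mx !addr0; congr block_mx.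
    by rewrite mul_mx_scalar scalerA mulrN mulfV // scaleN1r addNr.
  apply/matrixP => i j; rewrite mxE [X in X + _]mxE big_ord1 !mxE.
  have -> : rshift 1 i = lift ord0 i :> 'I_r.+1 by exact: val_inj.
  have -> : rshift 1 j = lift ord0 j :> 'I_r.+1 by exact: val_inj.
  have -> : lshift r (ord0 : 'I_1) = ord0 :> 'I_r.+1 by exact: val_inj.
  by rewrite -/a; field.
have := congr1 (fun B : 'M[R]_(1 + r) => \det B) LD; rewrite det_mulmx det_lblock det_ublock !det1 !mul1r det_scalar1 detZ => E.
have tt : (-1 : R) ^+ r * (-1) ^+ r = 1 by rewrite -expr2 sqrr_sign.
have -> : \det d = a * ((-1) ^+ r / a ^+ r * \det S) by rewrite E (exprNn a^-1) exprVn.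
transitivity ((-1) ^+ r * (-1) ^+ r * (a / a ^+ r * \det S)); first by ring.
by rewrite tt mul1r.
Qed.

End Determinants.

(** * Intersection numbers of closed forms *)

Section Intersection.
Context {R : realType} {n : nat} {M : topologicalType} (X : complex_manifold R n M).
Local Notation m := (n * 2)%N.
Local Notation V := 'rV[R]_m.
Local Notation smooth := (smooth_function X).

Variable w : coef2 X.
Hypothesis kw : kahler_form w.
Hypothesis n2 : (2 <= n)%N.
Variable A : bump_atlas X.
Local Notation mu := (@mu _ _ _ _ w A).
Local Notation closed2 a := (two_form a /\ closed_form a).
Implicit Types (a b : coef2 X) (s g : seq (coef2 X)) (i j : chart_index X) (z : V).

Let n0 : (0 < n)%N := ltnW n2.

Definition lin (c : R) a b : coef2 X := fun i z => c *: a i z + b i z.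

Lemma lin_two_form c a b : two_form a -> two_form b -> two_form (lin c a b).
Proof.
move=> [sa ta la] [sb tb lb]; split=> [i k l|i z Uz|i j z Uz dz].
- rewrite (_ : (fun z => _) = fun z => c * a i z k l + b i z k l); last by apply/funext => z; rewrite !mxE.
  apply: chart_sgen; apply: sg_add; [apply: sg_mul; [exact: sg_cst | exact: sg_base] | exact: sg_base].
- by rewrite /lin linearP /= ta // tb // scalerN opprD.
- by rewrite /lin (la i j) // (lb i j) // mulmxDr mulmxDl -scalemxAr -!scalemxAl.
Qed.

Lemma lin_closed c a b : two_form a -> two_form b -> closed_form a -> closed_form b -> closed_form (lin c a b).
Proof.
move=> [sa _ _] [sb _ _] ca cb i z Uz j k l.
have d p q q' : pderiv p (fun z => lin c a b i z q q') z = c * pderiv p (fun z => a i z q q') z + pderiv p (fun z => b i z q q') z.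
  rewrite (_ : (fun z => lin c a b i z q q') = fun z => c * a i z q q' + b i z q q'); last by apply/funext => y; rewrite !mxE.
  exact: pderiv_lin (sa i q q') (sb i q q') Uz.
have := ca i z Uz j k l; have := cb i z Uz j k l; rewrite !d => Hb Ha.
have lem (s1 s2 s3 t1 t2 t3 : R) : s1 + s2 + s3 = 0 -> t1 + t2 + t3 = 0 -> c * s1 + t1 + (c * s2 + t2) + (c * s3 + t3) = 0.
  by move=> E1 E2; transitivity (c * (s1 + s2 + s3) + (t1 + t2 + t3)); [ring | rewrite E1 E2 mulr0 addr0].
exact: lem Ha Hb.
Qed.

Lemma lin_closed11 c a b : closed11 a -> closed11 b -> closed11 (lin c a b).
Proof.
move=> [ta a11 ca] [tb b11 cb]; split; [exact: lin_two_form | | exact: lin_closed].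
by move=> i z Uz; rewrite /lin mulmxDr mulmxDl -scalemxAr -scalemxAl a11 // b11.
Qed.

Lemma dform_two_form (e : Defs.coef1 X) : one_form e -> two_form (dform e : coef2 X).
Proof.
move=> oe; split; [exact: dform_smooth oe.1 | | by move=> i j z Uz dz; exact: (dform_pulls kw oe (conj Uz dz))].
by move=> i z _; apply/matrixP => k l; rewrite !mxE opprB.
Qed.

Lemma dform_closed (e : Defs.coef1 X) : one_form e -> closed_form (dform e : coef2 X).
Proof.
move=> [se _] i z Uz j k l; have oU := @image_open _ _ _ X i.
have d p q q' : pderiv p (fun z => dform e i z q q') z = pderiv p (pderiv q (fun z => e i z 0 q')) z - pderiv p (pderiv q' (fun z => e i z 0 q)) z.
  have D q1 q2 := smooth_on_is_derive p (smooth_pderiv q1 (se i q2)) Uz.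
  rewrite (_ : (fun z => _) = fun z => pderiv q (fun z => e i z 0 q') z - pderiv q' (fun z => e i z 0 q) z); last by apply/funext => y; rewrite mxE.
  exact: (derive_val (is_derive := is_deriveB (D q q') (D q' q))).
have S p q q' : pderiv p (pderiv q (fun z => e i z 0 q')) z = pderiv q (pderiv p (fun z => e i z 0 q')) z by exact: schwarz oU (se i q') Uz.
rewrite !d; have lem (s1 s2 s3 t1 t2 t3 : R) : s1 = t1 -> s2 = t2 -> s3 = t3 -> s1 - s2 + (s3 - t1) + (t2 - t3) = 0.
  by move=> -> -> ->; ring.
exact: lem (S j k l) (S j l k) (S k l j).
Qed.

Lemma wedge_top_forms s : size s = n -> (forall k, two_form (nth w s k)) -> top_form (wedge s).
Proof.
move=> sn ts; apply: (wedge_top_form (w := w) sn) => [k i p q|k i j z o]; have [sk _ lk] := ts k; first exact: sk.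
exact: lk o.1 o.2.
Qed.

Definition ig s : R := mu (quot w (wedge s)).

Lemma ig_cont s : size s = n -> (forall k, two_form (nth w s k)) -> continuous (quot w (wedge s)).
Proof. by move=> sn ts; apply: (quot_cont kw n0); exact: wedge_top_forms. Qed.

Lemma ig_middle g a s : size (g ++ a :: s) = n -> ig (g ++ a :: s) = ig (a :: g ++ s).
Proof.
move=> sn; congr mu; congr quot; apply/funext => i; apply/funext => z; rewrite /wedge; congr (_ * _).
by apply: wl_perm; rewrite ?size_map // !map_cat /= map_cat -cat1s perm_catCA.
Qed.

Lemma quot_lin c a b s p : size s = n.-1 -> (forall k, two_form (nth w s k)) -> two_form a -> two_form b ->
  quot w (wedge (lin c a b :: s)) p = c * quot w (wedge (a :: s)) p + quot w (wedge (b :: s)) p.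
Proof. by move=> sn ts ta tb; rewrite /quot /wedge /= wl_cons_lin //; ring. Qed.

Lemma ig_lin c a b s : size s = n.-1 -> (forall k, two_form (nth w s k)) -> two_form a -> two_form b ->
  ig (lin c a b :: s) = c * ig (a :: s) + ig (b :: s).
Proof.
move=> sn ts ta tb; have S t : size (t :: s) = n by rewrite /= sn prednK.
rewrite /ig -(muL kw); try by apply: ig_cont => // -[|k] //=.
by congr mu; apply/funext => p; exact: quot_lin.
Qed.

(** The two forms differ by an exact form, which contributes 0 by Stokes' theorem. *)
Lemma ig_cohomologous a b s : size s = n.-1 -> (forall k, closed2 (nth w s k)) -> two_form a -> two_form b ->
  cohomologous a b -> ig (a :: s) = ig (b :: s).
Proof.
move=> sn cs ta tb [e oe abe]; have ts k : two_form (nth w s k) by case: (cs k).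
have -> : ig (a :: s) = ig (lin 1 (dform e) b :: s).
  have tl := lin_two_form 1 (dform_two_form oe) tb.
  have S t : size (t :: s) = n by rewrite /= sn prednK.
  congr mu; apply/funext => p; have [i di Uz] := dom_chart X p.
  rewrite -(chartK di) !(quotE kw n0) //; try by apply: wedge_top_forms => // -[|k] //=.
  congr (_ / _); rewrite /wedge /=; congr (_ * wl (_ :: _)); apply/matrixP => k l.
  by rewrite /lin scale1r !mxE -(abe i _ Uz) subrK.
rewrite ig_lin //; last exact: dform_two_form.
by rewrite /ig (stokes kw n0 sn cs A oe) mulr0 add0r.
Qed.

Hypothesis cM : compact [set: M].
Hypothesis conM : connected [set: M].

Lemma positive_lower_bound (f : M -> R) : continuous f -> (forall p, 0 < f p) -> exists2 C : R, 0 <= C & forall p, 1 <= C * f p.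
Proof.
move=> cf f0; have ci : continuous (fun p => (f p)^-1).
  by apply: cont_at => p; apply: cont_inv; [rewrite gt_eqF | exact: cf].
have /compact_bounded[B [_ BP]] : compact ((fun p => (f p)^-1) @` [set: M]).
  by apply: continuous_compact => //; exact: continuous_subspaceT.
exists (`|B| + 1) => [|p]; first by rewrite addr_ge0.
have := BP (`|B| + 1) _ (f p)^-1 (ex_intro2 _ _ p Logic.I erefl); rewrite ltr_pwDr ?ler_norm // => /(_ isT).
by rewrite /= ger0_norm ?invr_ge0 ?(ltW (f0 p)) // -ler_pdivrMr // mul1r.
Qed.

Lemma kahler_closed11 a : kahler_form a -> closed11 a. Proof. by case. Qed.

Lemma closed11_closed2 a : closed11 a -> closed2 a. Proof. by case. Qed.

Lemma dform_dcf_form11 (u : M -> R) i z : smooth u -> U i z -> form11 (dform (dcf u) i z).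
Proof.
move=> su Uz; pose H : 'M[R]_m := \matrix_(k, l) pderiv k (pderiv l (u \o inv i)) z.
have HT : H^T = H by apply/matrixP => k l; rewrite !mxE; exact: (schwarz l k (image_open i) (su i) Uz).
suff -> : dform (dcf u) i z = ddc H by exact: ddc_form11.
have d k l : pderiv k (fun z => dcf u i z 0 l) z = (H *m Jm) k l.
  rewrite mxE; have D p := smooth_on_is_derive k (smooth_pderiv p (su i)) Uz.
  have E := is_derive_sumf (index_enum 'I_m) (fun p => is_deriveZl ((Jm : 'M[R]_m) p l) (D p)).
  rewrite (_ : (fun z => _) = fun y => \sum_p (Jm : 'M[R]_m) p l * pderiv p (u \o inv i) y).
    by rewrite [LHS](derive_val (is_derive := E)); apply: eq_bigr => p _; rewrite [H k p]mxE mulrC.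
  by apply/funext => y; rewrite /dcf mxE; apply: eq_bigr => p _; rewrite [grad _ _ _ _ _]mxE mulrC.
apply/matrixP => k l; rewrite [LHS]mxE !d /ddc [RHS]mxE [RHS]addrC; congr (_ + _).
have := congr1 (fun B : 'M[R]_m => B k l) (trmx_mul H Jm); rewrite HT Jm_tr mulNmx mxE => ->.
by rewrite mxE opprK.
Qed.

(* Add dd^c u to the primitive part of a so that it becomes almost pointwise
   primitive, and apply the pointwise Hodge index inequality. *)
Lemma primitive_le0 a b g : (size g + 2 = n)%N -> (forall k, kahler_form (nth w g k)) -> closed11 a -> kahler_form b ->
  ig (a :: b :: g) = 0 -> ig (a :: a :: g) <= 0.
Proof.
move=> gn kg ca kb ab0; have [[ta _] [tb cb]] := (closed11_closed2 ca, closed11_closed2 (kahler_closed11 kb)).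
have bn : size (b :: g) = n.-1 by move: gn => /=; lia.
have kbg k : kahler_form (nth w (b :: g) k) by case: k => [|k] //=.
have tg k : closed2 (nth w g k) by exact: closed11_closed2 (kahler_closed11 (kg k)).
have S2 x y : size [:: x, y & g] = n by move: gn => /=; lia.
have top x y : two_form x -> two_form y -> top_form (wedge (x :: y :: g)).
  by move=> tx ty; apply: wedge_top_forms => // -[|[|k]] //=; case: (tg k).
have cont x y : two_form x -> two_form y -> continuous (quot w (wedge (x :: y :: g))).
  by move=> tx ty; apply: (quot_cont kw n0); exact: top.
(* The equation to solve is dd^c u /\ b /\ g = - a /\ b /\ g, divided by w^n. Its right hand side
   has mean zero because a.b.g = 0. *)
pose f p := (-1) * quot w (wedge (a :: b :: g)) p.
have cf : continuous f by apply: cont_at => p; apply: cont_mul; [exact: cont_cst | exact: cont].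
have mf : mu f = 0 by rewrite (muZ kw) ?[mu _]ab0 ?mulr0 //; exact: cont.
have bb0 p : 0 < quot w (wedge (b :: b :: g)) p.
  have [i di Uz] := dom_chart X p.
  rewrite -(chartK di) (quotE kw n0 _ Uz); last exact: top.
  rewrite divr_gt0 ?(dens_gt0 kw n0 Uz) // /wedge mulr_gt0 ?invr_gt0 ?exprn_gt0 // wl_kah_gt0 // ?size_map //.
  move=> x /(nthP 0)[k]; rewrite size_map => kl <-; rewrite (nth_map w) //; apply: kahler_kah => //.
  by case: k kl => [|k] kl //=; exact: kbg.
have [C C0 CP] := positive_lower_bound (cont _ _ tb tb) bb0.
have key eta : 0 < eta -> ig (a :: a :: g) <= C * eta.
  move=> eta0; have [u su uP] := approximate_solution kw n0 bn kbg conM cf mf eta0.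
  have ou := dcf_form su; pose h : coef2 X := dform (dcf u).
  have th : two_form h by exact: dform_two_form.
  have ch : closed_form h by exact: dform_closed.
  pose a' := lin 1 h a; have ta' : two_form a' by exact: lin_two_form.
  have ca' : closed_form a' by apply: lin_closed => //; case: ca.
  have h0 x : two_form x -> closed_form x -> ig (h :: x :: g) = 0.
    move=> tx cx; apply: (stokes kw n0 _ _ A ou); first by move: gn => /=; lia.
    by case.
  have swap x y : ig [:: x, y & g] = ig [:: y, x & g] by exact: (ig_middle (g := [:: x]) (S2 x y)).
  have -> : ig (a :: a :: g) = ig (a' :: a' :: g).
    have tx x : two_form x -> forall k, two_form (nth w (x :: g) k) by move=> tx [|k] //=; case: (tg k).
    have Sx x : size (x :: g) = n.-1 by move: gn => /=; lia.
    rewrite {1}/a' (ig_lin _ (Sx a') (tx _ ta')) // h0 // mulr0 add0r swap {1}/a' (ig_lin _ (Sx a) (tx _ ta)) //.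
    by rewrite h0 ?mulr0 ?add0r //; case: ca.
  have Lf p : quot w (wedge (a' :: b :: g)) p = lap w (b :: g) u p - f p.
    rewrite (quot_lin _ _ bn) //; first by rewrite mul1r /f mulN1r opprK.
    by move=> k; case: (kbg k) => -[].
  have cL : continuous (fun p => (lap w (b :: g) u p - f p) ^+ 2).
    have c : continuous (quot w (wedge (a' :: b :: g))) by exact: cont.
    under eq_fun do rewrite -Lf.
    by apply: cont_at => p; apply: cont_mul; exact: c.
  apply: le_trans (_ : _ <= C * mu (fun p => (lap w (b :: g) u p - f p) ^+ 2)) _; last by rewrite ler_wpM2l // ltW.
  rewrite -(muZ kw) //; apply: (mu_le kw n0) => [||p]; first exact: cont.
    by cont.
  rewrite -Lf; have [i di Uz] := dom_chart X p.
  have := CP p; have := bb0 p; rewrite -(chartK di) !(quotE kw n0 _ Uz); try exact: top.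
  set z := chart i p; set D := dens w i z.
  have D0 : 0 < D by exact: (dens_gt0 kw n0).
  have HI : wedge (a' :: a' :: g) i z * wedge (b :: b :: g) i z <= wedge (a' :: b :: g) i z ^+ 2.
    rewrite /wedge /= mulrACA exprMn -expr2 ler_pM2l ?exprn_gt0 ?invr_gt0 ?exprn_gt0 //.
    apply: wl_hodge_index => //; first by rewrite size_map.
    - move=> x /(nthP 0)[k]; rewrite size_map => kl <-; rewrite (nth_map w) //; exact: kahler_kah.
    - have Hs : form11 (h i z) by exact: dform_dcf_form11.
      rewrite /a' /lin; apply: form11_lin => //; case: ca => -[_ aT _] a11 _.
      by apply/andP; split; apply/eqP; [exact: aT | rewrite -imul_Jm; exact: a11].
    - exact: kahler_kah.
  (* Relative to w^n, b /\ b /\ g is at least 1 / C. So where a' /\ a' /\ g is positive, the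
     pointwise index inequality bounds it by [C] times the squared residual. *)
  move: HI; move: (wedge (a' :: a' :: g) i z) (wedge (b :: b :: g) i z) (wedge (a' :: b :: g) i z) => x y t HI y0 CD.
  have {}HI : x / D * (y / D) <= (t / D) ^+ 2.
    by rewrite mulrACA exprMn -expr2 ler_pM2r // exprn_gt0 // invr_gt0.
  have [x0|x0] := leP (x / D) 0; first by apply: le_trans x0 _; rewrite mulr_ge0 // sqr_ge0.
  apply: le_trans (_ : _ <= x / D * (C * (y / D))) _; first by rewrite -[leLHS]mulr1 ler_pM2l.
  by rewrite mulrCA ler_wpM2l.
rewrite leNgt; apply/negP => a0; have Ck := key (ig (a :: a :: g) / (C + 1)).
have C1 : 0 < C + 1 by lra.
have := Ck (divr_gt0 a0 C1); rewrite mulrCA -[leLHS]mulr1 ler_pM2l // ler_pdivlMr //; lra.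
Qed.

(** Subtracting from [a] its projection to [b] gives [a0] with a0.b.g = 0; then a0.a0.g <= 0 is the
    inequality. *)
Lemma reverse_cauchy_schwarz a b g : (size g + 2 = n)%N -> (forall k, kahler_form (nth w g k)) -> closed11 a -> kahler_form b ->
  0 < ig (b :: b :: g) -> ig (a :: a :: g) * ig (b :: b :: g) <= ig (b :: a :: g) ^+ 2.
Proof.
move=> gn kg ca kb bb0; have cb := kahler_closed11 kb.
have S2 x y : size [:: x, y & g] = n by move: gn => /=; lia.
have swap x y : ig [:: x, y & g] = ig [:: y, x & g] by exact: (ig_middle (g := [:: x]) (S2 x y)).
have [[ta _] [tb _]] := (closed11_closed2 ca, closed11_closed2 cb).
have tx x : two_form x -> forall k, two_form (nth w (x :: g) k) by move=> tx [|k] //=; case: (kg k) => -[].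
have Sx x : size (x :: g) = n.-1 by move: gn => /=; lia.
pose t := - (ig (b :: a :: g) / ig (b :: b :: g)); pose a0 := lin t b a.
have ca0 : closed11 a0 by exact: lin_closed11.
have [ta0 _] := closed11_closed2 ca0.
have L y : two_form y -> ig (a0 :: y :: g) = t * ig (b :: y :: g) + ig (a :: y :: g).
  by move=> ty; rewrite (ig_lin _ (Sx y) (tx _ ty)).
have z : ig (a0 :: b :: g) = 0 by rewrite L // [ig (a :: _)]swap /t mulNr divfK ?gt_eqF // addNr.
have := primitive_le0 gn kg ca0 kb z; rewrite L // ![ig [:: _, a0 & g]]swap [ig (a0 :: b :: _)]z mulr0 add0r L // -ler_pdivlMr //.
by rewrite /t; move: (ig (b :: a :: g)) => x; rewrite mulNr addrC subr_le0 mulrAC -expr2.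
Qed.

(* Functions of a form that descend to the finite-dimensional cohomology. *)
Definition tame (D : coef2 X -> R) :=
  (forall a b, closed11 a -> closed11 b -> cohomologous a b -> D a = D b) /\
  (forall p (e : 'I_p -> coef2 X), (forall q, closed11 (e q)) ->
    continuous (fun t : 'rV[R]_p => D (fun i z => \sum_(q < p) t 0 q *: e q i z))).

(** Nefness in a dual form: every tame function that is nonnegative on Kaehler forms is nonnegative
    at [a]. It needs no topology on the space of forms. *)
Definition lim_kahler a := closed11 a /\ forall D, tame D -> (forall a, kahler_form a -> 0 <= D a) -> 0 <= D a.

Lemma kahler_lim a : kahler_form a -> lim_kahler a.
Proof. by move=> ka; split=> [|D _ DK]; [exact: kahler_closed11 | exact: DK]. Qed.

Lemma rep_closed11 (c : H11 X) : closed11 (rep c).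
Proof. exact: (s2valP (cid2 (svalP c))). Qed.

Lemma rep_class (c : H11 X) : sval c = coh_class (rep c).
Proof. exact: (s2valP' (cid2 (svalP c))). Qed.

(** In coordinates of a basis a tame function is continuous, so the set where it is nonnegative is
    closed and contains the closure of the coordinates of Kaehler classes. *)
Lemma nef_lim (c : H11 X) : nef c -> lim_kahler (rep c).
Proof.
move=> [p [e [_ [t ct clo]]]]; split=> [|D [Dc Dcont] DK]; first exact: rep_closed11.
have cls (c' : H11 X) x : sval c' x -> closed11 x /\ cohomologous (rep c') x by rewrite rep_class.
have [cx hx] := cls _ _ ct; rewrite (Dc _ _ (rep_closed11 c) cx hx).
pose F (s : 'rV[R]_p) := D (fun i z => \sum_(q < p) s 0 q *: rep (e q) i z).
have cF : continuous F by apply: Dcont => q; exact: rep_closed11.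
have cl : closed [set s | 0 <= F s].
  by apply: (closed_comp (f := F) (D := [set x | 0 <= x])) => [s _|]; [exact: cF | exact: closed_ge].
suff sub : [set s | exists2 c', kahler_cone c' & coordinates (X := X) e s c'] `<=` [set s | 0 <= F s].
  by have H := closureS sub; rewrite -((closure_id _).1 cl) in H; exact: (H t clo).
move=> s [c' [x cx' kx] cs]; have [c1 h1] := cls _ _ cx'; have [c2 h2] := cls _ _ cs.
by rewrite /= /F -(Dc _ _ (rep_closed11 c') c2 h2) (Dc _ _ (rep_closed11 c') c1 h1); exact: DK.
Qed.

Lemma tame_cst (c : R) : tame (fun=> c).
Proof. by split=> // p e _; exact: cst_continuous. Qed.

Lemma tame_add D E : tame D -> tame E -> tame (fun x => D x + E x).
Proof.
move=> [D1 D2] [E1 E2]; split=> [a b ca cb ab|p e ce]; first by rewrite (D1 a b) // (E1 a b).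
by apply: cont_at => t; apply: cont_add; [exact: D2 | exact: E2].
Qed.

Lemma tame_mul D E : tame D -> tame E -> tame (fun x => D x * E x).
Proof.
move=> [D1 D2] [E1 E2]; split=> [a b ca cb ab|p e ce]; first by rewrite (D1 a b) // (E1 a b).
by apply: cont_at => t; apply: cont_mul; [exact: D2 | exact: E2].
Qed.

Lemma tame_det p (F : coef2 X -> 'M[R]_p) : (forall q q', tame (fun x => F x q q')) -> tame (fun x => \det (F x)).
Proof.
move=> tF; split=> [a b ca cb ab|k e ce]; first by congr (\det _); apply/matrixP => q q'; exact: (tF q q').1.
apply: cont_at => t; apply: cont_sum => v _; cont.
by apply: cont_prod => q _; exact: ((tF q (v q)).2 k e ce).
Qed.

Lemma span_closed11 p (t : 'rV[R]_p) (e : 'I_p -> coef2 X) (l : seq 'I_p) : (forall q, closed11 (e q)) ->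
  closed11 (fun i z => \sum_(q <- l) t 0 q *: e q i z).
Proof.
move=> ce; elim: l => [|q l IH].
  have := lin_closed11 (-1) (kahler_closed11 kw) (kahler_closed11 kw); congr closed11.
  by apply/funext => i; apply/funext => z; rewrite /lin scaleN1r addNr big_nil.
have := lin_closed11 (t 0 q) (ce q) IH; congr closed11.
by apply/funext => i; apply/funext => z; rewrite /lin big_cons.
Qed.

Lemma ig_span p (t : 'rV[R]_p) (e : 'I_p -> coef2 X) s : (forall q, closed11 (e q)) -> size s = n.-1 ->
  (forall k, closed2 (nth w s k)) -> ig ((fun i z => \sum_(q < p) t 0 q *: e q i z) :: s) = \sum_(q < p) t 0 q * ig (e q :: s).
Proof.
move=> ce sn cs; have ts k : two_form (nth w s k) by case: (cs k).
elim: (index_enum _) => [|q l IH].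
  rewrite big_nil /ig /quot /wedge /= (_ : (fun p => _) = fun=> 0) ?(mu0 kw) //; apply/funext => y.
  by rewrite big_nil wl_cons0 // mulr0 mul0r.
rewrite big_cons -IH -(ig_lin _ sn ts); [|by case: (ce q)|by case: (span_closed11 t l ce)].
by congr (ig (_ :: s)); apply/funext => i; apply/funext => z; rewrite /lin big_cons.
Qed.

Lemma tame_one s : size s = n.-1 -> (forall k, closed2 (nth w s k)) -> tame (fun x => ig (x :: s)).
Proof.
move=> sn cs; split=> [a b [ta _ _] [tb _ _] ab|p e ce]; first exact: ig_cohomologous.
apply: cont_at => t; rewrite (_ : (fun t => _) = fun t : 'rV[R]_p => \sum_(q < p) t 0 q * ig (e q :: s)).
  by cont.
by apply/funext => t'; exact: ig_span.
Qed.

Lemma ig_swap a b g : (size g + 2 = n)%N -> ig [:: a, b & g] = ig [:: b, a & g].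
Proof. by move=> gn; apply: (ig_middle (g := [:: a])); move: gn => /=; lia. Qed.

Lemma cons_closed2 a s : closed11 a -> (forall k, closed2 (nth w s k)) -> forall k, closed2 (nth w (a :: s) k).
Proof. by move=> ca cs [|k] //=; exact: closed11_closed2. Qed.

(** Needed for the entry d_00, in which the same class occupies two slots. *)
Lemma tame_two g : (size g + 2 = n)%N -> (forall k, closed2 (nth w g k)) -> tame (fun x => ig [:: x, x & g]).
Proof.
move=> gn cg; have S x : size (x :: g) = n.-1 by move: gn => /=; lia.
split=> [a b ca cb ab|p e ce].
  have [[ta _] [tb _]] := (closed11_closed2 ca, closed11_closed2 cb).
  rewrite (ig_cohomologous (S a) (cons_closed2 ca cg) ta tb ab) ig_swap //.
  exact: (ig_cohomologous (S b) (cons_closed2 cb cg) ta tb ab).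
apply: cont_at => t; rewrite (_ : (fun t => _) = fun t : 'rV[R]_p => \sum_(q < p) t 0 q * \sum_(q' < p) t 0 q' * ig [:: e q', e q & g]).
  by cont.
apply/funext => t'; have cx := span_closed11 t' (index_enum _) ce.
rewrite (ig_span t' ce (S _) (cons_closed2 cx cg)); apply: eq_bigr => q _; rewrite ig_swap //.
by rewrite (ig_span t' ce (S _) (cons_closed2 (ce q) cg)).
Qed.

(** * The two determinants *)

Variables (r : nat) (al : 'I_r -> coef2 X).
Hypothesis cal : forall q, closed11 (al q).

(** The list [s] holds beta_0 followed by the classes gamma, which are to be replaced by Kaehler
    forms; [al] holds the other beta_i, which stay fixed. *)
Definition member s (q : 'I_r.+1) : coef2 X := if unlift ord0 q is Some q' then al q' else head w s.

Definition gram s q q' : R := ig [:: member s q, member s q' & behead s].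

Definition minor_mx s : 'M[R]_r := \matrix_(q < r, q' < r)
  (gram s ord0 (lift ord0 q) * gram s ord0 (lift ord0 q') - gram s ord0 ord0 * gram s (lift ord0 q) (lift ord0 q')).

Lemma member0 s : member s ord0 = head w s. Proof. by rewrite /member unlift_none. Qed.

Lemma memberS s q : member s (lift ord0 q) = al q. Proof. by rewrite /member liftK. Qed.

(** The quadratic form of [minor_mx] at [x] is the defect in the reverse Cauchy-Schwarz inequality
    between beta_0 and the combination of the [al] with coefficients [x]. *)
Lemma kahler_dets s : size s = n.-1 -> (forall k, kahler_form (nth w s k)) ->
  0 <= \det (minor_mx s) /\ 0 <= (-1) ^+ r * \det (\matrix_(q, q') gram s q q').
Proof.
case: s => [|b g] sn ks; first by move: sn n2 => /=; lia.
have gn : (size g + 2 = n)%N by move: sn n2 => /=; lia.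
have kb : kahler_form b := ks 0; have kg k : kahler_form (nth w g k) := ks k.+1.
have cb := kahler_closed11 kb; have cg k := closed11_closed2 (kahler_closed11 (kg k)).
have S x : size (x :: g) = n.-1 by move: gn => /=; lia.
(* On the empty manifold all intersection numbers are 0; otherwise the self-intersection of [b] is
   positive and may be divided by. *)
have [[p0 _]|noM] := pselect (exists p : M, True); last first.
  have ig0 t : ig t = 0 by rewrite /ig (_ : quot w _ = fun=> 0) ?(mu0 kw) //; apply/funext => p; case: noM; exists p.
  split.
    apply: psd_det_ge0 => x; rewrite (_ : minor_mx _ = 0) ?mulmx0 ?mul0mx ?mxE //.
    by apply/matrixP => q q'; rewrite !mxE /gram !ig0 mulr0 subrr.
  rewrite (_ : \matrix_(q, q') _ = 0) ?det0 ?mulr0 //; by apply/matrixP => q q'; rewrite !mxE /gram ig0.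
have bb0 : 0 < ig [:: b, b & g].
  have tb k : two_form (nth w [:: b, b & g] k) by case: k => [|[|k]] /=; [case: kb => -[]|case: kb => -[]|case: (kg k) => -[]].
  have S2 : size [:: b, b & g] = n by move: gn => /=; lia.
  have pos p : 0 < quot w (wedge [:: b, b & g]) p.
    have [i di Uz] := dom_chart X p.
    rewrite -(chartK di) (quotE kw n0 _ Uz); last exact: wedge_top_forms.
    rewrite divr_gt0 ?(dens_gt0 kw n0 Uz) // /wedge mulr_gt0 ?invr_gt0 ?exprn_gt0 // wl_kah_gt0 // ?size_map //.
    move=> x /(nthP 0)[k]; rewrite size_map => kl <-; rewrite (nth_map w) //; apply: kahler_kah => //.
    by case: k kl => [|[|k]] kl //=.
  by apply: (mu_gt0 kw n0 A (p := p0)) => // [|p]; [exact: ig_cont | exact: ltW].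
have g00 : gram (b :: g) ord0 ord0 = ig [:: b, b & g] by rewrite /gram !member0.
have m_ge0 : 0 <= \det (minor_mx (b :: g)).
  apply: psd_det_ge0 => x; pose a : coef2 X := fun i z => \sum_(q < r) x 0 q *: al q i z.
  have ca : closed11 a by exact: span_closed11.
  have := reverse_cauchy_schwarz gn kg ca kb bb0; rewrite -subr_ge0; congr (_ <= _).
  have Eb : ig [:: b, a & g] = \sum_(q < r) x 0 q * gram (b :: g) ord0 (lift ord0 q).
    rewrite ig_swap // (ig_span x cal (S b) (cons_closed2 cb cg)); apply: eq_bigr => q _.
    by rewrite /gram member0 memberS ig_swap.
  have Ea : ig [:: a, a & g] = \sum_(q < r) x 0 q * \sum_(q' < r) x 0 q' * gram (b :: g) (lift ord0 q') (lift ord0 q).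
    rewrite (ig_span x cal (S a) (cons_closed2 ca cg)); apply: eq_bigr => q _; rewrite ig_swap //.
    rewrite (ig_span x cal (S _) (cons_closed2 (cal q) cg)); congr (_ * _); apply: eq_bigr => q' _.
    by rewrite /gram !memberS.
  rewrite Eb Ea mxE expr2 mulr_suml mulr_suml -sumrB; apply: eq_bigr => q _.
  rewrite [x^T _ _]mxE [(x *m _) _ _]mxE [RHS]mulr_suml [X in X - _]mulr_sumr [x 0 q * (\sum_(q' < r) _)]mulr_sumr [X in _ - X]mulr_suml -sumrB.
  apply: eq_bigr => q' _; rewrite mxE g00.
  move: (gram _ _ (lift ord0 q)) (gram _ ord0 (lift ord0 q')) (ig _) (gram _ _ _) (x 0 q) (x 0 q') => t1 t2 t3 t4 t5 t6; ring.
split=> //.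
have -> : (-1) ^+ r * \det (\matrix_(q, q') gram (b :: g) q q') = ig [:: b, b & g] / ig [:: b, b & g] ^+ r * \det (minor_mx (b :: g)).
  rewrite schur_det; last by rewrite mxE g00 gt_eqF.
  rewrite mxE g00; congr (_ * \det _); apply/matrixP => q q'; rewrite !mxE g00; congr (_ * _ - _).
  by rewrite /gram !member0 memberS ig_swap.
by rewrite mulr_ge0 // divr_ge0 ?exprn_ge0 // ltW.
Qed.

Lemma tame_sub D E : tame D -> tame E -> tame (fun x => D x - E x).
Proof.
move=> tD tE; rewrite (_ : (fun x => _) = fun x => D x + (-1) * E x); last by apply/funext => x; rewrite mulN1r.
by apply: tame_add => //; apply: tame_mul => //; exact: tame_cst.
Qed.

Lemma nth_cat_forall (Q : coef2 X -> Prop) s1 s2 : Q w ->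
  (forall k, Q (nth w (s1 ++ s2) k)) <-> (forall k, Q (nth w s1 k)) /\ (forall k, Q (nth w s2 k)).
Proof.
move=> Qw; split=> [H|[H1 H2] k]; last by rewrite nth_cat; case: ifP.
split=> k; last by have := H (size s1 + k)%N; rewrite nth_cat -ltn_subRL subnn addKn.
by have := H k; rewrite nth_cat; case: ltnP => // ks _; rewrite nth_default.
Qed.

(* The classes are replaced by limits of Kaehler classes one at a time. *)
Lemma lim_kahler_ge0 (Phi : seq (coef2 X) -> R) N :
  (forall s1 s2, (size s1 + size s2).+1 = N -> (forall k, closed11 (nth w s1 k)) -> (forall k, closed11 (nth w s2 k)) ->
     tame (fun x => Phi (s1 ++ x :: s2))) ->
  (forall s, size s = N -> (forall k, kahler_form (nth w s k)) -> 0 <= Phi s) ->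
  forall s, size s = N -> (forall k, lim_kahler (nth w s k)) -> 0 <= Phi s.
Proof.
move=> tP kP s sN ls; rewrite -[s]cats0.
have : forall k, kahler_form (nth w [::] k) by case.
have : (size s + size (Nil (coef2 X)) = N)%N by rewrite addn0.
move: {sN} [::] => s2; elim/last_ind: s s2 ls => [|s1 x IH] s2 ls sN ks; first exact: kP.
have [ls1 lx] : (forall k, lim_kahler (nth w s1 k)) /\ (forall k, lim_kahler (nth w [:: x] k)).
  by apply/nth_cat_forall; [exact: kahler_lim | rewrite cats1].
rewrite cat_rcons; apply: ((lx 0%N).2 (fun x => Phi (s1 ++ x :: s2))) => [|a ka].
  apply: tP => [|k|k]; [by rewrite -sN size_rcons addSn | by case: (ls1 k) | exact: kahler_closed11].
by apply: (IH (a :: s2) ls1) => [|[|k] //=]; rewrite -sN size_rcons /= addnS addSn.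
Qed.

(** If the varying form is the head of the list, it is beta_0 and fills zero, one or two slots
    according to [q] and [q']. Otherwise it is one of the gammas and occurs exactly once. *)
Lemma gram_tame s1 s2 q q' : (size s1 + size s2).+1 = n.-1 -> (forall k, closed11 (nth w s1 k)) ->
  (forall k, closed11 (nth w s2 k)) -> tame (fun x => gram (s1 ++ x :: s2) q q').
Proof.
move=> sn c1 c2; have cw := kahler_closed11 kw.
case: s1 sn c1 => [|y s1] /= sn c1.
  have S2 : (size s2 + 2 = n)%N by lia.
  have S x : size (x :: s2) = n.-1 by rewrite /= -sn.
  have cs2 k := closed11_closed2 (c2 k).
  rewrite /gram /member /=; case: unliftP => [p|] _; case: unliftP => [p'|] _ /=.
  - exact: tame_cst.
  - under eq_fun do rewrite ig_swap //.
    by apply: tame_one => //; exact: cons_closed2.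
  - by apply: tame_one => //; exact: cons_closed2.
  - exact: tame_two.
have cm p x : closed11 (member (y :: s1 ++ x :: s2) p).
  by rewrite /member; case: unliftP => [p'|] _; [exact: cal | exact: c1 0%N].
rewrite (_ : (fun x => _) = fun x => ig (x :: [:: member (y :: s1) q, member (y :: s1) q' & s1 ++ s2])).
  apply: tame_one => [|]; first by rewrite /= size_cat; lia.
  apply: cons_closed2; first exact: (cm q w).
  apply: cons_closed2; first exact: (cm q' w).
  move=> k; apply: closed11_closed2; move: k; apply/nth_cat_forall => //; split=> // k; exact: (c1 k.+1).
apply/funext => x; rewrite /gram /=.
by apply: (ig_middle (g := [:: member (y :: s1) q, member (y :: s1) q' & s1])); rewrite /= size_cat /=; lia.
Qed.

Lemma lim_dets s : size s = n.-1 -> (forall k, lim_kahler (nth w s k)) ->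
  0 <= \det (minor_mx s) /\ 0 <= (-1) ^+ r * \det (\matrix_(q, q') gram s q q').
Proof.
move=> sn ls; split.
  apply: (lim_kahler_ge0 (Phi := fun s => \det (minor_mx s))) sn ls => [s1 s2 sN c1 c2|t tn kt]; last by case: (kahler_dets tn kt).
  apply: tame_det => q q'; rewrite (_ : (fun x => _) = fun x => gram (s1 ++ x :: s2) ord0 (lift ord0 q) * gram (s1 ++ x :: s2) ord0 (lift ord0 q') - gram (s1 ++ x :: s2) ord0 ord0 * gram (s1 ++ x :: s2) (lift ord0 q) (lift ord0 q')).
    by apply: tame_sub; apply: tame_mul; exact: gram_tame.
  by apply/funext => x; rewrite mxE.
apply: (lim_kahler_ge0 (Phi := fun s => (-1) ^+ r * \det (\matrix_(q, q') gram s q q'))) sn ls => [s1 s2 sN c1 c2|t tn kt].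
  apply: tame_mul; first exact: tame_cst.
  apply: tame_det => q q'; under eq_fun do rewrite mxE.
  exact: gram_tame.
by case: (kahler_dets tn kt).
Qed.

End Intersection.

Theorem corollary3p7 (R : realType) (n r : nat) (hn : (2 <= n)%N)
  (hr : (1 <= r)%N) (M : topologicalType) (X : complex_manifold R n M)
  (M_compact : compact [set: M]) (M_connected : connected [set: M])
  (M_kahler : exists w : coef2 X, kahler_form w)
  (beta : 'I_r.+1 -> H11 X) (gamma : nat -> H11 X)
  (beta_nef : forall i, nef (beta i))
  (gamma_nef : forall k, (3 <= k <= n)%N -> nef (gamma k)) :
  let d (i j : 'I_r.+1) : R :=
    intersection_number (fun k : 'I_n =>
      match val k with
      | 0 => beta i
      | 1 => beta j
      | k'.+2 => gamma k'.+3
      end) in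
  0 <= \det (\matrix_(i < r, j < r)
         (d ord0 (lift ord0 i) * d ord0 (lift ord0 j)
            - d ord0 ord0 * d (lift ord0 i) (lift ord0 j)))
  /\ 0 <= (-1) ^+ r * \det (\matrix_(i < r.+1, j < r.+1) d i j).
Proof.
move=> d; have [w kw] := M_kahler; have [A] := bump_atlas_exists X M_compact.
have n0 : (0 < n)%N := ltnW hn.
pose al (q : 'I_r) := rep (beta (lift ord0 q)).
(* [iota 3 (n - 2)] runs through 3, ..., n and is empty for [n = 2]. *)
pose s := rep (beta ord0) :: [seq rep (gamma k) | k <- iota 3 (n - 2)].
have sn : size s = n.-1 by rewrite /= size_map size_iota; lia.
have cal q : closed11 (al q) by exact: rep_closed11.
have ls k : lim_kahler (nth w s k).
  case: k => [|k] /=; first exact: nef_lim.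
  (* Beyond the end of the list [nth] returns [w], which is Kaehler. *)
  have [kn|kn] := ltnP k (n - 2); last by rewrite nth_default ?size_map ?size_iota //; exact: kahler_lim.
  rewrite (nth_map 0%N) ?size_iota // nth_iota //; apply: nef_lim; apply: gamma_nef; lia.
have dE i j : d i j = gram w A al s i j.
  have mE q : member w al s q = rep (beta q) by rewrite /member; case: unliftP => [p|] ->.
  rewrite /gram !mE; set l := [:: _, _ & _].
  have ln : size l = n by move: sn => /=; lia.
  rewrite /ig -(integral_topE kw n0 A M_compact); last first.
    apply: (wedge_top_forms (w := w) ln) => -[|[|k]] /=; [by case: (rep_closed11 (beta i)) | by case: (rep_closed11 (beta j)) | by case: (ls k.+1) => -[]].
  congr integral_top; apply/funext => c; apply/funext => z; rewrite (wedgeE w c z ln).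
  congr wedge_top; apply/funext => -[[|[|k]] //= kn].
  by rewrite (nth_map 0%N) ?size_iota ?nth_iota //; lia.
have [Dm Dg] := lim_dets kw hn A M_compact M_connected cal sn ls; split.
  by rewrite (_ : \matrix_(i, j) _ = minor_mx w A al s) //; apply/matrixP => i j; rewrite !mxE !dE.
by rewrite (_ : \matrix_(i, j) _ = \matrix_(i, j) gram w A al s i j) //; apply/matrixP => i j; rewrite !mxE dE.
Qed.
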